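(* Let $\gamma_1\in(1,2)$ and $\gamma_1<\gamma_2$, and suppose that there is a constant $c_{f_1}>0$ such that $f_1(u_1)\le c_{f_1}u_1^{-\gamma_1-1}$ for all $u_1\in\mathbb R_+$. Suppose that $\lambda_\rho\to\infty$ and $\lambda_\rho\rho^{\gamma_1}\to0$ as $\rho\to0$. Let $$c_{\gamma_1,\gamma_2}=\left(-\frac{\Gamma(2-\gamma_1)}{\gamma_1(\gamma_1-1)}\cos\left(\frac{\pi\gamma_1}{2}\right)\right)^{1/\gamma_1}\left(\int_{\mathbb R_+}u_2^{\gamma_1}f_2(u_2)\,\mathrm du_2\right)^{1/\gamma_1}.$$ Then, as $\rho\to0$, the random field $$\left(\frac{\widetilde J_\rho(\mu)}{c_{\gamma_1,\gamma_2}\,\lambda_\rho^{1/\gamma_1}\rho^2}\right)_{\mu\in\mathcal M_P}$$ converges in finite-dimensional distributions to the linear random field $(S_{\gamma_1}(\mu))_{\mu\in\mathcal M_P}$, where $S_{\gamma_1}(\mu)=\int_{\mathbb R^2}f_\mu(x)\,\Lambda_{\gamma_1}(\mathrm dx)$ and $\Lambda_{\gamma_1}$ is the independently scattered $\gamma_1$-stable random measure on $\mathbb R^2$ with unit skewness and Lebesgue control measure.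
   Context: $\mathbb R_+=(0,\infty)$. For $x\in\mathbb R^2$, $u\in\mathbb R_+^2$, $B(x,u)=[x_1-\frac{u_1}{2},x_1+\frac{u_1}{2}]\times[x_2-\frac{u_2}{2},x_2+\frac{u_2}{2}]$ is the rectangle with centre $x$ and edge lengths $u_1,u_2$. Standing assumptions: $F$ is a probability measure on $\mathbb R_+^2$ of the form $F(\mathrm du)=f_1(u_1)f_2(u_2)\,\mathrm du_1\,\mathrm du_2$, where $f_1,f_2\ge0$ are measurable and $f_i(u_i)\sim u_i^{-\gamma_i-1}$ as $u_i\to\infty$ for $i=1,2$ ($f\sim g$ means $f/g\to1$), and $\int_{\mathbb R_+}u_if_i(u_i)\,\mathrm du_i<\infty$. For $\rho>0$, $F_\rho$ is the image measure of $F$ under $u\mapsto\rho u$, and $\lambda_\rho=\lambda(\rho)>0$ is a given function of $\rho$. $\mathcal M_2$ is the linear space of signed measures $\mu$ on $\mathbb R^2$ with finite total variation. Let $N_\rho$ be a Poisson random measure on $\mathbb R^2\times\mathbb R_+^2$ with intensity measure $\lambda_\rho\,\mathrm dx\,F_\rho(\mathrm du)$. For $\mu\in\mathcal M_2$ put $J_\rho(\mu)=\int_{\mathbb R^2\times\mathbb R_+^2}\mu(B(x,u))\,N_\rho(\mathrm dx,\mathrm du)$ and $\widetilde J_\rho(\mu)=J_\rho(\mu)-\mathbb E J_\rho(\mu)$. $\mathcal M_P$ is the set of all $\mu\in\mathcal M_2$ having a continuous density $f_\mu$, $\mu(\mathrm dx)=f_\mu(x)\,\mathrm dx$, for which there exist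 $C_\mu>0$, $c_\mu>0$ with $|f_\mu(x)|\le C_\mu e^{-c_\mu(|x_1|+|x_2|)}$ for all $x\in\mathbb R^2$. The law of $S_{\gamma_1}(\mu)$, $\mu\in\mathcal M_P$, is given by its characteristic function at $1$: $$\mathbb E\left(e^{iS_{\gamma_1}(\mu)}\right)=\exp\left(-\sigma_\mu^{\gamma_1}\left(1-i\beta_\mu\tan\left(\frac{\pi\gamma_1}{2}\right)\right)\right),$$ where $\sigma_\mu=\|f_\mu\|_{\gamma_1}$, $\beta_\mu=\|f_\mu\|_{\gamma_1}^{-\gamma_1}\left(\|f_{\mu+}\|_{\gamma_1}^{\gamma_1}-\|f_{\mu-}\|_{\gamma_1}^{\gamma_1}\right)$, $f_{\mu+}=\max(f_\mu,0)$, $f_{\mu-}=-\min(f_\mu,0)$, and $\|\cdot\|_{\gamma_1}$ is the $L^{\gamma_1}(\mathbb R^2)$ norm (for $\mu=0$, $S_{\gamma_1}(\mu)=0$). A random field $W$ indexed by a linear space of measures is linear if $W(a\mu+b\nu)=aW(\mu)+bW(\nu)$ almost surely for all $a,b\in\mathbb R$ and all $\mu,\nu$. *)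

(* Defs.v *)
From HB Require Import structures.
From mathcomp Require Import all_boot all_order all_algebra.
From mathcomp Require Import all_classical all_reals all_analysis.
From mathcomp Require Import measurable_realfun complex.

Set Implicit Arguments.
Unset Strict Implicit.
Unset Printing Implicit Defensive.
Import Order.TTheory GRing.Theory Num.Theory.
Import numFieldNormedType.Exports.
Import HBSimple.
Local Open Scope classical_set_scope.
Local Open Scope ring_scope.

Section characteristic_function.
Local Open Scope complex_scope.
Context {R : realType}.

Definition cexp (z : R[i]) : R[i] :=
  (expR (complex.Re z) * cos (complex.Im z)) +i*
  (expR (complex.Re z) * sin (complex.Im z)).

(* E[exp(i t X)], with the complex expectation taken componentwise *)
Definition charfun d (Om : measurableType d) (P : probability Om R)
    (X : Om -> R) (t : R) : R[i] :=
  fine 'E_P[fun w => cos (t * X w)] +i* fine 'E_P[fun w => sin (t * X w)].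

(* characteristic function at t of the stable law S_alpha(sigma, beta, 0),
   for alpha <> 1 *)
Definition stable_charfun (alpha sigma beta t : R) : R[i] :=
  cexp (- ((sigma `^ alpha * `|t| `^ alpha)%:C *
           (1 - 'i%C * (beta * Num.sg t * tan (pi * alpha / 2))%:C))).

Definition Gamma (x : R) : R :=
  \int[lebesgue_measure]_(t in `]0, +oo[) (t `^ (x - 1) * expR (- t)).

End characteristic_function.

Section modes_of_convergence.
Context {R : realType}.

Definition mutually_independent d d' (Om : measurableType d)
    (E : measurableType d') (P : probability Om R) n (X : 'I_n -> Om -> E) :=
  forall B : 'I_n -> set E, (forall i, measurable (B i)) ->
    P (\bigcap_i (X i @^-1` B i)) = (\prod_(i < n) P (X i @^-1` B i))%E.

Definition cvg_in_probability d (Om : measurableType d)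
    (P : probability Om R) (X : nat -> Om -> R) (Y : Om -> R) :=
  forall e : R, 0 < e ->
    P [set w | e <= `|X n w - Y w|] @[n --> \oo] --> 0%E.

(* weak convergence, along the filter Fl, of all the random vectors
   (X t i_1, ..., X t i_n) with i_1, ..., i_n in M *)
Definition cvg_fdd (T I : Type) (M : set I) (Fl : set_system T)
    d (Om : measurableType d) (P : probability Om R) (X : T -> I -> Om -> R)
    d' (Om' : measurableType d') (Q : probability Om' R) (Y : I -> Om' -> R) :=
  forall n (m : 'I_n -> I), (forall j, M (m j)) ->
  forall g : 'rV[R]_n -> R, continuous g ->
    (exists K : R, forall v, `|g v| <= K) ->
  ('E_P[fun w => g (\row_j X t (m j) w)])%E @[t --> Fl] -->
  ('E_Q[fun w => g (\row_j Y (m j) w)])%E.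

End modes_of_convergence.

(* N w A = N(A)(w); a kernel is a measure-valued map all of whose
   evaluations w |-> N w A, with A measurable, are measurable. *)
Record poisson_random_measure (R : realType) d d' (Om : measurableType d)
    (E : measurableType d') (P : probability Om R) (nu : set E -> \bar R)
    (N : R.-ker Om ~> E) : Prop := {
  prm_poisson : forall (A : set E) (m : R), measurable A -> nu A = m%:E ->
    forall k : nat, P [set w | N w A = k%:R%:E] =
      (expR (- m) * m ^+ k / k`!%:R)%:E ;
  prm_infinite : forall A : set E, measurable A -> nu A = +oo%E ->
    P [set w | N w A = +oo%E] = 1%E ;
  prm_independent : forall n (A : 'I_n -> set E),
    (forall i, measurable (A i)) -> trivIset setT A ->
    mutually_independent P (fun i w => N w (A i)) }.

(* Charges have finite values, so they are exactly the signed measures of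
   finite total variation. *)
Notation M2 R := (charge (R * R)%type R).

Section plane.
Context {R : realType}.

Definition leb2 := (@lebesgue_measure R \x @lebesgue_measure R)%E.

Definition Rplus : set R := `]0, +oo[.

Definition Rplus2 : set (R * R) := Rplus `*` Rplus.

Definition rect (x u : R * R) : set (R * R) :=
  `[x.1 - u.1 / 2, x.1 + u.1 / 2] `*` `[x.2 - u.2 / 2, x.2 + u.2 / 2].

Definition dilation (rho : R) (u : R * R) : R * R := (rho * u.1, rho * u.2).

Lemma measurable_dilation rho : measurable_fun setT (dilation rho).
Proof.
by apply/measurable_fun_pairP; split => /=; apply: measurable_funM.
Qed.

HB.instance Definition _ rho :=
  isMeasurableFun.Build _ _ _ _ (dilation rho) (measurable_dilation rho).

(* The measure lambda dx F_rho(du), where F_rho is the law of rho u when u has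
   law F; for F carried by Rplus2 and 0 < rho it is carried by
   setT `*` Rplus2. *)
Definition intensity (lambda : R) (F : probability (R * R)%type R) (rho : R)
    (A : set ((R * R) * (R * R))) : \bar R :=
  (lambda%:E * (leb2 \x distribution F (dilation rho)) A)%E.

Definition rect_integral (nu : {measure set ((R * R) * (R * R))%type -> \bar R})
    (mu : M2 R) : R :=
  fine (\int[nu]_(z in setT `*` Rplus2) mu (rect z.1 z.2)).

Definition continuous_density (mu : M2 R)
    (f : R * R -> R) :=
  continuous f /\
  forall A, measurable A -> mu A = (\int[leb2]_(x in A) (f x)%:E)%E.

(* the continuous density of mu (it is unique), and 0 if there is none *)
Definition density (mu : M2 R) : R * R -> R :=
  xget (fun=> 0) [set f | continuous_density mu f].

Definition MP : set (M2 R) :=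
  [set mu | continuous_density mu (density mu) /\
    exists C c : R, [/\ 0 < C, 0 < c &
      forall x, `|density mu x| <= C * expR (- c * (`|x.1| + `|x.2|))]].

Definition linear_field d (Om : measurableType d) (P : probability Om R)
    (W : M2 R -> Om -> R) :=
  forall (a b : R) mu nu, MP mu -> MP nu ->
    {ae P, forall w,
      W (cadd (cscale a mu) (cscale b nu)) w = a * W mu w + b * W nu w}.

Definition Lpnorm (p : R) (f : R * R -> R) : R :=
  fine ('N[leb2]_(p%:E)[EFin \o f])%E.

Definition sigma (alpha : R) (mu : M2 R) : R :=
  Lpnorm alpha (density mu).

Definition beta (alpha : R) (mu : M2 R) : R :=
  Lpnorm alpha (density mu) `^ (- alpha) *
  (Lpnorm alpha (fun x => Num.max (density mu x) 0) `^ alpha -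
   Lpnorm alpha (fun x => - Num.min (density mu x) 0) `^ alpha).

Definition finite_area : set (set (R * R)) :=
  [set A | measurable A /\ (leb2 A < +oo)%E].

(* independently scattered alpha-stable random measure with unit skewness and
   Lebesgue control measure, defined on the sets of finite area: L(A) has law
   S_alpha(|A|^(1/alpha), 1, 0) *)
Record stable_random_measure d (Om : measurableType d) (P : probability Om R)
    (alpha : R) (L : set (R * R) -> Om -> R) : Prop := {
  srm_measurable : forall A, finite_area A -> measurable_fun setT (L A) ;
  srm_stable : forall A, finite_area A -> forall t,
    charfun P (L A) t =
    stable_charfun alpha (fine (leb2 A) `^ alpha^-1) 1 t ;
  srm_independent : forall n (A : 'I_n -> set (R * R)),
    (forall i, finite_area (A i)) -> trivIset setT A ->
    mutually_independent P (fun i => L (A i)) ;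
  srm_sigma_additive : forall A : nat -> set (R * R),
    (forall i, finite_area (A i)) -> trivIset setT A ->
    finite_area (\bigcup_i A i) ->
    {ae P, forall w,
      series (fun i => L (A i) w) @ \oo --> L (\bigcup_i A i) w} }.

(* The term c = 0, whose level set may have infinite area, contributes 0. *)
Definition simple_stable_integral (Om : Type) (L : set (R * R) -> Om -> R)
    (g : {sfun (R * R)%type >-> R}) (w : Om) : R :=
  \sum_(c \in range g) c * L (g @^-1` [set c]) w.

(* Y is (a version of) the integral of f with respect to L, obtained by
   approximating f in L^alpha by simple functions. *)
Definition is_stable_integral d (Om : measurableType d) (P : probability Om R)
    (alpha : R) (L : set (R * R) -> Om -> R) (f : R * R -> R) (Y : Om -> R) :=
  measurable_fun setT Y /\
  exists g : nat -> {sfun (R * R)%type >-> R},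
    [/\ forall n, finite_area [set x | g n x != 0],
        ('N[leb2]_(alpha%:E)[EFin \o (fun x => g n x - f x)%R])%E
          @[n --> \oo] --> 0%E &
        cvg_in_probability P (fun n => simple_stable_integral L (g n)) Y].

Definition c_const (gamma1 : R) (f2 : R -> R) : R :=
  (- (Gamma (2 - gamma1) / (gamma1 * (gamma1 - 1)))
     * cos (pi * gamma1 / 2)) `^ gamma1^-1 *
  (\int[lebesgue_measure]_(u in Rplus) (u `^ gamma1 * f2 u)) `^ gamma1^-1.

End plane.

(* Main.v *)
Require Import Defs.
From HB Require Import structures.
From mathcomp Require Import all_boot all_order all_algebra.
From mathcomp Require Import all_classical all_reals all_analysis.
From mathcomp Require Import measurable_realfun complex finmap.
From mathcomp Require Import lra ring.

Set Implicit Arguments.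
Unset Strict Implicit.
Unset Printing Implicit Defensive.
Import Order.TTheory GRing.Theory Num.Theory.
Import numFieldNormedType.Exports.
Local Open Scope classical_set_scope.
Local Open Scope ring_scope.
Import HBNNSimple HBSimple.

(** The field is an integral against a Poisson random measure. For an integrand
    theta that is integrable for the intensity nu, Campbell's formula gives the
    characteristic function of the compensated integral: its exponent has real
    part the integral of cos theta - 1 and imaginary part the integral of
    sin theta - theta against nu ([prm_has_logcf]). Here theta is the mass
    mu (B (x, u)) divided by c kappa rho^2, with kappa = lambda^(1/gamma1).

    The substitution u = (rho kappa r, rho s) turns nu into the measure with
    density kappa^(gamma1 + 1) f1 (kappa r) f2 s in x, r, s
    ([intensity_integral_scale]). Since kappa tends to infinity, the density
    tends to r^(-gamma1 - 1) f2 s. Since rho kappa = (lambda rho^gamma1)^(1/gamma1)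
    tends to 0, the rectangle shrinks to its centre and theta tends to
    r s f_mu(x) / c ([phi_average]). Limit and integral commute
    ([exponent_cvg]): 1 - cos theta and |theta - sin theta| are at most
    2 min (theta^2, |theta|), the bound on f1 controls the density for all kappa,
    and the decay of f_mu gives |theta| <= C r s M(x1) M(x2) with
    M(x) = min (1, 4 / |x|); the resulting majorant is integrable because
    1 < gamma1 < 2 and f2 has a moment of order gamma1.

    In the limit the variables separate ([power_integral]): for each sign of f_mu,
    the exponent is a product of the moment of f2, of the integral of that part of
    f_mu to the power gamma1, and of the integrals of 1 - cos r and of
    plus or minus r - sin r against r^(-gamma1 - 1) dr. The latter are
    Gamma (2 - gamma1) / (gamma1 (gamma1 - 1)) times - cos (pi gamma1 / 2) and
    sin (pi gamma1 / 2) ([integral_cos_power], [integral_sin_power]). The constant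
    c is chosen to normalize the real part, and the ratio of the two gives the
    tangent in the stable exponent ([exponent_limits]).

    It remains to pass from one measure to finitely many. Both fields are linear
    up to null sets, so that a linear combination of coordinates is the coordinate
    of a single measure ([MP_linear_combination]) and all joint characteristic
    functions converge. The bound of the exponents by a constant times |t|^gamma1,
    uniform in rho ([exponent_bound]), gives tightness, and the two together give
    weak convergence by approximation of test functions by trigonometric
    polynomials ([weak_cvg_from_charfun]).

    The linearity and the law of the limit field come from simple functions. There
    the integral is a sum of independent stable variables; both properties pass to
    the limit because functions of small L^gamma1 norm have integrals that are
    small in probability ([stable_integral_linear], [stable_integral_logcf]). *)

(** * Elementary inequalities *)

Section elementary.
Context {R : realType}.
Implicit Types (f df : R -> R) (x y a b : R).

Lemma is_derive_continuous f (d : R) x : is_derive x 1 f d -> {for x, continuous f}.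
Proof. by move=> [/derivable1_diffP/differentiable_continuous]. Qed.

Lemma MVT_total f df a b : (forall x, is_derive x (1:R) f (df x)) -> a <= b ->
  exists2 c, a <= c <= b & f b - f a = df c * (b - a).
Proof.
move=> dfE ab; have [|c] := @MVT_segment R f df a b ab (fun x _ => dfE x).
  by apply: continuous_subspaceT => x; apply: is_derive_continuous (dfE x).
by rewrite in_itv /= => ? ?; exists c.
Qed.

Lemma ge0_from_derive f df x : (forall y, is_derive y (1:R) f (df y)) ->
  (forall y, 0 <= y -> 0 <= df y) -> 0 <= x -> f 0 <= f x.
Proof.
move=> dfE df0 x0; have [c /andP[c0 _] fE] := MVT_total dfE x0.
by rewrite -subr_ge0 fE subr0 mulr_ge0// df0.
Qed.

Lemma lipschitz_from_derive f df x y : (forall z, is_derive z (1:R) f (df z)) ->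
  (forall z, `|df z| <= 1 :> R) -> `|f x - f y| <= `|x - y|.
Proof.
move=> dfE df1; wlog xy : x y / y <= x.
  by move=> H; have [|/ltW] := leP y x; [exact: H|rewrite distrC (distrC x); exact: H].
have [c _ ->] := MVT_total dfE xy.
by rewrite normrM ler_piMl.
Qed.

Lemma cos_lipschitz x y : `|cos x - cos y| <= `|x - y|.
Proof.
apply: (@lipschitz_from_derive _ (fun z => - sin z)) => z.
by rewrite normrN ler_norml sin_geN1 sin_le1.
Qed.

Lemma sin_lipschitz x y : `|sin x - sin y| <= `|x - y|.
Proof.
apply: (@lipschitz_from_derive _ cos) => z.
by rewrite ler_norml cos_geN1 cos_le1.
Qed.

Lemma norm_sin_le x : `|sin x| <= `|x|.
Proof. by have := sin_lipschitz x 0; rewrite sin0 !subr0. Qed.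

Lemma ge0_subr_sin x : 0 <= x -> 0 <= x - sin x.
Proof.
move=> x0; rewrite subr_ge0 (le_trans (ler_norm _))//.
by rewrite (le_trans (norm_sin_le x))// ger0_norm.
Qed.

Lemma subr_sinN x : - x - sin (- x) = - (x - sin x).
Proof. by rewrite sinN; ring. Qed.

Lemma subr1_cos_ge0 x : 0 <= 1 - cos x.
Proof. by rewrite subr_ge0 cos_le1. Qed.

Lemma subr1_cos_le_norm x : 1 - cos x <= `|x|.
Proof.
have := cos_lipschitz 0 x; rewrite cos0 sub0r normrN; apply: le_trans.
exact: ler_norm.
Qed.

Lemma subr1_cos_le_sqr x : 1 - cos x <= x ^+ 2.
Proof.
wlog x0 : x / 0 <= x.
  move=> H; have [|/ltW x0] := leP 0 x; first exact: H.
  by rewrite -cosN -sqrrN; apply: H; rewrite oppr_ge0.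
have H (y : R) : is_derive y (1:R) (fun y => y ^+ 2 - 1 + cos y) (2 * y - sin y).
  by apply: is_derive_eq; rewrite /GRing.scale /=; ring.
have := fun K => @ge0_from_derive _ _ x H K x0.
rewrite cos0 expr0n /= => H0.
have : 0 - 1 + 1 <= x ^+ 2 - 1 + cos x.
  apply: H0 => // y y0.
  rewrite (_ : 2 * y - sin y = y + (y - sin y)); last by ring.
  by rewrite addr_ge0// ge0_subr_sin.
lra.
Qed.

Lemma norm_subr_sin_le_norm x : `|x - sin x| <= 2 * `|x|.
Proof.
rewrite (le_trans (ler_normB _ _))// mulr_natl mulr2n lerD2l; exact: norm_sin_le.
Qed.

Lemma norm_subr_sin_le_sqr x : `|x - sin x| <= x ^+ 2.
Proof.
wlog x0 : x / 0 <= x.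
  move=> H; have [|/ltW x0] := leP 0 x; first exact: H.
  by rewrite -normrN -subr_sinN -sqrrN; apply: H; rewrite oppr_ge0.
rewrite ger0_norm ?ge0_subr_sin//.
have H (y : R) : is_derive y (1:R) (fun y => y ^+ 2 - y + sin y) (2 * y - (1 - cos y)).
  by apply: is_derive_eq; rewrite /GRing.scale /=; ring.
have := fun K => @ge0_from_derive _ _ x H K x0.
rewrite sin0 expr0n /= => H0.
have : 0 - 0 + 0 <= x ^+ 2 - x + sin x.
  apply: H0 => // y y0.
  rewrite (_ : 2 * y - _ = y + (y - (1 - cos y))); last by ring.
  by rewrite addr_ge0// subr_ge0 -{2}(ger0_norm y0) subr1_cos_le_norm.
lra.
Qed.

Lemma subr1_expRN_le x : 1 - expR (- x) <= x.
Proof. by have := expR_ge1Dx (- x); lra. Qed.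

Lemma norm_subr1_expR_le x : x <= 0 -> `|1 - expR x| <= - x.
Proof.
move=> x0; rewrite ger0_norm ?subr_ge0 -?expR0 ?ler_expR//.
by have := expR_ge1Dx x; rewrite expR0; lra.
Qed.

End elementary.

(** * Exponential series with a phase *)

Section phase_series.
Context {R : realType}.
Variable a : R.
Let u (th : R) (k : nat) : R := cos (k%:R * a + th) * k`!%:R^-1.
Let W th x := limn (pseries (u th) x).

Let u_diffs th : pseries_diffs (u th) = u (th + a).
Proof.
apply/funext => k; rewrite /pseries_diffs /u factS natrM invfM.
rewrite mulrCA mulrA mulrA mulfK ?pnatr_eq0//.
by rewrite -natr1; congr (cos _ * _); ring.
Qed.

Let cvgu th x : cvgn (pseries (u th) x).
Proof.
apply: normed_cvg.
apply: (@series_le_cvg _ _ (exp_coeff `|x|)) => [n|n|n|].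
- exact: normr_ge0.
- by rewrite /exp_coeff /= divr_ge0.
- rewrite /exp_coeff /= /u !normrM normrX mulrC ler_wpM2l ?exprn_ge0//.
  rewrite normfV normr_nat ler_piMl ?invr_ge0//.
  by rewrite ler_norml cos_geN1 cos_le1.
- exact: is_cvg_series_exp_coeff.
Qed.

Let derW th x : is_derive x (1:R) (W th) (W (th + a) x).
Proof.
rewrite /W -u_diffs.
apply: (@pseries_snd_diffs _ _ (`|x| + 1)); rewrite ?u_diffs; try exact: cvgu.
by rewrite [ltRHS]ger0_norm ?addr_ge0// ltrDl.
Qed.

Let W_rot th b x : W (th + b) x = cos b * W th x - sin b * W (th - pi / 2) x.
Proof.
have lim2 (c e : R) (s t : R) : limn (fun n => c * pseries (u s) x n - e * pseries (u t) x n) =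
    c * W s x - e * W t x.
  by apply/cvg_lim => //; apply: cvgB; apply: cvgMr; exact: cvgu.
rewrite -lim2 /W; congr (limn _); apply/funext => n.
rewrite /pseries /series /= !mulr_sumr -sumrB; apply: eq_bigr => k _.
rewrite /u addrA cosD addrA cosBpihalf.
by ring.
Qed.

Let W0 th : W th 0 = cos th.
Proof.
apply/cvg_lim => //; apply: cvg_near_cst; exists 1%N => // n /= n0.
rewrite /pseries /series /=.
case: n n0 => // n _; rewrite big_nat_recl//= big1 ?addr0 => [|i _].
  by rewrite expr0 mulr1 /u mul0r add0r fact0 invr1 mulr1.
by rewrite expr0n /= mulr0.
Qed.

(** The left-hand side has derivative 0 in x: the differential equation
    W_th' = W_(th + a) only mixes W_th and W_(th - pi/2), through the rotation
    W_rot. *)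
Let W_conj th x :
  expR (- (x * cos a)) * (cos (x * sin a) * W th x + sin (x * sin a) * W (th - pi / 2) x) =
  cos th.
Proof.
pose h y := expR (- (y * cos a)) *
  (cos (y * sin a) * W th y + sin (y * sin a) * W (th - pi / 2) y).
suff dh (y : R) : is_derive y (1:R) h 0.
  rewrite -[LHS]/(h x) (@is_derive_0_is_cst _ h x 0 dh) /h !mul0r oppr0 expR0 cos0 sin0.
  by rewrite W0 mul0r addr0 !mul1r.
have d1 := derW th y; have d2 := derW (th - pi / 2) y.
apply: is_derive_eq.
rewrite /GRing.scale /= (W_rot th a y).
have -> : W (th - pi / 2 + a) y = cos a * W (th - pi / 2) y + sin a * W th y.
  have -> : th - pi / 2 + a = (th + a) - pi / 2 by ring.
  rewrite (_ : th + a - pi / 2 = th + (a - pi / 2)); last by ring.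
  rewrite (W_rot th (a - pi / 2) y) cosBpihalf.
  have -> : sin (a - pi / 2) = - cos a by rewrite -[in RHS](subrK (pi / 2) a) cosDpihalf opprK.
  by ring.
by ring.
Qed.

(** The real part of exp(i th) exp(x exp(i a)), by its power series: up to a
    factor, the characteristic function of a Poisson variable. *)
Lemma exp_series_phase th x :
  series (fun k => x ^+ k / k`!%:R * cos (k%:R * a + th)) @ \oo -->
  expR (x * cos a) * cos (x * sin a + th).
Proof.
have -> : series (fun k => x ^+ k / k`!%:R * cos (k%:R * a + th)) = pseries (u th) x.
  by apply/funext => n; apply: eq_bigr => k _ /=; rewrite /u; field; rewrite pnatr_eq0 -lt0n fact_gt0.
suff -> : expR (x * cos a) * cos (x * sin a + th) = W th x by exact: cvgu.
rewrite -(W_conj (x * sin a + th) x).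
rewrite mulrA -expRD subrr expR0 mul1r.
rewrite (addrC (x * sin a) th).
rewrite (_ : th + x * sin a - pi / 2 = th + (x * sin a - pi / 2)); last by ring.
rewrite (W_rot th (x * sin a) x) (W_rot th (x * sin a - pi / 2) x) cosBpihalf.
have -> : sin (x * sin a - pi / 2) = - cos (x * sin a).
  by rewrite -[in RHS](subrK (pi / 2) (x * sin a)) cosDpihalf opprK.
transitivity ((cos (x * sin a) ^+ 2 + sin (x * sin a) ^+ 2) * W th x); first by ring.
by rewrite cos2Dsin2 mul1r.
Qed.

End phase_series.

(** * Limits of real functions *)

Lemma cvg_congr (R : realType) T (F : set_system T) (f g : T -> R) (l l' : R) :
  f @ F --> l -> (forall x, f x = g x) -> l = l' -> g @ F --> l'.
Proof. by move=> fl /funext <- <-. Qed.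
Arguments cvg_congr [R T F f g l l'] _ _ _.

Lemma cvg_scale (R : realType) T (F : set_system T) {FF : Filter F} (f : T -> R)
    (l a : R) : f x @[x --> F] --> l -> (a * f x) @[x --> F] --> a * l.
Proof. by move=> fl; apply: cvgMl_tmp. Qed.
Arguments cvg_scale [R T F] {FF} [f l] a _.

Lemma dominated_cvg0 (R : realType) T (F : set_system T) {FF : Filter F} (u v : T -> R) :
  (forall x, `|u x| <= v x) -> v x @[x --> F] --> (0 : R) -> u x @[x --> F] --> (0 : R).
Proof.
move=> uv /cvgrPdist_le v0; apply/cvgrPdist_le => e e0.
apply: filterS (v0 e e0) => x; rewrite !sub0r !normrN; apply: le_trans.
by rewrite (le_trans (uv x))// ler_norm.
Qed.

(** * Integrals determined by their values on indicators *)

Lemma nnsfun_sum_indic d (T : measurableType d) (R : realType)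
    (g : {nnsfun T >-> R}) :
  exists s : seq R, (forall c, c \in s -> 0 <= c) /\
    forall x, g x = \sum_(c <- s) c * \1_(g @^-1` [set c]) x.
Proof.
exists (fset_set (range g)); split.
  move=> c; rewrite in_fset_set; last exact: fimfunP.
  by move=> /set_mem [x _ <-].
move=> x; rewrite {1}fimfunE fsbig_finite//; exact: fimfunP.
Qed.

Definition integral_like d (T : measurableType d) (R : realType)
    (I : (T -> \bar R) -> \bar R) :=
  [/\ forall f g, measurable_fun setT f -> measurable_fun setT g ->
        (forall x, 0 <= f x)%E -> (forall x, 0 <= g x)%E ->
        (I (fun x => f x + g x) = I f + I g)%E,
      forall (k : R) f, 0 <= k -> measurable_fun setT f ->
        (forall x, 0 <= f x)%E -> (I (fun x => k%:E * f x) = k%:E * I f)%E &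
      forall (g : nat -> T -> \bar R) f, (forall n, measurable_fun setT (g n)) ->
        (forall n x, 0 <= g n x)%E ->
        (forall x, {homo g^~ x : n m / (n <= m)%N >-> (n <= m)%E}) ->
        (forall x, g n x @[n --> \oo] --> f x) ->
        I (g n) @[n --> \oo] --> I f].

(** Additivity and monotone limits reduce the equality to indicators. This is
    used to identify integrals against images with density and against the mean
    of a random measure. *)
Lemma integral_likeE d (T : measurableType d) (R : realType)
    (m : {measure set T -> \bar R}) (I : (T -> \bar R) -> \bar R) :
  integral_like I ->
  (forall A, measurable A -> I (fun x => (\1_A x)%:E) = m A) ->
  forall f, measurable_fun setT f -> (forall x, 0 <= f x)%E ->
    I f = (\int[m]_x f x)%E.
Proof.
move=> [ID IZ Icvg] I1 f mf f0.
pose g := nnsfun_approx measurableT mf.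
have gI n : I (fun x => (g n x)%:E) = (\int[m]_x (g n x)%:E)%E.
  have [s [s0 sE]] := nnsfun_sum_indic (g n).
  under eq_integral do rewrite sE.
  rewrite (_ : (fun x => (g n x)%:E) = fun x =>
     (\sum_(c <- s) c * \1_(g n @^-1` [set c]) x)%:E); last first.
    by apply/funext => x; rewrite sE.
  have : forall c, c \in s -> 0 <= c by [].
  elim: s {s0 sE} => [|c s IH] s0.
    under eq_integral do rewrite big_nil.
    rewrite integral0.
    have -> : (fun x : T => (\sum_(c <- [::]) c * \1_(g n @^-1` [set c]) x)%:E) =
        (fun x => (0%:E * cst 0 x)%E).
      by apply/funext => x; rewrite big_nil mul0e.
    by rewrite IZ// mul0e.
  have mi y : measurable_fun setT (fun x => (\1_(g n @^-1` [set y]) x : R)%:E).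
    apply/measurable_EFinP; apply: measurable_indic.
    by apply: measurable_sfunP.
  have sums0 x : 0 <= \sum_(j <- s) j * \1_(g n @^-1` [set j]) x.
    rewrite big_seq; apply: sumr_ge0 => i si.
    by rewrite mulr_ge0// s0// in_cons si orbT.
  have ms : measurable_fun setT
      (fun x => (\sum_(j <- s) j * \1_(g n @^-1` [set j]) x : R)%:E).
    apply/measurable_EFinP; apply: measurable_sum => y.
    by apply: measurable_funM => //; exact/measurable_EFinP.
  have -> : (fun x : T => (\sum_(j <- (c :: s)) j * \1_(g n @^-1` [set j]) x)%:E) =
     (fun x => (c%:E * (\1_(g n @^-1` [set c]) x)%:E +
               (\sum_(j <- s) j * \1_(g n @^-1` [set j]) x)%:E)%E).
    by apply/funext => x; rewrite big_cons EFinD EFinM.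
  have c0 : 0 <= c by apply: s0; rewrite in_cons eqxx.
  rewrite ID//; last 2 first.
  - by apply: measurable_funeM; exact: mi.
  - by move=> x; rewrite mule_ge0// lee_fin.
  rewrite IZ//.
  rewrite I1; last exact: measurable_sfunP.
  rewrite IH; last by move=> y ys; rewrite s0// in_cons ys orbT.
  rewrite ge0_integralD//; last 3 first.
  - by move=> x _; rewrite mule_ge0// lee_fin.
  - by apply: measurable_funeM; exact: mi.
  - by move=> x _; rewrite lee_fin.
  rewrite ge0_integralZl// integral_indic ?setIT//.
have gnd x : {homo (fun n x => (g n x)%:E)^~ x : n k / (n <= k)%N >-> (n <= k)%E}.
  by move=> n k nk; rewrite lee_fin; exact/lefP/nd_nnsfun_approx.
have gf x : (g n x)%:E @[n --> \oo] --> f x.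
  by apply: cvg_nnsfun_approx => // y _; exact: f0.
have mg n : measurable_fun setT (fun x => (g n x)%:E) by exact/measurable_EFinP.
have g0 n x : (0 <= (g n x)%:E)%E by rewrite lee_fin.
have If := Icvg _ _ mg g0 gnd gf.
have := @cvg_monotone_convergence _ _ _ m setT measurableT _ mg
  (fun n x _ => g0 n x) (fun x _ => gnd x).
rewrite (_ : (\int[m]_x limn _ = \int[m]_x f x)%E); last first.
  by apply: eq_integral => x _; apply/cvg_lim => //; exact: gf.
under eq_fun do rewrite -gI.
by move=> H; rewrite -(cvg_lim _ If)// -(cvg_lim _ H).
Qed.

(** Functional form of the monotone class principle. *)
Lemma bounded_measurable_ind d (T : measurableType d) (R : realType)
    (Pr : (T -> R) -> Prop) :
  (forall A, measurable A -> Pr (\1_A)) ->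
  (forall (a : R) (f g : T -> R),
    measurable_fun setT f -> measurable_fun setT g ->
    (exists K, forall x, `|f x| <= K) -> (exists K, forall x, `|g x| <= K) ->
    Pr f -> Pr g -> Pr (fun x => a * f x + g x)) ->
  (forall (g : nat -> T -> R) f K, (forall n, measurable_fun setT (g n)) ->
     (forall n x, `|g n x| <= K) -> (forall x, g n x @[n --> \oo] --> f x) ->
     (forall n, Pr (g n)) -> Pr f) ->
  forall (f : T -> R) K, measurable_fun setT f -> (forall x, `|f x| <= K) -> Pr f.
Proof.
move=> P1 Plin Plim f K mf fK.
have bi A : exists K, forall x : T, `|\1_A x : R| <= K.
  by exists 1 => x; rewrite indicE; case: (_ \in _); rewrite ?normr1 ?normr0.
have bc (c : R) : exists K, forall x : T, `|cst c x| <= K by exists `|c|.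
have P0 : Pr (fun=> 0).
  rewrite (_ : (fun=> 0) = (fun x => -1 * \1_setT x + \1_setT x)).
    by apply: Plin => //; exact: P1.
  by apply/funext => x; rewrite indicT mulN1r addNr.
have Pc c : Pr (fun=> c).
  rewrite (_ : (fun=> c) = (fun x => c * \1_setT x + cst 0 x)).
    by apply: Plin => //; exact: P1.
  by apply/funext => x; rewrite indicT mulr1 addr0.
pose h x := f x + K.
have h0 x : (0 <= (h x)%:E)%E.
  by rewrite lee_fin /h -lerBlDr sub0r; have := fK x; rewrite ler_norml => /andP[].
have mh : measurable_fun setT (fun x => (h x)%:E).
  by apply/measurable_EFinP; apply: measurable_funD.
have hK x : h x <= K + K.
  by rewrite /h lerD2r (le_trans (ler_norm _)).
pose g := nnsfun_approx measurableT mh.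
have gh x : (g n x) @[n --> \oo] --> h x.
  have := @cvg_approx _ _ _ setT _ x (fun x _ => h0 x) I (ltry _).
  by under eq_fun do rewrite -(nnsfun_approxE measurableT mh).
have gK n x : `|g n x| <= K + K.
  rewrite ger0_norm// (le_trans _ (hK x))// -lee_fin.
  by rewrite /g nnsfun_approxE; apply: le_approx.
have Pg n : Pr (g n).
  have [s [_ sE]] := nnsfun_sum_indic (g n).
  rewrite (_ : (g n : T -> R) = fun x =>
     (\sum_(c <- s) c * \1_(g n @^-1` [set c]) x)); last first.
    by apply/funext => x; rewrite sE.
  elim: s {sE} => [|c s IH].
    by rewrite (_ : (fun _ => _) = (fun=> 0))//; apply/funext => x; rewrite big_nil.
  rewrite (_ : (fun _ => _) = (fun x => c * \1_(g n @^-1` [set c]) x +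
     \sum_(c <- s) c * \1_(g n @^-1` [set c]) x)); last first.
    by apply/funext => x; rewrite big_cons.
  apply: Plin => //.
  - by apply: measurable_sum => y; apply: measurable_funM.
  - exists (\sum_(c <- s) `|c|) => x.
    rewrite (le_trans (ler_norm_sum _ _ _))// ler_sum// => y _.
    rewrite normrM ler_piMr// indicE.
    by case: (_ \in _); rewrite ?normr1 ?normr0.
  - by apply: P1; apply: measurable_sfunP.
have Ph : Pr h by apply: (Plim g h (K + K)).
rewrite (_ : f = fun x => 1 * h x + cst (- K) x).
  apply: Plin => //; last exact: Pc.
  - exact/measurable_EFinP.
  - by exists (K + K) => x; rewrite ger0_norm// -lee_fin.
by apply/funext => x; rewrite mul1r /h /= addrK.
Qed.

(** The map p allows the density to live on the same set with another measurable
    structure. *)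
Lemma integral_density d (T : measurableType d) d' (T' : measurableType d')
    (R : realType) (m : {measure set T -> \bar R}) (nu : {measure set T' -> \bar R})
    (p : T -> T') (w : T -> R) :
  measurable_fun setT p -> measurable_fun setT w -> (forall x, 0 <= w x) ->
  (forall A, measurable A -> nu A = (\int[m]_(x in p @^-1` A) (w x)%:E)%E) ->
  forall f, measurable_fun setT f -> (forall x, 0 <= f x)%E ->
  (\int[nu]_x f x = \int[m]_x (f (p x) * (w x)%:E))%E.
Proof.
move=> mp mw w0 nuE f mf f0; apply/esym.
have mw' : measurable_fun setT (fun x => (w x)%:E) by exact/measurable_EFinP.
have mfw g : measurable_fun setT g -> measurable_fun setT (fun x => (g (p x) * (w x)%:E)%E).
  by move=> mg; apply: emeasurable_funM => //; exact: (measurableT_comp mg).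
apply: (integral_likeE (I := fun f => (\int[m]_x (f (p x) * (w x)%:E))%E)) => //.
- split.
  + move=> f1 f2 mf1 mf2 f10 f20.
    rewrite -ge0_integralD//.
    * by apply: eq_integral => x _; rewrite ge0_muleDl.
    * by move=> x _; rewrite mule_ge0// lee_fin.
    * exact: mfw.
    * by move=> x _; rewrite mule_ge0// lee_fin.
    * exact: mfw.
  + move=> k g k0 mg g0; rewrite -ge0_integralZl//.
    * by apply: eq_integral => x _; rewrite muleA.
    * exact: mfw.
    * by move=> x _; rewrite mule_ge0// lee_fin.
  + move=> g h mg g0 gnd gh.
    have := @cvg_monotone_convergence _ _ _ m setT measurableT
      (fun n x => (g n (p x) * (w x)%:E)%E) (fun n => mfw _ (mg n)) _ _.
    rewrite (_ : (\int[m]_x limn _ = \int[m]_x (h (p x) * (w x)%:E))%E); last first.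
      apply: eq_integral => x _; apply/cvg_lim => //.
      by apply: cvgeZr => //; exact: gh.
    apply.
      by move=> n x _; rewrite mule_ge0// lee_fin.
    by move=> x _ n k nk; rewrite lee_wpmul2r ?lee_fin//; exact: gnd.
- move=> A mA; rewrite nuE// [RHS]integral_mkcond.
  apply: eq_integral => x _; rewrite patchE indicE.
  rewrite (_ : (p x \in A) = (x \in p @^-1` A)); last by apply/idP/idP => /set_mem/mem_set.
  by case: ifPn => xA; rewrite ?mul1e ?mul0e.
Qed.

Lemma integral_kernel_mean d d' (Om : measurableType d) (E : measurableType d')
    (R : realType) (P : {measure set Om -> \bar R}) (N : R.-ker Om ~> E)
    (nu : {measure set E -> \bar R}) :
  (forall A, measurable A -> (\int[P]_w N w A)%E = nu A) ->
  forall f, measurable_fun setT f -> (forall x, 0 <= f x)%E ->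
  (\int[P]_w \int[N w]_x f x = \int[nu]_x f x)%E.
Proof.
move=> NE f mf f0.
have mN g : measurable_fun setT g -> (forall x, 0 <= g x)%E ->
    measurable_fun setT (fun w => (\int[N w]_x g x)%E).
  move=> mg g0; apply: measurable_fun_integral_kernel => // U mU.
  exact: measurable_kernel.
apply: (integral_likeE (I := fun f => (\int[P]_w \int[N w]_x f x)%E)) => //.
- split.
  + move=> f1 f2 mf1 mf2 f10 f20.
    rewrite -ge0_integralD//; last 4 first.
      by move=> w _; exact: integral_ge0.
      exact: mN.
      by move=> w _; exact: integral_ge0.
      exact: mN.
    by apply: eq_integral => w _; rewrite ge0_integralD.
  + move=> k g k0 mg g0; rewrite -ge0_integralZl//; last 2 first.
      exact: mN.
      by move=> w _; exact: integral_ge0.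
    by apply: eq_integral => w _; rewrite ge0_integralZl.
  + move=> g h mg g0 gnd gh.
    have := @cvg_monotone_convergence _ _ _ P setT measurableT
      (fun n w => (\int[N w]_x g n x)%E) (fun n => mN _ (mg n) (g0 n)) _ _.
    rewrite (_ : (\int[P]_w limn _ = \int[P]_w \int[N w]_x h x)%E); last first.
      apply: eq_integral => w _; apply/cvg_lim => //.
      have := @cvg_monotone_convergence _ _ _ (N w) setT measurableT
        _ mg (fun n x _ => g0 n x) (fun x _ => gnd x).
      rewrite (_ : (\int[N w]_x limn _ = \int[N w]_x h x)%E)//.
      by apply: eq_integral => x _; apply/cvg_lim => //; exact: gh.
    apply.
      by move=> n w _; exact: integral_ge0.
    move=> w _ n k nk; apply: ge0_le_integral => //.
    by move=> x _; exact: gnd.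
- move=> A mA; rewrite -NE//; apply: eq_integral => w _.
  by rewrite integral_indic// setIT.
Qed.

Section scaling.
Context {R : realType}.
Local Notation leb := (@lebesgue_measure R).

Let scal (c : R) (x : measurableTypeR R) : measurableTypeR R := c * x.

Let measurable_scal c : measurable_fun setT (scal c).
Proof. exact: measurable_funM. Qed.

Let push c : {measure set (measurableTypeR R) -> \bar R} :=
  measure_function_pushforward__canonical__measure_function_Measure
    leb (measurable_scal c).

Let lebesgue_measure_scale (c : R) (A : set (measurableTypeR R)) (c0 : 0 < c) :
  measurable A -> leb A = mscale (NngNum (ltW c0)) (push c) A.
Proof.
move=> mA; apply: lebesgue_measure_unique => //.
move=> _ [[a b]] _ <-.
transitivity (c%:E * leb (scal c @^-1` `]a, b]))%E; last by [].
rewrite (_ : _ @^-1` _ = `]a / c, b / c]%classic); last first.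
  by apply/seteqP; split => x /=; rewrite !in_itv/= /scal
    ltr_pdivrMr// ler_pdivlMr// ![x * c]mulrC.
rewrite !lebesgue_measure_itv/= !lte_fin ltr_pM2r ?invr_gt0//.
case: ifPn => _; last by rewrite mule0.
by rewrite -!EFinD -EFinM; congr EFin; field; rewrite gt_eqF.
Qed.

Lemma ge0_integral_scale (c : R) (f : R -> \bar R) : 0 < c ->
  measurable_fun setT f -> (forall x, 0 <= f x)%E ->
  (\int[leb]_x f x = c%:E * \int[leb]_x f (c * x)%R)%E.
Proof.
move=> c0 mf f0.
transitivity (\int[mscale (NngNum (ltW c0)) (push c)]_x f x)%E.
  by apply: eq_measure_integral => A mA _; exact: lebesgue_measure_scale.
rewrite ge0_integral_mscale//=; congr (_ * _)%E.
exact: (ge0_integral_pushforward (measurable_scal c)).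
Qed.
End scaling.

(** * Real-valued integrals *)

Section real_integrals.
Context d (T : measurableType d) (R : realType).
Variable m : {measure set T -> \bar R}.
Implicit Types f g : T -> R.

Lemma integrable_mfun f : m.-integrable setT (EFin \o f) -> measurable_fun setT f.
Proof. by move=> /integrableP[/measurable_EFinP]. Qed.

Lemma integrable_add f g : m.-integrable setT (EFin \o f) ->
  m.-integrable setT (EFin \o g) -> m.-integrable setT (EFin \o (fun x => f x + g x)).
Proof.
move=> jf jg; have := integrableD measurableT jf jg.
by apply: eq_integrable => // x _ /=; rewrite EFinD.
Qed.

Lemma integrable_scale (a : R) f : m.-integrable setT (EFin \o f) ->
  m.-integrable setT (EFin \o (fun x => a * f x)).
Proof.
move=> jf; have := integrableZl measurableT a jf.
by apply: eq_integrable => // x _ /=; rewrite EFinM.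
Qed.

Lemma integrable_opp f : m.-integrable setT (EFin \o f) ->
  m.-integrable setT (EFin \o (fun x => - f x)).
Proof.
by move=> /(integrable_scale (-1)); apply: eq_integrable => // x _ /=; rewrite mulN1r.
Qed.

Lemma integrable_sub f g : m.-integrable setT (EFin \o f) ->
  m.-integrable setT (EFin \o g) -> m.-integrable setT (EFin \o (fun x => f x - g x)).
Proof. by move=> jf jg; apply: integrable_add => //; exact: integrable_opp. Qed.

Lemma integrable_dominated f g : measurable_fun setT f ->
  (forall x, `|f x| <= g x) -> m.-integrable setT (EFin \o g) ->
  m.-integrable setT (EFin \o f).
Proof.
move=> mf fg; apply: le_integrable => //; first exact/measurable_EFinP.
by move=> x _ /=; rewrite lee_fin (le_trans (fg x))// ler_norm.
Qed.

Lemma integrable_abs f : m.-integrable setT (EFin \o f) ->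
  m.-integrable setT (EFin \o (fun x => `|f x|)).
Proof.
move=> jf; apply: le_integrable (jf) => //.
  by apply/measurable_EFinP; apply: measurableT_comp => //; exact: integrable_mfun.
by move=> x _ /=; rewrite normr_id.
Qed.

Lemma Rintegral_dominated_cvg (G : nat -> T -> R) (F g : T -> R) :
  (forall n, measurable_fun setT (G n)) ->
  (forall x, G n x @[n --> \oo] --> F x) ->
  m.-integrable setT (EFin \o g) -> (forall n x, `|G n x| <= g x) ->
  m.-integrable setT (EFin \o F) /\
  \int[m]_x G n x @[n --> \oo] --> \int[m]_x F x.
Proof.
move=> mG GF ig Gg.
have mF : measurable_fun setT F.
  by apply: measurable_fun_cvg => // x _; exact: GF.
have [] := @dominated_convergence _ _ _ m setT measurableT
  (fun n w => (G n w)%:E) (fun w => (F w)%:E) (EFin \o g) => //.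
- by move=> n; exact/measurable_EFinP.
- exact/measurable_EFinP.
- by apply: aeW => x _; apply/fine_cvgP; split; [exact: nearW|exact: GF].
- by apply: aeW => x n _ /=; rewrite lee_fin.
move=> iF _ H; split => //; apply: fine_cvg.
by rewrite fineK//; exact: integrable_fin_num.
Qed.

Lemma Rintegral_ge0_le f g : m.-integrable setT (EFin \o f) ->
  m.-integrable setT (EFin \o g) -> (forall x, f x <= g x) ->
  \int[m]_x f x <= \int[m]_x g x.
Proof. by move=> jf jg fg; apply: le_Rintegral. Qed.

Lemma EFin_Rintegral f : m.-integrable setT (EFin \o f) ->
  (\int[m]_x f x)%:E = (\int[m]_x (f x)%:E)%E.
Proof. by move=> jf; rewrite /Rintegral fineK//; exact: integrable_fin_num. Qed.

End real_integrals.

Lemma measurable_bigprod d (T : measurableType d) (R : realType) (I : finType)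
    (p : pred I) (h : I -> T -> R) : (forall i, measurable_fun setT (h i)) ->
  measurable_fun setT (fun w => \prod_(i | p i) h i w).
Proof.
move=> mh; rewrite (_ : (fun w => _) = fun w => \prod_i if p i then h i w else 1).
  by apply: measurable_prod => i _; case: (p i).
by apply/funext => w; rewrite big_mkcond.
Qed.

Lemma measurable_bigsum d (T : measurableType d) (R : realType) (I : finType)
    (p : pred I) (h : I -> T -> R) : (forall i, measurable_fun setT (h i)) ->
  measurable_fun setT (fun w => \sum_(i | p i) h i w).
Proof.
move=> mh; rewrite (_ : (fun w => _) = fun w => \sum_i if p i then h i w else 0).
  by apply: measurable_sum => i; case: (p i).
by apply/funext => w; rewrite big_mkcond.
Qed.

Lemma measurable_cos (R : realType) : measurable_fun setT (@cos R).
Proof. by apply: continuous_measurable_fun; exact: continuous_cos. Qed.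

Lemma measurable_sin (R : realType) : measurable_fun setT (@sin R).
Proof. by apply: continuous_measurable_fun; exact: continuous_sin. Qed.

Lemma norm_cos_le1 (R : realType) (x : R) : `|cos x| <= 1.
Proof. by rewrite ler_norml cos_geN1 cos_le1. Qed.

Lemma norm_sin_le1 (R : realType) (x : R) : `|sin x| <= 1.
Proof. by rewrite ler_norml sin_geN1 sin_le1. Qed.

(** * Characteristic functions and independence *)

Section expectations.
Context d (Om : measurableType d) (R : realType) (P : probability Om R).

Lemma bounded_integrable (f : Om -> R) (K : R) :
  measurable_fun setT f -> (forall w, `|f w| <= K) ->
  P.-integrable setT (EFin \o f).
Proof.
move=> mf fK; apply: measurable_bounded_integrable => //.
  by apply: le_lt_trans (ltry 1); rewrite probability_le1.
exists K; split; first by rewrite num_real.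
by move=> y Ky w _ /=; rewrite (le_trans (fK w))// ltW.
Qed.

Lemma expectation_cst (c : R) : \int[P]_w c = c.
Proof.
rewrite /Rintegral integral_cst//.
transitivity (fine (c%:E * 1)%E); last by rewrite mule1.
by congr (fine (_ * _)); exact: probability_setT.
Qed.

(** The real form of E exp(iX) = exp(A + iB). In this form the exponents of
    independent variables add up, and the exponents of the Poisson and of the
    stable integrals are single integrals. *)
Definition has_logcf (X : Om -> R) (A B : R) :=
  \int[P]_w cos (X w) = expR A * cos B /\
  \int[P]_w sin (X w) = expR A * sin B.

Lemma Rintegral_indic_preimage d' (E : measurableType d') (X : Om -> E) B :
  measurable_fun setT X -> measurable B ->
  \int[P]_w (\1_B (X w) : R) = fine (P (X @^-1` B)).
Proof.
move=> mX mB; rewrite /Rintegral.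
rewrite (_ : (fun w => _) = (fun w => (\1_(X @^-1` B) w : R)%:E)); last first.
  by apply/funext => w; rewrite !indicE.
by rewrite integral_indic ?setIT//; rewrite -[X in measurable X]setTI; exact: mX.
Qed.

(** One factor of a product expectation at a time: the class of functions h that
    factor out is linear, closed under bounded limits, and contains indicators. *)
Lemma expectation_factor d' (E : measurableType d') (X : Om -> E)
    (Z : Om -> R) (M c : R) :
  measurable_fun setT X -> measurable_fun setT Z -> (forall w, `|Z w| <= M) ->
  (forall B, measurable B ->
     \int[P]_w (\1_B (X w) * Z w) = \int[P]_w (\1_B (X w) : R) * c) ->
  forall (h : E -> R) (K : R), measurable_fun setT h -> (forall x, `|h x| <= K) ->
  \int[P]_w (h (X w) * Z w) = \int[P]_w h (X w) * c.
Proof.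
move=> mX mZ ZM H h K mh hK.
have M0 : 0 <= M by apply: le_trans (ZM point).
have mhX (g : E -> R) : measurable_fun setT g -> measurable_fun setT (fun w => g (X w)).
  by move=> mg; exact: measurableT_comp.
have iX (g : E -> R) : measurable_fun setT g -> (exists K : R, forall x, `|g x| <= K) ->
    P.-integrable setT (EFin \o (fun w => g (X w))).
  by move=> mg [L gL]; apply: (@bounded_integrable _ L) => //; exact: mhX.
have iXZ (g : E -> R) : measurable_fun setT g -> (exists K : R, forall x, `|g x| <= K) ->
    P.-integrable setT (EFin \o (fun w => g (X w) * Z w)).
  move=> mg [L gL]; apply: (@bounded_integrable _ (L * M)).
    by apply: measurable_funM => //; exact: mhX.
  by move=> w; rewrite normrM ler_pM.
move: h K mh hK.
apply: (bounded_measurable_ind (Pr := fun h : E -> R =>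
   \int[P]_w (h (X w) * Z w) = \int[P]_w h (X w) * c)) => //.
- move=> a f g mf mg bf bg If Ig.
  under eq_Rintegral do rewrite mulrDl -mulrA.
  rewrite RintegralD//; last 2 first.
  + by apply: integrable_scale; exact: iXZ.
  + exact: iXZ.
  rewrite RintegralZl//; last exact: iXZ.
  rewrite If Ig RintegralD//; last 2 first.
  + by apply: integrable_scale; exact: iX.
  + exact: iX.
  by rewrite RintegralZl//; [rewrite mulrDl mulrA|exact: iX].
- move=> g f K mg gK gf Ig.
  have bg n : exists K : R, forall x, `|g n x| <= K by exists K.
  have iK L : P.-integrable setT (EFin \o (fun=> L)).
    by apply: (@bounded_integrable _ `|L|).
  have [_ H1] := Rintegral_dominated_cvg (G := fun n w => g n (X w))
    (F := fun w => f (X w)) (fun n => mhX _ (mg n)) (fun w => gf (X w)) (iK K) (fun n w => gK n (X w)).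
  have [|||_ H2] := Rintegral_dominated_cvg (m := P) (G := fun n w => g n (X w) * Z w)
    (F := fun w => f (X w) * Z w) (g := fun=> K * M) _ _ (iK _).
  + by move=> n; apply: measurable_funM => //; exact: mhX.
  + by move=> w; apply: cvgMl; exact: gf.
  + by move=> n w; rewrite normrM ler_pM.
  have H3 : \int[P]_w g n (X w) * c @[n --> \oo] --> \int[P]_w f (X w) * c.
    exact: cvgMl.
  rewrite -(cvg_lim _ H2)// -(cvg_lim _ H3)//.
  by congr (limn _); apply/funext => n; exact: Ig.
Qed.

(** Induction on the number k of factors that are not indicators. *)
Lemma expectation_prod d' (E : measurableType d') n (X : 'I_n -> Om -> E) :
  (forall i, measurable_fun setT (X i)) -> mutually_independent P X ->
  forall h : 'I_n -> E -> R, (forall i, measurable_fun setT (h i)) ->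
  (forall i, exists K : R, forall x, `|h i x| <= K) ->
  \int[P]_w (\prod_i h i (X i w)) = \prod_i \int[P]_w h i (X i w).
Proof.
move=> mX indX.
suff H k : (k <= n)%N -> forall h : 'I_n -> E -> R,
    (forall i, measurable_fun setT (h i)) ->
    (forall i, exists K : R, forall x, `|h i x| <= K) ->
    (forall i : 'I_n, (k <= i)%N -> exists2 B, measurable B & h i = \1_B) ->
    \int[P]_w (\prod_i h i (X i w)) = \prod_i \int[P]_w h i (X i w).
  move=> h mh bh; apply: (H n) => // i.
  by rewrite leqNgt ltn_ord.
elim: k => [_|k IH kn] h mh bh hk.
  have /choice[B HB] : forall i, exists B, measurable B /\ h i = \1_B.
    by move=> i; have [B] := hk i isT; exists B.
  transitivity (fine (P (\bigcap_i (X i @^-1` B i)))).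
    rewrite /Rintegral; congr fine.
    rewrite (_ : (fun w => _) = (fun w => (\1_(\bigcap_i (X i @^-1` B i)) w : R)%:E)).
      rewrite integral_indic ?setIT//.
      by apply: fin_bigcap_measurable => // i _;
        rewrite -[X in measurable X]setTI; apply: mX => //; exact: (HB i).1.
    apply/funext => w; congr EFin; rewrite indicE.
    have [|/asboolPn] := pselect ((\bigcap_i (X i @^-1` B i)) w).
      move=> Hw; rewrite mem_set// big1// => i _.
      by rewrite (HB i).2 indicE mem_set//; exact: Hw.
    move=> /asboolPn Hw; rewrite memNset//.
    have [i Hi] : exists i, ~ B i (X i w).
      by apply/existsNP => H; apply: Hw => i _; exact: H.
    by rewrite (bigD1 i)//= (HB i).2 indicE memNset ?mul0r.
  rewrite indX; last by move=> i; exact: (HB i).1.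
  transitivity (fine (\prod_(i < n) (fine (P (X i @^-1` B i)))%:E)%E).
    congr fine; apply: eq_bigr => i _; rewrite fineK//.
    by rewrite fin_num_measure// -[X in measurable X]setTI; apply: mX => //; exact: (HB i).1.
  rewrite prodEFin/=; apply: eq_bigr => i _.
  rewrite (HB i).2; rewrite Rintegral_indic_preimage//; exact: (HB i).1.
pose o := Ordinal kn.
pose Z w := \prod_(i | i != o) h i (X i w).
have /choice[K hK] := bh.
have mZ : measurable_fun setT Z.
  by apply: measurable_bigprod => i; exact: measurableT_comp.
have K0 i : 0 <= K i by apply: le_trans (hK i point).
have ZM w : `|Z w| <= \prod_(i | i != o) K i.
  rewrite normr_prod; apply: ler_prod => i _; rewrite normr_ge0/=; exact: hK.
under eq_Rintegral do rewrite (bigD1 o)//=.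
rewrite [RHS](bigD1 o)//=.
apply: (expectation_factor (mX o) mZ ZM _ (mh o) (hK o)) => B mB.
pose h' i := if i == o then \1_B else h i.
have h'o : h' o = \1_B by rewrite /h' eqxx.
have h'i i : i != o -> h' i = h i by rewrite /h' => /negbTE ->.
have := IH (ltnW kn) h'.
under eq_Rintegral do rewrite (bigD1 o)//= h'o.
have -> : \prod_i \int[P]_w h' i (X i w) =
    \int[P]_w (\1_B (X o w) : R) * \prod_(i | i != o) \int[P]_w h i (X i w).
  by rewrite (bigD1 o)//= h'o; congr (_ * _); apply: eq_bigr => i io; rewrite h'i.
have -> : (fun w => \1_B (X o w) * \prod_(i | i != o) h' i (X i w)) = (fun w => \1_B (X o w) * Z w).
  by apply/funext => w; congr (_ * _); apply: eq_bigr => i io; rewrite h'i.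
apply.
- move=> i; rewrite /h'; case: ifP => // _; exact: measurable_indic.
- move=> i; rewrite /h'; case: ifP => // _.
  by exists 1 => x; rewrite indicE; case: (_ \in _); rewrite ?normr1 ?normr0.
- move=> i ki; rewrite /h'; case: ifPn => [_|io]; first by exists B.
  apply: hk; rewrite ltn_neqAle ki andbT.
  by apply: contra io => /eqP kE; apply/eqP/val_inj.
Qed.

(** The addition formulas of cos and sin, one variable at a time: the induction
    keeps the variables that are not yet added as factors of a product. *)
Lemma has_logcf_sum d' (E : measurableType d') n (X : 'I_n -> Om -> E)
    (g : 'I_n -> E -> R) (A B : 'I_n -> R) :
  (forall i, measurable_fun setT (X i)) -> mutually_independent P X ->
  (forall i, measurable_fun setT (g i)) ->
  (forall i, has_logcf (fun w => g i (X i w)) (A i) (B i)) ->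
  has_logcf (fun w => \sum_i g i (X i w)) (\sum_i A i) (\sum_i B i).
Proof.
move=> mX indX mg AB.
have H k : (k <= n)%N -> forall h : 'I_n -> E -> R,
    (forall i, measurable_fun setT (h i)) ->
    (forall i, exists K : R, forall x, `|h i x| <= K) ->
    \int[P]_w (cos (\sum_(i < n | (i < k)%N) g i (X i w)) *
       \prod_(i < n | (k <= i)%N) h i (X i w)) =
      expR (\sum_(i < n | (i < k)%N) A i) * cos (\sum_(i < n | (i < k)%N) B i) *
       \prod_(i < n | (k <= i)%N) \int[P]_w h i (X i w) /\
    \int[P]_w (sin (\sum_(i < n | (i < k)%N) g i (X i w)) *
       \prod_(i < n | (k <= i)%N) h i (X i w)) =
      expR (\sum_(i < n | (i < k)%N) A i) * sin (\sum_(i < n | (i < k)%N) B i) *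
       \prod_(i < n | (k <= i)%N) \int[P]_w h i (X i w).
  elim: k => [_|k IH kn] h mh bh.
    split.
      under eq_Rintegral do rewrite big_pred0// cos0 mul1r.
      rewrite [X in expR X]big_pred0// [X in cos X]big_pred0// expR0 cos0 !mul1r.
      exact: expectation_prod.
    under eq_Rintegral do rewrite big_pred0// sin0 mul0r.
    by rewrite [X in sin X]big_pred0// sin0 mulr0 mul0r /Rintegral integral0.
  pose o := Ordinal kn.
  have sumS (F : 'I_n -> R) : \sum_(i < n | (i < k.+1)%N) F i = \sum_(i < n | (i < k)%N) F i + F o.
    rewrite (bigD1 o)//= addrC; congr (_ + _); apply: eq_bigl => i.
    by rewrite ltnS [RHS]ltn_neqAle andbC.
  have prodS (F : 'I_n -> R) : \prod_(i < n | (k <= i)%N) F i = F o * \prod_(i < n | (k.+1 <= i)%N) F i.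
    rewrite (bigD1 o)//=; congr (_ * _); apply: eq_bigl => i.
    by rewrite [RHS]ltn_neqAle andbC eq_sym.
  pose hc (c : R -> R) i := if i == o then c \o g o else h i.
  have hco c : hc c o = c \o g o by rewrite /hc eqxx.
  have hci c (i : 'I_n) : (k.+1 <= i)%N -> hc c i = h i.
    by rewrite /hc; case: eqP => // ->; rewrite /= ltnn.
  have prodSw c w : \prod_(i < n | (k <= i)%N) hc c i (X i w) =
     c (g o (X o w)) * \prod_(i < n | (k.+1 <= i)%N) h i (X i w).
    by rewrite prodS hco; congr (_ * _); apply: eq_bigr => i ki; rewrite hci.
  have prodSP c : \prod_(i < n | (k <= i)%N) \int[P]_w hc c i (X i w) =
     \int[P]_w c (g o (X o w)) * \prod_(i < n | (k.+1 <= i)%N) \int[P]_w h i (X i w).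
    by rewrite prodS hco; congr (_ * _); apply: eq_bigr => i ki; rewrite hci.
  have mhc c : measurable_fun setT c -> forall i, measurable_fun setT (hc c i).
    by move=> mc i; rewrite /hc; case: ifP => // _; exact: measurableT_comp.
  have bhc (c : R -> R) : (forall x, `|c x| <= 1) -> forall i, exists K : R, forall x, `|hc c i x| <= K.
    by move=> c1 i; rewrite /hc; case: ifP => // _; exists 1 => x /=.
  have [Hcc Hsc] := IH (ltnW kn) _ (mhc _ (@measurable_cos R)) (bhc _ (@norm_cos_le1 R)).
  have [Hcs Hss] := IH (ltnW kn) _ (mhc _ (@measurable_sin R)) (bhc _ (@norm_sin_le1 R)).
  have int1 (a b : R -> R) : measurable_fun setT a -> measurable_fun setT b ->
     (forall x, `|a x| <= 1) -> (forall x, `|b x| <= 1) ->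
     P.-integrable setT (EFin \o (fun w => a (\sum_(i < n | (i < k)%N) g i (X i w)) *
         \prod_(i < n | (k <= i)%N) hc b i (X i w))).
    move=> ma mb a1 b1; have /choice[K hK] := bhc _ b1.
    apply: (@bounded_integrable _ (\prod_(i < n | (k <= i)%N) K i)).
      apply: measurable_funM.
        apply: measurableT_comp => //; apply: measurable_bigsum => i.
        exact: measurableT_comp.
      by apply: measurable_bigprod => i; apply: measurableT_comp => //; exact: mhc.
    move=> w; rewrite normrM -[leRHS]mul1r ler_pM//.
    rewrite normr_prod; apply: ler_prod => i _; rewrite normr_ge0/=; exact: hK.
  rewrite sumS sumS expRD cosD sinD.
  have [ABc ABs] := AB o.
  split.
  - under eq_Rintegral do rewrite sumS cosD mulrBl -!mulrA -!prodSw.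
    rewrite RintegralB//; last 2 first.
    + apply: int1; by [exact: measurable_cos|exact: measurable_sin|exact: norm_cos_le1|exact: norm_sin_le1].
    + apply: int1; by [exact: measurable_cos|exact: measurable_sin|exact: norm_cos_le1|exact: norm_sin_le1].
    rewrite Hcc Hss !prodSP ABc ABs; ring.
  - under eq_Rintegral do rewrite sumS sinD mulrDl -!mulrA -!prodSw.
    rewrite RintegralD//; last 2 first.
    + apply: int1; by [exact: measurable_cos|exact: measurable_sin|exact: norm_cos_le1|exact: norm_sin_le1].
    + apply: int1; by [exact: measurable_cos|exact: measurable_sin|exact: norm_cos_le1|exact: norm_sin_le1].
    rewrite Hsc Hcs !prodSP ABc ABs; ring.
have [||c s] := H n (leqnn n) (fun _ _ => 1).
- by move=> i; exact: measurable_cst.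
- by move=> i; exists 1 => x; rewrite normr1.
have e1 (F : 'I_n -> R) : \sum_(i < n | (i < n)%N) F i = \sum_i F i.
  by apply: eq_bigl => i; rewrite ltn_ord.
have e2 (F : 'I_n -> R) : \prod_(i < n | (n <= i)%N) F i = 1.
  by rewrite big_pred0// => i; rewrite leqNgt ltn_ord.
move: c s; rewrite !e1 !e2 !mulr1.
under eq_Rintegral do rewrite e1 mulr1.
under [X in _ -> X = _ -> _]eq_Rintegral do rewrite e1 mulr1.
by [].
Qed.

End expectations.

(** * Poisson variables *)

Section poisson_variable.
Context d (Om : measurableType d) (R : realType) (P : probability Om R).
Variables (X : Om -> \bar R) (m : R).
Hypothesis mX : measurable_fun setT X.
Hypothesis PX : forall k : nat,
  P [set w | X w = k%:R%:E] = (expR (- m) * m ^+ k / k`!%:R)%:E.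

Let D (k : nat) := [set w | X w = k%:R%:E].

Let mD k : measurable (D k).
Proof.
rewrite (_ : D k = setT `&` X @^-1` [set k%:R%:E]); last by rewrite setTI.
by apply: mX.
Qed.

Let tD : trivIset setT D.
Proof.
apply/trivIsetP => i j _ _ ij; apply/seteqP; split => // w [/=]; rewrite /D /=.
by move=> -> [] /eqP; rewrite eqr_nat (negbTE ij).
Qed.

Let cvg_exp_coeff : series (fun k => m ^+ k / k`!%:R) @ \oo --> expR m.
Proof.
have := @exp_series_phase R 0 0 m.
rewrite (_ : (fun k => _ * cos _) = (fun k => m ^+ k / k`!%:R)); last first.
  by apply/funext => k; rewrite mulr0 addr0 cos0 mulr1.
by rewrite sin0 cos0 mulr0 addr0 cos0 !mulr1.
Qed.

Lemma eseries_limit (u : nat -> R) (l : R) : series u @ \oo --> l ->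
  (\big[+%E/0%E]_(0 <= k <oo) (u k)%:E)%E = l%:E.
Proof.
move=> ul; rewrite -(cvg_lim _ ul)// -EFin_lim; last by apply/cvg_ex; exists l.
by congr (limn _); apply/funext => n /=; rewrite sumEFin.
Qed.

(** The variable may take values outside the natural numbers, but the Poisson
    weights add up to 1. *)
Let PD : P (\bigcup_k D k) = 1%E.
Proof.
rewrite measure_semi_bigcup//; last exact: bigcup_measurable.
rewrite (eq_eseriesr (fun k _ => PX k)).
apply: eseries_limit.
apply: cvg_congr (cvg_scale (expR (- m)) cvg_exp_coeff) _ _.
  move=> n; rewrite /series /= mulr_sumr.
  by apply: eq_bigr => k _; rewrite mulrA.
by rewrite -expRD addNr expR0.
Qed.

Lemma poisson_ge0_integral (g : \bar R -> \bar R) : measurable_fun setT g ->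
  (forall x, 0 <= g x)%E ->
  (\int[P]_w g (X w) =
   \big[+%E/0%E]_(0 <= k <oo) (g k%:R%:E * (expR (- m) * m ^+ k / k`!%:R)%:E))%E.
Proof.
move=> mg g0; have mgX : measurable_fun setT (fun w => g (X w)) by exact: measurableT_comp.
have mU : measurable (\bigcup_k D k) by exact: bigcup_measurable.
rewrite (@ge0_negligible_integral _ _ _ _ _ (~` (\bigcup_k D k)))//; last 2 first.
- exact: measurableC.
- by transitivity (1 - P (\bigcup_k D k))%E; [exact: probability_setC|rewrite PD subee].
rewrite setTD setCK ge0_integral_bigcup//; last exact: measurable_funS mgX.
apply: eq_eseriesr => k _.
rewrite -PX -integral_cst; last exact: mD.
by apply: eq_integral => w /set_mem; rewrite /D /= => ->.
Qed.

Lemma poisson_expectation : (forall w, 0 <= X w)%E -> (\int[P]_w X w = m%:E)%E.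
Proof.
move=> X0; transitivity (\int[P]_w `|X w|)%E.
  by apply: eq_integral => w _; rewrite gee0_abs.
rewrite (@poisson_ge0_integral abse)//.
transitivity (\big[+%E/0%E]_(0 <= k <oo) (k%:R * (expR (- m) * m ^+ k / k`!%:R))%:E)%E.
  by apply: eq_eseriesr => k _; rewrite EFinM gee0_abs ?lee_fin.
apply: eseries_limit.
rewrite -cvg_shiftS.
apply: cvg_congr (cvg_scale (m * expR (- m)) cvg_exp_coeff) _ _; last first.
  by rewrite -mulrA -expRD addNr expR0 mulr1.
move=> n; rewrite /series /= big_nat_recl//= mul0r add0r mulr_sumr.
apply: eq_bigr => k _; rewrite factS natrM exprS; field.
by rewrite pnatr_eq0 -lt0n fact_gt0 -[1]/(1%:R) -natrD pnatr_eq0.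
Qed.

Hypothesis m0 : 0 <= m.

(** Adding 1 to the cosine makes it nonnegative, so that the expectation is a
    series of nonnegative terms. The phase -pi/2 gives the sine. *)
Lemma poisson_cos_phase (c th : R) :
  \int[P]_w cos (c * fine (X w) + th) =
  expR (m * (cos c - 1)) * cos (m * sin c + th).
Proof.
have msh : measurable_fun setT (fun x : \bar R => cos (c * fine x + th)).
  apply: measurableT_comp; first exact: measurable_cos.
  by apply: measurable_funD => //; apply: measurable_funM => //.
pose g (x : \bar R) := (1 + cos (c * fine x + th))%:E.
have mg : measurable_fun setT g.
  by apply/measurable_EFinP; apply: measurable_funD.
have g0 x : (0 <= g x)%E.
  by rewrite lee_fin; have := @cos_geN1 R (c * fine x + th); lra.
have H := poisson_ge0_integral mg g0.
have imc : P.-integrable setT (EFin \o (fun w => cos (c * fine (X w) + th))).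
  apply: (@bounded_integrable _ _ _ _ _ 1) => [|w]; last exact: norm_cos_le1.
  exact: (measurableT_comp msh).
have i1 : P.-integrable setT (EFin \o cst (1 : R)).
  by apply: (@bounded_integrable _ _ _ _ _ 1) => // w; rewrite normr1.
have : \int[P]_w (1 + cos (c * fine (X w) + th)) =
    1 + expR (m * (cos c - 1)) * cos (m * sin c + th).
  rewrite /Rintegral H (@eseries_limit (fun k => (1 + cos (c * k%:R + th)) *
     (expR (- m) * m ^+ k / k`!%:R)) (1 + expR (m * (cos c - 1)) * cos (m * sin c + th)))//.
  apply: cvg_congr (cvgD (cvg_scale (expR (- m)) cvg_exp_coeff)
    (cvg_scale (expR (- m)) (@exp_series_phase R c th m))) _ _.
    move=> n; rewrite fctE /series /= !mulr_sumr -big_split.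
    by apply: eq_bigr => k _ /=; rewrite (mulrC c); field; rewrite pnatr_eq0 -lt0n fact_gt0.
  rewrite -expRD addNr expR0 mulrA -expRD; congr (1 + expR _ * _); ring.
rewrite RintegralD// => /eqP; rewrite (_ : \int[P]_x 1 = 1); last first.
  exact: expectation_cst.
by move=> /eqP /addrI.
Qed.

Lemma poisson_has_logcf (c : R) :
  has_logcf P (fun w => c * fine (X w)) (m * (cos c - 1)) (m * sin c).
Proof.
split.
  have := poisson_cos_phase c 0; rewrite addr0.
  by under eq_Rintegral do rewrite addr0.
have := poisson_cos_phase c (- (pi / 2)).
rewrite cosBpihalf.
by under eq_Rintegral do rewrite cosBpihalf.
Qed.

End poisson_variable.

(** * Integrals against a Poisson random measure *)

Lemma ae_all_seq d (T : measurableType d) (R : realType)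
    (m : {measure set T -> \bar R}) (I : eqType) (s : seq I) (Q : I -> T -> Prop) :
  (forall i, i \in s -> {ae m, forall w, Q i w}) ->
  {ae m, forall w, forall i, i \in s -> Q i w}.
Proof.
elim: s => [|i s IH] H; first exact: aeW.
have H1 : {ae m, forall w, Q i w} by apply: H; rewrite mem_head.
have H2 : {ae m, forall w, forall j, j \in s -> Q j w}.
  by apply: IH => j js; apply: H; rewrite in_cons js orbT.
by apply: filterS2 H1 H2 => w Qi Qs j; rewrite in_cons => /predU1P[->|/Qs].
Qed.

Lemma ae_eq_Rintegral d (T : measurableType d) (R : realType)
    (m : {measure set T -> \bar R}) (f g : T -> R) :
  measurable_fun setT f -> measurable_fun setT g ->
  {ae m, forall w, f w = g w} -> \int[m]_w f w = \int[m]_w g w.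
Proof.
move=> mf mg fg; rewrite /Rintegral; congr fine; apply: ae_eq_integral => //.
- exact/measurable_EFinP.
- exact/measurable_EFinP.
- by apply: filterS fg => w /= -> _.
Qed.

Lemma has_logcf_ae d (Om : measurableType d) (R : realType)
    (P : probability Om R) (X Y : Om -> R) (A B : R) :
  measurable_fun setT X -> measurable_fun setT Y ->
  {ae P, forall w, X w = Y w} -> has_logcf P X A B -> has_logcf P Y A B.
Proof.
move=> mX mY XY [XA XB]; split.
  rewrite -XA; apply: ae_eq_Rintegral.
  - exact: (measurableT_comp (@measurable_cos R)).
  - exact: (measurableT_comp (@measurable_cos R)).
  - by apply: filterS XY => w ->.
rewrite -XB; apply: ae_eq_Rintegral.
- exact: (measurableT_comp (@measurable_sin R)).
- exact: (measurableT_comp (@measurable_sin R)).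
- by apply: filterS XY => w ->.
Qed.

Section simple_functions.
Context d (E : measurableType d) (R : realType).
Variable g : E -> R.

(** The level set of the value 0 is left out because its measure may be
    infinite. *)
Definition nzvals : seq R := [seq c <- fset_set (range g) | c != 0].

Lemma nzvals_uniq : uniq nzvals.
Proof. by apply: filter_uniq; exact: fset_uniq. Qed.

Hypothesis mg : measurable_fun setT g.
Hypothesis fg : finite_set (range g).

Lemma mem_nzvals c : (c \in nzvals) = (c != 0) && (c \in range g).
Proof. by rewrite mem_filter; congr (_ && _); rewrite in_fset_set. Qed.

Lemma measurable_level c : measurable (g @^-1` [set c]).
Proof. by rewrite -[_ @^-1` _]setTI; exact: mg. Qed.

Lemma sfun_comp_sum (G : R -> R) x : G 0 = 0 ->
  G (g x) = \sum_(c <- nzvals) G c * \1_(g @^-1` [set c]) x.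
Proof.
move=> G0; have [g0|gx0] := eqVneq (g x) 0.
  rewrite g0 G0 big1_seq// => c /andP[_]; rewrite mem_nzvals => /andP[c0 _].
  by rewrite indicE memNset ?mulr0//= g0 => /esym/eqP; rewrite (negbTE c0).
rewrite (bigD1_seq (g x)) ?nzvals_uniq//=; last first.
  by rewrite mem_nzvals gx0; apply/mem_set; exists x.
rewrite indicE mem_set// mulr1 big1 ?addr0// => c cgx.
by rewrite indicE memNset ?mulr0//= => /esym/eqP; rewrite (negbTE cgx).
Qed.

Lemma Rintegral_sfun_comp (m : {measure set E -> \bar R}) (G : R -> R) : G 0 = 0 ->
  (forall c, c \in nzvals -> (m (g @^-1` [set c]) < +oo)%E) ->
  m.-integrable setT (EFin \o (G \o g)) /\
  \int[m]_x G (g x) = \sum_(c <- nzvals) G c * fine (m (g @^-1` [set c])).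
Proof.
move=> G0 mfin.
rewrite (_ : G \o g = fun x => \sum_(c <- nzvals) G c * \1_(g @^-1` [set c]) x); last first.
  by apply/funext => x /=; exact: sfun_comp_sum.
under eq_Rintegral do rewrite sfun_comp_sum//.
elim: nzvals mfin => [|c s IH] mfin.
  split; last by under eq_Rintegral do rewrite big_nil; rewrite big_nil /Rintegral integral0.
  apply: eq_integrable (integrable0 m setT) => // x _ /=.
  by rewrite big_nil.
have [|js Js] := IH; first by move=> e es; apply: mfin; rewrite in_cons es orbT.
have mA : measurable (g @^-1` [set c]) by exact: measurable_level.
have cfin : (m (g @^-1` [set c]) < +oo)%E by apply: mfin; rewrite mem_head.
have i1 : m.-integrable setT (EFin \o (fun x => \1_(g @^-1` [set c]) x : R)).
  apply/integrableP; split; first by apply/measurable_EFinP; exact: measurable_indic.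
  rewrite (eq_integral (fun x => (\1_(g @^-1` [set c]) x : R)%:E)).
    by rewrite integral_indic// setIT.
  by move=> x _ /=; rewrite ger0_norm.
have ic := integrable_scale (G c) i1.
split.
  apply: eq_integrable (integrable_add ic js) => // x _ /=.
  by rewrite big_cons.
under eq_Rintegral do rewrite big_cons.
rewrite RintegralD// Js big_cons RintegralZl//; congr (_ * _ + _).
by rewrite /Rintegral integral_indic// setIT.
Qed.

(** Markov's inequality on each level set. *)
Lemma integrable_sfun_fin (m : {measure set E -> \bar R}) :
  m.-integrable setT (EFin \o g) ->
  forall c, c \in nzvals -> (m (g @^-1` [set c]) < +oo)%E.
Proof.
move=> ig c; rewrite mem_nzvals => /andP[c0 _].
have mA : measurable (g @^-1` [set c]) by exact: measurable_level.
have : (`|c|%:E * m (g @^-1` [set c]) < +oo)%E.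
  case/integrableP: ig => _; apply: le_lt_trans.
  rewrite -[X in m X]setIT -integral_indic// -ge0_integralZl//; last first.
    exact/measurable_EFinP.
  apply: ge0_le_integral => //.
  - by apply: measurable_funeM; exact/measurable_EFinP.
  - by apply: measurableT_comp => //; exact/measurable_EFinP.
  move=> x _; rewrite -EFinM lee_fin indicE.
  by case: (boolP (x \in _)) => [/set_mem/= <-|]; rewrite ?mulr1 ?mulr0.
have := measure_ge0 m (g @^-1` [set c]).
by case: (m _) => [r|/=|//] _; rewrite ?ltry// gt0_muley// lte_fin normr_gt0.
Qed.

End simple_functions.

Lemma measurable_Rintegral_kernel d d' (Om : measurableType d)
    (E : measurableType d') (R : realType) (N : R.-ker Om ~> E) (f : E -> R) :
  measurable_fun setT f -> measurable_fun setT (fun w => \int[N w]_x f x).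
Proof.
move=> mf; rewrite /Rintegral; apply: measurableT_comp => //.
have mf' : measurable_fun setT (fun x => (f x)%:E) by exact/measurable_EFinP.
have H (k : E -> \bar R) : measurable_fun setT k -> (forall x, 0 <= k x)%E ->
    measurable_fun setT (fun w => (\int[N w]_x k x)%E).
  move=> mk k0; apply: measurable_fun_integral_kernel => // U mU.
  exact: measurable_kernel.
rewrite (_ : (fun w => _) = fun w => ((\int[N w]_x ((fun x => (f x)%:E)^\+ x)%E) -
   (\int[N w]_x ((fun x => (f x)%:E)^\- x)))%E); last first.
  by apply/funext => w; rewrite integralE.
apply: emeasurable_funB; apply: H => //.
- exact: measurable_funepos.
- exact: measurable_funeneg.
Qed.

Section poisson_integral.
Context d d' (Om : measurableType d) (E : measurableType d') (R : realType).
Variables (P : probability Om R) (nu : {measure set E -> \bar R}).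
Variable N : R.-ker Om ~> E.
Hypothesis HN : poisson_random_measure P nu N.

Let mN A : measurable A -> measurable_fun setT (fun w => N w A).
Proof. exact: measurable_kernel. Qed.

Lemma prm_mean A : measurable A -> (\int[P]_w N w A)%E = nu A.
Proof.
move=> mA; have m0 := measure_ge0 nu A.
case nuA : (nu A) => [m| |]; last by have := m0; rewrite [X in (_ <= X)%E -> _]nuA.
  apply: poisson_expectation => //; [exact: mN|exact: prm_poisson HN _ _ mA nuA].
have PA := prm_infinite HN mA nuA.
have mI : measurable [set w | N w A = +oo%E].
  by rewrite -[X in measurable X]setTI; exact: (mN mA measurableT (emeasurable_set1 +oo%E)).
apply/eqP; rewrite -leye_eq.
have <- : (\int[P]_(w in [set w | N w A = +oo%E]) cst +oo%E w = +oo)%E.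
  rewrite integral_cst//.
  by transitivity (+oo * (1 : \bar R))%E; [congr (_ * _)%E; exact: PA|rewrite mule1].
rewrite (_ : (\int[P]_(w in _) _ = \int[P]_(w in [set w | N w A = +oo%E]) N w A)%E).
  by apply: ge0_subset_integral => //; exact: mN.
by apply: eq_integral => w /set_mem /= ->.
Qed.

Lemma prm_ge0_integral (f : E -> \bar R) : measurable_fun setT f ->
  (forall x, 0 <= f x)%E -> (\int[P]_w \int[N w]_x f x = \int[nu]_x f x)%E.
Proof. by apply: integral_kernel_mean => A; exact: prm_mean. Qed.

Lemma prm_integrable_ae (f : E -> R) : nu.-integrable setT (EFin \o f) ->
  {ae P, forall w, (N w).-integrable setT (EFin \o f)}.
Proof.
move=> jf; have mf := integrable_mfun jf.
have mabs : measurable_fun setT (fun x => `|(f x)%:E|%E).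
  by apply: measurableT_comp => //; exact/measurable_EFinP.
have iP : P.-integrable setT (fun w => (\int[N w]_x `|(f x)%:E|)%E).
  apply/integrableP; split.
    by apply: measurable_fun_integral_kernel => // U mU; exact: measurable_kernel.
  rewrite (eq_integral (fun w => (\int[N w]_x `|(f x)%:E|)%E)); last first.
    by move=> w _; rewrite gee0_abs// integral_ge0.
  by rewrite prm_ge0_integral//; case/integrableP : jf.
have := integrable_ae measurableT iP; apply: filterS => w /(_ Logic.I) Hw.
apply/integrableP; split; first exact/measurable_EFinP.
by rewrite ltey_eq Hw.
Qed.

Let integrable_int (f : E -> R) : nu.-integrable setT (EFin \o f) ->
  (forall x, 0 <= f x) ->
  P.-integrable setT (EFin \o (fun w => \int[N w]_x f x)) /\
  \int[P]_w \int[N w]_x f x = \int[nu]_x f x.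
Proof.
move=> jf f0; have mf := integrable_mfun jf.
have mfE : measurable_fun setT (fun x => (f x)%:E) by exact/measurable_EFinP.
have mI : measurable_fun setT (fun w => (\int[N w]_x (f x)%:E)%E).
  by apply: measurable_fun_integral_kernel => // U mU; exact: measurable_kernel.
have e : ae_eq P setT (fun w => (\int[N w]_x f x)%:E) (fun w => (\int[N w]_x (f x)%:E)%E).
  apply: filterS (prm_integrable_ae jf) => w jw _.
  by rewrite EFin_Rintegral.
have mR : measurable_fun setT (fun w => (\int[N w]_x f x)%:E).
  exact/measurable_EFinP/measurable_Rintegral_kernel.
have intE : (\int[P]_w (\int[N w]_x f x)%:E = \int[nu]_x (f x)%:E)%E.
  transitivity (\int[P]_w \int[N w]_x (f x)%:E)%E; first exact: ae_eq_integral e.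
  by rewrite prm_ge0_integral// => x; rewrite lee_fin.
split; last by rewrite [LHS]/Rintegral intE.
apply/integrableP; split => //.
rewrite (eq_integral (fun w => (\int[N w]_x f x)%:E)); last first.
  by move=> w _ /=; rewrite ger0_norm// fine_ge0// integral_ge0// => x _; rewrite lee_fin.
by rewrite intE; exact: integrable_lty.
Qed.

Lemma prm_expectation (f : E -> R) : nu.-integrable setT (EFin \o f) ->
  P.-integrable setT (EFin \o (fun w => \int[N w]_x f x)) /\
  \int[P]_w \int[N w]_x f x = \int[nu]_x f x.
Proof.
move=> jf; have mf := integrable_mfun jf.
have ja := integrable_abs jf.
(* Both f + |f| and |f| are nonnegative and integrable. *)
pose p x := (`|f x| + f x); have jp : nu.-integrable setT (EFin \o p) by exact: integrable_add.
have p0 x : 0 <= p x by rewrite /p -lerBlDr sub0r -normrN; exact: ler_norm.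
have [ip Ep] := integrable_int jp p0.
have [ia Ea] := integrable_int ja (fun x => normr_ge0 (f x)).
have e : {ae P, forall w, \int[N w]_x p x - \int[N w]_x `|f x| = \int[N w]_x f x}.
  apply: filterS2 (prm_integrable_ae jf) (prm_integrable_ae ja) => w jw jaw.
  by rewrite /p RintegralD// addrAC subrr add0r.
have mY : measurable_fun setT (fun w => \int[N w]_x f x) by exact: measurable_Rintegral_kernel.
have id := integrable_sub ip ia.
have aeE : ae_eq P setT (EFin \o (fun w => \int[N w]_x p x - \int[N w]_x `|f x|))
    (EFin \o (fun w => \int[N w]_x f x)).
  by apply: filterS e => w /= -> _.
split.
  case/integrableP : id => mid lid; apply/integrableP; split.
    exact/measurable_EFinP.
  rewrite -(@ge0_ae_eq_integral _ _ _ _ _ (fun w => `|(\int[N w]_x p x - \int[N w]_x `|f x|)%:E|)%E)//.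
  - by apply: measurableT_comp => //; exact/measurable_EFinP.
  - by apply: measurableT_comp => //; exact/measurable_EFinP.
  - by apply: filterS e => w /= -> _.
rewrite -(ae_eq_Rintegral (integrable_mfun id) mY e) RintegralB//.
by rewrite Ep Ea RintegralD// addrAC subrr add0r.
Qed.

(** The level sets are disjoint, so that the integral is a sum of independent
    multiples of Poisson variables. *)
Lemma prm_simple_logcf (g : {sfun E >-> R}) : nu.-integrable setT (EFin \o g) ->
  has_logcf P (fun w => \int[N w]_x g x) (\int[nu]_x (cos (g x) - 1)) (\int[nu]_x sin (g x)).
Proof.
move=> ig; have mg : measurable_fun setT g by exact: measurable_funPT.
have fg : finite_set (range g) by exact: fimfunP.
have gfin := integrable_sfun_fin mg fg ig.
have [_ ->] := Rintegral_sfun_comp mg fg (G := fun x => cos x - 1)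
  (etrans (congr1 (fun z => z - 1) (cos0 R)) (subrr 1)) gfin.
have [_ ->] := Rintegral_sfun_comp mg fg (G := @sin R) (sin0 R) gfin.
pose s := nzvals g; pose c := tnth (in_tuple s).
pose A i := g @^-1` [set c i].
have mA i : measurable (A i) by exact: measurable_sfunP.
have cs i : c i \in s by exact: mem_tnth.
have tA : trivIset setT A.
  apply/trivIsetP => i j _ _ ij; apply/seteqP; split => // x [/= gi gj].
  move: ij; have /tuple_uniqP inj : uniq (in_tuple s) by exact: nzvals_uniq.
  have -> : i = j by apply: inj; rewrite -/(c i) -/(c j) -gi -gj.
  by rewrite eqxx.
have indep := prm_independent HN mA tA.
have H := @has_logcf_sum _ _ _ P _ _ _ (fun i w => N w (A i)) (fun i x => c i * fine x)
  (fun i => (cos (c i) - 1) * fine (nu (A i))) (fun i => sin (c i) * fine (nu (A i)))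
  (fun i => mN (mA i)) indep _ _.
rewrite !(big_tnth _ _ s) /=.
apply: has_logcf_ae (H _ _).
- by apply: measurable_bigsum => i; apply: measurable_funM => //;
    apply: measurableT_comp => //; exact: mN.
- exact/measurable_Rintegral_kernel.
- apply: filterS (prm_integrable_ae ig) => w iw.
  have [_ ->] := Rintegral_sfun_comp mg fg (G := id) erefl (integrable_sfun_fin mg fg iw).
  by rewrite (big_tnth _ _ s).
- by move=> i; apply: measurable_funM => //; exact: fine_measurable.
- move=> i; have [r0 rE] : 0 <= fine (nu (A i)) /\ nu (A i) = (fine (nu (A i)))%:E.
    split; first exact: fine_ge0.
    by rewrite fineK// ge0_fin_numE// gfin.
  rewrite ![_ * fine (nu _)]mulrC.
  apply: poisson_has_logcf => //; first exact: mN.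
  exact: prm_poisson HN _ _ (mA i) rE.
Qed.

(** The difference is at most the mean of the integral of |f - g| against N, and
    this mean is an integral against the intensity. *)
Lemma prm_expectation_dist (f g : E -> R) : nu.-integrable setT (EFin \o f) ->
  nu.-integrable setT (EFin \o g) ->
  forall h : R -> R, measurable_fun setT h -> (forall x, `|h x| <= 1) ->
  (forall x y, `|h x - h y| <= `|x - y|) ->
  `|\int[P]_w h (\int[N w]_x f x) - \int[P]_w h (\int[N w]_x g x)| <=
  \int[nu]_x `|f x - g x|.
Proof.
move=> jf jg h mh h1 hl.
have jd := integrable_sub jf jg; have ja := integrable_abs jd.
have [ia <-] := integrable_int ja (fun x => normr_ge0 _).
have mY k : measurable_fun setT k -> measurable_fun setT (fun w => h (\int[N w]_x k x)).
  by move=> mk; apply: measurableT_comp => //; exact: measurable_Rintegral_kernel.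
have iY k : measurable_fun setT k -> P.-integrable setT (EFin \o (fun w => h (\int[N w]_x k x))).
  by move=> mk; apply: (@bounded_integrable _ _ _ _ _ 1) => //; exact: mY.
have mf := integrable_mfun jf; have mg := integrable_mfun jg.
rewrite -RintegralB//; [|exact: iY|exact: iY].
apply: le_trans (le_normr_Rintegral _ _) _ => //.
  by apply: integrable_sub; exact: iY.
rewrite /Rintegral; apply: fine_le.
- apply: integrable_fin_num => //.
  by apply: integrable_abs; apply: integrable_sub; exact: iY.
- exact: integrable_fin_num.
apply: ae_ge0_le_integral => //.
- apply/measurable_EFinP; apply: measurableT_comp => //.
  by apply: measurable_funB; exact: mY.
- by move=> w _; rewrite lee_fin fine_ge0// integral_ge0// => x _; rewrite lee_fin.
- by case/integrableP : ia.
apply: filterS2 (prm_integrable_ae jf) (prm_integrable_ae jg) => w fw gw _.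
rewrite lee_fin (le_trans (hl _ _))// -RintegralB//.
by apply: le_normr_Rintegral => //; exact: integrable_sub.
Qed.

End poisson_integral.

Lemma has_logcf_cvg d (Om : measurableType d) (R : realType)
    (P : probability Om R) (Xn : nat -> Om -> R) (X : Om -> R)
    (An Bn : nat -> R) (A B : R) :
  (forall n, has_logcf P (Xn n) (An n) (Bn n)) ->
  \int[P]_w cos (Xn n w) @[n --> \oo] --> \int[P]_w cos (X w) ->
  \int[P]_w sin (Xn n w) @[n --> \oo] --> \int[P]_w sin (X w) ->
  An n @[n --> \oo] --> A -> Bn n @[n --> \oo] --> B ->
  has_logcf P X A B.
Proof.
move=> HX cX sX hA hB.
have eA : expR (An n) @[n --> \oo] --> expR A.
  by apply: continuous_cvg => //; exact: continuous_expR.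
split; [rewrite -(cvg_lim _ cX)//|rewrite -(cvg_lim _ sX)//]; apply/cvg_lim => //.
  under eq_fun do rewrite (HX _).1.
  by apply: cvgM => //; apply: continuous_cvg => //; exact: continuous_cos.
under eq_fun do rewrite (HX _).2.
by apply: cvgM => //; apply: continuous_cvg => //; exact: continuous_sin.
Qed.

(** Campbell's formula: both sides are continuous for the L^1 distance of the
    intensity, in which simple functions are dense. *)
Lemma prm_has_logcf d d' (Om : measurableType d) (E : measurableType d')
  (R : realType) (P : probability Om R) (nu : {measure set E -> \bar R})
  (N : R.-ker Om ~> E) (f : E -> R) : poisson_random_measure P nu N ->
  nu.-integrable setT (EFin \o f) ->
  has_logcf P (fun w => \int[N w]_x f x) (\int[nu]_x (cos (f x) - 1)) (\int[nu]_x sin (f x)).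
Proof.
move=> HN jf; have mf := integrable_mfun jf.
have [g [jg _ gf]] := approximation_sfun_integrable measurableT jf.
have jd n : nu.-integrable setT (EFin \o (fun x => `|f x - g n x|)).
  by apply: integrable_abs; exact: integrable_sub.
have D0 : \int[nu]_x `|f x - g n x| @[n --> \oo] --> 0 by apply: fine_cvg; exact: gf.
have lim (u : nat -> R) l : (forall n, `|l - u n| <= \int[nu]_x `|f x - g n x|) ->
    u n @[n --> \oo] --> l.
  move=> ul; apply/cvgrPdist_le => e e0.
  move/cvgrPdist_le : D0 => /(_ e e0); apply: filterS => n.
  rewrite sub0r normrN; apply: le_trans; rewrite (le_trans (ul n))//.
  exact: ler_norm.
apply: (has_logcf_cvg (fun n => prm_simple_logcf HN (jg n))).
- apply: lim => n; apply: (prm_expectation_dist HN jf (jg n) (@measurable_cos R)).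
    exact: norm_cos_le1.
  exact: cos_lipschitz.
- apply: lim => n; apply: (prm_expectation_dist HN jf (jg n) (@measurable_sin R)).
    exact: norm_sin_le1.
  exact: sin_lipschitz.
- have jc (k : E -> R) : nu.-integrable setT (EFin \o k) ->
      nu.-integrable setT (EFin \o (fun x => cos (k x) - 1)).
    move=> jk; apply: (integrable_dominated (g := fun x => `|k x|)).
    + apply: measurable_funB => //; apply: (measurableT_comp (@measurable_cos R)).
      exact: integrable_mfun jk.
    + by move=> x; rewrite distrC ger0_norm ?subr1_cos_ge0// subr1_cos_le_norm.
    + exact: integrable_abs.
  apply: lim => n; rewrite -RintegralB//; [|exact: jc|exact: jc].
  apply: le_trans (le_normr_Rintegral _ _) _ => //.
    by apply: integrable_sub; exact: jc.
  apply: Rintegral_ge0_le => //.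
    by apply/integrable_abs/integrable_sub; exact: jc.
  by move=> x; rewrite opprB addrA subrK; exact: cos_lipschitz.
- have js (k : E -> R) : nu.-integrable setT (EFin \o k) ->
      nu.-integrable setT (EFin \o (fun x => sin (k x))).
    move=> jk; apply: (integrable_dominated (g := fun x => `|k x|)).
    + apply: (measurableT_comp (@measurable_sin R)).
      exact: integrable_mfun jk.
    + by move=> x; exact: norm_sin_le.
    + exact: integrable_abs.
  apply: lim => n; rewrite -RintegralB//; [|exact: js|exact: js].
  apply: le_trans (le_normr_Rintegral _ _) _ => //.
    by apply: integrable_sub; exact: js.
  apply: Rintegral_ge0_le => //.
    by apply/integrable_abs/integrable_sub; exact: js.
  by move=> x; exact: sin_lipschitz.
Qed.

(** * Tails of a law from its characteristic function *)

Section tail.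
Context d (Om : measurableType d) (R : realType) (P : probability Om R).

Lemma integral_subr1_cos (dl x : R) : 0 < dl -> x != 0 ->
  (\int[lebesgue_measure]_(t in `[0%R, dl]) (1 - cos (t * x))%:E = (dl - sin (dl * x) / x)%:E)%E.
Proof.
move=> d0 x0.
have dF (t : R) : is_derive t (1:R) (fun t => t - sin (t * x) / x) (1 - cos (t * x)).
  apply: is_derive_eq; rewrite /GRing.scale /=; field; exact: x0.
have cF : continuous (fun t : R => t - sin (t * x) / x : R).
  by move=> t; apply: is_derive_continuous (dF t).
rewrite (@continuous_FTC2 _ _ (fun t => t - sin (t * x) / x))//.
- by rewrite mul0r sin0 mul0r subrr sube0.
- apply: continuous_subspaceT => t.
  apply: (@is_derive_continuous _ _ (sin (t * x) * x)).
  by apply: is_derive_eq; rewrite /GRing.scale /=; ring.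
- split.
  + by move=> t _; case: (dF t).
  + by apply: cvg_at_right_filter; exact: cF.
  + by apply: cvg_at_left_filter; exact: cF.
- by move=> t _; rewrite derive1E; apply: derive_val.
Qed.

(** Averaging 1 - cos (t X) over t in [0, dl] gives 1 - sin (dl X) / (dl X),
    which is at least 1/2 where |X| >= 2 / dl. *)
Lemma tail_from_charfun (X : Om -> R) (dl A : R) : measurable_fun setT X -> 0 < dl ->
  (forall t, 0 <= t <= dl -> 1 - \int[P]_w cos (t * X w) <= A) ->
  (P [set w | (2 / dl <= `|X w|)%R] <= (2 * A)%:E)%E.
Proof.
move=> mX d0 HA.
pose q (z : Om * R) : \bar R := ((1 - cos (z.2 * X z.1)) * \1_(`[0, dl]%classic) z.2)%:E.
have mq : measurable_fun setT q.
  apply/measurable_EFinP; apply: measurable_funM.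
    apply: measurable_funB => //; apply: (measurableT_comp (@measurable_cos R)).
    apply: measurable_funM => //.
    by apply: (measurableT_comp mX); exact: measurable_fst.
  by apply: (@measurableT_comp _ _ _ _ _ _ (\1_(`[0, dl]%classic) : R -> R)) => //;
    exact: measurable_indic.
have q0 z : (0 <= q z)%E.
  by rewrite lee_fin mulr_ge0// subr1_cos_ge0.
have F := @fubini_tonelli _ _ _ _ R P lebesgue_measure q mq q0.
have E2 : (\int[lebesgue_measure]_t \int[P]_w q (w, t) <= (A * dl)%:E)%E.
  apply: (@le_trans _ _ (\int[lebesgue_measure]_(t in `[0%R, dl]) A%:E)%E); last first.
    by rewrite integral_cst//= lebesgue_measure_itv/= lte_fin d0 sube0.
  rewrite [leRHS]integral_mkcond; apply: ge0_le_integral => //.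
  - by move=> t _; apply: integral_ge0.
  - apply: measurable_fun_fubini_tonelli_G => //.
  - apply/(measurable_restrictT _ _).1 => //.
  move=> t _; rewrite patchE; case: ifPn => [/set_mem tD|tD].
    have -> : (\int[P]_w q (w, t))%E = (1 - \int[P]_w cos (t * X w))%:E.
      rewrite -{1}(expectation_cst P 1) -RintegralB//; last 2 first.
      + by apply: (@bounded_integrable _ _ _ _ _ 1) => // w; rewrite normr1.
      + apply: (@bounded_integrable _ _ _ _ _ 1) => [|w]; last exact: norm_cos_le1.
        by apply: (measurableT_comp (@measurable_cos R)); exact: measurable_funM.
      rewrite EFin_Rintegral.
        by apply: eq_integral => w _; rewrite /q /= indicE mem_set// mulr1.
      apply: (@bounded_integrable _ _ _ _ _ 2) => [|w].
        apply: measurable_funB => //; apply: (measurableT_comp (@measurable_cos R)).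
        exact: measurable_funM.
      rewrite (le_trans (ler_normB _ _))// normr1.
      by have := norm_cos_le1 (t * X w); lra.
    by rewrite lee_fin HA//; move: tD; rewrite /= in_itv.
  rewrite (eq_integral (fun=> 0%E)) ?integral0// => w _.
  by rewrite /q /= indicE (negbTE tD) mulr0.
have E1 : ((dl / 2)%:E * P [set w | (2 / dl <= `|X w|)%R] <= \int[P]_w \int[lebesgue_measure]_t q (w, t))%E.
  have mS : measurable [set w | 2 / dl <= `|X w|].
    rewrite -[X in measurable X]setTI.
    rewrite (_ : [set w | _] = (fun w => `|X w|) @^-1` `[2 / dl, +oo[%classic).
      have mn : measurable_fun setT (fun w => `|X w|) by exact: measurableT_comp.
      by apply: mn.
    by apply/seteqP; split => w /=; rewrite in_itv /= andbT.
  rewrite -integral_cst// integral_mkcond; apply: ge0_le_integral => //.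
  - by move=> w _; rewrite patchE; case: ifP => // _; rewrite lee_fin divr_ge0// ltW.
  - apply/(measurable_restrictT _ _).1 => //.
  - by apply: measurable_fun_fubini_tonelli_F.
  move=> w _; rewrite patchE; case: ifPn => [/set_mem /= wS|_]; last exact: integral_ge0.
  have x0 : X w != 0.
    by rewrite -normr_gt0 (lt_le_trans _ wS)// divr_gt0.
  rewrite (_ : (\int[lebesgue_measure]_t q (w, t))%E =
    (\int[lebesgue_measure]_(t in `[0%R, dl]) (1 - cos (t * X w))%:E)%E); last first.
    rewrite [RHS]integral_mkcond; apply: eq_integral => t _.
    by rewrite patchE /q /= indicE; case: ifPn => _; rewrite ?mulr1 ?mulr0.
  rewrite integral_subr1_cos// lee_fin.
  have : `|sin (dl * X w) / X w| <= dl / 2.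
    rewrite normrM normfV ler_pdivrMr ?normr_gt0//.
    rewrite (le_trans (norm_sin_le1 _))// -ler_pdivrMl ?divr_gt0//.
    by rewrite mulr1 invf_div.
  by move/(le_trans (ler_norm _)); lra.
have := le_trans E1 (le_trans _ E2).
rewrite F => /(_ (lexx _)).
rewrite -lee_pdivlMl ?divr_gt0// -EFinM (_ : (dl / 2)^-1 * (A * dl) = 2 * A)//.
by field; rewrite gt_eqF.
Qed.

End tail.

(** * Bernstein polynomials *)

Section bernstein.
Context {R : realType}.
Implicit Types (f g : nat -> R) (p : R).

(** The expectation of f under the binomial law with parameters m and p, by
    conditioning on the first trial. *)
Fixpoint bern m f p : R :=
  if m is m'.+1 then p * bern m' (fun k => f k.+1) p + (1 - p) * bern m' f p
  else f 0%N.

Lemma bern_linear m a f g p :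
  bern m (fun k => a * f k + g k) p = a * bern m f p + bern m g p.
Proof.
elim: m f g => //= m IH f g; rewrite !IH; ring.
Qed.

Lemma eq_bern m f g p : (forall k, (k <= m)%N -> f k = g k) -> bern m f p = bern m g p.
Proof.
elim: m f g => [|m IH] f g fg /=; first exact: fg.
congr (_ * _ + _ * _); apply: IH => k km; apply: fg => //; exact: leqW.
Qed.

Lemma bern_cst m c p : bern m (fun=> c) p = c.
Proof. by elim: m => //= m ->; ring. Qed.

Lemma bern_ge0 m f p : 0 <= p <= 1 -> (forall k, 0 <= f k) -> 0 <= bern m f p.
Proof.
move=> /andP[p0 p1]; elim: m f => //= m IH f f0.
by rewrite addr_ge0// mulr_ge0 ?subr_ge0// IH.
Qed.

Lemma bern_variance m (a p : R) :
  bern m (fun k => (k%:R - a) ^+ 2) p = m%:R * (p * (1 - p)) + (m%:R * p - a) ^+ 2.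
Proof.
elim: m a => [|m IH] a /=; first by rewrite !mul0r !add0r.
rewrite IH (@eq_bern m _ (fun k => (k%:R - (a - 1)) ^+ 2)); last first.
  by move=> k _; rewrite -natr1; ring.
by rewrite IH -natr1; ring.
Qed.

Definition bern_weight m k p := bern m (fun j => (j == k)%:R) p.

Lemma bern_sum m f p : bern m f p = \sum_(k < m.+1) f k * bern_weight m k p.
Proof.
transitivity (bern m (fun j => \sum_(k < m.+1) f k * (j == k)%:R) p).
  apply: eq_bern => j jm; rewrite (bigD1 (Ordinal (jm : (j < m.+1)%N)))//= eqxx mulr1 big1 ?addr0//.
  by move=> k kj; rewrite -val_eqE /= eq_sym in kj; rewrite (negbTE kj) mulr0.
have H s : bern m (fun j => \sum_(k <- s) f (k : 'I_m.+1) * (j == k)%:R) p =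
    \sum_(k <- s) f k * bern_weight m k p.
  elim: s => [|k s IH]; first by rewrite (@eq_bern _ _ (fun=> 0)) ?bern_cst ?big_nil// => j _; rewrite big_nil.
  rewrite (@eq_bern _ _ (fun j => f k * (j == k)%:R + \sum_(k <- s) f k * (j == k)%:R)).
    by rewrite bern_linear IH big_cons.
  by move=> j _; rewrite big_cons.
exact: H.
Qed.

Lemma bern_weight_ge0 m k p : 0 <= p <= 1 -> 0 <= bern_weight m k p.
Proof. by move=> p01; apply: bern_ge0. Qed.

Lemma sum_bern_weight m p : \sum_(k < m.+1) bern_weight m k p = 1.
Proof.
rewrite -(bern_cst m 1 p) bern_sum; apply: eq_bigr => k _; by rewrite mul1r.
Qed.

Lemma sum_bern_weight_variance m p :
  \sum_(k < m.+1) (k%:R - m%:R * p) ^+ 2 * bern_weight m k p = m%:R * (p * (1 - p)).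
Proof.
by rewrite -(bern_sum m (fun k => (k%:R - m%:R * p) ^+ 2)) bern_variance subrr expr0n addr0.
Qed.

Section multivariate.
Variables (n m : nat) (p : 'I_n -> R).
Hypothesis p01 : forall j, 0 <= p j <= 1.
Let Wt (k : {ffun 'I_n -> 'I_m.+1}) := \prod_j bern_weight m (k j) (p j).

Lemma bern_prod_weight_ge0 k : 0 <= Wt k.
Proof. by apply: prodr_ge0 => j _; exact: bern_weight_ge0. Qed.

Lemma sum_bern_prod_weight : \sum_k Wt k = 1.
Proof.
rewrite -(bigA_distr_bigA (fun j k => bern_weight m (k : 'I_m.+1) (p j))).
by rewrite big1// => j _; exact: sum_bern_weight.
Qed.

Lemma sum_bern_prod_weight_variance i :
  \sum_(k : {ffun 'I_n -> 'I_m.+1}) ((k i)%:R - m%:R * p i) ^+ 2 * Wt k <= m%:R.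
Proof.
pose G j (k : 'I_m.+1) : R := (if j == i then (k%:R - m%:R * p j) ^+ 2 else 1) * bern_weight m k (p j).
rewrite (eq_bigr (fun k : {ffun 'I_n -> 'I_m.+1} => \prod_j G j (k j))); last first.
  move=> k _; rewrite /G big_split /= (bigD1 i)//= eqxx big1 ?mulr1//.
  by move=> j /negbTE ->.
rewrite -bigA_distr_bigA (bigD1 i)//= [X in _ * X]big1 ?mulr1; last first.
  move=> j ji; rewrite -[RHS](sum_bern_weight m (p j)); apply: eq_bigr => k _.
  by rewrite /G (negbTE ji) mul1r.
rewrite /G eqxx sum_bern_weight_variance ler_piMr//.
have /andP[p0 p1] := p01 i.
by rewrite mulr_ile1// ?subr_ge0//; lra.
Qed.

(** Chebyshev's inequality in the form of its proof: the penalty L times the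
    squared distance has mean at most L n / m. *)
Lemma bern_approx (h : {ffun 'I_n -> 'I_m.+1} -> R) (y e L : R) : (0 < m)%N -> 0 <= L ->
  (forall k, `|h k - y| <= e + L * \sum_i ((k i)%:R / m%:R - p i) ^+ 2) ->
  `|\sum_k h k * Wt k - y| <= e + L * (n%:R / m%:R).
Proof.
move=> m0 L0 H.
have -> : \sum_k h k * Wt k - y = \sum_k (h k - y) * Wt k.
  under [RHS]eq_bigr do rewrite mulrBl.
  by rewrite sumrB -mulr_sumr sum_bern_prod_weight mulr1.
apply: le_trans (ler_norm_sum _ _ _) _.
apply: (@le_trans _ _ (\sum_(k : {ffun 'I_n -> 'I_m.+1}) (e + L * \sum_i ((k i)%:R / m%:R - p i) ^+ 2) * Wt k)).
  by apply: ler_sum => k _; rewrite normrM (ger0_norm (bern_prod_weight_ge0 k)) ler_wpM2r// bern_prod_weight_ge0.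
under eq_bigr do rewrite mulrDl.
rewrite big_split /= -mulr_sumr sum_bern_prod_weight mulr1 lerD2l.
under eq_bigr do rewrite -mulrA mulr_suml.
rewrite -mulr_sumr exchange_big /= ler_wpM2l//.
apply: (@le_trans _ _ (\sum_(i < n) m%:R^-1)); last by rewrite sumr_const card_ord mulr_natl.
apply: ler_sum => i _.
have mR : (m%:R : R) != 0 by rewrite pnatr_eq0 -lt0n.
rewrite (eq_bigr (fun k : {ffun 'I_n -> 'I_m.+1} => m%:R ^- 2 * (((k i)%:R - m%:R * p i) ^+ 2 * Wt k))).
  rewrite -mulr_sumr (le_trans (ler_wpM2l _ (sum_bern_prod_weight_variance i)))//.
  by rewrite expr2 invfM -mulrA mulVf// mulr1.
by move=> k _; field.
Qed.

End multivariate.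
End bernstein.

(** * Approximation by trigonometric polynomials *)

Section trigonometric_polynomials.
Context {R : realType} (n : nat).

(** Trigonometric polynomials with arbitrary real frequencies. *)
Inductive trigpoly : ('rV[R]_n -> R) -> Prop :=
| trig_cos (a : 'I_n -> R) (b : R) : trigpoly (fun x => cos (\sum_j a j * x ord0 j + b))
| trig_lin (c : R) f g : trigpoly f -> trigpoly g -> trigpoly (fun x => c * f x + g x).

Lemma eq_trigpoly f g : (forall x, f x = g x) -> trigpoly f -> trigpoly g.
Proof. by move=> /funext ->. Qed.

Lemma trig_cst c : trigpoly (fun=> c).
Proof.
have u := trig_cos (fun=> 0) 0.
apply: eq_trigpoly (trig_lin (c - 1) u u) => x.
by rewrite big1 ?addr0 ?cos0; [ring|move=> j _; rewrite mul0r].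
Qed.

Lemma trig_scale c f : trigpoly f -> trigpoly (fun x => c * f x).
Proof. by move=> tf; apply: eq_trigpoly (trig_lin (c - 1) tf tf) => x; ring. Qed.

Lemma trig_add f g : trigpoly f -> trigpoly g -> trigpoly (fun x => f x + g x).
Proof. by move=> tf tg; apply: eq_trigpoly (trig_lin 1 tf tg) => x; ring. Qed.

Lemma trig_mul f g : trigpoly f -> trigpoly g -> trigpoly (fun x => f x * g x).
Proof.
move=> + tg; elim=> [a b|c f1 f2 _ IH1 _ IH2]; last first.
  by apply: eq_trigpoly (trig_lin c IH1 IH2) => x; ring.
elim: tg => [a' b'|c g1 g2 _ IH1 _ IH2]; last first.
  by apply: eq_trigpoly (trig_lin c IH1 IH2) => x; ring.
have H := trig_lin 2^-1 (trig_cos (fun j => a j + a' j) (b + b'))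
  (trig_scale 2^-1 (trig_cos (fun j => a j - a' j) (b - b'))).
apply: eq_trigpoly H => x.
set A := \sum_j a j * _; set B := \sum_j a' j * _.
have -> : \sum_j (a j + a' j) * x ord0 j + (b + b') = (A + b) + (B + b').
  by rewrite (eq_bigr (fun j => a j * x ord0 j + a' j * x ord0 j)) => [|j _];
    rewrite ?mulrDl// big_split /= -/A -/B; ring.
have -> : \sum_j (a j - a' j) * x ord0 j + (b - b') = (A + b) - (B + b').
  by rewrite (eq_bigr (fun j => a j * x ord0 j - a' j * x ord0 j)) => [|j _];
    rewrite ?mulrBl// sumrB /= -/A -/B; ring.
by rewrite cosD cosB; field.
Qed.

Lemma trig_bern m u p : trigpoly p -> trigpoly (fun x => bern m u (p x)).
Proof.
move=> tp; elim: m u => [|m IH] u /=; first exact: trig_cst.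
apply: trig_add; apply: trig_mul => //.
by apply: eq_trigpoly (trig_lin (-1) tp (trig_cst 1)) => x; ring.
Qed.

Lemma trig_sum (I : finType) (F : I -> 'rV[R]_n -> R) :
  (forall i, trigpoly (F i)) -> trigpoly (fun x => \sum_i F i x).
Proof.
move=> tF; elim: (index_enum I) => [|i s IH].
  by apply: eq_trigpoly (trig_cst 0) => x; rewrite big_nil.
by apply: eq_trigpoly (trig_add (tF i) IH) => x; rewrite big_cons.
Qed.

Lemma trig_prod (I : finType) (F : I -> 'rV[R]_n -> R) :
  (forall i, trigpoly (F i)) -> trigpoly (fun x => \prod_i F i x).
Proof.
move=> tF; elim: (index_enum I) => [|i s IH].
  by apply: eq_trigpoly (trig_cst 1) => x; rewrite big_nil.
by apply: eq_trigpoly (trig_mul (tF i) IH) => x; rewrite big_cons.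
Qed.

Lemma trigpoly_bounded f : trigpoly f -> exists K : R, forall x, `|f x| <= K.
Proof.
elim=> [a b|c f1 f2 _ [K1 H1] _ [K2 H2]].
  by exists 1 => x; rewrite ler_norml cos_geN1 cos_le1.
exists (`|c| * K1 + K2) => x; rewrite (le_trans (ler_normD _ _))// lerD// normrM.
by rewrite ler_wpM2l.
Qed.

Lemma trigpoly_measurable d (Om : measurableType d) (X : 'I_n -> Om -> R) f :
  (forall j, measurable_fun setT (X j)) -> trigpoly f ->
  measurable_fun setT (fun w => f (\row_j X j w)).
Proof.
move=> mX; elim=> [a b|c f1 f2 _ H1 _ H2]; last first.
  by apply: measurable_funD => //; exact: measurable_funM.
apply: (measurableT_comp (@measurable_cos R)); apply: measurable_funD => //.
apply: measurable_sum => j; apply: measurable_funM => //.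
by rewrite (_ : (fun w => _) = X j)//; apply/funext => w; rewrite mxE.
Qed.

Lemma compact_unif_continuous (K : set 'rV[R]_n) (h : 'rV[R]_n -> R) (e : R) :
  compact K -> continuous h -> 0 < e ->
  exists2 r : R, 0 < r & forall x y : 'rV[R]_n, K x -> (forall j, `|x ord0 j - y ord0 j| < r) ->
    `|h x - h y| <= e.
Proof.
move=> cK ch e0; move/compact_near_coveringP : cK => cK.
have := cK R (0 : R)^'+ (fun r x => forall y : 'rV[R]_n, (forall j, `|x ord0 j - y ord0 j| < r) ->
    `|h x - h y| <= e) _ _.
case.
- move=> x Kx.
  have : \forall z \near x, `|h x - h z| < e / 2.
    by have /cvgrPdist_lt := ch x; apply; rewrite divr_gt0.
  move=> /nbhs_ballP[r /= r0 Hr].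
  have r20 : 0 < r / 2 by rewrite divr_gt0.
  near=> z q => y yq.
  have zx : ball x (r / 2) z by near: z; exact: nbhsx_ballx.
  have qr : q < r / 2 by near: q; exact: nbhs_right_lt.
  have zr : `|h x - h z| < e / 2 by apply: Hr; apply: le_ball zx; lra.
  have yr : `|h x - h y| < e / 2.
    apply: Hr; split => // i j; have := zx.2 i j; rewrite /ball /=.
    have -> : i = ord0 by exact: ord1.
    move=> H; have /= := yq j; have := ler_normD (x ord0 j - z ord0 j) (z ord0 j - y ord0 j).
    rewrite addrA subrK; lra.
  rewrite distrC in zr; have := ler_normD (h z - h x) (h x - h y); rewrite addrA subrK; lra.
- move=> /= r r0 Hr.
  have r20 : 0 < r / 2 by rewrite divr_gt0.
  exists (r / 2) => // x y Kx; apply: (Hr (r / 2)) => //=.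
  by rewrite sub0r normrN gtr0_norm//; lra.
Unshelve. all: by end_near.
Qed.

Definition clamp (s u : R) := Num.max (- s) (Num.min s u).

Lemma clamp_id s u : `|u| <= s -> clamp s u = u.
Proof.
by rewrite ler_norml => /andP[? ?]; rewrite /clamp min_r// max_r.
Qed.

Lemma continuous_asin_clamp s : 0 <= s < 1 -> continuous (fun u => asin (clamp s u) : R).
Proof.
move=> /andP[s0 s1] u; apply: (@continuous_comp _ _ _ (clamp s) (@asin R)).
  apply: continuous_max; first exact: cst_continuous.
  by apply: continuous_min; [exact: cst_continuous|exact: id].
apply: continuous_asin; rewrite /clamp.
rewrite lt_max gt_max lt_min gt_min; lra.
Qed.

Lemma continuous_rowmap (f : 'I_n -> R -> R) : (forall j, continuous (f j)) ->
  continuous (fun x : 'rV[R]_n => \row_j f j (x ord0 j)).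
Proof.
move=> cf x A /nbhs_ballP[e /= e0 eA].
have : \forall y \near (x : 'rV[R]_n), forall j : 'I_n, `|f j (x ord0 j) - f j ((y : 'rV[R]_n) ord0 j)| < e.
  apply: (@filter_forall _ _ _ _ (nbhs_filter (x : 'rV[R]_n))) => j.
  have cfj : {for x, continuous (fun y : 'rV[R]_n => f j (y ord0 j))}.
    by apply: (@continuous_comp _ _ _ (fun y : 'rV[R]_n => y ord0 j) (f j));
      [exact: coord_continuous|exact: cf].
  by have /cvgrPdist_lt := cfj; exact.
by apply: filterS => y H; apply: eA; split => // i j; rewrite /ball /= !mxE; exact: H.
Qed.

(** The numbers p_j = (1 + sin (x_j / 2K)) / 2 lie in the unit interval and
    determine x on the box |x_j| <= K. So g is there a continuous function h of
    p, whose Bernstein polynomials are trigonometric polynomials in x; they are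
    bounded by the bound of g on the whole space, not only on the box. *)
Lemma trig_approx (g : 'rV[R]_n -> R) (M K e : R) : continuous g ->
  (forall x, `|g x| <= M) -> 0 < K -> 0 < e ->
  exists T, [/\ trigpoly T, forall x, `|T x| <= M &
    forall x : 'rV[R]_n, (forall j, `|x ord0 j| <= K) -> `|T x - g x| <= e].
Proof.
move=> cg gM K0 e0.
have M0 : 0 <= M by apply: le_trans (gM 0).
have pi1 : (1 : R) <= pi / 2 by exact: pihalf_ge1.
have s01 : 0 <= sin (2^-1 : R) < (1 : R).
  apply/andP; split; first by apply: sin_ge0_pi; lra.
  by rewrite -[ltRHS]sin_pihalf ltr_sin ?in_itv/=; lra.
have K20 : 0 < 2 * K by rewrite mulr_gt0.
(* Clamping extends h continuously to all p; sin (1/2) is the largest value of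
   2 p_j - 1 on the box. *)
pose h (p : 'rV[R]_n) := g (\row_j (2 * K * asin (clamp (sin 2^-1) (2 * p ord0 j - 1)))).
have ch : continuous h.
  move=> p; apply: (@continuous_comp _ _ _ (fun p : 'rV[R]_n =>
    \row_j (2 * K * asin (clamp (sin 2^-1) (2 * p ord0 j - 1)))) g); last exact: cg.
  apply: (@continuous_rowmap (fun _ u => 2 * K * asin (clamp (sin 2^-1) (2 * u - 1)))) => _ u.
  have c1 : {for u, continuous (fun u : R => 2 * u - 1 : R)}.
    by apply: cvgB; [apply: cvg_scale; exact: cvg_id|exact: cvg_cst].
  have c2 : {for u, continuous (fun v : R => asin (clamp (sin 2^-1) (2 * v - 1)) : R)}.
    exact (@continuous_comp R R R (fun u : R => 2 * u - 1 : R)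
      (fun v => asin (clamp (sin 2^-1) v) : R) u c1
      (@continuous_asin_clamp (sin 2^-1) s01 (2 * u - 1))).
  exact: (cvg_scale (2 * K) c2).
pose Kc : set 'rV[R]_n := [set v | forall j, `[0, 1]%classic (v ord0 j)].
have cK : compact Kc by apply: (@rV_compact R n (fun=> `[0, 1]%classic)) => j; exact: segment_compact.
have [r r0 Hr] := compact_unif_continuous cK ch (divr_gt0 e0 (ltr0Sn R 1)).
(* Beyond the distance r the penalty L r^2 = 2 M exceeds the oscillation of g. *)
pose L := 2 * M / r ^+ 2.
have L0 : 0 <= L by apply: divr_ge0; [exact: mulr_ge0|exact: sqr_ge0].
have [m m0 mL] : exists2 m, (0 < m)%N & L * (n%:R / m%:R) <= e / 2.
  have Ln : 0 <= L * n%:R by rewrite mulr_ge0.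
  exists (Num.truncn (L * n%:R / (e / 2))).+1 => //.
  have := @truncnS_gt R (L * n%:R / (e / 2)); rewrite ltr_pdivrMr ?divr_gt0// => H.
  rewrite mulrA ler_pdivrMr ?ltr0n//; rewrite (mulrC (e / 2)); exact: ltW.
pose p j (x : 'rV[R]_n) := (1 + sin (x ord0 j / (2 * K))) / 2.
have p01 x j : 0 <= p j x <= 1.
  by rewrite /p; have := @sin_geN1 R (x ord0 j / (2 * K)); have := @sin_le1 R (x ord0 j / (2 * K)); lra.
pose hk (k : {ffun 'I_n -> 'I_m.+1}) := h (\row_j ((k j)%:R / m%:R)).
pose T x := \sum_k hk k * \prod_j bern_weight m (k j) (p j x).
exists T; split.
- apply: trig_sum => k; apply: trig_scale; apply: trig_prod => j; apply: trig_bern.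
  have H := trig_lin 2^-1 (trig_cos (fun i => (i == j)%:R / (2 * K)) (- (pi / 2))) (trig_cst 2^-1).
  apply: eq_trigpoly H => x; rewrite /p.
  rewrite (bigD1 j)//= eqxx mul1r big1 => [|i /negbTE ->]; last by rewrite !mul0r.
  by rewrite addr0 cosBpihalf (mulrC _ (x ord0 j)); ring.
- move=> x; apply: le_trans (ler_norm_sum _ _ _) _.
  apply: (@le_trans _ _ (M * \sum_(k : {ffun 'I_n -> 'I_m.+1}) \prod_j bern_weight m (k j) (p j x))); last first.
    by rewrite sum_bern_prod_weight mulr1.
  rewrite mulr_sumr; apply: ler_sum => k _; have W0 := bern_prod_weight_ge0 (p01 x) k.
  by rewrite normrM (ger0_norm W0) ler_wpM2r// gM.
- move=> x xK.
  have -> : g x = h (\row_j p j x).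
    rewrite /h; congr (g _); apply/rowP => j; rewrite !mxE.
    have -> : 2 * p j x - 1 = sin (x ord0 j / (2 * K)) by rewrite /p; lra.
    have xK1 : `|x ord0 j / (2 * K)| <= 2^-1.
      rewrite normrM normfV (gtr0_norm K20) ler_pdivrMr// mulrA mulVf// mul1r.
      exact: xK.
    have /andP[xl xr] : - 2^-1 <= x ord0 j / (2 * K) <= 2^-1 by rewrite -ler_norml.
    have : `|sin (x ord0 j / (2 * K))| <= sin 2^-1.
      have msin (u v : R) : - (pi / 2) <= u -> u <= v -> v <= pi / 2 -> sin u <= sin v.
        move=> u1 uv v1; move: (uv); rewrite le_eqVlt => /predU1P[->//|uv'].
        by apply: ltW; rewrite ltr_sin ?in_itv/= ?u1 ?v1 ?(le_trans uv)// (le_trans u1).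
      by rewrite ler_norml -sinN !msin//; lra.
    move=> /clamp_id ->; rewrite sinK.
      by rewrite mulrC divfK// lt0r_neq0.
    by rewrite in_itv /=; lra.
  apply: le_trans (bern_approx (e := e / 2) (p01 x) m0 L0 _) _; last first.
    by apply: le_trans (lerD (lexx (e / 2)) mL) _; rewrite -splitr.
  move=> k; have [Hk|] := pselect (forall j, `|(k j)%:R / m%:R - p j x| < r).
    apply: (@le_trans _ _ (e / 2)).
      apply: Hr.
        move=> j; rewrite mxE /= in_itv /= divr_ge0//=.
        by rewrite ler_pdivrMr ?ltr0n// mul1r ler_nat -ltnS.
      by move=> j; rewrite !mxE.
    rewrite lerDl mulr_ge0// sumr_ge0// => i _; exact: sqr_ge0.
  move=> /existsNP[j /negP]; rewrite -leNgt => rj.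
  apply: (@le_trans _ _ (2 * M)).
    by rewrite (le_trans (ler_normB _ _))// mulr_natl mulr2n lerD// gM.
  apply: (@le_trans _ _ (L * ((k j)%:R / m%:R - p j x) ^+ 2)).
    rewrite /L -mulrA ler_peMr ?mulr_ge0//.
    rewrite ler_pdivlMl ?exprn_gt0// mulr1 -[leRHS]real_normK ?num_real//.
    by rewrite lerXn2r ?nnegrE// ltW.
  rewrite -[leLHS]add0r lerD//; first by rewrite divr_ge0// ltW.
  rewrite ler_wpM2l// (bigD1 j)//= lerDl sumr_ge0// => i _; exact: sqr_ge0.
Qed.

End trigonometric_polynomials.

(** * Convergence in distribution from characteristic functions *)

Section levy.
Context {R : realType} (n : nat) (T : Type) (Fl : set_system T) {FF : Filter Fl}.
Context d (Om : measurableType d) (P : probability Om R).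
Context d' (Om' : measurableType d') (Q : probability Om' R).
Variables (X : T -> 'I_n -> Om -> R) (Y : 'I_n -> Om' -> R).
Hypothesis mX : forall t j, measurable_fun setT (X t j).
Hypothesis mY : forall j, measurable_fun setT (Y j).
Hypothesis cvg_cos : forall a : 'I_n -> R,
  \int[P]_w cos (\sum_j a j * X t j w) @[t --> Fl] --> \int[Q]_w cos (\sum_j a j * Y j w).
Hypothesis cvg_sin : forall a : 'I_n -> R,
  \int[P]_w sin (\sum_j a j * X t j w) @[t --> Fl] --> \int[Q]_w sin (\sum_j a j * Y j w).
Hypothesis tight : forall e : R, 0 < e -> exists K : R, [/\ 0 < K,
  \forall t \near Fl, forall j, (P [set w | (K <= `|X t j w|)%R] <= e%:E)%E &
  forall j, (Q [set w | (K <= `|Y j w|)%R] <= e%:E)%E].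

Let lin_integral d1 (O1 : measurableType d1) (P1 : probability O1 R)
    (c : R) (f g : O1 -> R) : measurable_fun setT f -> measurable_fun setT g ->
  (exists K : R, forall w, `|f w| <= K) -> (exists K : R, forall w, `|g w| <= K) ->
  \int[P1]_w (c * f w + g w) = c * \int[P1]_w f w + \int[P1]_w g w.
Proof.
move=> mf mg [K1 f1] [K2 g1].
have jf := bounded_integrable P1 mf f1.
have jg := bounded_integrable P1 mg g1.
by rewrite RintegralD//; [rewrite RintegralZl|exact: integrable_scale].
Qed.

Let cvg_trigpoly f : trigpoly f ->
  \int[P]_w f (\row_j X t j w) @[t --> Fl] --> \int[Q]_w f (\row_j Y j w).
Proof.
elim=> [a b|c f1 f2 t1 H1 t2 H2]; last first.
  have [K1 b1] := trigpoly_bounded t1; have [K2 b2] := trigpoly_bounded t2.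
  have H t : \int[P]_w (c * f1 (\row_j X t j w) + f2 (\row_j X t j w)) =
      c * \int[P]_w f1 (\row_j X t j w) + \int[P]_w f2 (\row_j X t j w).
    by apply: lin_integral; [exact: trigpoly_measurable|exact: trigpoly_measurable
      |exists K1|exists K2].
  under eq_fun do rewrite H.
  rewrite lin_integral; last 4 first.
  - exact: trigpoly_measurable.
  - exact: trigpoly_measurable.
  - by exists K1.
  - by exists K2.
  by apply: cvgD => //; exact: cvg_scale.
have E d1 (O1 : measurableType d1) (P1 : probability O1 R) (Z : 'I_n -> O1 -> R) :
    (forall j, measurable_fun setT (Z j)) ->
    \int[P1]_w cos (\sum_j a j * (\row_j Z j w) ord0 j + b) =
    cos b * \int[P1]_w cos (\sum_j a j * Z j w) +
    (- sin b) * \int[P1]_w sin (\sum_j a j * Z j w).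
  move=> mZ.
  have mS : measurable_fun setT (fun w => \sum_j a j * Z j w).
    by apply: measurable_sum => j; apply: measurable_funM.
  have m1 : measurable_fun setT (fun w => cos (\sum_j a j * Z j w)).
    exact: (measurableT_comp (@measurable_cos R)).
  have m2 : measurable_fun setT (fun w => sin (\sum_j a j * Z j w)).
    exact: (measurableT_comp (@measurable_sin R)).
  have j2 := bounded_integrable P1 m2 (fun w => norm_sin_le1 _).
  rewrite -(@RintegralZl _ _ _ P1 _ _ (- sin b) measurableT j2) -lin_integral//.
  - by apply: eq_Rintegral => w _; under eq_bigr do rewrite mxE; rewrite cosD; ring.
  - exact: measurable_funM.
  - by exists 1 => w; exact: norm_cos_le1.
  - by exists (`|- sin b| * 1) => w; rewrite normrM ler_wpM2l// norm_sin_le1.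
under eq_fun do rewrite E//.
rewrite E//; apply: cvgD; apply: cvg_scale; [exact: cvg_cos|exact: cvg_sin].
Qed.

(** On the box the two functions are e-close; off the box, which is left with
    probability at most n e, they differ by at most 2 M. *)
Let dist_integral d1 (O1 : measurableType d1) (P1 : probability O1 R)
    (Z : 'I_n -> O1 -> R) (f g : 'rV[R]_n -> R) (M K e : R) :
  (forall j, measurable_fun setT (Z j)) ->
  measurable_fun setT (fun w => f (\row_j Z j w)) ->
  measurable_fun setT (fun w => g (\row_j Z j w)) ->
  (forall x, `|f x| <= M) -> (forall x, `|g x| <= M) ->
  (forall x : 'rV[R]_n, (forall j, `|x ord0 j| <= K) -> `|f x - g x| <= e) ->
  0 <= e -> (forall j, (P1 [set w | (K <= `|Z j w|)%R] <= e%:E)%E) ->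
  `|\int[P1]_w f (\row_j Z j w) - \int[P1]_w g (\row_j Z j w)| <= e + 2 * M * (n%:R * e).
Proof.
move=> mZ mf mg fM gM fg e0 PK.
have M0 : 0 <= M by apply: le_trans (fM 0).
have jf := bounded_integrable P1 mf (fun w => fM _).
have jg := bounded_integrable P1 mg (fun w => gM _).
have mS j : measurable [set w | (K <= `|Z j w|)%R].
  rewrite (_ : [set w | _] = setT `&` (fun w => `|Z j w|) @^-1` `[K, +oo[%classic).
    have mn : measurable_fun setT (fun w => `|Z j w|) by exact: measurableT_comp.
    by apply: mn.
  by apply/seteqP; split => w /=; rewrite in_itv /= andbT => // -[].
rewrite -RintegralB//; apply: le_trans (le_normr_Rintegral _ _) _ => //.
  exact: integrable_sub.
pose u w := e + 2 * M * \sum_j (\1_[set w | (K <= `|Z j w|)%R] w : R).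
have ji j : P1.-integrable setT (EFin \o (fun w => \1_[set w | (K <= `|Z j w|)%R] w : R)).
  apply: (@bounded_integrable _ _ _ _ _ 1) => [|w]; first exact: measurable_indic.
  by rewrite indicE; case: (_ \in _); rewrite ?normr1 ?normr0.
have [jS ES] : P1.-integrable setT (EFin \o (fun w => \sum_j (\1_[set w | (K <= `|Z j w|)%R] w : R))) /\
    \int[P1]_w (\sum_j (\1_[set w | (K <= `|Z j w|)%R] w : R)) =
    \sum_j \int[P1]_w (\1_[set w | (K <= `|Z j w|)%R] w : R).
  elim: (index_enum 'I_n) => [|j s [IH1 IH2]].
    split; last by under eq_Rintegral do rewrite big_nil; rewrite big_nil expectation_cst.
    by apply: eq_integrable (integrable0 P1 setT) => // w _ /=; rewrite big_nil.
  split.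
    by apply: eq_integrable (integrable_add (ji j) IH1) => // w _ /=; rewrite big_cons.
  by under eq_Rintegral do rewrite big_cons; rewrite RintegralD// IH2 big_cons.
have jc : P1.-integrable setT (EFin \o (fun=> e)).
  by apply: (@bounded_integrable _ _ _ _ _ `|e|).
apply: (@le_trans _ _ (\int[P1]_w u w)).
  apply: Rintegral_ge0_le.
  - by apply/integrable_abs/integrable_sub.
  - by apply: integrable_add => //; exact: integrable_scale.
  move=> w; rewrite /u.
  have [Hw|/existsNP[j /negP]] := pselect (forall j, `|(\row_j Z j w) ord0 j| <= K).
    by rewrite (le_trans (fg _ Hw))// lerDl mulr_ge0// ?mulr_ge0// sumr_ge0.
  rewrite mxE -ltNge => Kj; apply: (@le_trans _ _ (2 * M)).
    by rewrite (le_trans (ler_normB _ _))// mulr_natl mulr2n lerD.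
  rewrite -[leLHS]add0r lerD// ler_peMr ?mulr_ge0//.
  rewrite (bigD1 j)//= indicE mem_set//=; last exact: ltW.
  by rewrite lerDl sumr_ge0.
rewrite /u RintegralD//; last exact: integrable_scale.
rewrite expectation_cst lerD2l RintegralZl// ler_wpM2l ?mulr_ge0//.
rewrite ES (le_trans (_ : _ <= \sum_(j < n) e))//; last by rewrite sumr_const card_ord mulr_natl.
apply: ler_sum => j _; rewrite /Rintegral integral_indic// setIT.
by rewrite -lee_fin fineK ?fin_num_measure//; exact: PK.
Qed.

Let measurable_continuous_row d1 (O1 : measurableType d1) (Z : 'I_n -> O1 -> R)
    (g : 'rV[R]_n -> R) (M : R) :
  (forall j, measurable_fun setT (Z j)) -> continuous g -> (forall x, `|g x| <= M) ->
  measurable_fun setT (fun w => g (\row_j Z j w)).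
Proof.
move=> mZ cg gM.
have /choice[f Hf] : forall k : nat, exists f, [/\ trigpoly f, forall x, `|f x| <= M &
    forall x : 'rV[R]_n, (forall j, `|x ord0 j| <= k.+1%:R) -> `|f x - g x| <= k.+1%:R^-1].
  by move=> k; apply: trig_approx; rewrite ?invr_gt0.
apply: (@measurable_fun_cvg _ _ _ _ (fun k w => f k (\row_j Z j w))) => [k|w _].
  by apply: trigpoly_measurable => //; have [] := Hf k.
set x := \row_j Z j w.
apply/cvgrPdist_le => e e0.
near=> k.
have [_ _ Hk] := Hf k; rewrite distrC (le_trans (Hk x _))//.
  move=> j; apply: (@le_trans _ _ (\sum_j `|x ord0 j|)).
    by rewrite (bigD1 j)//= lerDl sumr_ge0.
  rewrite (@le_trans _ _ k%:R) ?ler_nat//.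
  near: k; exact: nbhs_infty_ger.
rewrite invf_ple ?posrE//; rewrite (@le_trans _ _ k%:R) ?ler_nat//.
near: k; exact: nbhs_infty_ger.
Unshelve. all: by end_near.
Qed.

(** The expectations of trigonometric polynomials converge by linearity; up to
    the small probability of leaving a large box, one of them replaces g on both
    sides. *)
Lemma weak_cvg_from_charfun (g : 'rV[R]_n -> R) : continuous g ->
  (exists K : R, forall v, `|g v| <= K) ->
  ('E_P[fun w => g (\row_j X t j w)])%E @[t --> Fl] --> ('E_Q[fun w => g (\row_j Y j w)])%E.
Proof.
move=> cg [M gM].
have M0 : 0 <= M by apply: le_trans (gM 0).
have mg t := measurable_continuous_row (mX t) cg gM.
have mg' := measurable_continuous_row mY cg gM.
have jg t := bounded_integrable P (mg t) (fun w => gM _).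
have jg' := bounded_integrable Q mg' (fun w => gM _).
have EE t : ('E_P[fun w => g (\row_j X t j w)])%E = (\int[P]_w g (\row_j X t j w))%:E.
  by rewrite unlock EFin_Rintegral.
have -> : ('E_Q[fun w => g (\row_j Y j w)])%E = (\int[Q]_w g (\row_j Y j w))%:E.
  by rewrite unlock EFin_Rintegral.
under eq_fun do rewrite EE.
apply: cvg_EFin; first exact: nearW.
apply/cvgrPdist_le => e e0 /=.
(* The error adds up to D times the tolerance of the approximation. *)
pose D := 3 + 4 * M * n%:R.
have D0 : 0 < D by rewrite /D ltr_pwDl// ?mulr_ge0.
have eD : 0 < e / D by rewrite divr_gt0.
have [K [K0 PK QK]] := tight eD.
have [f [tf fM fg]] := trig_approx cg gM K0 eD.
have mf t := trigpoly_measurable (mX t) tf.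
have mf' := trigpoly_measurable mY tf.
have HQ := dist_integral mY mf' mg' fM gM fg (ltW eD) QK.
have /cvgrPdist_le/(_ _ eD) := cvg_trigpoly tf.
apply: filterS2 PK => t PK Ht.
have HP := dist_integral (mX t) (mf t) (mg t) fM gM fg (ltW eD) PK.
set a := \int[Q]_w g _ in HQ *; set b := \int[Q]_w f _ in HQ Ht.
set a' := \int[P]_w g _ in HP *; set b' := \int[P]_w f _ in HP Ht.
have -> : a - a' = - (b - a) + (b - b') + (b' - a') by ring.
rewrite (le_trans (ler_normD _ _))// (le_trans (lerD (ler_normD _ _) (lexx _)))// normrN.
have -> : e = (e / D + 2 * M * (n%:R * (e / D))) + e / D + (e / D + 2 * M * (n%:R * (e / D))).
  by rewrite /D; field; rewrite -/D gt_eqF.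
by rewrite !lerD.
Qed.

End levy.

(** * Integrals of 1 - cos r and r - sin r against powers of r *)

Section power_integrals.
Context {R : realType}.
Local Notation leb := (@lebesgue_measure R).
Implicit Types (r a b : R).

Definition ppow b r : R := \1_(@Rplus R) r * r `^ b.

Lemma ppowE b r : 0 < r -> ppow b r = r `^ b.
Proof.
by move=> r0; rewrite /ppow indicE mem_set ?mul1r// /Rplus /= in_itv /= r0.
Qed.

Lemma ppow0 b r : r <= 0 -> ppow b r = 0.
Proof.
move=> r0; rewrite /ppow indicE memNset ?mul0r// /Rplus /= in_itv /= andbT.
by apply/negP; rewrite -leNgt.
Qed.

Lemma ppow_ge0 b r : 0 <= ppow b r.
Proof. by rewrite /ppow mulr_ge0// powR_ge0. Qed.

Lemma measurable_Rplus : measurable (@Rplus R).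
Proof. exact: measurable_itv. Qed.

Lemma measurable_ppow b : measurable_fun setT (ppow b).
Proof.
apply: measurable_funM; first by apply: measurable_indic; exact: measurable_Rplus.
exact: measurable_powR.
Qed.

Lemma gt0_powRD (r a b : R) : 0 < r -> r `^ (a + b) = r `^ a * r `^ b.
Proof. by move=> r0; apply: powRD; apply/implyP => _; rewrite gt_eqF. Qed.

Lemma mulr_powR (r a : R) : 0 < r -> r * r `^ a = r `^ (a + 1).
Proof. by move=> r0; rewrite gt0_powRD// powRr1 ?ltW// mulrC. Qed.

Lemma is_derive_powR b r : 0 < r -> is_derive r (1:R) (fun x => x `^ b) (b * r `^ (b - 1)).
Proof. exact: is_derive1_powR. Qed.

Lemma continuous_powR b r : 0 < r -> {for r, continuous (fun x => x `^ b : R)}.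
Proof. by move=> r0; apply: is_derive_continuous (is_derive_powR b r0). Qed.

Lemma segment_FTC (l : R) (f F : R -> R) a b : l < a -> a < b ->
  (forall r, l < r -> is_derive r (1:R) F (f r)) ->
  (forall r, l < r -> {for r, continuous f}) ->
  (\int[leb]_(r in `[a, b]) (f r)%:E = (F b - F a)%:E)%E.
Proof.
move=> a0 ab dF cf.
have pos x : x \in `[a, b] -> l < x.
  by rewrite in_itv /= => /andP[ax _]; exact: lt_le_trans ax.
have cF r : l < r -> {for r, continuous F}.
  by move=> r0; apply: is_derive_continuous (dF r r0).
rewrite (@continuous_FTC2 _ _ F)//.
- apply: continuous_in_subspaceT => x /set_mem xab; apply: cf; exact: pos.
- split.
  + by move=> t tab; case: (dF t _) => //; apply: pos; exact: subset_itv_oo_cc.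
  + by apply: cvg_at_right_filter; apply: cF.
  + by apply: cvg_at_left_filter; apply: cF; exact: lt_trans ab.
- move=> t tab; rewrite derive1E; apply: derive_val.
  by apply: dF; apply: pos; exact: subset_itv_oo_cc.
Qed.

(** Monotone convergence along growing segments; this covers intervals that are
    open at 0 or unbounded. *)
Lemma improper_FTC_le (f F : R -> R) (a b : nat -> R) (M : R) :
  (forall n, 0 < a n) -> (forall n, a n < b n) ->
  (forall n m, (n <= m)%N -> a m <= a n /\ b n <= b m) ->
  (forall r, 0 < r -> is_derive r (1:R) F (f r)) ->
  (forall r, 0 < r -> {for r, continuous f}) ->
  (forall r, 0 < r -> 0 <= f r) -> measurable_fun setT f ->
  (forall n, F (b n) - F (a n) <= M) ->
  (\int[leb]_(r in \bigcup_n `[a n, b n]%classic) (f r)%:E <= M%:E)%E.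
Proof.
move=> a0 ab nest dF cf f0 mf FM.
pose D n := `[a n, b n]%classic.
have pos n x : D n x -> 0 < x.
  by rewrite /D /= in_itv /= => /andP[ax _]; exact: lt_le_trans ax.
have H := @ge0_nondecreasing_set_cvg_integral _ (measurableTypeR R) R D (EFin \o f) leb _ _ _ _.
have {}H : (\int[leb]_(x in D i) (f x)%:E)%E @[i --> \oo] -->
    (\int[leb]_(x in \bigcup_i D i) (f x)%:E)%E.
  apply: H.
  - move=> n m nm; apply/subsetPset => x; rewrite /D /= !in_itv /=.
    have [am bm] := nest _ _ nm.
    by move=> /andP[ax xb]; rewrite (le_trans am)// (le_trans xb).
  - by move=> n; exact: measurable_itv.
  - by move=> n; apply/measurable_EFinP; exact: measurable_funTS.
  - by move=> n x Dx; rewrite lee_fin f0//; exact: pos Dx.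
rewrite -(cvg_lim _ H)//; apply: lime_le; first by apply/cvg_ex; eexists; exact: H.
by apply: nearW => n; rewrite (segment_FTC (a0 n) (ab n) dF cf) lee_fin.
Qed.

(** Equal to r^(-be) on ]0, 1] and to r^(-be-1) beyond, hence integrable at
    both ends when 0 < be < 1. *)
Definition pdom (be : R) r : R := ppow (- be - 1) r * Num.min r 1.

Lemma pdom_ge0 be r : 0 <= pdom be r.
Proof.
have [r0|r0] := leP r 0; first by rewrite /pdom ppow0// mul0r.
by rewrite /pdom mulr_ge0 ?ppow_ge0// le_min ler01 ltW.
Qed.

Lemma measurable_pdom be : measurable_fun setT (pdom be).
Proof.
apply: measurable_funM; first exact: measurable_ppow.
exact: measurable_minr.
Qed.

Lemma bigcup_itv01 : \bigcup_n `[(n.+2%:R : R)^-1, 1]%classic = `]0, 1]%classic.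
Proof.
apply/seteqP; split => [x [n _]|x] /=; rewrite !in_itv /=.
  by move=> /andP[nx ->]; rewrite (lt_le_trans _ nx)// invr_gt0.
move=> /andP[x0 x1].
exists (Num.truncn x^-1) => //=; rewrite in_itv /= x1 andbT.
rewrite -[leRHS]invrK lef_pV2 ?posrE ?invr_gt0//.
by apply: ltW; apply: lt_le_trans (truncnS_gt _) _; rewrite ler_nat.
Qed.

Lemma bigcup_itv1y : \bigcup_n `[(1 : R), n.+2%:R]%classic = `[1, +oo[%classic.
Proof.
apply/seteqP; split => [x [n _]|x] /=; rewrite !in_itv /=.
  by move=> /andP[->].
rewrite andbT => x1; exists (Num.truncn x) => //=; rewrite in_itv /= x1 /=.
by apply: ltW; apply: lt_le_trans (truncnS_gt _) _; rewrite ler_nat.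
Qed.

Lemma integral_pow01 be : 0 < be < 1 ->
  (\int[leb]_(r in `]0%R, 1%R]) (r `^ (- be))%:E <= ((1 - be)^-1)%:E)%E.
Proof.
move=> /andP[b0 b1]; have b10 : 1 - be != 0 by rewrite subr_eq0 gt_eqF.
rewrite -bigcup_itv01.
apply: (@improper_FTC_le _ (fun x => x `^ (1 - be) / (1 - be))).
- by move=> n; rewrite invr_gt0.
- by move=> n; rewrite invf_lt1// ltr1n.
- by move=> n m nm; split => //; rewrite lef_pV2 ?posrE// ler_nat !ltnS.
- move=> r r0; have D := is_derive_powR (1 - be) r0.
  apply: is_derive_eq; rewrite /GRing.scale /=.
  by rewrite (_ : 1 - be - 1 = - be); [field|ring].
- by move=> r r0; exact: continuous_powR.
- by move=> r r0; exact: powR_ge0.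
- exact: measurable_powR.
- move=> n; rewrite powR1 div1r lerBlDr lerDl divr_ge0 ?powR_ge0//; lra.
Qed.

Lemma integral_pow1y be : 0 < be ->
  (\int[leb]_(r in `[1%R, +oo[) (r `^ (- be - 1))%:E <= (be^-1)%:E)%E.
Proof.
move=> b0; rewrite -bigcup_itv1y.
apply: (@improper_FTC_le _ (fun x => - (x `^ (- be) / be))) => //.
- by move=> n; rewrite ltr1n.
- by move=> n m nm; split => //; rewrite ler_nat !ltnS.
- move=> r r0; have D := is_derive_powR (- be) r0.
  apply: is_derive_eq; rewrite /GRing.scale /=; field; exact: lt0r_neq0.
- by move=> r r0; exact: continuous_powR.
- by move=> r r0; exact: powR_ge0.
- move=> n; rewrite powR1 div1r opprK addrC lerBlDr lerDl divr_ge0 ?powR_ge0//; exact: ltW.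
Qed.

Lemma integrable_pdom be : 0 < be < 1 -> leb.-integrable setT (EFin \o pdom be).
Proof.
move=> /andP[b0 b1]; apply/integrableP; split.
  by apply/measurable_EFinP; exact: measurable_pdom.
apply: (@le_lt_trans _ _ (((1 - be)^-1)%:E + (be^-1)%:E)%E); last by rewrite ltry.
apply: le_trans (leeD (integral_pow01 (introT andP (conj b0 b1))) (integral_pow1y b0)).
rewrite [X in (_ <= X + _)%E]integral_mkcond [X in (_ <= _ + X)%E]integral_mkcond.
have m1 : measurable_fun setT ((fun r => (r `^ (- be))%:E) \_ `]0%R, 1%R]).
  by apply/(measurable_restrictT _ _).1 => //; apply/measurable_EFinP;
    apply: measurable_funTS; exact: measurable_powR.
have m2 : measurable_fun setT ((fun r => (r `^ (- be - 1))%:E) \_ `[1%R, +oo[).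
  by apply/(measurable_restrictT _ _).1 => //; apply/measurable_EFinP;
    apply: measurable_funTS; exact: measurable_powR.
have p1 x : (0 <= ((fun r => (r `^ (- be))%:E) \_ `]0%R, 1%R]) x)%E.
  by rewrite patchE; case: ifP => // _; rewrite lee_fin powR_ge0.
have p2 x : (0 <= ((fun r => (r `^ (- be - 1))%:E) \_ `[1%R, +oo[) x)%E.
  by rewrite patchE; case: ifP => // _; rewrite lee_fin powR_ge0.
rewrite -ge0_integralD//; apply: ge0_le_integral => //.
- by apply: measurableT_comp => //; apply/measurable_EFinP; exact: measurable_pdom.
- exact: emeasurable_funD.
move=> r _ /=; rewrite ger0_norm ?pdom_ge0//.
have [r0|r0] := leP r 0.
  by rewrite /pdom ppow0// mul0r adde_ge0.
rewrite /pdom ppowE//; have [r1|r1] := leP r 1.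
  apply: le_trans (leeDl _ (p2 r)); rewrite patchE mem_set /=; last by rewrite in_itv /= r0 r1.
  by rewrite lee_fin mulrC mulr_powR// subrK.
apply: le_trans (leeDr _ (p1 r)); rewrite patchE mem_set /=; last by rewrite in_itv /= ltW.
by rewrite mulr1.
Qed.

Lemma cvg_invn_powR be : 0 < be -> (n.+2%:R^-1 : R) `^ be @[n --> \oo] --> (0 : R).
Proof.
move=> b0; have /cvg_at_rightP H := powR_cvg0 b0; apply: H; split.
  by move=> n; rewrite invr_gt0.
have := @cvg_harmonic R; rewrite -cvg_shiftS; exact.
Qed.

(** Integration by parts on the half-line: the boundary terms vanish because
    pdom be is small enough at 0 and at infinity. *)
Lemma power_by_parts (k k1 : R -> R) (a be C : R) : 0 < be < 1 ->
  (forall r, 0 < r -> is_derive r (1:R) k (k1 r)) ->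
  (forall r, 0 < r -> {for r, continuous k1}) ->
  measurable_fun setT k -> measurable_fun setT k1 ->
  (forall r, 0 < r -> `|k r| * r `^ (- a - 1) <= C * pdom be r) ->
  (forall r, 0 < r -> `|k1 r| * r `^ (- a) <= C * pdom be r) ->
  \int[leb]_r (k1 r * ppow (- a) r) = a * \int[leb]_r (k r * ppow (- a - 1) r).
Proof.
move=> b01 dk ck1 mk mk1 H1 H2.
have iC : leb.-integrable setT (EFin \o (fun r => C * pdom be r)).
  by apply: integrable_scale; exact: integrable_pdom.
have i1 : leb.-integrable setT (EFin \o (fun r => k1 r * ppow (- a) r)).
  apply: integrable_dominated iC.
    by apply: measurable_funM => //; exact: measurable_ppow.
  move=> r; have [r0|r0] := leP r 0; first by rewrite ppow0// mulr0 normr0 /pdom ppow0// mul0r mulr0.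
  by rewrite ppowE// normrM (ger0_norm (powR_ge0 _ _)) H2.
have i0 : leb.-integrable setT (EFin \o (fun r => k r * ppow (- a - 1) r)).
  apply: integrable_dominated iC.
    by apply: measurable_funM => //; exact: measurable_ppow.
  move=> r; have [r0|r0] := leP r 0; first by rewrite ppow0// mulr0 normr0 /pdom ppow0// mul0r mulr0.
  by rewrite ppowE// normrM (ger0_norm (powR_ge0 _ _)) H1.
pose h r := k r * r `^ (- a).
pose h1 r := k1 r * r `^ (- a) - a * (k r * r `^ (- a - 1)).
have dh r : 0 < r -> is_derive r (1:R) h (h1 r).
  move=> r0; have D1 := dk r r0; have D2 := is_derive_powR (- a) r0.
  by apply: is_derive_eq; rewrite /GRing.scale /= /h1; ring.
have ck r : 0 < r -> {for r, continuous k}.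
  by move=> r0; apply: is_derive_continuous (dk r r0).
have ch1 r : 0 < r -> {for r, continuous h1}.
  move=> r0; apply: cvgB; first by apply: cvgM; [exact: ck1|exact: continuous_powR].
  by apply: cvg_scale; apply: cvgM; [exact: ck|exact: continuous_powR].
pose x n : R := n.+2%:R^-1; pose y n : R := n.+2%:R.
have x0 n : 0 < x n by rewrite invr_gt0.
have xy n : x n < y n by rewrite /x /y (@lt_trans _ _ 1) ?invf_lt1// ltr1n.
have mh1 : measurable_fun setT h1.
  apply: measurable_funB; first by apply: measurable_funM => //; exact: measurable_powR.
  by apply: measurable_funM => //; apply: measurable_funM => //; exact: measurable_powR.
pose G n r := \1_`[x n, y n] r * h1 r.
have Gint n : \int[leb]_r G n r = h (y n) - h (x n).
  rewrite /Rintegral -[RHS]/(fine (h (y n) - h (x n))%:E).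
  rewrite -(segment_FTC (x0 n) (xy n) dh ch1) [in RHS]integral_mkcond.
  congr fine; apply: eq_integral => r _; rewrite /G patchE indicE.
  by case: ifPn => _; rewrite ?mul1r ?mul0r.
pose F r := k1 r * ppow (- a) r - a * (k r * ppow (- a - 1) r).
have [_ GF] : leb.-integrable setT (EFin \o F) /\
    \int[leb]_r G n r @[n --> \oo] --> \int[leb]_r F r.
  apply: (@Rintegral_dominated_cvg _ _ R leb G F (fun r => (1 + `|a|) * (C * pdom be r))).
  - by move=> n; apply: measurable_funM => //; exact: measurable_indic.
  - move=> r; have [r0|r0] := leP r 0.
      apply: cvg_near_cst; apply: nearW => n.
      rewrite /F !ppow0// !mulr0 subrr /G indicE memNset ?mul0r//= in_itv /=.
      by apply/negP; rewrite negb_and -ltNge (le_lt_trans r0).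
    apply: cvg_near_cst; near=> n.
    rewrite /F !ppowE// /G indicE mem_set ?mul1r//= in_itv /=; apply/andP; split.
      rewrite /x -[leRHS]invrK lef_pV2 ?posrE ?invr_gt0//.
      rewrite (@le_trans _ _ n%:R) ?ler_nat//; last by rewrite -addn2 leq_addr.
      by near: n; exact: nbhs_infty_ger.
    rewrite /y (@le_trans _ _ n%:R) ?ler_nat//; last by rewrite -addn2 leq_addr.
    by near: n; exact: nbhs_infty_ger.
  - by apply: integrable_scale.
  - move=> n r; rewrite /G indicE; have [r0|r0] := leP r 0.
      rewrite memNset ?mul0r ?normr0; first by rewrite /pdom ppow0// mul0r !mulr0.
      by rewrite /= in_itv /=; apply/negP; rewrite negb_and -ltNge (le_lt_trans r0).
    apply: (@le_trans _ _ `|h1 r|).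
      by case: (_ \in _); rewrite ?mul1r// mul0r normr0.
    rewrite /h1 (le_trans (ler_normB _ _))// mulrDl mul1r lerD//.
      by rewrite normrM (ger0_norm (powR_ge0 _ _)) H2.
    by rewrite !normrM (ger0_norm (powR_ge0 _ _)) ler_wpM2l// H1.
have h0 : h (y n) - h (x n) @[n --> \oo] --> (0 : R).
  have C0 : 0 <= C.
    have p1 : pdom be 1 = 1 by rewrite /pdom ppowE// powR1 mul1r minxx.
    have := H1 1 ltr01; rewrite powR1 p1 !mulr1; exact: le_trans.
  have /andP[b0 b1] := b01.
  have hb r : 0 < r -> `|h r| <= C * (r * pdom be r).
    move=> r0; rewrite /h normrM (ger0_norm (powR_ge0 _ _)) mulrCA.
    rewrite (_ : r `^ (- a) = r * r `^ (- a - 1)).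
      by rewrite [leLHS]mulrCA; apply: ler_wpM2l; [exact: ltW|exact: H1].
    by rewrite mulr_powR// subrK.
  have hy n : `|h (y n)| <= C * x n `^ be.
    rewrite (le_trans (hb _ _))// ler_wpM2l// /pdom ppowE// min_r ?ler1n// mulr1.
    rewrite mulr_powR// subrK /x -powR_inv1// -powRrM.
    by rewrite mulN1r.
  have hx n : `|h (x n)| <= C * x n `^ (1 - be).
    rewrite (le_trans (hb _ _))// ler_wpM2l// /pdom ppowE// min_l; last first.
      by rewrite invf_le1// ler1n.
    rewrite (mulrC (_ `^ _)) !mulr_powR//.
    by rewrite (_ : - be - 1 + 1 + 1 = 1 - be)//; ring.
  have lim0 (u : nat -> R) be' : 0 < be' -> (forall n, `|u n| <= C * x n `^ be') ->
      u n @[n --> \oo] --> (0 : R).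
    move=> b'0 ub.
    have H : C * x n `^ be' @[n --> \oo] --> C * 0.
      by apply: cvg_scale; exact: cvg_invn_powR.
    by rewrite mulr0 in H; exact: dominated_cvg0 H.
  rewrite -[0]subr0; apply: cvgB; [apply: (lim0 _ be) => //|apply: (lim0 _ (1 - be)) => //].
  by rewrite subr_gt0.
have F0 : \int[leb]_r F r = 0.
  rewrite -(cvg_lim _ GF)//; under eq_fun do rewrite Gint.
  exact/cvg_lim.
move: F0; rewrite /F RintegralB//; last exact: integrable_scale.
by rewrite RintegralZl// => /eqP; rewrite subr_eq0 => /eqP.
Unshelve. all: by end_near.
Qed.

(** Let G(th) be the integral over the half-line of
    (exp(-zr) - 1 + zr) r^(-g-1), for z = exp(i th). Differentiating under the
    integral and integrating by parts give G' = i g G on ]-pi/2, pi/2[, so that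
    G(th) = exp(i g th) G(0), also at th = pi/2 by continuity. There, the
    integrand is exp(-ir) - 1 + ir, while G(0) is a value of Gamma up to two
    integrations by parts. U and V are the real and imaginary parts of G. *)
Section oscillating_integrals.
Variable g : R.
Hypothesis g12 : 1 < g < 2.

Let Cc (th r : R) := 1 - expR (- (r * cos th)) * cos (r * sin th).
Let Ss (th r : R) := expR (- (r * cos th)) * sin (r * sin th).
Let u (th r : R) := - Cc th r + r * cos th.
Let v (th r : R) := r * sin th - Ss th r.
Let u1 th r := cos th * Cc th r - sin th * Ss th r.
Let v1 th r := sin th * Cc th r + cos th * Ss th r.

Let dur th r : is_derive r (1:R) (u th) (u1 th r).
Proof. by apply: is_derive_eq; rewrite /GRing.scale /= /u1 /Cc /Ss; ring. Qed.

Let dvr th r : is_derive r (1:R) (v th) (v1 th r).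
Proof. by apply: is_derive_eq; rewrite /GRing.scale /= /v1 /Cc /Ss; ring. Qed.

Let duth th r : is_derive th (1:R) (u^~ r) (- (r * v1 th r)).
Proof. by apply: is_derive_eq; rewrite /GRing.scale /= /v1 /Cc /Ss; ring. Qed.

Let dvth th r : is_derive th (1:R) (v^~ r) (r * u1 th r).
Proof. by apply: is_derive_eq; rewrite /GRing.scale /= /u1 /Cc /Ss; ring. Qed.

Let cu1 th r : {for r, continuous (u1 th)}.
Proof.
apply: (@is_derive_continuous _ _ (cos th * (Ss th r * sin th + (1 - Cc th r) * cos th)
  - sin th * (- cos th * Ss th r + (1 - Cc th r) * sin th))).
by apply: is_derive_eq; rewrite /GRing.scale /= /Cc /Ss; ring.
Qed.

Let cv1 th r : {for r, continuous (v1 th)}.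
Proof.
apply: (@is_derive_continuous _ _ (sin th * (Ss th r * sin th + (1 - Cc th r) * cos th)
  + cos th * (- cos th * Ss th r + (1 - Cc th r) * sin th))).
by apply: is_derive_eq; rewrite /GRing.scale /= /Cc /Ss; ring.
Qed.

Let bounds th r : 0 <= cos th -> 0 <= r ->
  `|Cc th r| <= 3 * Num.min r 1 /\ `|Ss th r| <= Num.min r 1.
Proof.
move=> c0 r0.
have x0 : 0 <= r * cos th by rewrite mulr_ge0.
have xr : r * cos th <= r by rewrite ler_piMr// cos_le1.
have yr : `|r * sin th| <= r.
  by rewrite normrM ger0_norm// ler_piMr// ler_norml sin_geN1 sin_le1.
have e1 : expR (- (r * cos th)) <= 1 by rewrite -expR0 ler_expR oppr_le0.
have e0 := expR_gt0 (- (r * cos th)).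
have ee : `|1 - expR (- (r * cos th))| <= Num.min r 1.
  rewrite ger0_norm ?subr_ge0// le_min; apply/andP; split; last by lra.
  by apply: le_trans xr; exact: subr1_expRN_le.
have m0 : 0 <= Num.min r 1 by rewrite le_min r0 ler01.
split.
  rewrite /Cc (_ : 1 - _ = (1 - expR (- (r * cos th))) +
    expR (- (r * cos th)) * (1 - cos (r * sin th))); last by ring.
  rewrite (le_trans (ler_normD _ _))//.
  rewrite (_ : 3 * _ = Num.min r 1 + 2 * Num.min r 1); last by ring.
  rewrite lerD// normrM (gtr0_norm e0) ger0_norm ?subr1_cos_ge0//.
  rewrite (@le_trans _ _ (1 - cos (r * sin th)))//.
    by rewrite ler_piMl// subr1_cos_ge0.
  have [r1|r1] := leP r 1.
    by apply: le_trans (subr1_cos_le_norm _) _; lra.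
  by have := @cos_geN1 R (r * sin th); lra.
rewrite /Ss normrM (gtr0_norm e0) (@le_trans _ _ `|sin (r * sin th)|)//.
  by rewrite ler_piMl.
rewrite le_min; apply/andP; split; first exact: le_trans (norm_sin_le _) yr.
by rewrite ler_norml sin_geN1 sin_le1.
Qed.

Let bound1 th r : 0 <= cos th -> 0 <= r ->
  `|u1 th r| <= 4 * Num.min r 1 /\ `|v1 th r| <= 4 * Num.min r 1.
Proof.
move=> c0 r0; have [bC bS] := bounds c0 r0.
have nc : `|cos th| <= 1 by rewrite ler_norml cos_geN1 cos_le1.
have ns : `|sin th| <= 1 by rewrite ler_norml sin_geN1 sin_le1.
have H (a b : R) : `|a| <= 1 -> `|b| <= 1 ->
    `|a * Cc th r| + `|b * Ss th r| <= 4 * Num.min r 1.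
  move=> a1 b1; rewrite (_ : 4 * _ = 3 * Num.min r 1 + Num.min r 1); last by ring.
  have A : `|a| * `|Cc th r| <= `|Cc th r| by rewrite ler_piMl.
  have B : `|b| * `|Ss th r| <= `|Ss th r| by rewrite ler_piMl.
  rewrite (normrM a) (normrM b); exact: (lerD (le_trans A bC) (le_trans B bS)).
by split; [apply: le_trans (ler_normB _ _) _|apply: le_trans (ler_normD _ _) _]; exact: H.
Qed.

Let bound0 th r : 0 <= cos th -> 0 <= r ->
  `|u th r| <= 4 * (r * Num.min r 1) /\ `|v th r| <= 4 * (r * Num.min r 1).
Proof.
move=> c0 r0.
have u0 : u th 0 = 0 by rewrite /u /Cc !mul0r oppr0 expR0 cos0; ring.
have v0 : v th 0 = 0 by rewrite /v /Ss !mul0r sin0 mulr0 subrr.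
have mono c : 0 <= c <= r -> Num.min c 1 <= Num.min r 1.
  by move=> /andP[_ cr]; rewrite le_min !ge_min cr lexx !orbT.
have [cu cur uE] := MVT_total (dur th) r0.
have [cv cvr vE] := MVT_total (dvr th) r0.
rewrite u0 !subr0 in uE; rewrite v0 !subr0 in vE.
have H (c w : R) : 0 <= c <= r -> `|w| <= 4 * Num.min c 1 ->
    `|w * r| <= 4 * (r * Num.min r 1).
  move=> cr wc; rewrite normrM (ger0_norm r0) mulrC mulrCA ler_wpM2l//.
  by rewrite (le_trans wc)// ler_wpM2l// mono.
rewrite uE vE; split.
  by have /andP[? _] := cur; apply: (H cu) => //; apply: (bound1 _ _).1.
by have /andP[? _] := cvr; apply: (H cv) => //; apply: (bound1 _ _).2.
Qed.

Let be := g - 1.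
Let be01 : 0 < be < 1.
Proof. by move: g12 => /andP[? ?]; rewrite /be; lra. Qed.

Let pdomE r : 0 < r -> r * Num.min r 1 * ppow (- g - 1) r = pdom be r.
Proof.
move=> r0; rewrite /pdom !ppowE// mulrAC (mulr_powR _ r0).
by congr (_ `^ _ * _); rewrite /be; ring.
Qed.

Let pdomE1 r : 0 < r -> Num.min r 1 * r `^ (- g) = pdom be r.
Proof.
move=> r0; rewrite /pdom !ppowE// mulrC.
by congr (_ `^ _ * _); rewrite /be; ring.
Qed.

Let mu_ th : measurable_fun setT (u th).
Proof.
by apply: continuous_measurable_fun => r; apply: is_derive_continuous (dur th r).
Qed.

Let mv_ th : measurable_fun setT (v th).
Proof.
by apply: continuous_measurable_fun => r; apply: is_derive_continuous (dvr th r).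
Qed.

Let f (w : R -> R -> R) th r := w th r * ppow (- g - 1) r.

Let integrable_f (w : R -> R -> R) th : measurable_fun setT (w th) ->
  (forall r, 0 <= r -> `|w th r| <= 4 * (r * Num.min r 1)) ->
  leb.-integrable setT (EFin \o f w th) /\ (forall r, `|f w th r| <= 4 * pdom be r).
Proof.
move=> mw wb.
have fb r : `|f w th r| <= 4 * pdom be r.
  rewrite /f normrM (ger0_norm (ppow_ge0 _ _)).
  have [r0|r0] := leP r 0; first by rewrite ppow0// mulr0 mulr_ge0// pdom_ge0.
  by rewrite -pdomE// mulrA ler_wpM2r ?ppow_ge0// wb// ltW.
split => //; apply: (@integrable_dominated _ _ R leb _ (fun r => 4 * pdom be r)) => //.
  by apply: measurable_funM => //; exact: measurable_ppow.
by apply: integrable_scale; exact: integrable_pdom.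
Qed.

Let U th := \int[leb]_r f u th r.
Let V th := \int[leb]_r f v th r.

Let UE th : 0 <= cos th -> \int[leb]_r (u1 th r * ppow (- g) r) = g * U th.
Proof.
move=> c0; apply: (@power_by_parts (u th) (u1 th) g be 4 be01).
- by move=> r _; exact: dur.
- by move=> r _; exact: cu1.
- exact: mu_.
- by apply: continuous_measurable_fun => r; exact: cu1.
- move=> r r0; rewrite -pdomE// ppowE// mulrA ler_wpM2r ?powR_ge0//.
  by apply: (bound0 c0 _).1; exact: ltW.
- move=> r r0; rewrite -pdomE1// mulrA ler_wpM2r ?powR_ge0//.
  by apply: (bound1 c0 _).1; exact: ltW.
Qed.

Let VE th : 0 <= cos th -> \int[leb]_r (v1 th r * ppow (- g) r) = g * V th.
Proof.
move=> c0; apply: (@power_by_parts (v th) (v1 th) g be 4 be01).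
- by move=> r _; exact: dvr.
- by move=> r _; exact: cv1.
- exact: mv_.
- by apply: continuous_measurable_fun => r; exact: cv1.
- move=> r r0; rewrite -pdomE// ppowE// mulrA ler_wpM2r ?powR_ge0//.
  by apply: (bound0 c0 _).2; exact: ltW.
- move=> r r0; rewrite -pdomE1// mulrA ler_wpM2r ?powR_ge0//.
  by apply: (bound1 c0 _).2; exact: ltW.
Qed.

Let I0 : set R := `]- (pi / 2), (pi / 2)[.

Let cosI th : I0 th -> 0 <= cos th.
Proof. by rewrite /I0 /= in_itv /= => thI; apply/ltW/cos_gt0_pihalf. Qed.

Let ppow_shift r : r * ppow (- g - 1) r = ppow (- g) r.
Proof.
have [r0|r0] := leP r 0; first by rewrite !ppow0// mulr0.
by rewrite !ppowE// mulr_powR// subrK.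
Qed.

(** Domination of the derivative is uniform in th as long as cos th >= 0, where
    the exponentials are at most 1. *)
Let derive_integral (w dw : R -> R -> R) th : I0 th ->
  (forall th r, is_derive th (1:R) (w^~ r) (r * dw th r)) ->
  (forall th, measurable_fun setT (w th)) ->
  (forall th r, 0 <= cos th -> 0 <= r -> `|w th r| <= 4 * (r * Num.min r 1)) ->
  (forall th r, 0 <= cos th -> 0 <= r -> `|dw th r| <= 4 * Num.min r 1) ->
  is_derive th (1:R) (fun th => \int[leb]_r f w th r) (\int[leb]_r (dw th r * ppow (- g) r)).
Proof.
move=> thI dwE mw w0 w1.
have d1 th' r : is_derive th' (1:R) ((f w)^~ r) (dw th' r * ppow (- g) r).
  have D := dwE th' r.
  by rewrite -ppow_shift /f; apply: is_derive_eq; rewrite /GRing.scale /=; ring.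
have intf x : I0 x -> leb.-integrable setT (EFin \o f w x).
  by move=> xI; apply: (integrable_f (mw x) _).1 => r r0; apply: w0 => //; exact: cosI.
have der x y : I0 x -> setT y -> derivable ((f w)^~ y) x 1 by move=> _ _; case: (d1 x y).
have G0 (y : R) : 0 <= 4 * pdom be y by rewrite mulr_ge0// pdom_ge0.
have iG : leb.-integrable setT (EFin \o (fun y => 4 * pdom be y)).
  by apply: integrable_scale; exact: integrable_pdom.
have Gub x y : I0 x -> setT y -> `|partial1of2 (f w) x y| <= 4 * pdom be y.
  move=> xI _; rewrite partial1of2E derive_val normrM (ger0_norm (ppow_ge0 _ _)).
  have [y0|y0] := leP y 0; first by rewrite ppow0// mulr0.
  rewrite -pdomE1// ppowE// mulrA ler_wpM2r ?powR_ge0//.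
  by apply: w1; [exact: cosI|exact: ltW].
have E := differentiation_under_integral measurableT thI intf der G0 iG Gub.
have D := derivable_under_integral measurableT thI intf der G0 iG Gub.
apply: DeriveDef => //; rewrite -derive1E E.
by apply: eq_Rintegral => r _; rewrite partial1of2E derive_val.
Qed.

Let dU th : I0 th -> is_derive th (1:R) U (- (g * V th)).
Proof.
move=> thI; rewrite -VE; last exact: cosI.
have := @derive_integral u (fun th r => - v1 th r) th thI _ mu_ _ _.
rewrite (_ : \int[leb]_r (- v1 th r * _) = - \int[leb]_r (v1 th r * ppow (- g) r)).
  apply.
  - by move=> t r; rewrite mulrN; exact: duth.
  - by move=> t r c0 r0; exact: (bound0 c0 r0).1.
  - by move=> t r c0 r0; rewrite normrN; exact: (bound1 c0 r0).2.
rewrite -[RHS]mulN1r -RintegralZl//.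
  by apply: eq_Rintegral => r _; ring.
apply: (@integrable_dominated _ _ R leb _ (fun r => 4 * pdom be r)) => //.
- apply: measurable_funM; last exact: measurable_ppow.
  by apply: continuous_measurable_fun => r; exact: cv1.
- move=> r; rewrite normrM (ger0_norm (ppow_ge0 _ _)).
  have [y0|y0] := leP r 0; first by rewrite ppow0// mulr0 mulr_ge0// pdom_ge0.
  rewrite -pdomE1// ppowE// mulrA ler_wpM2r ?powR_ge0//.
  by apply: (bound1 _ _).2; [exact: cosI|exact: ltW].
- by apply: integrable_scale; exact: integrable_pdom.
Qed.

Let dV th : I0 th -> is_derive th (1:R) V (g * U th).
Proof.
move=> thI; rewrite -UE; last exact: cosI.
apply: derive_integral => //.
- by move=> t r c0 r0; exact: (bound0 c0 r0).2.
- by move=> t r c0 r0; exact: (bound1 c0 r0).1.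
Qed.

Let rotation th : 0 <= th < pi / 2 ->
  U th * cos (g * th) + V th * sin (g * th) = U 0 /\
  V th * cos (g * th) - U th * sin (g * th) = 0.
Proof.
move=> /andP[th0 thp].
have pI t : 0 <= t <= th -> I0 t.
  by move=> /andP[? ?]; rewrite /I0 /= in_itv /=; have := @pi_gt0 R; lra.
have V0 : V 0 = 0.
  rewrite /V /Rintegral (eq_integral (fun=> 0%E)) ?integral0// => r _.
  by rewrite /f /v /Ss sin0 !mulr0 sin0 mulr0 subrr mul0r.
have const (h : R -> R) : (forall t, 0 <= t <= th -> is_derive t (1:R) h 0) -> h th = h 0.
  move=> dh; have [|c _] := @MVT_segment R h (fun=> 0) 0 th th0
    (fun x xI => dh x (let: conj a b := andP (subset_itv_oo_cc xI) in introT andP (conj a b))).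
    apply: continuous_in_subspaceT => x /set_mem; rewrite /= in_itv /= => xI.
    exact: is_derive_continuous (dh x xI).
  by rewrite mul0r => /eqP; rewrite subr_eq0 => /eqP.
split.
  transitivity ((fun t => U t * cos (g * t) + V t * sin (g * t)) 0).
    apply: (const (fun t => U t * cos (g * t) + V t * sin (g * t))) => t /pI tI; have D1 := dU tI; have D2 := dV tI.
    by apply: is_derive_eq; rewrite /GRing.scale /=; ring.
  by rewrite /= mulr0 cos0 sin0 mulr0 addr0 mulr1.
transitivity ((fun t => V t * cos (g * t) - U t * sin (g * t)) 0).
  apply: (const (fun t => V t * cos (g * t) - U t * sin (g * t))) => t /pI tI; have D1 := dU tI; have D2 := dV tI.
  by apply: is_derive_eq; rewrite /GRing.scale /=; ring.
by rewrite /= mulr0 cos0 sin0 mulr0 V0 mul0r subrr.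
Qed.

Let rotation_pihalf :
  U (pi / 2) = U 0 * cos (g * (pi / 2)) /\ V (pi / 2) = U 0 * sin (g * (pi / 2)).
Proof.
pose t (n : nat) : R := pi / 2 - n.+2%:R^-1.
have p1 := @pihalf_ge1 R.
have tn n : 0 <= t n < pi / 2.
  have : (n.+2%:R^-1 : R) <= 1 by rewrite invf_le1// ler1n.
  have : (0 : R) < n.+2%:R^-1 by rewrite invr_gt0.
  rewrite /t; move: n.+2%:R^-1 => z z0 z1; lra.
have cost n : 0 <= cos (t n).
  by apply: cos_ge0_pihalf; have := tn n; lra.
have tcvg : t n @[n --> \oo] --> (pi / 2 : R).
  rewrite -[X in _ --> X]subr0; apply: cvgB; first exact: cvg_cst.
  by have := @cvg_harmonic R; rewrite -cvg_shiftS.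
have cvgW (w : R -> R -> R) : (forall th, measurable_fun setT (w th)) ->
    (forall th r, 0 <= cos th -> 0 <= r -> `|w th r| <= 4 * (r * Num.min r 1)) ->
    (forall r, continuous (w^~ r)) ->
    \int[leb]_r f w (t n) r @[n --> \oo] --> \int[leb]_r f w (pi / 2) r.
  move=> mw wb cw.
  apply: (@Rintegral_dominated_cvg _ _ R leb (fun n => f w (t n)) (f w (pi / 2))
    (fun r => 4 * pdom be r) _ _ _ _).2.
  - by move=> n; apply: measurable_funM; [exact: mw|exact: measurable_ppow].
  - move=> r; rewrite /f; apply: cvgM; last exact: cvg_cst.
    exact: (cvg_comp _ _ tcvg (cw r (pi / 2))).
  - by apply: integrable_scale; exact: integrable_pdom.
  - move=> n; apply: (integrable_f (mw (t n)) _).2 => r r0; exact: wb.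
have cU : U (t n) @[n --> \oo] --> U (pi / 2).
  apply: cvgW => //; first by move=> th r c0 r0; exact: (bound0 c0 r0).1.
  by move=> r th; apply: is_derive_continuous (duth th r).
have cV : V (t n) @[n --> \oo] --> V (pi / 2).
  apply: cvgW => //; first by move=> th r c0 r0; exact: (bound0 c0 r0).2.
  by move=> r th; apply: is_derive_continuous (dvth th r).
have ccos : cos (g * t n) @[n --> \oo] --> cos (g * (pi / 2)).
  by apply: continuous_cvg; [exact: continuous_cos|exact: cvg_scale].
have csin : sin (g * t n) @[n --> \oo] --> sin (g * (pi / 2)).
  by apply: continuous_cvg; [exact: continuous_sin|exact: cvg_scale].
have E1 : U (pi / 2) * cos (g * (pi / 2)) + V (pi / 2) * sin (g * (pi / 2)) = U 0.
  have H : U (t n) * cos (g * t n) + V (t n) * sin (g * t n) @[n --> \oo] -->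
      U (pi / 2) * cos (g * (pi / 2)) + V (pi / 2) * sin (g * (pi / 2)).
    by apply: cvgD; exact: cvgM.
  rewrite -(cvg_lim _ H)//; apply/cvg_lim => //; apply: cvg_near_cst; apply: nearW => n.
  by have [] := rotation (tn n).
have E2 : V (pi / 2) * cos (g * (pi / 2)) - U (pi / 2) * sin (g * (pi / 2)) = 0.
  have H : V (t n) * cos (g * t n) - U (t n) * sin (g * t n) @[n --> \oo] -->
      V (pi / 2) * cos (g * (pi / 2)) - U (pi / 2) * sin (g * (pi / 2)).
    by apply: cvgB; exact: cvgM.
  rewrite -(cvg_lim _ H)//; apply/cvg_lim => //; apply: cvg_near_cst; apply: nearW => n.
  by have [] := rotation (tn n).
have cs := cos2Dsin2 (g * (pi / 2)).
set c := cos (g * (pi / 2)) in E1 E2 cs *; set s := sin (g * (pi / 2)) in E1 E2 cs *.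
split.
  transitivity (U (pi / 2) * (c ^+ 2 + s ^+ 2)); first by rewrite cs mulr1.
  transitivity ((U (pi / 2) * c + V (pi / 2) * s) * c - (V (pi / 2) * c - U (pi / 2) * s) * s); first by ring.
  by rewrite E1 E2 mul0r subr0.
transitivity (V (pi / 2) * (c ^+ 2 + s ^+ 2)); first by rewrite cs mulr1.
transitivity ((U (pi / 2) * c + V (pi / 2) * s) * s + (V (pi / 2) * c - U (pi / 2) * s) * c); first by ring.
by rewrite E1 E2 mul0r addr0.
Qed.

Let U0E : U 0 = Gamma (2 - g) / (g * (g - 1)).
Proof.
have [g1 g2] := andP g12.
have c0 : (0 : R) <= cos 0 by rewrite cos0.
have H1 := UE c0.
have H2 : \int[leb]_r (expR (- r) * ppow (1 - g) r) =
    (g - 1) * \int[leb]_r ((1 - expR (- r)) * ppow (- g) r).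
  have := @power_by_parts (fun r => 1 - expR (- r)) (fun r => expR (- r)) (g - 1) be 1 be01.
  rewrite (_ : - (g - 1) = 1 - g); last by ring.
  rewrite (_ : 1 - g - 1 = - g); last by ring.
  apply.
  - by move=> r _; apply: is_derive_eq; rewrite /GRing.scale /=; ring.
  - move=> r _; apply: (@is_derive_continuous _ _ (- expR (- r))).
    by apply: is_derive_eq; rewrite /GRing.scale /=; ring.
  - apply: continuous_measurable_fun => r; apply: (@is_derive_continuous _ _ (expR (- r))).
    by apply: is_derive_eq; rewrite /GRing.scale /=; ring.
  - apply: continuous_measurable_fun => r; apply: (@is_derive_continuous _ _ (- expR (- r))).
    by apply: is_derive_eq; rewrite /GRing.scale /=; ring.
  - move=> r r0; rewrite mul1r -pdomE1// ler_wpM2r ?powR_ge0// ger0_norm.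
      by rewrite le_min subr1_expRN_le lerBlDr lerDl ltW// expR_gt0.
    by rewrite subr_ge0 -expR0 ler_expR oppr_le0 ltW.
  - move=> r r0; rewrite mul1r /pdom ppowE// ger0_norm ?expR_ge0//.
    rewrite (_ : r `^ (1 - g) = r * r `^ (- g)); last by rewrite mulr_powR// addrC.
    rewrite (_ : - be - 1 = - g); last by rewrite /be; ring.
    rewrite (mulrC r) mulrCA ler_wpM2l ?powR_ge0// le_min; apply/andP; split.
      by rewrite ler_piMl//; [exact: ltW|rewrite -expR0 ler_expR oppr_le0 ltW].
    rewrite expRN mulrC ler_pdivrMr ?expR_gt0// mul1r.
    by apply: le_trans (expR_ge1Dx r); rewrite lerDr.
have E : \int[leb]_r (u1 0 r * ppow (- g) r) = \int[leb]_r ((1 - expR (- r)) * ppow (- g) r).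
  by apply: eq_Rintegral => r _; rewrite /u1 /Cc /Ss cos0 sin0 !mulr0 cos0 !mul1r !mulr1 mul0r subr0.
have GE : Gamma (2 - g) = \int[leb]_r (expR (- r) * ppow (1 - g) r).
  rewrite /Gamma /Rintegral integral_mkcond; congr fine; apply: eq_integral => r _.
  rewrite patchE /ppow indicE -[X in _ \in X]/Rplus.
  case: ifPn => _; last by rewrite mul0r mulr0.
  by rewrite mul1r mulrC (_ : 2 - g - 1 = 1 - g)//; ring.
rewrite GE H2 -E H1; field.
by rewrite subr_eq0 (gt_eqF g1) (gt_eqF (lt_trans ltr01 g1)).
Qed.

Lemma integral_cos_power :
  \int[leb]_r ((1 - cos r) * ppow (- g - 1) r) =
    - (Gamma (2 - g) / (g * (g - 1))) * cos (pi * g / 2).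
Proof.
have [E _] := rotation_pihalf.
rewrite mulNr -U0E (_ : pi * g / 2 = g * (pi / 2)); last by ring.
rewrite -E -[RHS]mulN1r /U -RintegralZl//.
  apply: eq_Rintegral => r _; rewrite /f /u /Cc cos_pihalf sin_pihalf mulr0 oppr0 expR0.
  by rewrite !mul1r mulr1 addr0 mulN1r mulNr opprK.
apply: (integrable_f (mu_ _) _).1 => r r0.
by apply: (bound0 _ r0).1; rewrite cos_pihalf.
Qed.

Lemma integral_sin_power :
  \int[leb]_r ((r - sin r) * ppow (- g - 1) r) =
    Gamma (2 - g) / (g * (g - 1)) * sin (pi * g / 2).
Proof.
have [_ E] := rotation_pihalf.
rewrite -U0E (_ : pi * g / 2 = g * (pi / 2)); last by ring.
rewrite -E /V; apply: eq_Rintegral => r _.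
rewrite /f /v /Ss cos_pihalf sin_pihalf mulr0 oppr0 expR0.
by rewrite mulr1 mul1r.
Qed.

End oscillating_integrals.

End power_integrals.

(** * Power functions and the convergence of their integrals *)

Section powers.
Context {R : realType}.
Variable a : R.
Hypothesis a0 : 0 < a.

Definition apow (x : R) : R := `|x| `^ a.

Definition spow (x : R) : R := Num.sg x * `|x| `^ a.

Lemma apow_ge0 x : 0 <= apow x. Proof. exact: powR_ge0. Qed.

Lemma apow0 : apow 0 = 0.
Proof. by rewrite /apow normr0 powR0// gt_eqF. Qed.

Lemma spow0 : spow 0 = 0. Proof. by rewrite /spow sgr0 mul0r. Qed.

Lemma apowM x y : apow (x * y) = apow x * apow y.
Proof. by rewrite /apow normrM powRM. Qed.

Lemma spowM x y : spow (x * y) = spow x * spow y.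
Proof. by rewrite /spow sgrM normrM powRM// mulrACA. Qed.

Lemma norm_spow_le x : `|spow x| <= apow x.
Proof.
rewrite /spow normrM (ger0_norm (powR_ge0 _ _)) ler_piMl ?powR_ge0//.
by case: sgrP; rewrite ?normrN ?normr1 ?normr0.
Qed.

Lemma apow_le x y : `|x| <= `|y| -> apow x <= apow y.
Proof. by move=> xy; apply: ge0_ler_powR => //; rewrite ?nnegrE ?normr_ge0 ?(ltW a0). Qed.

Lemma apow_add x y : apow (x + y) <= 2 `^ a * (apow x + apow y).
Proof.
have H u v : `|u| <= `|v| -> apow (u + v) <= 2 `^ a * (apow u + apow v).
  move=> uv; apply: (@le_trans _ _ (apow (2 * v))).
    apply: apow_le; rewrite normrM (ger0_norm (ler0n _ 2)).
    by apply: le_trans (ler_normD _ _) _; rewrite mulr_natl mulr2n lerD2r.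
  rewrite apowM {1}/apow ger0_norm// ler_wpM2l ?powR_ge0//.
  by rewrite lerDr apow_ge0.
have [/H//|/ltW /H] := leP `|x| `|y|.
by rewrite addrC [apow y + _]addrC.
Qed.

Lemma spow_parts x :
  spow x = Num.max x 0 `^ a - (- Num.min x 0) `^ a.
Proof.
rewrite /spow; case: sgrP => [->|x0|x0].
- by rewrite mul0r maxxx minxx oppr0 subrr.
- by rewrite mul1r max_l ?ltW// min_r ?ltW// oppr0 powR0 ?gt_eqF// subr0.
- by rewrite mulN1r max_r ?ltW// min_l ?ltW// powR0 ?gt_eqF// sub0r.
Qed.

Lemma apow_parts x :
  apow x = Num.max x 0 `^ a + (- Num.min x 0) `^ a.
Proof.
rewrite /apow; case: (ltrgtP x 0) => [x0|x0|->].
- by rewrite ltr0_norm// powR0 ?gt_eqF// add0r.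
- by rewrite gtr0_norm// oppr0 powR0 ?gt_eqF// addr0.
- by rewrite normr0 oppr0 powR0 ?gt_eqF// addr0.
Qed.

Lemma measurable_powRa (b : R) : measurable_fun setT (fun x : R => x `^ b).
Proof. exact: measurable_powR. Qed.

Lemma measurable_apow : measurable_fun setT apow.
Proof. exact: (measurableT_comp (@measurable_powRa a)). Qed.

Lemma measurable_spow : measurable_fun setT spow.
Proof.
rewrite (_ : spow = fun x => Num.max x 0 `^ a - (- Num.min x 0) `^ a); last first.
  by apply/funext => x; exact: spow_parts.
apply: measurable_funB; apply: (measurableT_comp (@measurable_powRa a)).
  exact: measurable_maxr.
by apply: measurableT_comp => //; exact: measurable_minr.
Qed.

(** Either x is close to y relatively to y, and then homogeneity reduces to the
    continuity of the power function at 1, or both x and y are at most a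
    constant times x - y. *)
Lemma homogeneous_modulus (Phi : R -> R) (e : R) : 0 < e ->
  (forall x, `|Phi x| <= apow x) ->
  (forall r y, 0 < r -> Phi (r * y) = r `^ a * Phi y) ->
  exists2 C : R, 0 <= C &
    forall x y, `|Phi x - Phi y| <= e * apow y + C * apow (x - y).
Proof.
move=> e0 Phi_le PhiM.
have : \forall r \near (1 : R), `|1 `^ a - r `^ a| < e.
  have := @continuous_powR R a 1 (ltr01 : 0 < 1 :> R).
  by move=> /cvgrPdist_lt /(_ _ e0).
move=> /nbhs_ballP[dl /= dl0 Hdl].
pose k := Num.min dl 1.
have k0 : 0 < k by rewrite lt_min dl0/=.
exists ((1 + k^-1) `^ a + k^-1 `^ a); first by rewrite addr_ge0 ?powR_ge0.
move=> x y; have [xy|xy] := ltP `|x - y| (k * `|y|).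
  have y0 : y != 0.
    by apply: contraTneq xy => ->; rewrite normr0 mulr0 -leNgt normr_ge0.
  have r1 : `|1 - x / y| < k.
    by rewrite -(divff y0) -mulrBl normrM normfV ltr_pdivrMr ?normr_gt0// distrC.
  have r0 : 0 < x / y.
    have : `|1 - x / y| < 1 by apply: lt_le_trans r1 _; rewrite ge_min lexx orbT.
    by move=> /(le_lt_trans (ler_norm _)); rewrite ltrBlDr ltrDl.
  have re : `|1 `^ a - (x / y) `^ a| < e.
    by apply: Hdl; rewrite /ball/=; apply: lt_le_trans r1 _; rewrite ge_min lexx.
  rewrite -{1}(divfK y0 x) PhiM// -{2}[Phi y]mul1r -mulrBl normrM.
  rewrite ler_wpDr ?mulr_ge0 ?addr_ge0 ?powR_ge0//.
  apply: ler_pM => //; rewrite distrC; move: re; rewrite powR1 => /ltW//.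
have yk : `|y| <= k^-1 * `|x - y| by rewrite ler_pdivlMl.
have xk : `|x| <= (1 + k^-1) * `|x - y|.
  by rewrite mulrDl mul1r -{1}(subrK y x) (le_trans (ler_normD _ _))// lerD2l.
have pw c u : 0 <= c -> `|u| <= c * `|x - y| -> apow u <= c `^ a * apow (x - y).
  move=> c0 uc; rewrite -[X in X `^ a](ger0_norm c0) -apowM; apply: apow_le.
  by rewrite normrM (ger0_norm c0).
rewrite ler_wpDl ?mulr_ge0 ?apow_ge0 ?(ltW e0)//.
rewrite (le_trans (ler_normB _ _))// mulrDl lerD//.
  by apply: le_trans (Phi_le _) _; apply: pw => //; rewrite addr_ge0 ?invr_ge0 ?ltW.
by apply: le_trans (Phi_le _) _; apply: pw => //; rewrite invr_ge0 ltW.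
Qed.

Lemma apow_hom r y : 0 < r -> apow (r * y) = r `^ a * apow y.
Proof. by move=> r0; rewrite apowM {1}/apow gtr0_norm. Qed.

Lemma spow_hom r y : 0 < r -> spow (r * y) = r `^ a * spow y.
Proof. by move=> r0; rewrite spowM {1}/spow gtr0_sg// mul1r gtr0_norm. Qed.

Section integrals.
Context d (T : measurableType d) (m : {measure set T -> \bar R}).

Definition Lpow (f : T -> R) :=
  measurable_fun setT f /\ m.-integrable setT (EFin \o (apow \o f)).

Lemma Lpow_add f g : Lpow f -> Lpow g -> Lpow (fun x => f x + g x).
Proof.
move=> [mf jf] [mg jg].
have mfg : measurable_fun setT (fun x => f x + g x) by exact: measurable_funD.
split => //.
apply: (@integrable_dominated _ _ _ _ _ (fun x => 2 `^ a * (apow (f x) + apow (g x)))).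
- exact: (measurableT_comp measurable_apow).
- by move=> x /=; rewrite ger0_norm ?apow_ge0//; exact: apow_add.
- exact: (integrable_scale (2 `^ a) (integrable_add jf jg)).
Qed.

Lemma Rintegral_apow_add f g : Lpow f -> Lpow g ->
  \int[m]_x apow (f x + g x) <= 2 `^ a * (\int[m]_x apow (f x) + \int[m]_x apow (g x)).
Proof.
move=> Lf Lg; have [_ jfg] := Lpow_add Lf Lg; case: Lf Lg => [mf jf] [mg jg].
rewrite -RintegralD// -RintegralZl//; last exact: integrable_add.
apply: Rintegral_ge0_le => //.
  exact: (integrable_scale (2 `^ a) (integrable_add jf jg)).
by move=> x; exact: apow_add.
Qed.

Lemma Lpow_scale c f : Lpow f -> Lpow (fun x => c * f x).
Proof.
move=> [mf jf]; split; first exact: measurable_funM.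
by apply: eq_integrable (integrable_scale (apow c) jf) => // x _ /=; rewrite apowM.
Qed.

Lemma Rintegral_apow_scale c f : Lpow f ->
  \int[m]_x apow (c * f x) = apow c * \int[m]_x apow (f x).
Proof.
by move=> [mf jf]; rewrite -RintegralZl//; apply: eq_Rintegral => x _; rewrite apowM.
Qed.

Lemma Lpow_sub f g : Lpow f -> Lpow g -> Lpow (fun x => f x - g x).
Proof.
move=> Lf Lg; have := Lpow_add Lf (Lpow_scale (-1) Lg).
by under eq_fun do rewrite mulN1r.
Qed.

Lemma integrable_Phi (Phi : R -> R) f : measurable_fun setT Phi ->
  (forall x, `|Phi x| <= apow x) -> Lpow f ->
  m.-integrable setT (EFin \o (Phi \o f)).
Proof.
move=> mPhi Phi_le [mf jf]; apply: integrable_dominated jf.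
  exact: (measurableT_comp mPhi).
by move=> x /=; exact: Phi_le.
Qed.

(** Functions of power growth are continuous for L^a convergence; this applies
    to |x|^a and to sg x |x|^a. *)
Lemma cvg_Rintegral_homogeneous (Phi : R -> R) (g : nat -> T -> R) f :
  measurable_fun setT Phi -> (forall x, `|Phi x| <= apow x) ->
  (forall r y, 0 < r -> Phi (r * y) = r `^ a * Phi y) ->
  Lpow f -> (forall n, Lpow (g n)) ->
  \int[m]_x apow (g n x - f x) @[n --> \oo] --> (0 : R) ->
  \int[m]_x Phi (g n x) @[n --> \oo] --> \int[m]_x Phi (f x).
Proof.
move=> mPhi Phi_le PhiM Lf Lg gf; apply/cvgrPdist_lt => e e0.
set I := \int[m]_x apow (f x).
have I0 : 0 <= I by apply: Rintegral_ge0 => x _; exact: apow_ge0.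
have e1 : 0 < e / (2 * (I + 1)) by rewrite divr_gt0// mulr_gt0// ltr_wpDl.
have [C C0 HC] := homogeneous_modulus e1 Phi_le PhiM.
have e2 : 0 < e / (2 * (C + 1)) by rewrite divr_gt0// mulr_gt0// ltr_wpDl.
move/cvgrPdist_lt : gf => /(_ _ e2).
apply: filterS => n; rewrite sub0r normrN.
set D := \int[m]_x apow _ => Dn.
have Ld := Lpow_sub (Lg n) Lf.
have jP h := @integrable_Phi _ h mPhi Phi_le.
rewrite distrC -RintegralB//; [|exact: (jP _ (Lg n))|exact: jP].
apply: (@le_lt_trans _ _ (e / (2 * (I + 1)) * I + C * D)).
  rewrite (_ : _ * I = \int[m]_x (e / (2 * (I + 1)) * apow (f x))); last first.
    by rewrite RintegralZl//; exact: Lf.2.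
  rewrite (_ : C * D = \int[m]_x (C * apow (g n x - f x))); last first.
    by rewrite RintegralZl//; exact: Ld.2.
  have jA := integrable_scale (e / (2 * (I + 1))) Lf.2.
  have jD := integrable_scale C Ld.2.
  rewrite -RintegralD//.
  have jB := integrable_sub (jP _ (Lg n)) (jP _ Lf).
  apply: le_trans (le_normr_Rintegral _ _) _ => //.
  apply: Rintegral_ge0_le => //.
  - exact: integrable_abs.
  - exact: integrable_add.
rewrite [ltRHS](splitr e).
apply: ler_ltD.
  rewrite -mulrA mulrC -ler_pdivlMr ?divr_gt0//.
  rewrite ler_pdivrMl ?mulr_gt0 ?ltr_wpDl//.
  have -> : 2 * (I + 1) * (e / 2 / e) = I + 1 by field; lra.
  by rewrite lerDl.
apply: le_lt_trans (_ : (C + 1) * D < _).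
  apply: ler_wpM2r; last by rewrite lerDl.
  by apply: Rintegral_ge0 => x _; exact: apow_ge0.
rewrite mulrC -ltr_pdivlMr ?ltr_wpDl//; apply: le_lt_trans (ler_norm _) _.
by move: Dn; rewrite invfM mulrA.
Qed.

End integrals.
End powers.

(** * Continuous densities in the plane *)

Section densities.
Context {R : realType}.
Local Notation leb := (@lebesgue_measure R).

Definition grid (n : nat) (x : R) : R := (Num.floor (n.+1%:R * x))%:~R / n.+1%:R.

Lemma grid_dist n x : `|x - grid n x| <= n.+1%:R^-1.
Proof.
have n0 : (0 : R) < n.+1%:R by rewrite ltr0n.
rewrite /grid -[X in X - _](mulKf (lt0r_neq0 n0)) [_^-1 * _]mulrC -mulrBl normrM.
have -> : `|n.+1%:R^-1| = n.+1%:R^-1 :> R by rewrite ger0_norm// invr_ge0 ltW.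
rewrite ler_piMl ?invr_ge0 ?(ltW n0)//.
have /andP[h1 h2] := floor_itv (n.+1%:R * x).
rewrite ger0_norm ?subr_ge0// lerBlDl.
by move: h2; rewrite intrD => /ltW.
Qed.

Lemma grid_cvg x : grid n x @[n --> \oo] --> x.
Proof.
apply/cvgrPdist_le => e e0; near=> n.
apply: le_trans (grid_dist n x) _.
rewrite invf_ple ?posrE ?ltr0n//.
by near: n; apply: filterS (nbhs_infty_ger (e^-1)) => n /le_trans; apply; rewrite ler_nat.
Unshelve. all: by end_near. Qed.

(** A continuous function is the limit of its values at the nodes of finer and
    finer grids. *)
Lemma continuous_measurable_plane (f : R * R -> R) : continuous f -> measurable_fun setT f.
Proof.
move=> cf.
apply: (@measurable_fun_cvg _ _ _ _ (fun n z => f (grid n z.1, grid n z.2))); last first.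
  move=> z _; apply: continuous_cvg; first exact: cf.
  have -> : z = (z.1, z.2) by case: (z).
  exact (@cvg_pair _ _ _ \oo _ _ _ _ _ _ _ (@grid_cvg z.1) (@grid_cvg z.2)).
move=> n _ B mB; rewrite setTI.
pose c (p : int) : set R := [set x | Num.floor (n.+1%:R * x) = p].
have mc p : measurable (c p).
  have n0 : (0 : R) < n.+1%:R by rewrite ltr0n.
  rewrite (_ : c p = `[p%:~R / n.+1%:R, (p + 1)%:~R / n.+1%:R[%classic) //.
  apply/seteqP; split => x /=; rewrite in_itv/= ler_pdivrMr// ltr_pdivlMr// [x * _]mulrC.
    by move=> <-; exact: floor_itv.
  exact: floor_def.
pose D (p : int * int) : set (R * R) :=
  if f (p.1%:~R / n.+1%:R, p.2%:~R / n.+1%:R) \in B then c p.1 `*` c p.2 else set0.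
rewrite (_ : _ @^-1` B = \bigcup_p D p).
  apply: countable_bigcupT_measurable; first exact: countableP.
  move=> p; rewrite /D; case: ifP => // _.
  exact: measurableX.
apply/seteqP; split => z /=.
  move=> Bz; exists (Num.floor (n.+1%:R * z.1), Num.floor (n.+1%:R * z.2)) => //.
  by rewrite /D mem_set.
move=> [[p q] _]; rewrite /D; case: ifPn => [/set_mem/= Bf [zp zq]|//].
by move: zp zq; rewrite /c /grid /= => -> ->.
Qed.

Definition box (x : R * R) (e : R) : set (R * R) :=
  `]x.1 - e, x.1 + e[ `*` `]x.2 - e, x.2 + e[.

Lemma leb2_box_gt0 (x : R * R) (e : R) : 0 < e ->
  (0 < leb2 (box x e))%E.
Proof.
move=> e0; have -> : (leb2 (box x e) = 
    leb `](x.1 - e)%R, (x.1 + e)%R[%classic * leb `](x.2 - e)%R, (x.2 + e)%R[%classic)%E.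
  by apply: product_measure1E; exact: measurable_itv.
have H y : leb `]y - e, y + e[%classic = (e + e)%:E.
  rewrite lebesgue_measure_itv /= lte_fin ltrD2l gtrN// -EFinB; congr EFin; ring.
rewrite !H.
by rewrite -EFinM lte_fin mulr_gt0// addr_gt0.
Qed.

(** Around a point where the two continuous functions differ, they differ on a
    box, whose measure is positive. *)
Lemma continuous_ae_eq (f g : R * R -> R) : continuous f -> continuous g ->
  {ae (@leb2 R), forall x, f x = g x} -> f = g.
Proof.
move=> cf cg [A [mA A0 fgA]]; apply/funext => x; apply/eqP/negP => /negP fgx.
have c : {for x, continuous (fun z => f z - g z)} by apply: cvgB; [exact: cf|exact: cg].
have : \forall z \near x, f z - g z != 0.
  have d0 : 0 < `|f x - g x| by rewrite normr_gt0 subr_eq0.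
  move/cvgrPdist_lt : c => /(_ _ d0); apply: filterS => z.
  by apply: contraTneq => ->; rewrite subr0 ltxx.
move=> /nbhs_ballP[e /= e0 He].
have /(lt_le_trans (leb2_box_gt0 x e0)) : (leb2 (box x e) <=
   leb2 A)%E.
  apply: le_measure; [|exact: mem_set|].
    apply: mem_set; apply: measurableX; exact: measurable_itv.
  move=> z /= [z1 z2]; apply: fgA => /= fgz.
  have : f z - g z != 0.
    apply: He; split => /=; rewrite /ball/= ltr_distlC.
      by move: z1; rewrite /= in_itv.
    by move: z2; rewrite /= in_itv.
  by rewrite fgz subrr eqxx.
by rewrite A0 ltxx.
Qed.

Lemma continuous_density_integrable (mu : M2 R) f : continuous_density mu f ->
  (@leb2 R).-integrable setT (EFin \o f).
Proof.
move=> [cf muf]; have mf := continuous_measurable_plane cf.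
apply/integrableP; split; first exact/measurable_EFinP.
have : mu setT \is a fin_num by exact: fin_num_measure.
rewrite muf// => fin; apply/abse_integralP => //; first exact/measurable_EFinP.
by rewrite ltey_eq abse_fin_num fin.
Qed.

Lemma continuous_density_unique (mu : M2 R) f g :
  continuous_density mu f -> continuous_density mu g -> f = g.
Proof.
move=> Hf Hg; have jf := continuous_density_integrable Hf.
case: Hf Hg => cf muf [cg mug]; apply: continuous_ae_eq => //.
have : ae_eq leb2 setT (EFin \o f) (EFin \o g).
  apply: integral_ae_eq => //.
    by apply/measurable_EFinP; exact: continuous_measurable_plane.
  by move=> E _ mE; rewrite -muf// -mug.
by apply: filterS => x /(_ I)[].
Qed.

Lemma densityE (mu : M2 R) f : continuous_density mu f -> density mu = f.
Proof.
move=> muf; apply: (@continuous_density_unique mu) => //.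
exact: (xgetPex (fun=> 0) (ex_intro _ f muf)).
Qed.

Lemma density_comb (a b : R) (mu nu : M2 R) f g :
  continuous_density mu f -> continuous_density nu g ->
  continuous_density (cadd (cscale a mu) (cscale b nu)) (fun x => a * f x + b * g x).
Proof.
move=> Hf Hg; have jf := continuous_density_integrable Hf.
have jg := continuous_density_integrable Hg.
case: Hf Hg => cf muf [cg nug]; split.
  move=> x; apply: cvgD; apply: cvgM; [exact: cvg_cst|exact: cf|exact: cvg_cst|exact: cg].
move=> A mA; have jA h : (@leb2 R).-integrable setT (EFin \o h) -> (@leb2 R).-integrable A (EFin \o h).
  by move=> jh; apply: integrableS jh.
transitivity (a%:E * mu A + b%:E * nu A)%E => //.
rewrite muf// nug// -!integralZl//; [|exact: jA|exact: jA].
rewrite -integralD//; last 2 first.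
- by have := jA _ (integrable_scale a jf); apply: eq_integrable.
- by have := jA _ (integrable_scale b jg); apply: eq_integrable.
Qed.

(** The slower of the two exponential rates bounds both densities. *)
Lemma MP_comb (a b : R) (mu nu : M2 R) : MP mu -> MP nu ->
  MP (cadd (cscale a mu) (cscale b nu)) /\
  density (cadd (cscale a mu) (cscale b nu)) = (fun x => a * density mu x + b * density nu x).
Proof.
move=> [dmu [C1 [c1 [C10 c10 H1]]]] [dnu [C2 [c2 [C20 c20 H2]]]].
have D := density_comb a b dmu dnu; have E := densityE D.
split=> //; split; first by rewrite E.
exists (`|a| * C1 + `|b| * C2 + 1), (Num.min c1 c2); split.
- by rewrite ltr_wpDl// addr_ge0// mulr_ge0// ltW.
- by rewrite lt_min c10.
have H h C c x k : 0 < C -> 0 < c -> Num.min c1 c2 <= c ->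
    `|h| <= C * expR (- c * (`|x.1| + `|x.2|)) ->
    `|k * h| <= `|k| * C * expR (- Num.min c1 c2 * (`|(x : R * R).1| + `|x.2|)).
  move=> C0 c0 cc hC; rewrite normrM -mulrA ler_wpM2l//.
  apply: le_trans hC _; rewrite ler_pM2l// ler_expR !mulNr lerN2.
  by rewrite ler_wpM2r// addr_ge0.
move=> x; rewrite E; apply: le_trans (ler_normD _ _) _.
rewrite !mulrDl mul1r ler_wpDr ?expR_ge0//; apply: lerD.
  by apply: H (H1 x) => //; rewrite ge_min lexx.
by apply: H (H2 x) => //; rewrite ge_min lexx orbT.
Qed.

End densities.

(** * Stable integrals of simple functions *)

(** The complex exponential of the definition, by components. *)
Lemma stable_charfun_parts (R : realType) (alpha s b t : R) :
  stable_charfun alpha s b t =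
  (let A := s `^ alpha * `|t| `^ alpha in
   let B := A * (b * Num.sg t * tan (pi * alpha / 2)) in
   Complex (expR (- A) * cos B) (expR (- A) * sin B)).
Proof.
rewrite /stable_charfun /cexp /=; congr Complex; congr (expR _ * _);
  rewrite ?(mul0r, mulr0, mul1r, subr0, sub0r, add0r, addr0, oppr0) ?opprK //;
  congr (_ _); ring.
Qed.

Lemma fine_expectation d (Om : measurableType d) (R : realType) (P : probability Om R)
  (X : Om -> R) : fine 'E_P[X] = \int[P]_w X w.
Proof. by rewrite unlock. Qed.

Lemma measurable_norm_ge d (Om : measurableType d) (R : realType) (f : Om -> R) (c : R) :
  measurable_fun setT f -> measurable [set w | c <= `|f w|].
Proof.
move=> mf; rewrite (_ : [set w | _] = (fun w => `|f w|) @^-1` `[c, +oo[%classic); last first.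
  by apply/seteqP; split => w /=; rewrite in_itv/= andbT.
have mn : measurable_fun setT (fun w => `|f w|) by exact: measurableT_comp.
by rewrite -[_ @^-1` _]setTI; exact: mn.
Qed.

(** Bounded Lipschitz functions of X n and Y are close off the set where X n and
    Y are far apart. *)
Lemma cvg_in_probability_expectation d (Om : measurableType d) (R : realType)
    (P : probability Om R) (X : nat -> Om -> R) (Y : Om -> R) (h : R -> R) (K : R) :
  (forall n, measurable_fun setT (X n)) -> measurable_fun setT Y ->
  cvg_in_probability P X Y ->
  measurable_fun setT h -> (forall x, `|h x| <= 1) -> 0 < K ->
  (forall x y, `|h x - h y| <= K * `|x - y|) ->
  \int[P]_w h (X n w) @[n --> \oo] --> \int[P]_w h (Y w).
Proof.
move=> mX mY XY mh h1 K0 hK; apply/cvgrPdist_le => e e0.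
have e1 : 0 < e / 2 / K by rewrite !divr_gt0.
have e4 : 0 < e / 4 by rewrite divr_gt0.
have /fine_cvgP[_ /cvgrPdist_le /(_ _ e4)] := XY _ e1.
apply: filterS => n; rewrite sub0r normrN /= => Pn.
set A := [set w | _] in Pn.
have mA : measurable A.
  by apply: measurable_norm_ge; exact: measurable_funB.
pose ind w : R := e / 2 + 2 * \1_A w.
have ji : P.-integrable setT (EFin \o ind).
  apply: integrable_add; first exact: (@bounded_integrable _ _ _ P _ (`|e / 2|)).
  apply: integrable_scale; apply: (@bounded_integrable _ _ _ P _ (1)) => //.
  by move=> w; rewrite indicE; case: (_ \in _); rewrite ?normr1 ?normr0.
have jh Z : measurable_fun setT Z -> P.-integrable setT (EFin \o (fun w => h (Z w))).
  move=> mZ; apply: (@bounded_integrable _ _ _ P _ (1)) => //.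
  exact: (measurableT_comp mh).
have jB := integrable_sub (jh _ mY) (jh _ (mX n)).
rewrite -RintegralB//; [|exact: jh|exact: jh].
apply: le_trans (le_normr_Rintegral _ _) _ => //.
apply: (@le_trans _ _ (\int[P]_w ind w)).
  apply: Rintegral_ge0_le => //; first exact: integrable_abs.
  move=> w; rewrite /ind indicE; have [|] := boolP (w \in A).
    move=> _; rewrite mulr1 ler_wpDl ?divr_ge0 ?(ltW e0)//.
    by rewrite (le_trans (ler_normB _ _))// lerD.
  move=> /negP wA; rewrite mulr0 addr0; apply: le_trans (hK _ _) _.
  rewrite mulrC -ler_pdivlMr// distrC ltW// ltNge; apply/negP => wA'.
  by apply: wA; apply: mem_set.
rewrite RintegralD//; last 2 first.
- exact: (@bounded_integrable _ _ _ P _ (`|e / 2|)).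
- apply: integrable_scale; apply: (@bounded_integrable _ _ _ P _ (1)) => //.
  by move=> w; rewrite indicE; case: (_ \in _); rewrite ?normr1 ?normr0.
rewrite expectation_cst RintegralZl//; last first.
  apply: (@bounded_integrable _ _ _ P _ (1)) => //.
  by move=> w; rewrite indicE; case: (_ \in _); rewrite ?normr1 ?normr0.
rewrite (_ : \int[P]_w \1_A w = fine (P A)); last first.
  by rewrite /Rintegral integral_indic ?setIT.
by have := ler_norm (fine (P A)); lra.
Qed.

Section finite_additivity.
Context {R : realType} d (Om : measurableType d) (Q : probability Om R).
Variables (alpha : R) (L : set (R * R) -> Om -> R).
Hypothesis a12 : 1 < alpha < 2.
Hypothesis HL : stable_random_measure Q alpha L.
Local Notation leb2 := (@leb2 R).
Local Notation T := (tan (pi * alpha / 2)).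

Lemma srm_logcf A t : finite_area A ->
  has_logcf Q (fun w => t * L A w) (- (apow alpha t * fine (leb2 A)))
    (T * (spow alpha t * fine (leb2 A))).
Proof.
move=> fA; have := srm_stable HL fA t.
rewrite stable_charfun_parts /charfun !fine_expectation /= => -[c s].
have a0 : alpha != 0 by case/andP: a12 => h _; rewrite gt_eqF// (lt_trans ltr01).
have E : (fine (leb2 A) `^ alpha^-1) `^ alpha = fine (leb2 A).
  by rewrite -powRrM mulVf// powRr1// fine_ge0.
rewrite E in c s; split; [rewrite c|rewrite s]; rewrite /apow /spow;
  rewrite [fine _ * `|t| `^ _]mulrC; congr (_ * _); congr (_ _); ring.
Qed.

Lemma finite_area0 : finite_area (@set0 (R * R)%type).
Proof. by split => //; have -> : leb2 set0 = 0%E by exact: measure0. Qed.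

Lemma finite_areaU (A B : set (R * R)) : finite_area A -> finite_area B -> finite_area (A `|` B).
Proof.
move=> [mA fA] [mB fB]; split; first exact: measurableU.
by apply: le_lt_trans (measureU2 _ mA mB) _ => //; rewrite lte_add_pinfty.
Qed.

Lemma finite_areaS (A B : set (R * R)) : measurable A -> A `<=` B -> finite_area B -> finite_area A.
Proof.
move=> mA AB [mB fB]; split => //; apply: le_lt_trans fB.
by apply: le_measure => //; exact: mem_set.
Qed.

(** Sigma-additivity for the constant sequence set0 makes a series with constant
    terms converge. *)
Lemma srm_set0 : {ae Q, forall w, L set0 w = 0}.
Proof.
have t0 : trivIset setT (fun _ : nat => @set0 (R * R)%type).
  by apply/trivIsetP => i j _ _ _; rewrite set0I.
have := srm_sigma_additive HL (fun=> finite_area0) t0.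
rewrite bigcup0// => /(_ finite_area0) => H; apply: filterS H => w H.
have c0 : (fun=> L set0 w) @ \oo --> (0 : R).
  by apply: cvg_series_cvg_0; apply/cvg_ex; exists (L set0 w).
exact: (cvg_unique _ (cvg_cst (L set0 w)) c0).
Qed.

Lemma srm_add A B : finite_area A -> finite_area B -> A `&` B = set0 ->
  {ae Q, forall w, L (A `|` B) w = L A w + L B w}.
Proof.
move=> fA fB AB.
pose D i := nth set0 [:: A; B] i.
have DE : \bigcup_i D i = A `|` B.
  apply/seteqP; split => x.
    by move=> [[|[|i]] _]; rewrite /D/=; [left|right|rewrite nth_nil].
  by move=> [Ax|Bx]; [exists 0%N|exists 1%N].
have fD i : finite_area (D i).
  by case: i => [|[|i]]; [exact: fA|exact: fB|rewrite /D/= nth_nil; exact: finite_area0].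
have tD : trivIset setT D.
  apply/trivIsetP => -[|[|i]] [|[|j]]// _ _ _; rewrite /D/= ?nth_nil ?set0I ?setI0//.
  by rewrite setIC.
have := srm_sigma_additive HL fD tD; rewrite DE => /(_ (finite_areaU fA fB)) H.
 apply: filterS2 srm_set0 H => w w0 H.
suff H2 : series (fun i => L (D i) w) n @[n --> \oo] --> L A w + L B w.
  exact: (cvg_unique _ H H2).
apply: cvg_near_cst; near=> n.
have n2 : (2 <= n)%N by near: n; exact: nbhs_infty_ge.
rewrite /series/= -(subnKC n2) big_ltn// big_ltn// big_nat big1 ?addr0//.
by move=> [|[|i]]// _; rewrite /D/= nth_nil.
Unshelve. all: by end_near. Qed.

Lemma srm_bigU (J : choiceType) (s : seq J) (D : J -> set (R * R)) : uniq s ->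
  (forall j, finite_area (D j)) -> trivIset setT D ->
  finite_area (\big[setU/set0]_(j <- s) D j) /\
  {ae Q, forall w, L (\big[setU/set0]_(j <- s) D j) w = \sum_(j <- s) L (D j) w}.
Proof.
move=> us fD tD; elim: s us => [|i s IH] us.
  rewrite big_nil; split; first exact: finite_area0.
  by apply: filterS srm_set0 => w ->; rewrite big_nil.
move: us => /= /andP[nis us].
have [fs Hs] := IH us; rewrite big_cons; split; first exact: finite_areaU.
have dis : D i `&` \big[setU/set0]_(j <- s) D j = set0.
  rewrite -subset0 => x [Dx]; rewrite -bigcup_seq => -[j /= js Djx].
  have ij : i != j by apply: contraNneq nis => ->.
  have /trivIsetP /(_ i j I I ij) dij := tD.
  by have : (D i `&` D j) x by []; rewrite dij.
have H1 := srm_add (fD i) fs dis.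
by apply: filterS2 Hs H1 => w Hw ->; rewrite big_cons Hw.
Qed.

Lemma simple_stable_integralE (g : {sfun (R * R)%type >-> R}) w :
  simple_stable_integral L g w = \sum_(c <- nzvals g) c * L (g @^-1` [set c]) w.
Proof.
rewrite /simple_stable_integral fsbig_finite/=; last exact: fimfunP.
rewrite /nzvals big_filter [RHS]big_mkcond/=; apply: eq_bigr => c _.
by case: eqVneq => // ->; rewrite mul0r.
Qed.

Lemma nzvals_level_finite (g : {sfun (R * R)%type >-> R}) c :
  finite_area [set x | g x != 0] -> c \in nzvals g -> finite_area (g @^-1` [set c]).
Proof.
move=> fg; rewrite mem_nzvals ?fimfunP// => /andP[c0 _].
apply: finite_areaS fg; first exact: measurable_sfunP.
by move=> x /= ->.
Qed.

Lemma measurable_simple_stable_integral (g : {sfun (R * R)%type >-> R}) :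
  finite_area [set x | g x != 0] -> measurable_fun setT (simple_stable_integral L g).
Proof.
move=> fg; rewrite (_ : simple_stable_integral L g =
    fun w => \sum_(i < size (nzvals g)) tnth (in_tuple (nzvals g)) i *
       L (g @^-1` [set tnth (in_tuple (nzvals g)) i]) w); last first.
  by apply/funext => w; rewrite simple_stable_integralE big_tnth.
apply: measurable_bigsum => i; apply: measurable_funM => //.
apply: (srm_measurable HL); apply: nzvals_level_finite => //; exact: mem_tnth.
Qed.

(** The integral of a simple function may be computed on any finite partition
    that resolves it. *)
Lemma simple_stable_integral_partition (J : choiceType) (s : seq J) (D : J -> set (R * R))
    (c : J -> R) (g : {sfun (R * R)%type >-> R}) : uniq s ->
  (forall j, finite_area (D j)) -> trivIset setT D ->
  (forall x, g x = \sum_(j <- s) c j * \1_(D j) x) ->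
  {ae Q, forall w, simple_stable_integral L g w = \sum_(j <- s) c j * L (D j) w}.
Proof.
move=> us fD tD gE.
have gD j x : j \in s -> D j x -> g x = c j.
  move=> js Djx; rewrite gE (bigD1_seq j)//= indicE mem_set// mulr1 big1 ?addr0// => i ij.
  rewrite indicE memNset ?mulr0// => Dix.
  by have /trivIsetP /(_ i j I I ij)/seteqP[/(_ x) + _] := tD; apply; split.
have level e : e != 0 -> g @^-1` [set e] = \big[setU/set0]_(j <- [seq j <- s | c j == e]) D j.
  move=> e0; rewrite -bigcup_seq; apply/seteqP; split => x /=.
    move=> gxe; have : exists2 j, j \in s & D j x.
      apply: contrapT => H; move: e0; rewrite -gxe gE big1_seq ?eqxx// => j /andP[_ js].
      by rewrite indicE memNset ?mulr0// => Djx; apply: H; exists j.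
    move=> [j js Djx]; exists j => //=; rewrite mem_filter js andbT.
    by rewrite -(gD _ _ js Djx) gxe.
  by move=> [j /=]; rewrite mem_filter => /andP[/eqP <- js] /gD; exact.
have H1 : {ae Q, forall w, forall e, e \in nzvals g ->
    L (g @^-1` [set e]) w = \sum_(j <- [seq j <- s | c j == e]) L (D j) w}.
  apply: (@ae_all_seq _ _ _ _ _ _ (fun e w => L (g @^-1` [set e]) w =
     \sum_(j <- [seq j <- s | c j == e]) L (D j) w)) => e.
  rewrite mem_nzvals ?fimfunP// => /andP[e0 _]; rewrite level//.
  by have [_ H] := srm_bigU (filter_uniq (fun j => c j == e) us) fD tD; exact: H.
have H2 := srm_set0.
apply: filterS2 H1 H2 => w H1 H2.
rewrite simple_stable_integralE.
transitivity (\sum_(e <- nzvals g) \sum_(j <- s) (if c j == e then e * L (D j) w else 0)).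
  rewrite [LHS]big_seq [RHS]big_seq; apply: eq_bigr => e es.
  by rewrite H1// big_filter mulr_sumr big_mkcond.
rewrite exchange_big/= [LHS]big_seq [RHS]big_seq; apply: eq_bigr => j js.
have [cj|cj] := boolP (c j \in nzvals g).
  rewrite (bigD1_seq (c j)) ?nzvals_uniq//= eqxx big1 ?addr0// => e.
  by rewrite eq_sym => /negbTE ->.
rewrite big1_seq; last first.
  move=> e /andP[_ es]; case: eqP => // ce.
  by move: cj; rewrite ce es.
move: cj; rewrite mem_nzvals ?fimfunP// negb_and negbK => /orP[/eqP ->|cj]; first by rewrite mul0r.
suff -> : D j = set0 by rewrite H2 mulr0.
rewrite -subset0 => x Djx; move: cj; rewrite -(gD _ _ js Djx).
by move=> /negP; apply; apply: mem_set; exists x.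
Qed.

(** The common refinement of the level sets of g1 and g2 resolves every function
    of the two. The piece where both vanish may have infinite area; it is
    replaced by the empty set, which G0 makes harmless. *)
Lemma simple_stable_integral_joint (G : R * R -> R) (g1 g2 g : {sfun (R * R)%type >-> R}) :
  G (0, 0) = 0 ->
  finite_area [set x | g1 x != 0] -> finite_area [set x | g2 x != 0] ->
  (forall x, g x = G (g1 x, g2 x)) ->
  let D (p : R * R) := if p == (0, 0) then set0 else g1 @^-1` [set p.1] `&` g2 @^-1` [set p.2] in
  let s := [seq (u, v) | u <- fset_set (range g1), v <- fset_set (range g2)] in
  {ae Q, forall w, simple_stable_integral L g w = \sum_(p <- s) G p * L (D p) w}.
Proof.
move=> G0 f1 f2 gG D s.
apply: simple_stable_integral_partition.
- apply: allpairs_uniq; [exact: fset_uniq|exact: fset_uniq|].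
  by move=> [a b] [u v] _ _ /= [-> ->].
- move=> p; rewrite /D; case: eqP => [_|p0]; first exact: finite_area0.
  apply: finite_areaS (finite_areaU f1 f2).
    by apply: measurableI; exact: measurable_sfunP.
  move=> x /= [g1p g2p]; apply/orP; rewrite g1p g2p -negb_and.
  by apply/negP => /andP[/eqP p1 /eqP p2]; apply: p0; case: p p1 p2 {g1p g2p} => /= ? ? -> ->.
- apply/trivIsetP => p q _ _ pq; rewrite -subset0 => x [].
  rewrite /D; case: ifP => // _; case: ifP => // _ /= [p1 p2] [q1 q2].
  by move: pq; rewrite [p]surjective_pairing [q]surjective_pairing -p1 -p2 -q1 -q2 eqxx.
move=> x; set p := (g1 x, g2 x).
have [p0|p0] := eqVneq p (0, 0).
  rewrite gG -/p p0 G0 big1// => q _; rewrite indicE memNset ?mulr0// /D.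
  by case: eqP => [_ []|q0 /= [q1 q2]]; apply: q0; rewrite -p0 /p q1 q2 -surjective_pairing.
rewrite (bigD1_seq p)/=; last 2 first.
- by apply: allpairs_f; rewrite in_fset_set ?mem_set//; exact: fimfunP.
- apply: allpairs_uniq; [exact: fset_uniq|exact: fset_uniq|].
  by move=> [a b] [u v] _ _ /= [-> ->].
rewrite indicE mem_set; last by rewrite /D (negbTE p0).
rewrite mulr1 big1 ?addr0// => q qp; rewrite indicE memNset ?mulr0// /D.
by case: eqP => [_ []|q0 /= [q1 q2]]; move: qp; rewrite /p q1 q2 -surjective_pairing eqxx.
Qed.

Lemma simple_stable_integral_linear (a b : R) (g1 g2 g : {sfun (R * R)%type >-> R}) :
  finite_area [set x | g1 x != 0] -> finite_area [set x | g2 x != 0] ->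
  (forall x, g x = a * g1 x + b * g2 x) ->
  {ae Q, forall w, simple_stable_integral L g w =
     a * simple_stable_integral L g1 w + b * simple_stable_integral L g2 w}.
Proof.
move=> f1 f2 gE.
have E1 := simple_stable_integral_joint (G := fun p => p.1) (g := g1) erefl f1 f2 (fun=> erefl).
have E2 := simple_stable_integral_joint (G := fun p => p.2) (g := g2) erefl f1 f2 (fun=> erefl).
have E : a * 0 + b * 0 = 0 by rewrite !mulr0 addr0.
have E3 := simple_stable_integral_joint (G := fun p => a * p.1 + b * p.2) E f1 f2 gE.
apply: filterS3 E1 E2 E3 => w -> -> ->.
rewrite !mulr_sumr -big_split/=; apply: eq_bigr => p _; ring.
Qed.

Lemma simple_stable_logcf (g : {sfun (R * R)%type >-> R}) t :
  finite_area [set x | g x != 0] ->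
  has_logcf Q (fun w => t * simple_stable_integral L g w)
    (- (apow alpha t * \int[leb2]_x apow alpha (g x)))
    (T * (spow alpha t * \int[leb2]_x spow alpha (g x))).
Proof.
move=> fg; have a0 : 0 < alpha by case/andP: a12 => h _; exact: lt_trans ltr01 h.
have fl c := @nzvals_level_finite g c fg.
have mg : measurable_fun setT g by exact: measurable_funPT.
have rg : finite_set (range g) by exact: fimfunP.
have gfin c : c \in nzvals g -> (leb2 (g @^-1` [set c]) < +oo)%E by move=> /fl[].
have [_ ->] := @Rintegral_sfun_comp _ (measurableTypeR R * measurableTypeR R)%type R g mg rg leb2 (@apow R alpha) (apow0 a0) gfin.
have [_ ->] := @Rintegral_sfun_comp _ (measurableTypeR R * measurableTypeR R)%type R g mg rg leb2 (spow alpha) (spow0 alpha) gfin.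
pose s := nzvals g; pose c := tnth (in_tuple s).
pose A i := g @^-1` [set c i].
have cs i : c i \in s by exact: mem_tnth.
have fA i : finite_area (A i) by exact: (fl _ (cs i)).
have tA : trivIset setT A.
  apply/trivIsetP => i j _ _ ij; apply/seteqP; split => // x [/= gi gj].
  move: ij; have /tuple_uniqP inj : uniq (in_tuple s) by exact: nzvals_uniq.
  have -> : i = j by apply: inj; rewrite -/(c i) -/(c j) -gi -gj.
  by rewrite eqxx.
have H := @has_logcf_sum _ _ _ Q _ _ _ (fun i w => L (A i) w) (fun i x => t * c i * x)
  (fun i => - (apow alpha (t * c i) * fine (leb2 (A i))))
  (fun i => T * (spow alpha (t * c i) * fine (leb2 (A i))))
  (fun i => srm_measurable HL (fA i)) (srm_independent HL fA tA) _ _.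
have -> : (fun w => t * simple_stable_integral L g w) =
          (fun w => \sum_i t * c i * L (A i) w).
  apply/funext => w; rewrite simple_stable_integralE (big_tnth _ _ s) mulr_sumr.
  by apply: eq_bigr => i _; rewrite mulrA.
rewrite !(big_tnth _ _ s) !mulr_sumr -sumrN.
rewrite (eq_bigr (fun i => - (apow alpha (t * c i) * fine (leb2 (A i))))); last first.
  by move=> i _; rewrite apowM mulrA.
rewrite [X in has_logcf _ _ _ X](eq_bigr (fun i => T * (spow alpha (t * c i) * fine (leb2 (A i)))));
  last by move=> i _; rewrite spowM -(mulrA (spow alpha t)).
apply: H => i; first exact: measurable_funM.
exact: srm_logcf.
Qed.

End finite_additivity.

(** * Stable integrals of functions *)

Lemma ae_eq_measure d (T : measurableType d) (R : realType)
    (m : {measure set T -> \bar R}) (A B : set T) : measurable A -> measurable B ->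
  {ae m, forall x, A x <-> B x} -> m A = m B.
Proof.
move=> mA mB AB.
have H C : measurable C -> m C = (\int[m]_x (\1_C x : R)%:E)%E.
  by move=> mC; rewrite integral_indic// setIT.
rewrite (H _ mA) (H _ mB); apply: ae_eq_integral => //.
- by apply/measurable_EFinP; exact: measurable_indic.
- by apply/measurable_EFinP; exact: measurable_indic.
apply: filterS AB => x AB _; congr EFin; rewrite !indicE; congr (_ %:R).
congr (nat_of_bool _); apply/idP/idP => /set_mem /AB; exact: mem_set.
Qed.

Lemma sfun_comb d (T : measurableType d) (R : realType) (a b : R)
    (g1 g2 : {sfun T >-> R}) :
  exists g : {sfun T >-> R}, forall x, g x = a * g1 x + b * g2 x.
Proof.
exists (scale_sfun a g1 + scale_sfun b g2) => x; rewrite sfunD /=.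
by rewrite (mulrC (g1 x)) (mulrC (g2 x)).
Qed.

Lemma finite_area_comb (R : realType) (a b : R) (g1 g2 g : {sfun (R * R)%type >-> R}) :
  finite_area [set x | g1 x != 0] -> finite_area [set x | g2 x != 0] ->
  (forall x, g x = a * g1 x + b * g2 x) -> finite_area [set x | g x != 0].
Proof.
move=> f1 f2 gE; apply: finite_areaS (finite_areaU f1 f2).
  have mg : measurable_fun setT g by exact: measurable_funPT.
  rewrite (_ : [set x | _] = ~` (g @^-1` [set 0])).
    by apply: measurableC; rewrite -[_ @^-1` _]setTI; exact: mg.
  by apply/seteqP; split => x /= /eqP.
move=> x /=; rewrite gE; apply: contraPP => /not_orP[/negP/negPn/eqP -> /negP/negPn/eqP ->].
by rewrite !mulr0 addr0 eqxx.
Qed.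

Section convergence_in_probability.
Context d (Om : measurableType d) (R : realType) (P : probability Om R).

Lemma cvg_prob_squeeze (u v : nat -> \bar R) : (forall n, (0 <= u n <= v n)%E) ->
  v n @[n --> \oo] --> 0%E -> u n @[n --> \oo] --> 0%E.
Proof.
move=> uv v0; apply: (squeeze_cvge _ (cvg_cst _) v0); exact: nearW.
Qed.

Lemma cvg_in_probability_comb (a b : R) (X Y : nat -> Om -> R) (X' Y' : Om -> R) :
  (forall n, measurable_fun setT (X n)) -> (forall n, measurable_fun setT (Y n)) ->
  measurable_fun setT X' -> measurable_fun setT Y' ->
  cvg_in_probability P X X' -> cvg_in_probability P Y Y' ->
  cvg_in_probability P (fun n w => a * X n w + b * Y n w) (fun w => a * X' w + b * Y' w).
Proof.
move=> mX mY mX' mY' HX HY e e0.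
have k0 (c : R) : 0 < e / (2 * (`|c| + 1)) by rewrite divr_gt0// mulr_gt0// ltr_wpDl.
have H : (P [set w | (e / (2 * (`|a| + 1)) <= `|X n w - X' w|)%R] +
    P [set w | (e / (2 * (`|b| + 1)) <= `|Y n w - Y' w|)%R])%E @[n --> \oo] --> 0%E.
  rewrite -[X in _ --> X]adde0; apply: cvgeD => //; [exact: HX|exact: HY].
apply: cvg_prob_squeeze H => n; rewrite measure_ge0/=.
have mA (c : R) (Z Z' : Om -> R) : measurable_fun setT Z -> measurable_fun setT Z' ->
    measurable [set w | c <= `|Z w - Z' w|].
  by move=> mZ mZ'; apply: measurable_norm_ge; exact: measurable_funB.
apply: le_trans (measureU2 _ _ _); [|exact: mA|exact: mA].
apply: le_measure.
- by apply: mem_set; apply: mA; apply: measurable_funD; exact: measurable_funM.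
- by apply: mem_set; apply: measurableU; exact: mA.
move=> w /=; apply: contraPP => /not_orP[/negP]; rewrite -ltNge => h1 /negP.
rewrite -ltNge => h2; apply/negP; rewrite -ltNge.
have bd c (x : R) : `|x| < e / (2 * (`|c| + 1)) -> `|c * x| < e / 2.
  move=> h; apply: (@le_lt_trans _ _ ((`|c| + 1) * `|x|)).
    by rewrite normrM ler_wpM2r// lerDl.
  by rewrite mulrC -ltr_pdivlMr ?ltr_wpDl// -mulrA -invfM.
rewrite (_ : _ - _ = a * (X n w - X' w) + b * (Y n w - Y' w)); last by ring.
rewrite (splitr e); apply: le_lt_trans (ler_normD _ _) _; apply: ltrD; exact: bd.
Qed.

Lemma cvg_in_probability_unique (X : nat -> Om -> R) (Y Z : Om -> R) :
  (forall n, measurable_fun setT (X n)) -> measurable_fun setT Y -> measurable_fun setT Z ->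
  cvg_in_probability P X Y -> cvg_in_probability P X Z ->
  {ae P, forall w, Y w = Z w}.
Proof.
move=> mX mY mZ XY XZ.
have H := cvg_in_probability_comb 1 (-1) mX mX mY mZ XY XZ.
have mA (e : R) : measurable [set w | e <= `|Y w - Z w|].
  by apply: measurable_norm_ge; exact: measurable_funB.
have A0 (e : R) : 0 < e -> P [set w | e <= `|Y w - Z w|] = 0%E.
  move=> e0; have := H _ e0.
  under eq_fun => n.
    rewrite (_ : [set w | _] = [set w | e <= `|Y w - Z w|]); first over.
    apply: eq_set => w; rewrite [X in `|X|](_ : _ = - (Y w - Z w)) ?normrN//; ring.
  by move=> h; exact: (cvg_unique _ (cvg_cst _) h).
apply: (@negligibleS _ _ _ P (\bigcup_n [set w | n.+1%:R^-1 <= `|Y w - Z w|])); last first.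
  apply: negligible_bigcup => n; apply/negligibleP => //.
  by apply: A0; rewrite invr_gt0 ltr0n.
move=> w /= YZ.
have d0 : 0 < `|Y w - Z w| by rewrite normr_gt0 subr_eq0; apply/eqP.
have [n _ /(_ n (leqnn n))] := near_infty_natSinv_lt (PosNum d0).
by move=> /= /ltW h; exists n.
Qed.

End convergence_in_probability.

Lemma subr1_logcf_le (R : realType) (A B : R) : A <= 0 ->
  1 - expR A * cos B <= `|A| + `|B|.
Proof.
move=> A0; have e1 : expR A <= 1 by rewrite -[leRHS]expR0 ler_expR.
rewrite (_ : _ - _ = (1 - expR A) + expR A * (1 - cos B)); last by ring.
apply: lerD.
  rewrite (ler0_norm A0); apply: le_trans (ler_norm _) (norm_subr1_expR_le A0).
apply: (@le_trans _ _ (1 - cos B)); last exact: subr1_cos_le_norm.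
by rewrite ler_piMl// subr1_cos_ge0.
Qed.

Section stable_integrals.
Context {R : realType} d (Om : measurableType d) (Q : probability Om R).
Variables (alpha : R) (L : set (R * R) -> Om -> R).
Hypothesis a12 : 1 < alpha < 2.
Hypothesis HL : stable_random_measure Q alpha L.
Local Notation leb2 := (@leb2 R).
Local Notation T := (tan (pi * alpha / 2)).

Let a0 : 0 < alpha. Proof. by case/andP: a12 => h _; exact: lt_trans ltr01 h. Qed.

Lemma Lpow_sfun (g : {sfun (R * R)%type >-> R}) : finite_area [set x | g x != 0] ->
  Lpow alpha leb2 g.
Proof.
move=> fg; have mg : measurable_fun setT g by exact: measurable_funPT.
split => //; have rg : finite_set (range g) by exact: fimfunP.
have gfin c : c \in nzvals g -> (leb2 (g @^-1` [set c]) < +oo)%E.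
  by move=> /(nzvals_level_finite fg)[].
by have [] := @Rintegral_sfun_comp _ (measurableTypeR R * measurableTypeR R)%type R g mg rg leb2
  (@apow R alpha) (apow0 a0) gfin.
Qed.

(** The exponent of t I(g) is at most (1 + |T|) |t|^alpha times the integral
    of |g|^alpha, so functions of small norm have integrals of small
    probability to be large. *)
Lemma simple_stable_integral_tail (g : {sfun (R * R)%type >-> R}) (dl : R) :
  finite_area [set x | g x != 0] -> 0 < dl ->
  (Q [set w | (2 / dl <= `|simple_stable_integral L g w|)%R] <=
   (2 * ((1 + `|T|) * (apow alpha dl * \int[leb2]_x apow alpha (g x))))%:E)%E.
Proof.
move=> fg dl0; apply: tail_from_charfun => //.
  exact: (measurable_simple_stable_integral HL).
move=> t /andP[t0 tdl]; have [-> _] := simple_stable_logcf a12 HL t fg.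
have I0 : 0 <= \int[leb2]_x apow alpha (g x).
  by apply: Rintegral_ge0 => x _; exact: apow_ge0.
apply: le_trans (subr1_logcf_le _ _) _.
  by rewrite oppr_le0 mulr_ge0// apow_ge0.
have ad : apow alpha t <= apow alpha dl.
  by apply: apow_le => //; rewrite !ger0_norm// ltW.
rewrite [leRHS]mulrDl [X in _ <= X + _]mul1r normrN; apply: lerD.
  by rewrite ger0_norm ?mulr_ge0 ?apow_ge0// ler_wpM2r.
rewrite normrM ler_wpM2l// normrM; apply: ler_pM => //.
  exact: le_trans (norm_spow_le _ _) ad.
have Lg := Lpow_sfun fg.
have jT : leb2.-integrable setT (EFin \o (spow alpha \o g)).
  apply: (@integrable_Phi R alpha _ _ leb2) Lg; [exact: measurable_spow|exact: norm_spow_le].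
apply: le_trans (le_normr_Rintegral _ _) _ => //.
apply: Rintegral_ge0_le => //; [exact: integrable_abs|exact: Lg.2|].
by move=> x; exact: norm_spow_le.
Qed.

Lemma Lnorm_pow (h : R * R -> R) :
  (('N[leb2]_(alpha%:E)[EFin \o h]) `^ alpha = \int[leb2]_x (apow alpha (h x))%:E)%E.
Proof. by rewrite poweR_Lnorm// gt_eqF. Qed.

Lemma Lnorm_fin_Lpow (h : R * R -> R) : measurable_fun setT h ->
  ('N[leb2]_(alpha%:E)[EFin \o h] < +oo)%E -> Lpow alpha leb2 h.
Proof.
move=> mh hfin; split => //; apply/integrableP; split.
  by apply/measurable_EFinP; exact: (measurableT_comp (measurable_apow _)).
have -> : (\int[leb2]_x `|(EFin \o (apow alpha \o h)) x| = \int[leb2]_x (apow alpha (h x))%:E)%E.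
  by apply: eq_integral => x _ /=; rewrite ger0_norm// apow_ge0.
by rewrite -Lnorm_pow poweR_lty.
Qed.

Lemma Lpnorm_pow (h : R * R -> R) : Lpow alpha leb2 h ->
  Lpnorm alpha h `^ alpha = \int[leb2]_x apow alpha (h x).
Proof.
move=> [mh jh]; rewrite /Lpnorm /Rintegral -Lnorm_pow.
have : (('N[leb2]_(alpha%:E)[EFin \o h]) `^ alpha)%E \is a fin_num.
  by rewrite Lnorm_pow; exact: integrable_fin_num jh.
have := Lnorm_ge0 leb2 alpha%:E (EFin \o h).
case: ('N[leb2]_(alpha%:E)[EFin \o h])%E => [r|//|//] _.
  by rewrite poweR_EFin.
by rewrite poweRyr ?gt_eqF.
Qed.

(** The limit f is integrable because it differs from a simple function by a
    function of finite norm. *)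
Lemma Lpow_approx (g : nat -> {sfun (R * R)%type >-> R}) (f : R * R -> R) :
  measurable_fun setT f -> (forall n, finite_area [set x | g n x != 0]) ->
  ('N[leb2]_(alpha%:E)[EFin \o (fun x => g n x - f x)%R])%E @[n --> \oo] --> 0%E ->
  Lpow alpha leb2 f /\ \int[leb2]_x apow alpha (g n x - f x) @[n --> \oo] --> (0 : R).
Proof.
move=> mf fg Nf.
have mg n : measurable_fun setT (fun x => g n x - f x).
  by apply: measurable_funB => //; exact: measurable_funPT.
have /fine_cvgP[fin fc] := Nf.
have Lf : Lpow alpha leb2 f.
  have [n _ /(_ n (leqnn n)) /= nfin] := fin.
  have Ld : Lpow alpha leb2 (fun x => g n x - f x).
    by apply: Lnorm_fin_Lpow => //; rewrite ltey_eq nfin.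
  have := Lpow_sub a0 (Lpow_sfun (fg n)) Ld.
  by under eq_fun do rewrite opprB addrC subrK.
split => //; apply/cvgrPdist_lt => e e0.
have k0 : 0 < e `^ alpha^-1 by rewrite powR_gt0.
move/cvgrPdist_lt : fc => /(_ _ k0); apply: filterS => n.
rewrite !sub0r !normrN /= => H.
have Ld := Lpow_sub a0 (Lpow_sfun (fg n)) Lf.
rewrite -Lpnorm_pow// /Lpnorm.
have N0 : 0 <= fine 'N[leb2]_(alpha%:E)[EFin \o (fun x => g n x - f x)].
  by apply: fine_ge0; exact: Lnorm_ge0.
rewrite ger0_norm ?powR_ge0//.
have -> : e = (e `^ alpha^-1) `^ alpha by rewrite -powRrM mulVf ?gt_eqF// powRr1// ltW.
by apply: gt0_ltr_powR; rewrite ?nnegrE ?powR_ge0//; move: H; rewrite ger0_norm.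
Qed.

Lemma simple_stable_integral_cvg0 (h : nat -> {sfun (R * R)%type >-> R}) :
  (forall n, finite_area [set x | h n x != 0]) ->
  \int[leb2]_x apow alpha (h n x) @[n --> \oo] --> (0 : R) ->
  cvg_in_probability Q (fun n => simple_stable_integral L (h n)) (fun=> 0).
Proof.
move=> fh h0 e e0; pose dl := 2 / e; have dl0 : 0 < dl by rewrite divr_gt0.
pose K := 2 * ((1 + `|T|) * apow alpha dl).
apply: (@cvg_prob_squeeze R _ (fun n => (K * \int[leb2]_x apow alpha (h n x))%:E)).
  move=> n; rewrite measure_ge0/=; have := simple_stable_integral_tail (fh n) dl0.
  rewrite /dl invf_div mulrCA mulfV// mulr1 !mulrA.
  rewrite /K /dl !mulrA => H; apply: le_trans H.
  rewrite (_ : [set w | _] = [set w | e <= `|simple_stable_integral L (h n) w|])//.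
  by apply: eq_set => w; rewrite subr0.
apply: cvg_EFin; first exact: nearW.
by rewrite -[X in _ --> X](mulr0 K); apply: cvgMr.
Qed.

(** Convergence in probability of the integrals and L^alpha convergence of the
    integrands carry the formula from simple functions to the limit. *)
Lemma stable_integral_logcf (f : R * R -> R) (Y : Om -> R) (t : R) :
  measurable_fun setT f -> is_stable_integral Q alpha L f Y ->
  Lpow alpha leb2 f /\
  has_logcf Q (fun w => t * Y w) (- (apow alpha t * \int[leb2]_x apow alpha (f x)))
    (T * (spow alpha t * \int[leb2]_x spow alpha (f x))).
Proof.
move=> mf [mY [g [fg Nf gY]]]; have [Lf gf] := Lpow_approx mf fg Nf.
split => //; have Lg n := Lpow_sfun (fg n).
have mI n := measurable_simple_stable_integral HL (fg n).
have trig (h : R -> R) : measurable_fun setT h -> (forall x, `|h x| <= 1) ->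
    (forall x y, `|h x - h y| <= `|x - y|) ->
    \int[Q]_w h (t * simple_stable_integral L (g n) w) @[n --> \oo] --> \int[Q]_w h (t * Y w).
  move=> mh h1 hl.
  apply: (@cvg_in_probability_expectation _ _ _ _ _ _ (fun x => h (t * x)) (`|t| + 1)) => //.
  - by apply: (measurableT_comp mh); exact: measurable_funM.
  - move=> x y; apply: le_trans (hl _ _) _; rewrite -mulrBr normrM.
    by rewrite ler_wpM2r// lerDl.
apply: has_logcf_cvg (fun n => simple_stable_logcf a12 HL t (fg n)) _ _ _ _.
- by apply: trig; [exact: measurable_cos|exact: norm_cos_le1|exact: cos_lipschitz].
- by apply: trig; [exact: measurable_sin|exact: norm_sin_le1|exact: sin_lipschitz].
- apply: cvgN; apply: cvgMr.
  apply: (cvg_Rintegral_homogeneous a0) gf => //; first exact: measurable_apow.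
  + by move=> x; rewrite ger0_norm// apow_ge0.
  + by move=> r y; exact: apow_hom.
- apply: cvgMr; apply: cvgMr.
  apply: (cvg_Rintegral_homogeneous a0) gf => //; first exact: measurable_spow.
  + exact: norm_spow_le.
  + by move=> r y; exact: spow_hom.
Qed.

(** The simple functions g n approximating a f1 + b f2 and the combination of
    those approximating f1 and f2 differ by h n, which tends to 0 in L^alpha;
    so both limits in probability agree. *)
Lemma stable_integral_linear (a b : R) (f1 f2 : R * R -> R) (Y1 Y2 Y : Om -> R) :
  measurable_fun setT f1 -> measurable_fun setT f2 ->
  is_stable_integral Q alpha L f1 Y1 -> is_stable_integral Q alpha L f2 Y2 ->
  is_stable_integral Q alpha L (fun x => a * f1 x + b * f2 x) Y ->
  {ae Q, forall w, Y w = a * Y1 w + b * Y2 w}.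
Proof.
move=> mf1 mf2 [mY1 [g1 [fg1 N1 gY1]]] [mY2 [g2 [fg2 N2 gY2]]] [mY [g [fg N gY]]].
have mf : measurable_fun setT (fun x => a * f1 x + b * f2 x).
  by apply: measurable_funD; exact: measurable_funM.
have [Lf1 c1] := Lpow_approx mf1 fg1 N1; have [Lf2 c2] := Lpow_approx mf2 fg2 N2.
have [Lf c] := Lpow_approx mf fg N.
have [u uE] := choice (fun n => sfun_comb a b (g1 n) (g2 n)).
have [h hE] := choice (fun n => sfun_comb 1 (-1) (g n) (u n)).
have fu n := finite_area_comb (fg1 n) (fg2 n) (uE n).
have fh n := finite_area_comb (fg n) (fu n) (hE n).
have h0 : \int[leb2]_x apow alpha (h n x) @[n --> \oo] --> (0 : R).
  pose A n := \int[leb2]_x apow alpha (g n x - (a * f1 x + b * f2 x)).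
  pose A1 n := \int[leb2]_x apow alpha (g1 n x - f1 x).
  pose A2 n := \int[leb2]_x apow alpha (g2 n x - f2 x).
  pose k := 2 `^ alpha : R.
  pose v n := k * (A n + k * (apow alpha (- a) * A1 n + apow alpha (- b) * A2 n)).
  apply: (dominated_cvg0 (v := v)); last first.
    have -> : 0 = k * (0 + k * (apow alpha (- a) * 0 + apow alpha (- b) * 0)) :> R.
      by rewrite !(mulr0, addr0).
    apply: cvgMr; apply: cvgD; first exact: c.
    by apply: cvgMr; apply: cvgD; apply: cvgMr; [exact: c1|exact: c2].
  move=> n; rewrite ger0_norm; last by apply: Rintegral_ge0 => x _; exact: apow_ge0.
  have L0 := Lpow_sub a0 (Lpow_sfun (fg n)) Lf.
  have L1 := Lpow_sub a0 (Lpow_sfun (fg1 n)) Lf1.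
  have L2 := Lpow_sub a0 (Lpow_sfun (fg2 n)) Lf2.
  have -> : \int[leb2]_x apow alpha (h n x) =
      \int[leb2]_x apow alpha ((g n x - (a * f1 x + b * f2 x)) +
        ((- a) * (g1 n x - f1 x) + (- b) * (g2 n x - f2 x))).
    by apply: eq_Rintegral => x _; congr apow; rewrite hE uE; ring.
  have L3 := Lpow_add a0 (Lpow_scale (- a) L1) (Lpow_scale (- b) L2).
  apply: le_trans (Rintegral_apow_add a0 L0 L3) _.
  rewrite ler_wpM2l ?powR_ge0// lerD2l.
  apply: le_trans (Rintegral_apow_add a0 (Lpow_scale (- a) L1) (Lpow_scale (- b) L2)) _.
  by rewrite !Rintegral_apow_scale.
have mI k fk := @measurable_simple_stable_integral _ _ _ Q _ _ HL k fk.
have C1 := cvg_in_probability_comb a b (fun n => mI _ (fg1 n)) (fun n => mI _ (fg2 n)) mY1 mY2 gY1 gY2.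
have mC n : measurable_fun setT (fun w => a * simple_stable_integral L (g1 n) w +
    b * simple_stable_integral L (g2 n) w).
  by apply: measurable_funD; apply: measurable_funM => //; exact: mI.
have mYY : measurable_fun setT (fun w => a * Y1 w + b * Y2 w).
  by apply: measurable_funD; exact: measurable_funM.
have C2 := cvg_in_probability_comb 1 (-1) (fun n => mI _ (fg n)) mC mY mYY gY C1.
have E : {ae Q, forall w, 1 * Y w + (-1) * (a * Y1 w + b * Y2 w) = 0}.
  have C0 := simple_stable_integral_cvg0 fh h0.
  have aeh n : {ae Q, forall w, simple_stable_integral L (h n) w =
      1 * simple_stable_integral L (g n) w + (-1) * (a * simple_stable_integral L (g1 n) w +
      b * simple_stable_integral L (g2 n) w)}.
    apply: filterS2 (simple_stable_integral_linear HL (fg n) (fu n) (hE n))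
      (simple_stable_integral_linear HL (fg1 n) (fg2 n) (uE n)) => w -> ->//.
  have mZ : measurable_fun setT (fun w => 1 * Y w + (-1) * (a * Y1 w + b * Y2 w)).
    by apply: measurable_funD; exact: measurable_funM.
  apply: (@cvg_in_probability_unique _ _ _ _ (fun n => simple_stable_integral L (h n))) => //.
    by move=> n; exact: mI.
  move=> e e0; have := C2 e e0; apply: cvg_trans; apply: near_eq_cvg; apply: nearW => n.
  have mB (Z Z' : Om -> R) : measurable_fun setT Z -> measurable_fun setT Z' ->
      measurable [set w | e <= `|Z w - Z' w|].
    by move=> ? ?; apply: measurable_norm_ge; exact: measurable_funB.
  apply: ae_eq_measure => //.
  - by apply: mB => //; apply: measurable_funD; apply: measurable_funM => //; exact: mI.
  - by apply: mB => //; exact: mI.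
  - by apply: filterS (aeh n) => w /= ->.
apply: filterS E => w; rewrite mul1r mulN1r => /eqP; rewrite subr_eq0 => /eqP//.
Qed.

End stable_integrals.

(** * The stable field *)

Section stable_field.
Context {R : realType} d (Om : measurableType d) (Q : probability Om R).
Variables (alpha : R) (L : set (R * R) -> Om -> R) (S : M2 R -> Om -> R).
Hypothesis a12 : 1 < alpha < 2.
Hypothesis HL : stable_random_measure Q alpha L.
Hypothesis HS : forall mu, MP mu -> is_stable_integral Q alpha L (density mu) (S mu).
Local Notation leb2 := (@leb2 R).
Local Notation T := (tan (pi * alpha / 2)).

Let a0 : 0 < alpha. Proof. by case/andP: a12 => h _; exact: lt_trans ltr01 h. Qed.

Lemma measurable_density (mu : M2 R) : MP mu -> measurable_fun setT (density mu).
Proof. by move=> [[cmu _] _]; exact: continuous_measurable_plane. Qed.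

Lemma stable_linear_field : linear_field Q S.
Proof.
move=> a b mu nu Mmu Mnu; have [Mc dc] := MP_comb a b Mmu Mnu.
have H := HS Mc; rewrite dc in H.
exact: (stable_integral_linear a12 HL (measurable_density Mmu) (measurable_density Mnu)
  (HS Mmu) (HS Mnu) H).
Qed.

Lemma Lpow_density (mu : M2 R) : MP mu -> Lpow alpha leb2 (density mu).
Proof. by move=> M; have [] := stable_integral_logcf a12 HL 1 (measurable_density M) (HS M). Qed.

Lemma stable_field_logcf (mu : M2 R) : MP mu ->
  has_logcf Q (S mu) (- \int[leb2]_x apow alpha (density mu x))
    (T * \int[leb2]_x spow alpha (density mu x)).
Proof.
move=> M; have [_] := stable_integral_logcf a12 HL 1 (measurable_density M) (HS M).
rewrite /apow /spow normr1 powR1 sgr1 !mul1r.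
by rewrite (_ : (fun w => 1 * S mu w) = S mu)//; apply/funext => w; rewrite mul1r.
Qed.

Lemma Rintegral_parts (f : R * R -> R) : Lpow alpha leb2 f ->
  [/\ Lpow alpha leb2 (fun x => Num.max (f x) 0),
      Lpow alpha leb2 (fun x => - Num.min (f x) 0),
      \int[leb2]_x apow alpha (f x) = \int[leb2]_x apow alpha (Num.max (f x) 0) +
        \int[leb2]_x apow alpha (- Num.min (f x) 0) &
      \int[leb2]_x spow alpha (f x) = \int[leb2]_x apow alpha (Num.max (f x) 0) -
        \int[leb2]_x apow alpha (- Num.min (f x) 0)].
Proof.
move=> [mf jf].
have dom (k : R -> R) : measurable_fun setT k -> (forall x, `|k x| <= `|x|) ->
    Lpow alpha leb2 (fun x => k (f x)).
  move=> mk kx; have mkf : measurable_fun setT (fun x => k (f x)) by exact: (measurableT_comp mk).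
  split => //; apply: integrable_dominated jf.
    exact: (measurableT_comp (measurable_apow alpha)).
  by move=> x /=; rewrite ger0_norm ?apow_ge0//; apply: apow_le => //; exact: kx.
have L1 : Lpow alpha leb2 (fun x => Num.max (f x) 0).
  apply: (dom (fun y => Num.max y 0)); first exact: measurable_maxr.
  by move=> x; rewrite /Num.max; case: ifP => // _; rewrite normr0.
have L2 : Lpow alpha leb2 (fun x => - Num.min (f x) 0).
  apply: (dom (fun y => - Num.min y 0)).
    by apply: measurableT_comp => //; exact: measurable_minr.
  by move=> x; rewrite normrN /Num.min; case: ifP => // _; rewrite normr0.
have p1 (y : R) : apow alpha (Num.max y 0) = Num.max y 0 `^ alpha.
  by rewrite /apow ger0_norm// le_max lexx orbT.
have p2 (y : R) : apow alpha (- Num.min y 0) = (- Num.min y 0) `^ alpha.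
  by rewrite /apow ger0_norm// oppr_ge0 ge_min lexx orbT.
split => //.
  rewrite -RintegralD//; [|exact: L1.2|exact: L2.2].
  by apply: eq_Rintegral => x _; rewrite p1 p2 apow_parts.
rewrite -RintegralB//; [|exact: L1.2|exact: L2.2].
by apply: eq_Rintegral => x _; rewrite p1 p2 spow_parts.
Qed.

(** If the norm of the density is 0, the skewness is a quotient by 0; then both
    parts of the exponent vanish. *)
Lemma stable_field_charfun (mu : M2 R) : MP mu ->
  charfun Q (S mu) 1 = stable_charfun alpha (sigma alpha mu) (beta alpha mu) 1.
Proof.
move=> M; have [H1 H2] := stable_field_logcf M; have Lf := Lpow_density M.
have [L1 L2 EI ES] := Rintegral_parts Lf.
rewrite stable_charfun_parts /charfun !fine_expectation /= normr1 powR1 mulr1 sgr1 mulr1.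
have -> : (fun w => cos (1 * S mu w)) = (fun w => cos (S mu w)).
  by apply/funext => w; rewrite mul1r.
have -> : (fun w => sin (1 * S mu w)) = (fun w => sin (S mu w)).
  by apply/funext => w; rewrite mul1r.
rewrite H1 H2 /sigma /beta powRN !Lpnorm_pow// -ES.
set I := \int[leb2]_x apow _ _; set J := \int[leb2]_x spow _ _.
have -> : I * (I^-1 * J * T) = T * J; last by [].
have [I0|I0] := eqVneq I 0; last by field.
have I1 : 0 <= \int[leb2]_x apow alpha (Num.max (density mu x) 0).
  by apply: Rintegral_ge0 => x _; exact: apow_ge0.
have I2 : 0 <= \int[leb2]_x apow alpha (- Num.min (density mu x) 0).
  by apply: Rintegral_ge0 => x _; exact: apow_ge0.
have -> : J = 0.
  move: EI; rewrite -/I I0 => /esym/eqP; rewrite paddr_eq0// => /andP[/eqP i1 /eqP i2].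
  by rewrite /J ES i1 i2 subr0.
by rewrite I0 !(mul0r, mulr0).
Qed.

End stable_field.

(** * Lebesgue measure on the plane *)

Section plane_measure.
Context {R : realType}.
Local Notation leb := (@lebesgue_measure R).

(** A copy of the plane measure on which sigma-finiteness can be declared, as
    the theorems of Fubini and Tonelli require. *)
Definition pl : set (measurableTypeR R * measurableTypeR R) -> \bar R := @leb2 R.
HB.instance Definition _ := Measure.on pl.
Lemma pl_sigma_finite : sigma_finite setT pl.
Proof.
have /sigma_finiteP[F [TF ndF Foo]] := sigma_finiteT leb.
exists (fun n => F n `*` F n).
  rewrite -setXTT TF predeqE => -[x y]; split.
    move=> [/= [n _ Fnx] [k _ Gky]]; exists (maxn n k) => //; split.
    - by move: x Fnx; exact/subsetPset/ndF/leq_maxl.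
    - by move: y Gky; exact/subsetPset/ndF/leq_maxr.
  by move=> [n _ []/= ? ?]; split; exists n.
move=> k; have [? ?] := Foo k.
split; first exact: measurableX.
have -> : pl (F k `*` F k) = (leb (F k) * leb (F k))%E by exact: product_measure1E.
by rewrite lte_mul_pinfty// ge0_fin_numE.
Qed.
HB.instance Definition _ := Measure_isSigmaFinite.Build _ _ _ pl pl_sigma_finite.

End plane_measure.
Arguments pl {R}.

(** * The measure of a rectangle *)

Section rectangles.
Context {R : realType}.
Local Notation leb := (@lebesgue_measure R).
Local Notation leb2 := (@leb2 R).

Definition wt (y : R) : R := (1 + y ^+ 2)^-1.

(** Equal to min 1 (4 / |x|). It bounds the mean of wt over each segment centred
    at x: a segment shorter than |x| stays where wt is small, and a longer one
    carries at most the total mass pi of wt. *)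
Definition Mt (x : R) : R := 4 / Num.max `|x| 4.

Lemma wt_gt0 y : 0 < wt y.
Proof. by rewrite invr_gt0 ltr_pwDl// sqr_ge0. Qed.

Lemma wt_le1 y : wt y <= 1.
Proof. by rewrite invf_le1 ?lerDl ?sqr_ge0// ltr_pwDl// sqr_ge0. Qed.

Lemma continuous_wt : continuous wt.
Proof.
move=> x; apply: cvgV.
  by rewrite gt_eqF// ltr_pwDl// sqr_ge0.
by apply: cvgD; [exact: cvg_cst|exact: exprn_continuous].
Qed.

Lemma measurable_wt : measurable_fun setT wt.
Proof. exact: continuous_measurable_fun continuous_wt. Qed.

Lemma max4_gt0 (x : R) : 0 < Num.max `|x| 4. Proof. by rewrite lt_max ltr0n orbT. Qed.

Lemma Mt_gt0 x : 0 < Mt x. Proof. by rewrite divr_gt0// max4_gt0. Qed.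

Lemma measurable_Mt : measurable_fun setT Mt.
Proof.
apply: measurable_funM => //.
rewrite (_ : (fun x => _) = fun x : R => Num.max `|x| 4 `^ (-1)); last first.
  by apply/funext => x; rewrite powR_inv1// ltW// max4_gt0.
apply: (measurableT_comp (@measurable_powR R (-1))).
by apply: measurable_maxr => //; exact: measurableT_comp.
Qed.

(** The exponential decay is only used through this polynomial one, whose
    primitive is the arctangent. *)
Lemma exp_le_wt (c y : R) : 0 < c -> expR (- c * `|y|) <= (1 + 4 / c ^+ 2) * wt y.
Proof.
move=> c0; have y0 := normr_ge0 y.
rewrite mulNr expRN /wt ler_pdivlMr ?ltr_pwDl ?sqr_ge0// ler_pdivrMl ?expR_gt0//.
have h : 1 + c ^+ 2 * y ^+ 2 / 4 <= expR (c * `|y|).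
  have -> : c * `|y| = c * `|y| / 2 + c * `|y| / 2 by exact: splitr.
  rewrite expRD.
  have e1 : 1 + c * `|y| / 2 <= expR (c * `|y| / 2) by exact: expR_ge1Dx.
  have p0 : 0 <= c * `|y| / 2 by rewrite divr_ge0// mulr_ge0// ltW.
  have q : (1 + c * `|y| / 2) * (1 + c * `|y| / 2) <= expR (c * `|y| / 2) * expR (c * `|y| / 2).
    by apply: ler_pM => //; rewrite addr_ge0.
  apply: le_trans q; rewrite -(real_normK (num_real y)).
  rewrite (_ : (1 + _) * _ = 1 + c ^+ 2 * `|y| ^+ 2 / 4 + c * `|y|); last by field.
  by rewrite lerDl mulr_ge0// ltW.
apply: le_trans (ler_wpM2r _ h); last by rewrite addr_ge0// divr_ge0// sqr_ge0.
rewrite [leRHS](_ : _ = 1 + y ^+ 2 + (4 / c ^+ 2 + c ^+ 2 * y ^+ 2 / 4)); last by field; rewrite gt_eqF.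
have q1 : 0 <= 4 / c ^+ 2 by rewrite divr_ge0// sqr_ge0.
have q2 : 0 <= c ^+ 2 * y ^+ 2 / 4 by rewrite divr_ge0// mulr_ge0// sqr_ge0.
by rewrite lerDl addr_ge0.
Qed.

Lemma leb_seg (x a : R) : 0 < a -> leb `[x - a / 2, x + a / 2]%classic = a%:E.
Proof.
move=> a0; have h : x - a / 2 < x + a / 2 by lra.
rewrite lebesgue_measure_itv/= lte_fin h -EFinB; congr EFin; lra.
Qed.

Lemma seg_wt_le (x a : R) : 0 < a ->
  (\int[leb]_(y in `[(x - a / 2)%R, (x + a / 2)%R]) (wt y)%:E <= (a * Mt x)%:E)%E.
Proof.
move=> a0; have mI : measurable (`[x - a / 2, x + a / 2]%classic : set R) by exact: measurable_itv.
have sup k : 0 <= k -> (forall y, x - a / 2 <= y <= x + a / 2 -> wt y <= k) ->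
    (\int[leb]_(y in `[(x - a / 2)%R, (x + a / 2)%R]) (wt y)%:E <= (a * k)%:E)%E.
  move=> k0 H; apply: (@le_trans _ _ (\int[leb]_(y in `[(x - a / 2)%R, (x + a / 2)%R]) k%:E)%E).
    have h1 y : `[x - a / 2, x + a / 2]%classic y -> (0 <= (wt y)%:E)%E.
      by rewrite lee_fin ltW// wt_gt0.
    have h2 : measurable_fun `[x - a / 2, x + a / 2]%classic (fun y => (wt y)%:E).
      by apply/measurable_EFinP; apply: measurable_funTS; exact: measurable_wt.
    have h3 y : `[x - a / 2, x + a / 2]%classic y -> ((wt y)%:E <= k%:E)%E.
      by rewrite /= in_itv/= lee_fin => /H.
    exact: ge0_le_integral.
  rewrite integral_cst//= leb_seg// -EFinM mulrC lexx//.
rewrite /Mt; have [x4|x4] := leP `|x| 4.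
  by apply: sup => [|y _]; rewrite divff// wt_le1.
have x0 : 0 < `|x| by exact: lt_trans x4.
have [ax|ax] := leP a `|x|.
  apply: sup => [|y]; first by rewrite divr_ge0.
  move=> /andP[y1 y2]; rewrite /wt invf_ple ?posrE ?divr_gt0 ?ltr_pwDl ?sqr_ge0//.
  rewrite invf_div.
  have yx : `|x| / 2 <= `|y|.
    move: ax x0 y1 y2; case: (ger0P x) => hx ax x0 y1 y2; case: (ger0P y) => hy; lra.
  apply: (@le_trans _ _ (1 + (`|x| / 2) ^+ 2)); last first.
    by rewrite lerD2l -(real_normK (num_real y)) lerXn2r// nnegrE// divr_ge0// ltW.
  have := sqr_ge0 (`|x| / 2 - 1); lra.
have xl : x - a / 2 - 1 < x - a / 2 by lra.
have xr : x - a / 2 < x + a / 2 by lra.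
rewrite (segment_FTC xl xr (fun r _ => is_derive1_atan r)) ?lee_fin; last first.
  by move=> r _; exact: continuous_wt.

have h1 := atan_ltpi2 (x + a / 2); have h2 := atan_gtNpi2 (x - a / 2).
have h3 : pi <= (4 : R) by have := pihalf_lt2 R; lra.
apply: (@le_trans _ _ 4); first lra.
by rewrite mulrCA -[leLHS]mulr1 ler_pM2l// ler_pdivlMr// mul1r ltW.
Qed.

Lemma measurable_rect (x u : R * R) : measurable (rect x u).
Proof. by apply: measurableX; exact: measurable_itv. Qed.

Lemma leb2_rect (x u : R * R) : 0 < u.1 -> 0 < u.2 -> leb2 (rect x u) = (u.1 * u.2)%:E.
Proof.
move=> u1 u2.
have -> : leb2 (rect x u) = (leb `[(x.1 - u.1 / 2)%R, (x.1 + u.1 / 2)%R]%classic *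
    leb `[(x.2 - u.2 / 2)%R, (x.2 + u.2 / 2)%R]%classic)%E.
  by apply: product_measure1E; exact: measurable_itv.
by rewrite !leb_seg.
Qed.

Lemma rect_wt_le (x u : R * R) : 0 < u.1 -> 0 < u.2 ->
  (\int[leb2]_(y in rect x u) (wt y.1 * wt y.2)%:E <=
   (u.1 * u.2 * (Mt x.1 * Mt x.2))%:E)%E.
Proof.
move=> u1 u2.
pose I1 := `[(x.1 - u.1 / 2)%R, (x.1 + u.1 / 2)%R]%classic.
pose I2 := `[(x.2 - u.2 / 2)%R, (x.2 + u.2 / 2)%R]%classic.
have mI1 : measurable I1 by exact: measurable_itv.
have mI2 : measurable I2 by exact: measurable_itv.
pose k1 y : R := wt y * \1_I1 y; pose k2 y : R := wt y * \1_I2 y.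
have mk1 : measurable_fun setT k1.
  by apply: measurable_funM; [exact: measurable_wt|exact: measurable_indic].
have mk2 : measurable_fun setT k2.
  by apply: measurable_funM; [exact: measurable_wt|exact: measurable_indic].
have k10 y : 0 <= k1 y by rewrite mulr_ge0// ltW// wt_gt0.
have k20 y : 0 <= k2 y by rewrite mulr_ge0// ltW// wt_gt0.
have E1 : (\int[leb]_y (k1 y)%:E = \int[leb]_(y in I1) (wt y)%:E)%E.
  rewrite [RHS]integral_mkcond; apply: eq_integral => y _.
  by rewrite patchE /k1 indicE; case: (y \in I1); rewrite ?mulr1 ?mulr0.
have E2 : (\int[leb]_y (k2 y)%:E = \int[leb]_(y in I2) (wt y)%:E)%E.
  rewrite [RHS]integral_mkcond; apply: eq_integral => y _.
  by rewrite patchE /k2 indicE; case: (y \in I2); rewrite ?mulr1 ?mulr0.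
have -> : (\int[leb2]_(y in rect x u) (wt y.1 * wt y.2)%:E =
    \int[leb2]_y (k1 y.1 * k2 y.2)%:E)%E.
  rewrite integral_mkcond; apply: eq_integral => y _; rewrite patchE /k1 /k2 !indicE.
  have -> : (y \in rect x u) = (y.1 \in I1) && (y.2 \in I2).
    by apply/idP/andP => [/set_mem[/mem_set ? /mem_set ?]|[/set_mem ? /set_mem ?]]//; apply: mem_set.
  by case: (y.1 \in I1); case: (y.2 \in I2); rewrite ?(mulr1, mulr0, mul0r).
rewrite fubini_tonelli1//=; last 2 first.
- apply/measurable_EFinP; apply: measurable_funM.
    exact: (measurableT_comp mk1 measurable_fst).
  exact: (measurableT_comp mk2 measurable_snd).
- by move=> y; rewrite lee_fin mulr_ge0.
rewrite [X in (X <= _)%E](_ : _ = \int[leb]_y ((k1 y)%:E * (\int[leb]_y2 (k2 y2)%:E)))%E; last first.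
  apply: eq_integral => y _; rewrite /fubini_F /=; under eq_integral do rewrite EFinM.
  by rewrite ge0_integralZl//; [exact/measurable_EFinP|by move=> z _; rewrite lee_fin|rewrite lee_fin].
rewrite ge0_integralZr//; last 2 first.
- by move=> z _; rewrite lee_fin.
- by apply: integral_ge0 => y _; rewrite lee_fin.
  rewrite E1 E2 mulrACA EFinM; apply: lee_pmul.
  - by apply: integral_ge0 => y _; rewrite lee_fin ltW// wt_gt0.
  - by apply: integral_ge0 => y _; rewrite lee_fin ltW// wt_gt0.
  - exact: seg_wt_le.
  - exact: seg_wt_le.
exact/measurable_EFinP.
Qed.

Lemma pos_neg_parts (a : R) : a = Num.max a 0 - Num.max (- a) 0.
Proof.
have [a0|/ltW a0] := leP 0 a.
  have -> : Num.max (- a) 0 = 0 by apply: max_r; rewrite oppr_le0.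
  by rewrite subr0.
have -> : Num.max (- a) 0 = - a by apply: max_l; rewrite oppr_ge0.
by rewrite sub0r opprK.
Qed.

Lemma measurable_rect_graph : measurable [set q : ((R * R) * (R * R)) * (R * R) | rect q.1.1 q.1.2 q.2].
Proof.
have m1 (g : ((R * R) * (R * R)) * (R * R) -> R) : measurable_fun setT g ->
    measurable [set q | 0 <= g q].
  move=> mg; rewrite (_ : [set q | _] = g @^-1` `[0, +oo[%classic); last first.
    by apply/seteqP; split => w /=; rewrite in_itv/= andbT.
  by rewrite -[_ @^-1` _]setTI; exact: mg.
have mfst (g : ((R * R) * (R * R)) * (R * R) -> R * R) : measurable_fun setT g ->
    measurable_fun setT (fun q => (g q).1) by move=> mg; exact: (measurableT_comp measurable_fst mg).
have msnd (g : ((R * R) * (R * R)) * (R * R) -> R * R) : measurable_fun setT g ->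
    measurable_fun setT (fun q => (g q).2) by move=> mg; exact: (measurableT_comp measurable_snd mg).
rewrite (_ : [set q | _] =
    ([set q | 0 <= q.2.1 - (q.1.1.1 - q.1.2.1 / 2)] `&`
     [set q | 0 <= (q.1.1.1 + q.1.2.1 / 2) - q.2.1]) `&`
    ([set q | 0 <= q.2.2 - (q.1.1.2 - q.1.2.2 / 2)] `&`
     [set q | 0 <= (q.1.1.2 + q.1.2.2 / 2) - q.2.2])).
  have b1 : measurable_fun setT (fun q : ((R * R) * (R * R)) * (R * R) => q.1.1).
    exact: (measurableT_comp measurable_fst measurable_fst).
  have b2 : measurable_fun setT (fun q : ((R * R) * (R * R)) * (R * R) => q.1.2).
    exact: (measurableT_comp measurable_snd measurable_fst).
  have b3 : measurable_fun setT (fun q : ((R * R) * (R * R)) * (R * R) => q.2).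
    exact: measurable_snd.
  have b1' := mfst _ b1; have b1'' := msnd _ b1; have b2' := mfst _ b2; have b2'' := msnd _ b2.
  have b3' := mfst _ b3; have b3'' := msnd _ b3.
  have h1 := measurable_funM b2' (measurable_cst (2^-1 : R)).
  have h2 := measurable_funM b2'' (measurable_cst (2^-1 : R)).
  apply: measurableI; apply: measurableI; apply: m1.
  - exact: (measurable_funB b3' (measurable_funB b1' h1)).
  - exact: (measurable_funB (measurable_funD b1' h1) b3').
  - exact: (measurable_funB b3'' (measurable_funB b1'' h2)).
  - exact: (measurable_funB (measurable_funD b1'' h2) b3'').
apply/seteqP; split => q /=; rewrite /rect/= !in_itv/= !subr_ge0.
  by move=> [/andP[-> ->] /andP[-> ->]].
by move=> [[-> ->] [-> ->]].
Qed.

Section mass.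
Variables (f : R * R -> R) (K : R).
Hypothesis cf : continuous f.
Hypothesis jf : leb2.-integrable setT (EFin \o f).
Hypothesis fK : forall y, `|f y| <= K * (wt y.1 * wt y.2).

(** The mass that the measure with density f gives to the rectangle of centre z.1
    and edges z.2, extended by 0 to edges that are not positive. *)
Definition phi (z : (R * R) * (R * R)) : R :=
  \1_(@Rplus2 R) z.2 * \int[leb2]_(y in rect z.1 z.2) f y.

Let jr x u : leb2.-integrable (rect x u) (EFin \o f).
Proof. by apply: integrableS jf => //; exact: measurable_rect. Qed.

Lemma phi0 x u : ~ Rplus2 u -> phi (x, u) = 0.
Proof. by move=> Nu; rewrite /phi indicE memNset// mul0r. Qed.

Lemma phiE x u : 0 < u.1 -> 0 < u.2 -> phi (x, u) = \int[leb2]_(y in rect x u) f y.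
Proof.
move=> u1 u2; rewrite /phi indicE mem_set ?mul1r//.
by split; rewrite /Rplus /= in_itv/= ?u1 ?u2.
Qed.

(** This bound is linear in the area of the rectangle and, to the power g > 1,
    integrable over the centres; the exponential bound on f would not give a
    better power in the centre, since long rectangles reach far. *)
Lemma norm_phi_le x u : 0 < u.1 -> 0 < u.2 ->
  `|phi (x, u)| <= K * (u.1 * u.2 * (Mt x.1 * Mt x.2)).
Proof.
move=> u1 u2; rewrite phiE//; apply: le_trans (le_normr_Rintegral _ (jr x u)) _.
  exact: measurable_rect.
have K0 : 0 <= K.
  have := le_trans (normr_ge0 _) (fK (0, 0)).
  by rewrite pmulr_lge0// mulr_gt0// wt_gt0.
rewrite -lee_fin /Rintegral fineK; last first.
  by apply: integrable_fin_num; [exact: measurable_rect|exact: integrable_norm (jr x u)].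
apply: (@le_trans _ _ (K%:E * \int[leb2]_(y in rect x u) (wt y.1 * wt y.2)%:E)%E).
  have mw : measurable_fun (rect x u) (fun y : R * R => (wt y.1 * wt y.2)%:E).
    apply/measurable_EFinP; apply: measurable_funTS; apply: measurable_funM.
      exact: (measurableT_comp measurable_wt measurable_fst).
    exact: (measurableT_comp measurable_wt measurable_snd).
  rewrite -ge0_integralZl//; last 2 first.
  - exact: measurable_rect.
  - by move=> y _; rewrite lee_fin mulr_ge0// ltW// wt_gt0.
  have h1 y : rect x u y -> (0 <= `|f y|%:E)%E by rewrite lee_fin.
  have h2 : measurable_fun (rect x u) (fun y => `|f y|%:E).
    have [mf _] := integrableP _ _ _ (jr x u).
    by apply/measurable_EFinP; apply: measurableT_comp => //; exact/measurable_EFinP.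
  have h3 y : rect x u y -> (`|f y|%:E <= K%:E * (wt y.1 * wt y.2)%:E)%E.
    by rewrite -EFinM lee_fin.
  have h4 : measurable_fun (rect x u) (fun y => K%:E * (wt y.1 * wt y.2)%:E)%E.
    exact: measurable_funeM.
  by apply: ge0_le_integral => //; exact: measurable_rect.
rewrite [leRHS]EFinM; apply: lee_wpmul2l; rewrite ?lee_fin//; exact: rect_wt_le.
Qed.

Lemma phi_average (x : R * R) (a b : nat -> R) :
  (forall n, 0 < a n) -> (forall n, 0 < b n) ->
  a n @[n --> \oo] --> (0 : R) -> b n @[n --> \oo] --> (0 : R) ->
  phi (x, (a n, b n)) / (a n * b n) @[n --> \oo] --> f x.
Proof.
move=> a0 b0 ca cb; apply/cvgrPdist_le => e e0.
have cx : {for x, continuous f} by exact: cf.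
move/cvgrPdist_le: cx => /(_ _ e0) /nbhs_ballP[dl /= dl0 Hdl].
have d2 : 0 < dl by [].
have Ha : \forall n \near \oo, a n < dl.
  by move/cvgrPdist_lt : ca => /(_ _ d2); apply: filterS => n; rewrite sub0r normrN gtr0_norm.
have Hb : \forall n \near \oo, b n < dl.
  by move/cvgrPdist_lt : cb => /(_ _ d2); apply: filterS => n; rewrite sub0r normrN gtr0_norm.
apply: filterS2 Ha Hb => n an bn.
have ab : 0 < a n * b n by rewrite mulr_gt0.
rewrite (@phiE x (a n, b n) (a0 n) (b0 n)).
have -> : f x = (\int[leb2]_(y in rect x (a n, b n)) f x) / (a n * b n).
  rewrite /Rintegral integral_cst; last exact: measurable_rect.
  transitivity (fine ((f x)%:E * (a n * b n)%:E)%E / (a n * b n)).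
    by rewrite -EFinM/= mulfK// gt_eqF.
  have L := @leb2_rect x (a n, b n) (a0 n) (b0 n); rewrite /= in L; by rewrite -L.
have jc : leb2.-integrable (rect x (a n, b n)) (EFin \o cst (f x)).
  apply/integrableP; split; first exact/measurable_EFinP.
  apply: (@le_lt_trans _ _ (`|f x|%:E * leb2 (rect x (a n, b n)))%E).
    rewrite -integral_cst; last exact: measurable_rect.
    by rewrite le_eqVlt; apply/orP; left; apply/eqP; exact: eq_integral.
  by rewrite (@leb2_rect x (a n, b n) (a0 n) (b0 n)) -EFinM ltry.
rewrite -mulrBl -RintegralB//; [|exact: measurable_rect].
rewrite normrM normfV (gtr0_norm ab) ler_pdivrMr//.
apply: le_trans (le_normr_Rintegral _ _) _; first exact: measurable_rect.
  have := @integrableB _ _ _ leb2 _ (measurable_rect x (a n, b n)) _ _ jc (jr _ _).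
  by apply: eq_integrable => //; exact: measurable_rect.
have jn : leb2.-integrable (rect x (a n, b n)) (EFin \o (fun y => `|f x - f y|)).
  have := @integrableB _ _ _ leb2 _ (measurable_rect x (a n, b n)) _ _ jc (jr _ _).
  by move=> /integrable_norm; apply: eq_integrable => //; exact: measurable_rect.
rewrite -lee_fin /Rintegral fineK; last first.
  by apply: integrable_fin_num => //; exact: measurable_rect.
have h1 y : rect x (a n, b n) y -> (0 <= `|f x - f y|%:E)%E by rewrite lee_fin.
have h3 y : rect x (a n, b n) y -> (`|f x - f y|%:E <= e%:E)%E.
  move=> [/=]; rewrite !in_itv/= => y1 y2; rewrite lee_fin; apply: Hdl.
  have h (s t c : R) : 0 < c -> c < dl -> s - c / 2 <= t <= s + c / 2 -> `|s - t| < dl.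
    by move=> c0 cd /andP[? ?]; rewrite ltr_norml; apply/andP; split; lra.
  by split => /=; rewrite /ball/=; [exact: h y1|exact: h y2].
have [mn _] := integrableP _ _ _ jn.
apply: (@le_trans _ _ (\int[leb2]_(y in rect x (a n, b n)) e%:E)%E).
  by apply: ge0_le_integral => //; exact: measurable_rect.
rewrite integral_cst; last exact: measurable_rect.
have L := @leb2_rect x (a n, b n) (a0 n) (b0 n); rewrite /= in L.
by rewrite [leRHS]EFinM -L.
Qed.

Lemma measurable_phi : measurable_fun setT phi.
Proof.
have mf : measurable_fun setT f by exact: continuous_measurable_plane.
have part (g : R * R -> R) : measurable_fun setT g -> (forall y, 0 <= g y) ->
    measurable_fun setT (fun z : (R * R) * (R * R) => \int[leb2]_(y in rect z.1 z.2) g y).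
  move=> mg g0; apply: (measurableT_comp (@fine_measurable R setT measurableT)).
  have H := @measurable_fun_fubini_tonelli_F _ _ ((R * R) * (R * R))%type
    _ R pl
    (fun q => (g q.2 * \1_[set q : ((R * R) * (R * R)) * (R * R) | rect q.1.1 q.1.2 q.2] q)%:E).
  have {}H : measurable_fun setT (fun z : (R * R) * (R * R) =>
      \int[leb2]_y (g y * \1_[set q : ((R * R) * (R * R)) * (R * R) | rect q.1.1 q.1.2 q.2] (z, y))%:E)%E.
    apply: H; last by move=> q; rewrite lee_fin mulr_ge0.
    apply/measurable_EFinP; apply: measurable_funM; last exact: measurable_indic measurable_rect_graph.
    exact: (measurableT_comp mg measurable_snd).
  apply: eq_measurable_fun H => z _; rewrite [RHS]integral_mkcond.
  apply: eq_integral => y _; rewrite patchE indicE; case: ifPn => yr.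
    by rewrite mem_set ?mulr1//; exact: set_mem yr.
  by rewrite memNset ?mulr0// => h; move/negP: yr; apply; exact: mem_set.
apply: measurable_funM.
  have mR : measurable (@Rplus2 R) by apply: measurableX; exact: measurable_itv.
  have mi : measurable_fun setT (\1_(@Rplus2 R) : R * R -> R) by exact: measurable_indic.
  exact: (measurableT_comp mi measurable_snd).
pose fp y := Num.max (f y) 0; pose fn y := Num.max (- f y) 0.
have mp : measurable_fun setT fp by exact: measurable_maxr.
have mn : measurable_fun setT fn by apply: measurable_maxr => //; exact: measurableT_comp.
have p0 y : 0 <= fp y by rewrite le_max lexx orbT.
have n0 y : 0 <= fn y by rewrite le_max lexx orbT.
rewrite (_ : (fun z => _) = fun z : (R * R) * (R * R) =>
    \int[leb2]_(y in rect z.1 z.2) fp y - \int[leb2]_(y in rect z.1 z.2) fn y).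
  by apply: measurable_funB; exact: part.
apply/funext => z; have ja := integrable_abs jf.
have jp : leb2.-integrable setT (EFin \o fp).
  apply: integrable_dominated ja => // y; rewrite ger0_norm// /fp ge_max normr_ge0 andbT.
  exact: ler_norm.
have jn : leb2.-integrable setT (EFin \o fn).
  apply: integrable_dominated ja => // y; rewrite ger0_norm// /fn ge_max normr_ge0 andbT.
  by rewrite -normrN ler_norm.
have js g : leb2.-integrable setT (EFin \o g) -> leb2.-integrable (rect z.1 z.2) (EFin \o g).
  by move=> jg; apply: integrableS jg => //; exact: measurable_rect.
rewrite -RintegralB; [|exact: measurable_rect|exact: js|exact: js].
by apply: eq_Rintegral => y _; exact: pos_neg_parts.
Qed.

End mass.
End rectangles.

(** * Integrals against the intensity *)

Section intensity.
Context {R : realType}.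
Local Notation leb := (@lebesgue_measure R).
Local Notation leb2 := (@leb2 R).
Local Notation PT := (measurableTypeR R * measurableTypeR R)%type.

Definition retype (z : PT * (R * R)) : (R * R) * (R * R) := z.

Lemma measurable_retype : measurable_fun setT retype.
Proof. by move=> _ Y mY; rewrite setTI; exact: mY. Qed.

Section formula.
Variables (f1 f2 : R -> R) (F : probability (R * R)%type R) (lambda rho : R).
Hypothesis mf1 : measurable_fun setT f1.
Hypothesis mf2 : measurable_fun setT f2.
Hypothesis f10 : forall u, 0 <= f1 u.
Hypothesis f20 : forall u, 0 <= f2 u.
Hypothesis FE : forall A, measurable A ->
  F A = (\int[leb2]_(u in A) (f1 u.1 * f2 u.2)%:E)%E.
Hypothesis l0 : 0 < lambda.

(** Lebesgue measure and the kernels carry two convertible measurable structures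
    on the same set; the measure is transported from the first to the second. *)
Definition intensity_measure : {measure set ((R * R) * (R * R))%type -> \bar R} :=
  measure_function_pushforward__canonical__measure_function_Measure
    (mscale (NngNum (ltW l0)) (pl \x distribution F (dilation rho))%E) measurable_retype.

Let w (u : R * R) : R := f1 u.1 * f2 u.2.

Let w0 u : 0 <= w u. Proof. by rewrite mulr_ge0. Qed.

Let mw : measurable_fun setT w.
Proof.
apply: measurable_funM.
  exact: (measurableT_comp mf1 measurable_fst).
exact: (measurableT_comp mf2 measurable_snd).
Qed.

Lemma intensity_integral (H : (R * R) * (R * R) -> \bar R) :
  measurable_fun setT H -> (forall z, 0 <= H z)%E ->
  (\int[intensity_measure]_z H z =
   lambda%:E * \int[leb2]_x \int[leb2]_u (H (x, dilation rho u) * (w u)%:E))%E.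
Proof.
move=> mH H0.
transitivity (\int[mscale (NngNum (ltW l0)) (pl \x distribution F (dilation rho))%E]_z H (retype z))%E.
  exact: (ge0_integral_pushforward measurable_retype).
rewrite ge0_integral_mscale//.
congr (_ * _)%E; rewrite fubini_tonelli1//=.
apply: eq_integral => x _; rewrite /fubini_F.
have mHx : measurable_fun setT (fun v : R * R => H (x, v)).
  exact: (measurableT_comp mH (measurable_pair1 _)).
transitivity (\int[F]_u H (x, dilation rho u))%E.
  exact: (ge0_integral_pushforward (measurable_dilation rho)).
have mid : measurable_fun setT (id : PT -> (R * R)%type).
  by move=> _ Y mY; rewrite setTI; exact: mY.
apply: (@integral_density _ PT _ (R * R)%type R leb2 F id w mid mw w0) => //.
exact: (measurableT_comp mHx (measurable_dilation rho)).
Qed.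

(** Rescaling the first edge by kappa turns the intensity into an integral over
    a fixed product space. *)
Lemma intensity_integral_scale (kappa : R) (H : (R * R) * (R * R) -> R) : 0 < kappa ->
  measurable_fun setT H -> (forall z, 0 <= H z) ->
  (\int[intensity_measure]_z (H z)%:E =
   \int[pl \x pl]_z (H (z.1, (rho * (kappa * z.2.1), rho * z.2.2)) *
      (lambda * kappa * f1 (kappa * z.2.1) * f2 z.2.2))%:E)%E.
Proof.
move=> k0 mH H0; rewrite intensity_integral//; last exact/measurable_EFinP.
pose G (z : (R * R) * (R * R)) : R := H (z.1, dilation rho z.2) * w z.2.
have G0 z : 0 <= G z by rewrite mulr_ge0.
have mG : measurable_fun setT G.
  apply: measurable_funM; last exact: (measurableT_comp mw measurable_snd).
  apply: (measurableT_comp mH); apply/measurable_fun_pairP; split; first exact: measurable_fst.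
  exact: (measurableT_comp (measurable_dilation rho) measurable_snd).
pose sc (u : R * R) : R * R := (kappa * u.1, u.2).
have msc : measurable_fun setT sc.
  apply/measurable_fun_pairP; split => /=; first by apply: measurable_funM.
  exact: measurable_snd.
have mGx x : measurable_fun setT (fun u => G (x, u)).
  exact: (measurableT_comp mG (measurable_pair1 x)).
have scale (g : R * R -> R) : measurable_fun setT g -> (forall u, 0 <= g u) ->
    (\int[leb2]_u (g u)%:E = kappa%:E * \int[leb2]_u (g (sc u))%:E)%E.
  move=> mg g0.
  have mg1 : measurable_fun setT (fun u : PT => (g u)%:E) by exact/measurable_EFinP.
  have mg2 : measurable_fun setT (fun u : PT => (g (sc u))%:E).
    by apply/measurable_EFinP; exact: (measurableT_comp mg msc).
  rewrite fubini_tonelli1//.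
  rewrite [in RHS]fubini_tonelli1//.
    rewrite (@ge0_integral_scale _ kappa)//.
    - exact: measurable_fun_fubini_tonelli_F.
    - by move=> x; apply: integral_ge0 => y _; rewrite lee_fin.
  by move=> x; rewrite lee_fin.
transitivity (lambda%:E * \int[leb2]_x (kappa%:E * \int[leb2]_u (G (x, sc u))%:E))%E.
  congr (_ * _)%E; apply: eq_integral => x _.
  exact: (scale (fun u => G (x, u)) (mGx x) (fun u => G0 _)).
pose K (z : (R * R) * (R * R)) : R := G (z.1, sc z.2).
have mK : measurable_fun setT (fun z : PT * PT => (K z)%:E).
  apply/measurable_EFinP; apply: (measurableT_comp mG); apply/measurable_fun_pairP; split.
    exact: measurable_fst.
  exact: (measurableT_comp msc measurable_snd).
have K0 (z : PT * PT) : (0 <= (K z)%:E)%E by rewrite lee_fin /K; exact: G0.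
have mI0 := @measurable_fun_fubini_tonelli_F _ _ PT PT R pl _ mK K0.
have mI : measurable_fun setT (fun x : PT => \int[pl]_u (K (x, u))%:E)%E.
  exact: mI0.
have EI0 := @fubini_tonelli1 _ _ PT PT R pl pl _ mK K0.
have EI : (\int[pl \x pl]_z (K z)%:E = \int[pl]_x \int[pl]_u (K (x, u))%:E)%E.
  exact: EI0.
rewrite ge0_integralZl//; first last.
- by rewrite lee_fin ltW.
- by move=> x _; apply: integral_ge0 => y _; rewrite lee_fin.
rewrite muleA -EFinM.
transitivity ((lambda * kappa)%:E * \int[pl \x pl]_z (K z)%:E)%E.
  by congr (_ * _)%E; rewrite EI.
rewrite -ge0_integralZl//; last by rewrite lee_fin mulr_ge0// ltW.
apply: eq_integral => z _; rewrite -EFinM; congr EFin.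
rewrite /K /G /w /sc /dilation /=; ring.
Qed.

End formula.
End intensity.

Section power_scaling.
Context {R : realType}.
Local Notation leb := (@lebesgue_measure R).
Local Notation PT := (measurableTypeR R * measurableTypeR R)%type.
Variable g : R.
Hypothesis g0 : 0 < g.

(** * Separation of the variables in the limit integral *)

Lemma ppow_scale (c r b : R) : 0 < c -> ppow b (c * r) = c `^ b * ppow b r.
Proof.
move=> c0; have [r0|r0] := leP r 0.
  by rewrite !ppow0 ?mulr0// pmulr_rle0.
by rewrite !ppowE ?mulr_gt0// powRM// ltW.
Qed.

Variable W : R -> R.
Hypothesis mW : measurable_fun setT W.
Hypothesis W0 : forall x, 0 <= W x.
Hypothesis W00 : W 0 = 0.

Definition Wint (e : R) : \bar R := (\int[leb]_r (W (e * r) * ppow (- g - 1) r)%:E)%E.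

Let mWe e : measurable_fun setT (fun r : R => (W (e * r) * ppow (- g - 1) r)%:E).
Proof.
apply/measurable_EFinP; apply: measurable_funM; last exact: measurable_ppow.
by apply: (measurableT_comp mW); exact: measurable_funM.
Qed.

Let We0 e r : (0 <= (W (e * r) * ppow (- g - 1) r)%:E)%E.
Proof. by rewrite lee_fin mulr_ge0// ppow_ge0. Qed.

Lemma Wint_ge0 e : (0 <= Wint e)%E. Proof. by apply: integral_ge0 => r _; exact: We0. Qed.

Lemma Wint_scale (c e : R) : 0 < c -> Wint (c * e) = ((c `^ g)%:E * Wint e)%E.
Proof.
move=> c0; rewrite /Wint [in RHS](ge0_integral_scale c0 (mWe e) (We0 e)).
rewrite muleA -EFinM -ge0_integralZl//; last 2 first.
- apply/measurable_EFinP; apply: measurable_funM.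
    apply: (measurableT_comp mW); apply: measurable_funM => //; exact: measurable_funM.
  by apply: (measurableT_comp (measurable_ppow _)); exact: measurable_funM.
- by rewrite lee_fin mulr_ge0 ?powR_ge0// ltW.
apply: eq_integral => r _; rewrite -EFinM; congr EFin.
rewrite ppow_scale// (_ : e * (c * r) = c * e * r); last by ring.
rewrite (_ : c `^ g * c * _ = (c `^ g * (c * c `^ (- g - 1))) * (W (c * e * r) * ppow (- g - 1) r)); last by ring.
rewrite mulr_powR// (_ : - g - 1 + 1 = - g); last by ring.
by rewrite powRN mulfV ?mul1r// gt_eqF// powR_gt0.
Qed.

Lemma WintE (a : R) :
  Wint a = ((Num.max a 0 `^ g)%:E * Wint 1 + (Num.max (- a) 0 `^ g)%:E * Wint (-1))%E.
Proof.
have z : (0 : R) `^ g = 0 by rewrite powR0// gt_eqF.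
have [a0|a0|->] := ltgtP a 0.
- rewrite z mul0e add0e max_l; last by rewrite oppr_ge0 ltW.
  by rewrite -Wint_scale ?oppr_gt0// mulrN1 opprK.
- rewrite max_r; last by rewrite oppr_le0 ltW.
  by rewrite z mul0e adde0 -Wint_scale// mulr1.
- rewrite oppr0 ?maxxx z !mul0e adde0 /Wint.
  by apply: integral0_eq => r _; rewrite mul0r W00 mul0r.
Qed.

(** Substituting r := r / (s |k x|) in the inner integral over the first edge
    gives s^g |k x|^g times a constant that only depends on the sign of k x. *)
Lemma power_integral (k : R * R -> R) (h : R -> R) :
  measurable_fun setT k -> measurable_fun setT h -> (forall s, 0 <= h s) ->
  (forall s, s <= 0 -> h s = 0) ->
  (\int[pl \x pl]_z (W (z.2.1 * z.2.2 * k z.1) * (ppow (- g - 1) z.2.1 * h z.2.2))%:E =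
   (\int[leb]_s (s `^ g * h s)%:E) *
     (Wint 1 * \int[pl]_x (Num.max (k x) 0 `^ g)%:E +
      Wint (-1) * \int[pl]_x (Num.max (- k x) 0 `^ g)%:E))%E.
Proof.
move=> mk mh h0 hneg.
have mpow (u : R * R -> R) : measurable_fun setT u -> measurable_fun setT (fun x : PT => (u x `^ g)%:E).
  by move=> mu; apply/measurable_EFinP; exact: (measurableT_comp (measurable_powR g) mu).
have mp : measurable_fun setT (fun x : PT => (Num.max (k x) 0 `^ g)%:E).
  by apply: mpow; exact: measurable_maxr.
have mn : measurable_fun setT (fun x : PT => (Num.max (- k x) 0 `^ g)%:E).
  by apply: mpow; apply: measurable_maxr => //; exact: measurableT_comp.
pose G (z : PT * PT) := (W (z.2.1 * z.2.2 * k z.1) * (ppow (- g - 1) z.2.1 * h z.2.2))%:E.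
have G0 z : (0 <= G z)%E by rewrite lee_fin mulr_ge0// mulr_ge0// ppow_ge0.
have m2 : measurable_fun setT (fun z : PT * PT => z.2) by exact: measurable_snd.
have m21 : measurable_fun setT (fun z : PT * PT => z.2.1) by exact: (measurableT_comp measurable_fst m2).
have m22 : measurable_fun setT (fun z : PT * PT => z.2.2) by exact: (measurableT_comp measurable_snd m2).
have mG : measurable_fun setT G.
  apply/measurable_EFinP; apply: measurable_funM.
    apply: (measurableT_comp mW); apply: measurable_funM; first exact: measurable_funM.
    exact: (measurableT_comp mk measurable_fst).
  apply: measurable_funM; first exact: (measurableT_comp (measurable_ppow _) m21).
  exact: (measurableT_comp mh m22).
have EI0 := @fubini_tonelli1 _ _ PT PT R pl pl G mG G0.
have {EI0}-> : (\int[pl \x pl]_z G z = \int[pl]_x \int[pl]_u G (x, u))%E by exact: EI0.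
set M := (\int[leb]_s _)%E.
have M0 : (0 <= M)%E by apply: integral_ge0 => s _; rewrite lee_fin mulr_ge0 ?powR_ge0.
have inner x : (\int[pl]_u G (x, u) = M * Wint (k x))%E.
  have mGx : measurable_fun setT (fun u : PT => G (x, u)).
    exact: (measurableT_comp mG (measurable_pair1 x)).
  have G0x (u : PT) : (0 <= G (x, u))%E by exact: G0.
  have EI1 := @fubini_tonelli2 _ _ (measurableTypeR R) (measurableTypeR R) R leb leb _ mGx G0x.
  transitivity (\int[leb]_s \int[leb]_r G (x, (r, s)))%E; first exact: EI1.
  rewrite /M muleC -ge0_integralZl//; last 3 first.
  - apply/measurable_EFinP; apply: measurable_funM => //; exact: measurable_powR.
  - by move=> s _; rewrite lee_fin mulr_ge0 ?powR_ge0.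
  - exact: Wint_ge0.
  apply: eq_integral => s _; rewrite /G /=.
  have [s0|s0] := leP s 0.
    rewrite hneg// mulr0 mule0; apply: integral0_eq => r _.
    by rewrite !mulr0.
  rewrite muleC EFinM muleAC -Wint_scale// muleC /Wint -ge0_integralZl//; last by rewrite lee_fin.
    apply: eq_integral => r _; rewrite -EFinM; congr EFin.
    rewrite (_ : r * s * k x = s * k x * r); ring.
  exact: (mWe (s * k x)).
rewrite (eq_integral (fun x : PT => M * Wint (k x))%E); last by move=> x _; exact: inner.
rewrite ge0_integralZl//; last 2 first.
- rewrite (_ : (fun x => Wint (k x)) = fun x : PT => ((Num.max (k x) 0 `^ g)%:E * Wint 1 +
     (Num.max (- k x) 0 `^ g)%:E * Wint (-1))%E); last by apply/funext => x; exact: WintE.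
  by apply: emeasurable_funD; apply: emeasurable_funM.
- by move=> x _; exact: Wint_ge0.
congr (_ * _)%E.
rewrite (eq_integral (fun x : PT => (Num.max (k x) 0 `^ g)%:E * Wint 1 +
     (Num.max (- k x) 0 `^ g)%:E * Wint (-1))%E); last by move=> x _; exact: WintE.
rewrite ge0_integralD//; last 4 first.
- by move=> x _; rewrite mule_ge0 ?Wint_ge0// lee_fin powR_ge0.
- exact: emeasurable_funM.
- by move=> x _; rewrite mule_ge0 ?Wint_ge0// lee_fin powR_ge0.
- exact: emeasurable_funM.
rewrite !ge0_integralZr ?Wint_ge0//.
  by rewrite [X in (X + _)%E]muleC [X in (_ + X)%E]muleC.
all: by move=> x _; rewrite lee_fin powR_ge0.
Qed.

End power_scaling.

(** * Integrable bounds of the edge and of the centre variables *)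

Section domination.
Context {R : realType}.
Local Notation leb := (@lebesgue_measure R).
Local Notation PT := (measurableTypeR R * measurableTypeR R)%type.

(** The minimum of x^2 and |x| is the common size of 1 - cos x and x - sin x;
    against r^(-g-1) it is integrable at 0 since g < 2 and at infinity since
    g > 1. *)
Definition minsq (x : R) : R := Num.min (x ^+ 2) `|x|.

Lemma minsq_ge0 x : 0 <= minsq x.
Proof. by rewrite le_min sqr_ge0 normr_ge0. Qed.

Lemma minsq0 : minsq 0 = 0.
Proof. by rewrite /minsq expr0n/= normr0 minxx. Qed.

Lemma minsq_le x y : `|x| <= y -> minsq x <= minsq y.
Proof.
move=> xy; have y0 : 0 <= y by exact: le_trans xy.
rewrite /minsq (ger0_norm y0) le_min; apply/andP; split.
  by rewrite ge_min -(real_normK (num_real x)) lerXn2r// nnegrE.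
by rewrite ge_min xy orbT.
Qed.

Lemma measurable_minsq : measurable_fun setT minsq.
Proof.
apply: measurable_minr; first by apply: measurable_funX; exact: measurable_id.
exact: normr_measurable.
Qed.

Variable g : R.
Hypothesis g12 : 1 < g < 2.

Let g0 : 0 < g. Proof. by case/andP: g12 => h _; exact: lt_trans ltr01 h. Qed.

Let b01 : 0 < g - 1 < 1.
Proof. by case/andP: g12 => h1 h2; apply/andP; split; lra. Qed.

Lemma Wint_minsq_fin e : `|e| = 1 -> (Wint g minsq e < +oo)%E.
Proof.
move=> e1; have /integrableP[_] := integrable_pdom b01; apply: le_lt_trans.
rewrite /Wint; apply: ge0_le_integral => //.
- by move=> r _; rewrite lee_fin mulr_ge0 ?minsq_ge0 ?ppow_ge0.
- apply/measurable_EFinP; apply: measurable_funM; last exact: measurable_ppow.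
  by apply: (measurableT_comp measurable_minsq); exact: measurable_funM.
- by apply: measurableT_comp => //; apply/measurable_EFinP; exact: measurable_pdom.
move=> r _ /=; rewrite lee_fin ger0_norm ?pdom_ge0// /pdom.
have [r0|r0] := leP r 0; first by rewrite !ppow0// mulr0 mul0r.
rewrite !ppowE// /minsq normrM e1 mul1r (gtr0_norm r0) -(real_normK (num_real (e * r))).
rewrite normrM e1 mul1r (gtr0_norm r0) (_ : - (g - 1) - 1 = - g - 1 + 1); last by ring.
rewrite -mulr_powR// mulrC -mulrA mulrCA ler_wpM2l ?powR_ge0//.
rewrite ge_min; have [r1|r1] := leP r 1; first by rewrite expr2 lexx.
by rewrite mulr1 lexx orbT.
Qed.

Lemma integral_reflect (h : R -> \bar R) : measurable_fun setT h -> (forall x, 0 <= h x)%E ->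
  (\int[leb]_x h (- x)%R = \int[leb]_x h x)%E.
Proof.
move=> mh h0.
have mN : measurable_fun setT (-%R : measurableTypeR R -> measurableTypeR R) by [].
transitivity (\int[measure_function_pushforward__canonical__measure_function_Measure leb mN]_x h x)%E.
  by apply/esym; exact: (ge0_integral_pushforward mN).
by apply: eq_measure_integral => A mA _; exact: lebesgue_measureN.
Qed.

Lemma integral_Mt_fin : (\int[leb]_x (Mt x `^ g)%:E < +oo)%E.
Proof.
(* On [-1, 1] the function is at most 1; further out it is at most 4^g |x|^-g,
   which is pdom there. *)
pose D (x : R) : R := 4 `^ g * (pdom (g - 1) x + pdom (g - 1) (- x)) + \1_(`[-1, 1]%classic) x.
have mp := @measurable_pdom R (g - 1).
have mpn : measurable_fun setT (fun x : R => pdom (g - 1) (- x)).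
  exact: (measurableT_comp mp).
have p0 x : (0 <= (pdom (g - 1) x)%:E :> \bar R)%E by rewrite lee_fin pdom_ge0.
have jp := integrable_pdom b01.
have jn : leb.-integrable setT (EFin \o (fun x : R => pdom (g - 1) (- x))).
  apply/integrableP; split; first exact/measurable_EFinP.
  have /integrableP[_] := jp; apply: le_lt_trans; rewrite -[leRHS]integral_reflect.
  - by rewrite le_eqVlt; apply/orP; left; apply/eqP; exact: eq_integral.
  - by apply: measurableT_comp => //; exact/measurable_EFinP.
  - by move=> x /=; rewrite lee_fin.
have ji : leb.-integrable setT (EFin \o (\1_(`[-1, 1]%classic : set R) : R -> R)).
  exact: (@integrable_indic_itv R (-1) 1 true false).
have jD : leb.-integrable setT (EFin \o D).
  exact: (integrable_add (integrable_scale (4 `^ g) (integrable_add jp jn)) ji).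
have mM : measurable_fun setT (fun x : R => Mt x `^ g).
  exact: (measurableT_comp (measurable_powR g) measurable_Mt).
have jM : leb.-integrable setT (EFin \o (fun x => Mt x `^ g)).
  apply: (@integrable_dominated _ _ R leb _ D) => // x.
  rewrite ger0_norm ?powR_ge0// /D.
  have i0 : 0 <= \1_(`[-1, 1]%classic : set R) x :> R by [].
  have n0 := @pdom_ge0 R (g - 1) x; have n1 := @pdom_ge0 R (g - 1) (- x).
  have f0 : 0 <= 4 `^ g :> R by exact: powR_ge0.
  have [x1|x1] := leP `|x| 1.
    have -> : \1_(`[-1, 1]%classic : set R) x = 1 :> R.
      by rewrite indicE mem_set//= in_itv/= -ler_norml.
    rewrite ler_wpDl ?mulr_ge0 ?addr_ge0//.
    have -> : 1 = 1 `^ g :> R by rewrite powR1.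
    apply: ge0_ler_powR; rewrite ?nnegrE ?(ltW g0) ?(ltW (Mt_gt0 x))//.
    rewrite /Mt ler_pdivrMr ?max4_gt0// mul1r le_max lexx orbT//.
  have x0 : 0 < `|x| by exact: lt_trans x1.
  have pd : Mt x `^ g <= 4 `^ g * pdom (g - 1) `|x|.
    rewrite /pdom ppowE// min_r ?(ltW x1)// mulr1 (_ : - (g - 1) - 1 = - g); last by ring.
    have -> : 4 `^ g * `|x| `^ (- g) = (4 / `|x|) `^ g.
      by rewrite powRM ?invr_ge0// -(powR_inv1 (normr_ge0 x)) -powRrM mulN1r.
    apply: ge0_ler_powR; rewrite ?nnegrE ?(ltW g0) ?(ltW (Mt_gt0 x)) ?divr_ge0//.
    by rewrite /Mt ler_pM2l// lef_pV2 ?posrE ?max4_gt0// le_max lexx.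
  apply: le_trans pd _; rewrite ler_wpDr// ler_wpM2l//.
  by case: (ger0P x) => _; rewrite ?lerDl ?lerDr.
rewrite -ge0_fin_numE; first exact: integrable_fin_num jM.
by apply: integral_ge0 => x _; rewrite lee_fin powR_ge0.
Qed.

Lemma integral_Mt2_fin (A : R) : 0 <= A ->
  (\int[pl]_x ((A * (Mt x.1 * Mt x.2)) `^ g)%:E < +oo)%E.
Proof.
move=> A0.
have mM : measurable_fun setT (fun x : R => Mt x `^ g).
  exact: (measurableT_comp (measurable_powR g) measurable_Mt).
pose G (x : PT) := ((A * (Mt x.1 * Mt x.2)) `^ g)%:E.
have GE (x : PT) : G x = ((A `^ g * Mt x.1 `^ g)%:E * (Mt x.2 `^ g)%:E)%E.
  by rewrite /G powRM ?mulr_ge0 ?(ltW (Mt_gt0 _))// powRM ?(ltW (Mt_gt0 _))// mulrA EFinM.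
have mG : measurable_fun setT G.
  rewrite (_ : G = fun x : PT => ((A `^ g * Mt x.1 `^ g)%:E * (Mt x.2 `^ g)%:E)%E).
    apply: emeasurable_funM; apply/measurable_EFinP.
      by apply: measurable_funM => //; exact: (measurableT_comp mM measurable_fst).
    exact: (measurableT_comp mM measurable_snd).
  by apply/funext.
have G0 x : (0 <= G x)%E by rewrite lee_fin powR_ge0.
have E := @fubini_tonelli1 _ _ (measurableTypeR R) (measurableTypeR R) R leb leb G mG G0.
have -> : (\int[pl]_x G x = \int[leb]_x \int[leb]_y G (x, y))%E by exact: E.
have M0 : (0 <= \int[leb]_x (Mt x `^ g)%:E)%E.
  by apply: integral_ge0 => x _; rewrite lee_fin powR_ge0.
rewrite (eq_integral (fun x : measurableTypeR R => (A `^ g * Mt x `^ g)%:E * \int[leb]_y (Mt y `^ g)%:E)%E); last first.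
  move=> x _; rewrite -ge0_integralZl//.
  - by apply: eq_integral => y _; rewrite GE.
  - exact/measurable_EFinP.
  - by move=> y _; rewrite lee_fin powR_ge0.
  - by rewrite lee_fin mulr_ge0 ?powR_ge0.
rewrite ge0_integralZr//; last 2 first.
- by apply/measurable_EFinP; exact: measurable_funM.
- by move=> x _; rewrite lee_fin mulr_ge0 ?powR_ge0.
rewrite lte_mul_pinfty//; last exact: integral_Mt_fin.
- by apply: integral_ge0 => x _; rewrite lee_fin mulr_ge0 ?powR_ge0.
rewrite ge0_fin_numE; last by apply: integral_ge0 => x _; rewrite lee_fin mulr_ge0 ?powR_ge0.
rewrite (eq_integral (fun x : measurableTypeR R => (A `^ g)%:E * (Mt x `^ g)%:E)%E); last by move=> x _; rewrite EFinM.
rewrite ge0_integralZl//; last 3 first.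
- exact/measurable_EFinP.
- by move=> x _; rewrite lee_fin powR_ge0.
- by rewrite lee_fin powR_ge0.
by rewrite lte_mul_pinfty ?lee_fin ?powR_ge0//; exact: integral_Mt_fin.
Qed.

End domination.

(** * Domination and convergence of the characteristic exponents *)

Section exponents.
Context {R : realType}.
Local Notation leb := (@lebesgue_measure R).
Local Notation leb2 := (@leb2 R).
Local Notation PT := (measurableTypeR R * measurableTypeR R)%type.
Local Notation MM := (@pl R \x @pl R)%E.
Variables (g c cf : R) (f1 f2 : R -> R).
Hypothesis g12 : 1 < g < 2.
Hypothesis c0 : 0 < c.
Hypothesis cf0 : 0 < cf.
Hypothesis mf1 : measurable_fun setT f1.
Hypothesis mf2 : measurable_fun setT f2.
Hypothesis f10 : forall u, 0 <= f1 u.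
Hypothesis f20 : forall u, 0 <= f2 u.
Hypothesis f1neg : forall u, u <= 0 -> f1 u = 0.
Hypothesis f2neg : forall u, u <= 0 -> f2 u = 0.
Hypothesis f1_le : forall u, 0 < u -> f1 u <= cf * u `^ (- g - 1).
Hypothesis m2_fin : (\int[leb]_s (s `^ g * f2 s)%:E < +oo)%E.

Let g0 : 0 < g. Proof. by case/andP: g12 => h _; exact: lt_trans ltr01 h. Qed.

Definition mt (x : R * R) : R := Mt x.1 * Mt x.2.

Lemma mt_gt0 x : 0 < mt x. Proof. by rewrite mulr_gt0// Mt_gt0. Qed.

Lemma measurable_mt : measurable_fun setT mt.
Proof.
by apply: measurable_funM; [exact: (measurableT_comp measurable_Mt measurable_fst)
  |exact: (measurableT_comp measurable_Mt measurable_snd)].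
Qed.

(** Dominates every integrand below; it does not depend on rho and kappa. *)
Definition dom (A : R) (z : (R * R) * (R * R)) : R :=
  2 * cf * (minsq (z.2.1 * z.2.2 * (A * mt z.1)) * (ppow (- g - 1) z.2.1 * f2 z.2.2)).

Lemma measurable_dom A : measurable_fun setT (dom A).
Proof.
have m2 : measurable_fun setT (fun z : (R * R) * (R * R) => z.2) by exact: measurable_snd.
have m21 : measurable_fun setT (fun z : (R * R) * (R * R) => z.2.1).
  exact: (measurableT_comp measurable_fst m2).
have m22 : measurable_fun setT (fun z : (R * R) * (R * R) => z.2.2).
  exact: (measurableT_comp measurable_snd m2).
apply: measurable_funM => //; apply: measurable_funM.
  apply: (measurableT_comp measurable_minsq); apply: measurable_funM; first exact: measurable_funM.
  by apply: measurable_funM => //; exact: (measurableT_comp measurable_mt measurable_fst).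
apply: measurable_funM; first exact: (measurableT_comp (measurable_ppow _) m21).
exact: (measurableT_comp mf2 m22).
Qed.

Let kern_ge0 (A : R) (z : (R * R) * (R * R)) :
  0 <= minsq (z.2.1 * z.2.2 * (A * mt z.1)) * (ppow (- g - 1) z.2.1 * f2 z.2.2).
Proof.
by apply: mulr_ge0; [exact: minsq_ge0|apply: mulr_ge0; [exact: ppow_ge0|exact: f20]].
Qed.

Lemma dom_ge0 A z : 0 <= dom A z.
Proof. by apply: mulr_ge0; [rewrite mulr_ge0// ltW|exact: kern_ge0]. Qed.

Lemma integral_dom (A : R) : 0 <= A ->
  (\int[MM]_z (dom A z)%:E = (2 * cf)%:E * ((\int[leb]_s (s `^ g * f2 s)%:E) *
     (Wint g minsq 1 * \int[pl]_x ((A * mt x) `^ g)%:E)))%E.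
Proof.
move=> A0.
have mk : measurable_fun setT (fun x => A * mt x) by apply: measurable_funM => //; exact: measurable_mt.
have := power_integral g0 measurable_minsq minsq_ge0 minsq0 mk mf2 f20 f2neg.
have -> : (\int[pl]_x (Num.max (- (A * mt x)) 0 `^ g)%:E = 0)%E.
  apply: integral0_eq => x _; rewrite max_r ?oppr_le0 ?mulr_ge0 ?(ltW (mt_gt0 _))//.
  by rewrite powR0// gt_eqF.
rewrite mule0 adde0.
have -> : (\int[pl]_x (Num.max (A * mt x) 0 `^ g)%:E = \int[pl]_x ((A * mt x) `^ g)%:E)%E.
  by apply: eq_integral => x _; rewrite max_l// mulr_ge0// ltW// mt_gt0.
move=> <-; rewrite -ge0_integralZl//; last 3 first.
- have := measurable_dom A; rewrite /dom => mD.
  have : measurable_fun setT (fun z => (2 * cf)^-1 * dom A z) by exact: measurable_funM.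
  by move=> h; apply/measurable_EFinP; apply: eq_measurable_fun h => z _;
    rewrite /dom mulKf// mulf_neq0 ?gt_eqF.
- by move=> z _; rewrite lee_fin; exact: kern_ge0.
- by rewrite lee_fin mulr_ge0// ltW.
Qed.

Lemma integrable_dom (A : R) : 0 <= A -> MM.-integrable setT (EFin \o dom A).
Proof.
move=> A0; apply/integrableP; split; first by apply/measurable_EFinP; exact: measurable_dom.
rewrite (eq_integral (fun z : PT * PT => (dom A z)%:E)); last first.
  by move=> z _ /=; rewrite ger0_norm// dom_ge0.
rewrite integral_dom//.
have W0 := @Wint_ge0 R g minsq minsq_ge0 1.
have Wf := Wint_minsq_fin g12 (normr1 R).
have If := integral_Mt2_fin g12 A0.
have I0 : (0 <= \int[pl]_x ((A * mt x) `^ g)%:E)%E.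
  by apply: integral_ge0 => x _; rewrite lee_fin powR_ge0.
have M0 : (0 <= \int[leb]_s (s `^ g * f2 s)%:E)%E.
  by apply: integral_ge0 => s _; rewrite lee_fin mulr_ge0 ?powR_ge0.
have p1 : (Wint g minsq 1 * \int[pl]_x ((A * mt x) `^ g)%:E < +oo)%E.
  by rewrite lte_mul_pinfty// ge0_fin_numE.
have p2 : ((\int[leb]_s (s `^ g * f2 s)%:E) *
     (Wint g minsq 1 * \int[pl]_x ((A * mt x) `^ g)%:E) < +oo)%E.
  by rewrite lte_mul_pinfty// ge0_fin_numE.
by rewrite lte_mul_pinfty// lee_fin mulr_ge0// ltW.
Qed.

Lemma Rintegral_dom_scale (A : R) : 0 <= A ->
  \int[MM]_z dom A z = A `^ g * \int[MM]_z dom 1 z.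
Proof.
move=> A0; rewrite /Rintegral !integral_dom//.
set M := (\int[leb]_s _)%E; set W := Wint _ _ _.
have -> : (\int[pl]_x ((A * mt x) `^ g)%:E = (A `^ g)%:E * \int[pl]_x ((1 * mt x) `^ g)%:E)%E.
  rewrite -ge0_integralZl//; last 3 first.
  - apply/measurable_EFinP; apply: (measurableT_comp (measurable_powR g)).
    by apply: measurable_funM => //; exact: measurable_mt.
  - by move=> x _; rewrite lee_fin powR_ge0.
  - by rewrite lee_fin powR_ge0.
  by apply: eq_integral => x _; rewrite -EFinM mul1r powRM// ltW// mt_gt0.
rewrite (muleCA W) (muleCA M) (muleCA (2 * cf)%:E).
have : ((2 * cf)%:E * (M * (W * \int[pl]_x ((1 * mt x) `^ g)%:E)))%E \is a fin_num.
  by rewrite -integral_dom//; exact: integrable_fin_num (integrable_dom ler01).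
by case: (_ * _)%E.
Qed.

Section one_measure.
Variables (f : R * R -> R) (K : R).
Hypothesis cf_ : continuous f.
Hypothesis jf : leb2.-integrable setT (EFin \o f).
Hypothesis fK : forall y, `|f y| <= K * (wt y.1 * wt y.2).

Let K0 : 0 <= K.
Proof.
have := le_trans (normr_ge0 _) (fK (0, 0)).
by rewrite pmulr_lge0// mulr_gt0// wt_gt0.
Qed.

(** The integrand of the normalized field, for kappa = lambda^(1/g). *)
Definition theta (rho kappa : R) (z : (R * R) * (R * R)) : R :=
  phi f z / (c * kappa * rho ^+ 2).

(** In the variables r and s with u = (rho kappa r, rho s), the density of the
    intensity is weight, which tends to r^(-g-1) f2 s, and theta tends to
    r s f(x) / c. *)
Definition rescale (rho kappa : R) (z : (R * R) * (R * R)) : (R * R) * (R * R) :=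
  (z.1, (rho * (kappa * z.2.1), rho * z.2.2)).

Definition weight (kappa : R) (z : (R * R) * (R * R)) : R :=
  kappa `^ g * kappa * f1 (kappa * z.2.1) * f2 z.2.2.

Lemma theta_le (rho kappa : R) z : 0 < rho -> 0 < kappa -> 0 < z.2.1 -> 0 < z.2.2 ->
  `|theta rho kappa (rescale rho kappa z)| <= z.2.1 * z.2.2 * (K / c * mt z.1).
Proof.
move=> r0 k0 z1 z2; rewrite /theta normrM normfV.
have d0 : 0 < c * kappa * rho ^+ 2 by rewrite !mulr_gt0// exprn_gt0.
rewrite (gtr0_norm d0) ler_pdivrMr//.
have h1 : 0 < (rho * (kappa * z.2.1), rho * z.2.2).1 by rewrite /= !mulr_gt0.
have h2 : 0 < (rho * (kappa * z.2.1), rho * z.2.2).2 by rewrite /= !mulr_gt0.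
apply: le_trans (norm_phi_le jf fK z.1 h1 h2) _ => /=.
rewrite le_eqVlt; apply/orP; left; apply/eqP; rewrite /mt; field; exact: lt0r_neq0.
Qed.

Lemma weight_le (kappa : R) z : 0 < kappa ->
  0 <= weight kappa z <= cf * (ppow (- g - 1) z.2.1 * f2 z.2.2).
Proof.
move=> k0; rewrite /weight !mulr_ge0 ?powR_ge0 ?(ltW k0)//= mulrA ler_wpM2r//.
have [r0|r0] := leP z.2.1 0.
  by rewrite f1neg ?pmulr_rle0// mulr0 mulr_ge0 ?ppow_ge0// ltW.
rewrite ppowE//; have kr : 0 < kappa * z.2.1 by rewrite mulr_gt0.
apply: (@le_trans _ _ (kappa `^ g * kappa * (cf * (kappa * z.2.1) `^ (- g - 1)))).
  by rewrite ler_wpM2l ?mulr_ge0 ?powR_ge0 ?(ltW k0)//; exact: f1_le.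
rewrite powRM ?(ltW k0) ?(ltW r0)//.
rewrite (_ : kappa `^ g * kappa * _ = cf * (kappa `^ g * (kappa * kappa `^ (- g - 1))) * z.2.1 `^ (- g - 1)); last by ring.
rewrite mulr_powR// (_ : - g - 1 + 1 = - g); last by ring.
by rewrite powRN mulfV ?mulr1// gt_eqF// powR_gt0.
Qed.

Variable Psi : R -> R.
Hypothesis cPsi : continuous Psi.
Hypothesis Psi0 : forall x, 0 <= Psi x.
Hypothesis Psi_le : forall x, Psi x <= 2 * minsq x.

Let mPsi : measurable_fun setT Psi. Proof. exact: continuous_measurable_fun. Qed.

Lemma exponent_dom (t rho kappa : R) z : 0 < rho -> 0 < kappa ->
  0 <= Psi (t * theta rho kappa (rescale rho kappa z)) * weight kappa z <=
  dom (`|t| * (K / c)) z.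
Proof.
move=> r0 k0; have /andP[w0 wle] := weight_le z k0.
rewrite mulr_ge0//=.
have [z1|z1] := leP z.2.1 0.
  by rewrite /weight f1neg ?pmulr_rle0// mulr0 mul0r mulr0 dom_ge0.
have [z2|z2] := leP z.2.2 0.
  by rewrite /weight f2neg// !mulr0 dom_ge0.
rewrite /dom mulrACA; apply: ler_pM => //.
apply: le_trans (Psi_le _) _; rewrite ler_wpM2l//; apply: minsq_le.
rewrite normrM (_ : z.2.1 * z.2.2 * _ = `|t| * (z.2.1 * z.2.2 * (K / c * mt z.1))); last by ring.
by rewrite ler_wpM2l//; exact: theta_le.
Qed.

Let phi_meas := measurable_phi cf_ jf.

Lemma measurable_theta rho kappa : measurable_fun setT (theta rho kappa).
Proof. by apply: measurable_funM. Qed.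

Lemma measurable_rescale rho kappa : measurable_fun setT (rescale rho kappa).
Proof.
have m2 : measurable_fun setT (fun z : (R * R) * (R * R) => z.2) by exact: measurable_snd.
have m21 : measurable_fun setT (fun z : (R * R) * (R * R) => z.2.1).
  exact: (measurableT_comp measurable_fst m2).
have m22 : measurable_fun setT (fun z : (R * R) * (R * R) => z.2.2).
  exact: (measurableT_comp measurable_snd m2).
apply/measurable_fun_pairP; split; first exact: measurable_fst.
apply/measurable_fun_pairP; split => /=; last exact: measurable_funM.
by apply: measurable_funM => //; exact: measurable_funM.
Qed.

Lemma measurable_weight kappa : measurable_fun setT (weight kappa).
Proof.
have m2 : measurable_fun setT (fun z : (R * R) * (R * R) => z.2) by exact: measurable_snd.
have m21 : measurable_fun setT (fun z : (R * R) * (R * R) => z.2.1).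
  exact: (measurableT_comp measurable_fst m2).
have m22 : measurable_fun setT (fun z : (R * R) * (R * R) => z.2.2).
  exact: (measurableT_comp measurable_snd m2).
apply: measurable_funM; last exact: (measurableT_comp mf2 m22).
apply: measurable_funM => //; apply: (measurableT_comp mf1); exact: measurable_funM.
Qed.

Definition integrand (t rho kappa : R) (z : (R * R) * (R * R)) : R :=
  Psi (t * theta rho kappa (rescale rho kappa z)) * weight kappa z.

Lemma measurable_integrand t rho kappa : measurable_fun setT (integrand t rho kappa).
Proof.
apply: measurable_funM; last exact: measurable_weight.
apply: (measurableT_comp mPsi); apply: measurable_funM => //.
exact: (measurableT_comp (measurable_theta _ _) (measurable_rescale _ _)).
Qed.

(** The bound is uniform in rho and kappa and of order |t|^g: this is the source
    of tightness. *)
Lemma integrable_integrand (t rho kappa : R) : 0 < rho -> 0 < kappa ->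
  MM.-integrable setT (EFin \o integrand t rho kappa) /\
  \int[MM]_z integrand t rho kappa z <= (`|t| * (K / c)) `^ g * \int[MM]_z dom 1 z.
Proof.
move=> r0 k0; have A0 : 0 <= `|t| * (K / c) by rewrite mulr_ge0// divr_ge0// ltW.
have jd := integrable_dom A0.
have ji : MM.-integrable setT (EFin \o integrand t rho kappa).
  apply: (@integrable_dominated _ _ R MM _ (dom (`|t| * (K / c)))) => //.
    exact: measurable_integrand.
  by move=> z; have /andP[h1 h2] := exponent_dom t z r0 k0; rewrite ger0_norm.
split => //; rewrite -Rintegral_dom_scale//; apply: Rintegral_ge0_le => //.
by move=> z; have /andP[h1 h2] := exponent_dom t z r0 k0.
Qed.

Definition limit_integrand (z : (R * R) * (R * R)) : R :=
  Psi (z.2.1 * z.2.2 * (f z.1 / c)) * (ppow (- g - 1) z.2.1 * f2 z.2.2).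

(** Dominated convergence; the rectangle of edges rho kappa r and rho s shrinks
    to its centre. *)
Lemma exponent_cvg (rho kappa : nat -> R) :
  f1 u / u `^ (- g - 1) @[u --> +oo] --> (1 : R) ->
  (forall n, 0 < rho n) -> (forall n, 0 < kappa n) ->
  kappa n @[n --> \oo] --> +oo -> rho n @[n --> \oo] --> (0 : R) ->
  rho n * kappa n @[n --> \oo] --> (0 : R) ->
  MM.-integrable setT (EFin \o limit_integrand) /\
  \int[MM]_z integrand 1 (rho n) (kappa n) z @[n --> \oo] --> \int[MM]_z limit_integrand z.
Proof.
move=> f1t r0 k0 koo rc rkc.
have A0 : 0 <= `|1 : R| * (K / c) by rewrite mulr_ge0// divr_ge0// ltW.
apply: (@Rintegral_dominated_cvg _ _ R MM _ _ (dom (`|1 : R| * (K / c)))).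
- by move=> n; exact: measurable_integrand.
- move=> z; rewrite /limit_integrand.
  have [z1|z1] := leP z.2.1 0.
    rewrite ppow0// mul0r mulr0; apply: cvg_near_cst; apply: nearW => n.
    by rewrite /integrand /weight f1neg ?pmulr_rle0// mulr0 mul0r mulr0.
  have [z2|z2] := leP z.2.2 0.
    rewrite f2neg// !mulr0; apply: cvg_near_cst; apply: nearW => n.
    by rewrite /integrand /weight f2neg// !mulr0.
  have cw : weight (kappa n) z @[n --> \oo] --> ppow (- g - 1) z.2.1 * f2 z.2.2.
    apply: cvgM; last exact: cvg_cst.
    have koo' : kappa n * z.2.1 @[n --> \oo] --> +oo.
      apply/cvgryPge => A; move/cvgryPge : koo => /(_ (A / z.2.1)); apply: filterS => n.
      by rewrite ler_pdivrMr.
    have H : f1 (kappa n * z.2.1) / (kappa n * z.2.1) `^ (- g - 1) @[n --> \oo] --> (1 : R).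
      exact: (cvg_comp _ _ koo' f1t).
    have H2 : (f1 (kappa n * z.2.1) / (kappa n * z.2.1) `^ (- g - 1)) * z.2.1 `^ (- g - 1)
       @[n --> \oo] --> 1 * z.2.1 `^ (- g - 1).
      by apply: cvgM; [exact: H|exact: cvg_cst].
    rewrite ppowE//; apply: cvg_congr H2 _ _; last by rewrite mul1r.
    move=> n /=; have kn := k0 n; rewrite powRM ?(ltW kn) ?(ltW z1)//.
    have p1 : 0 < kappa n `^ (- g - 1) by rewrite powR_gt0.
    have p2 : 0 < z.2.1 `^ (- g - 1) by rewrite powR_gt0.
    have E : kappa n `^ g * kappa n = (kappa n `^ (- g - 1))^-1.
      by rewrite -powRN opprB opprK addrC mulrC mulr_powR.
    by rewrite E; field; rewrite !lt0r_neq0.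
  have ct : 1 * theta (rho n) (kappa n) (rescale (rho n) (kappa n) z) @[n --> \oo] -->
      z.2.1 * z.2.2 * (f z.1 / c).
    have a0 n : 0 < rho n * (kappa n * z.2.1) by rewrite !mulr_gt0.
    have b0 n : 0 < rho n * z.2.2 by rewrite mulr_gt0.
    have ca : rho n * (kappa n * z.2.1) @[n --> \oo] --> (0 : R).
      have H : (rho n * kappa n) * z.2.1 @[n --> \oo] --> 0 * z.2.1.
        by apply: cvgM; [exact: rkc|exact: cvg_cst].
      by apply: cvg_congr H _ _; [move=> n; rewrite mulrA|rewrite mul0r].
    have cb : rho n * z.2.2 @[n --> \oo] --> (0 : R).
      have H : rho n * z.2.2 @[n --> \oo] --> 0 * z.2.2.
        by apply: cvgM; [exact: rc|exact: cvg_cst].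
      by apply: cvg_congr H _ _; [move=> n|rewrite mul0r].
    have H := phi_average cf_ jf (x := z.1) a0 b0 ca cb.
    have H2 : phi f (z.1, (rho n * (kappa n * z.2.1), rho n * z.2.2)) /
        (rho n * (kappa n * z.2.1) * (rho n * z.2.2)) * (z.2.1 * z.2.2 / c)
        @[n --> \oo] --> f z.1 * (z.2.1 * z.2.2 / c).
      by apply: cvgM; [exact: H|exact: cvg_cst].
    apply: cvg_congr H2 _ _; last by ring.
    move=> n; rewrite /theta /rescale mul1r.
    have rn := r0 n; have kn := k0 n.
    by field; rewrite !lt0r_neq0.
  apply: cvgM; last exact: cw.
  by apply: continuous_cvg; [exact: cPsi|exact: ct].
- exact: integrable_dom.
move=> n z; have /andP[h1 h2] := exponent_dom 1 z (r0 n) (k0 n).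
by rewrite ger0_norm.
Qed.

End one_measure.
End exponents.

(** * Moments of the edge lengths *)

Section moments.
Context {R : realType}.
Local Notation leb := (@lebesgue_measure R).

Lemma integral_gt0_itv (h : R -> R) (a b e : R) : measurable_fun setT h -> (forall x, 0 <= h x) ->
  a < b -> 0 < e -> (forall x, a <= x <= b -> e <= h x) ->
  (0 < \int[leb]_x (h x)%:E)%E.
Proof.
move=> mh h0 ab e0 he.
apply: (@lt_le_trans _ _ (\int[leb]_x (e * \1_(`[a, b]%classic : set R) x)%:E)%E).
  under eq_integral do rewrite EFinM.
  rewrite ge0_integralZl//; last by rewrite lee_fin ltW.
    rewrite integral_indic//.
    have L : leb `[a, b]%classic = (b - a)%:E by rewrite lebesgue_measure_itv/= lte_fin ab -EFinB.
    rewrite setIT (_ : (_ * _ = e%:E * leb `[a, b]%classic)%E)// L -EFinM lte_fin.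
    by rewrite mulr_gt0// subr_gt0.
  by apply/measurable_EFinP; apply: measurable_indic; exact: measurable_itv.
apply: ge0_le_integral => //.
- by move=> x _; rewrite lee_fin mulr_ge0// ltW.
- by apply/measurable_EFinP; exact: measurable_funM.
- exact/measurable_EFinP.
move=> x _; rewrite lee_fin indicE; case: (boolP (x \in _)) => [/set_mem|_].
  by rewrite /= in_itv/= mulr1 => /he.
by rewrite mulr0.
Qed.

Variables (g g2 : R) (f2 : R -> R).
Hypothesis g1 : 1 < g.
Hypothesis gg2 : g < g2.
Hypothesis mf2 : measurable_fun setT f2.
Hypothesis f20 : forall u, 0 <= f2 u.
Hypothesis f2neg : forall u, u <= 0 -> f2 u = 0.
Hypothesis f2t : f2 u / u `^ (- g2 - 1) @[u --> +oo] --> (1 : R).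

Let msf : measurable_fun setT (fun s => s `^ g * f2 s).
Proof. by apply: measurable_funM => //; exact: measurable_powR. Qed.

Let msf0 s : 0 <= s `^ g * f2 s. Proof. by rewrite mulr_ge0 ?powR_ge0. Qed.

Let tail : exists2 A : R, 1 <= A & forall u, A <= u ->
  2^-1 * u `^ (- g2 - 1) <= f2 u <= 2 * u `^ (- g2 - 1).
Proof.
have h0 : 0 < 2^-1 :> R by rewrite invr_gt0.
move/cvgrPdist_lt : f2t => /(_ _ h0) [A [_ HA]].
exists (Num.max 1 (A + 1)); first by rewrite le_max lexx.
move=> u; rewrite ge_max => /andP[u1 uA].
have u0 : 0 < u by exact: lt_le_trans u1.
have p0 : 0 < u `^ (- g2 - 1) by rewrite powR_gt0.
have : `|1 - f2 u / u `^ (- g2 - 1)| < 2^-1 by apply: HA; rewrite (lt_le_trans _ uA)// ltrDl.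
rewrite ltr_norml => /andP[h1 h2].
by rewrite -(divfK (lt0r_neq0 p0) (f2 u)) !ler_pM2r//; apply/andP; split; lra.
Qed.

Lemma moment_gt0 : (0 < \int[leb]_s (s `^ g * f2 s)%:E)%E.
Proof.
have [A A1 HA] := tail.
have A0 : 0 < A by exact: lt_le_trans A1.
apply: (@integral_gt0_itv _ A (A + 1) (2^-1 * (A + 1) `^ (- g2 - 1))) => //.
- by rewrite ltrDl.
- by rewrite mulr_gt0 ?invr_gt0// powR_gt0// addr_gt0.
move=> x /andP[Ax xA]; have x0 : 0 < x by exact: lt_le_trans Ax.
have /andP[h _] := HA _ Ax.
have h1 : 2^-1 * (A + 1) `^ (- g2 - 1) <= f2 x.
  apply: le_trans h; rewrite ler_wpM2l ?invr_ge0//.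
  rewrite (_ : - g2 - 1 = - (g2 + 1)); last by ring.
  have g20 : 0 <= g2 + 1 by rewrite addr_ge0// ltW// (lt_trans _ gg2)// (lt_trans ltr01 g1).
  rewrite !powRN lef_pV2 ?posrE ?powR_gt0 ?addr_gt0//.
  by apply: ge0_ler_powR => //; rewrite nnegrE ltW// addr_gt0.
apply: le_trans h1 _; rewrite ler_peMl//.
have -> : 1 = x `^ 0 :> R by rewrite powRr0.
by apply: ler_powR; [exact: le_trans Ax|rewrite ltW// (lt_trans ltr01 g1)].
Qed.

(** Below A the g-th power is at most A^(g-1) times s; beyond A the tail of f2
    makes s^g f2 s decay faster than 1 / s. *)
Lemma moment_fin : (\int[leb]_s (s * f2 s)%:E < +oo)%E ->
  (\int[leb]_s (s `^ g * f2 s)%:E < +oo)%E.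
Proof.
move=> mean; have [A A1 HA] := tail.
have A0 : 0 < A by exact: lt_le_trans A1.
(* The exponent has to be below 1 for pdom and at most g2 - g for the tail. *)
pose be := Num.min (g2 - g) (2^-1).
have be01 : 0 < be < 1.
  rewrite /be lt_min subr_gt0 gg2 invr_gt0 ltr0n/= gt_min; apply/orP; right; lra.
pose D s : R := A `^ (g - 1) * (s * f2 s) + 2 * pdom be s.
have ms : measurable_fun setT (fun s : R => s * f2 s) by exact: measurable_funM.
have s0 s : 0 <= s * f2 s.
  by have [h|h] := leP s 0; [rewrite f2neg// mulr0|rewrite mulr_ge0// ltW].
have jm : leb.-integrable setT (EFin \o (fun s => s * f2 s)).
  apply/integrableP; split; first exact/measurable_EFinP.
  apply: le_lt_trans mean; rewrite le_eqVlt; apply/orP; left; apply/eqP.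
  by apply: eq_integral => s _ /=; rewrite ger0_norm.
have jD : leb.-integrable setT (EFin \o D).
  exact: (integrable_add (integrable_scale _ jm) (integrable_scale 2 (integrable_pdom be01))).
have j : leb.-integrable setT (EFin \o (fun s => s `^ g * f2 s)).
  apply: (@integrable_dominated _ _ R leb _ D) => // s; rewrite ger0_norm// /D.
  have p0 := @pdom_ge0 R be s.
  have [h|h] := leP s 0; first by rewrite f2neg// !mulr0 add0r mulr_ge0.
  have [sA|sA] := leP s A.
    apply: (@le_trans _ _ (A `^ (g - 1) * (s * f2 s))); last by rewrite lerDl mulr_ge0.
    rewrite mulrA ler_wpM2r//.
    have -> : s `^ g = s `^ (g - 1) * s by rewrite mulrC mulr_powR// subrK.
    rewrite ler_wpM2r ?(ltW h)//; apply: ge0_ler_powR; rewrite ?nnegrE ?(ltW h) ?(ltW A0)//.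
    by rewrite subr_ge0 ltW.
  rewrite ler_wpDl ?(mulr_ge0 (powR_ge0 _ _) (s0 s))//.
  have /andP[_ h2] := HA _ (ltW sA).
  have s1 : 1 <= s by apply: le_trans A1 (ltW sA).
  rewrite /pdom ppowE// min_r// mulr1.
  apply: le_trans (ler_wpM2l (powR_ge0 _ _) h2) _.
  rewrite mulrCA ler_wpM2l// -gt0_powRD//; apply: ler_powR => //.
  have : be <= g2 - g by rewrite /be ge_min lexx.
  lra.
rewrite -ge0_fin_numE; first exact: integrable_fin_num j.
by apply: integral_ge0 => s _; rewrite lee_fin.
Qed.

End moments.

(** * The constants of the limit *)

Section values.
Context {R : realType}.
Local Notation leb := (@lebesgue_measure R).
Variable g : R.
Hypothesis g12 : 1 < g < 2.

Let b01 : 0 < g - 1 < 1.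
Proof. by case/andP: g12 => h1 h2; apply/andP; split; lra. Qed.

Definition psi1 (x : R) : R := 1 - cos x.
(** The function x - sin x takes both signs; limits are taken for its positive and
    its negative part. *)
Definition psi2 (x : R) : R := Num.max (x - sin x) 0.
Definition psi3 (x : R) : R := Num.max (sin x - x) 0.

Lemma psi1_ge0 x : 0 <= psi1 x. Proof. exact: subr1_cos_ge0. Qed.

Lemma psi2_ge0 x : 0 <= psi2 x. Proof. by rewrite le_max lexx orbT. Qed.

Lemma psi3_ge0 x : 0 <= psi3 x. Proof. by rewrite le_max lexx orbT. Qed.

Lemma continuous_psi1 : continuous psi1.
Proof. by move=> x; apply: cvgB; [exact: cvg_cst|exact: continuous_cos]. Qed.

Lemma continuous_pos_part (h : R -> R) : continuous h -> continuous (fun x => Num.max (h x) 0).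
Proof.
move=> ch x; have E (y : R) : Num.max y 0 = (y + `|y|) / 2.
  by rewrite maxr_absE subr0 addr0.
have -> : (fun x => Num.max (h x) 0) = (fun x => (h x + `|h x|) / 2).
  by apply/funext => y; exact: E.
apply: cvgM; last exact: cvg_cst.
by apply: cvgD; [exact: ch|apply: cvg_norm; exact: ch].
Qed.

Lemma continuous_psi2 : continuous psi2.
Proof.
apply: continuous_pos_part => x; apply: cvgB; [exact: cvg_id|exact: continuous_sin].
Qed.

Lemma continuous_psi3 : continuous psi3.
Proof.
apply: continuous_pos_part => x; apply: cvgB; [exact: continuous_sin|exact: cvg_id].
Qed.

Lemma psi1_le x : psi1 x <= 2 * minsq x.
Proof.
rewrite mulr_natl mulr2n ler_wpDl ?minsq_ge0// /minsq le_min.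
by rewrite subr1_cos_le_sqr subr1_cos_le_norm.
Qed.

Lemma subr_sin_minsq (x : R) : `|x - sin x| <= 2 * minsq x.
Proof.
rewrite /minsq minr_pMr// le_min norm_subr_sin_le_norm andbT.
apply: le_trans (norm_subr_sin_le_sqr x) _.
by rewrite mulr_natl mulr2n lerDl sqr_ge0.
Qed.

Lemma psi2_le x : psi2 x <= 2 * minsq x.
Proof.
rewrite /psi2 ge_max mulr_ge0 ?minsq_ge0// andbT.
exact: le_trans (ler_norm _) (subr_sin_minsq x).
Qed.

Lemma psi3_le x : psi3 x <= 2 * minsq x.
Proof.
rewrite /psi3 ge_max mulr_ge0 ?minsq_ge0// andbT.
by apply: le_trans (ler_norm _) _; rewrite distrC; exact: subr_sin_minsq.
Qed.

Lemma psi23 x : psi2 x - psi3 x = x - sin x.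
Proof. by rewrite /psi2 /psi3 -(opprB x) -pos_neg_parts. Qed.

Definition Kcos : R := - (Gamma (2 - g) / (g * (g - 1))) * cos (pi * g / 2).
Definition Ksin : R := Gamma (2 - g) / (g * (g - 1)) * sin (pi * g / 2).

Lemma Wint_fin (Psi : R -> R) e : measurable_fun setT Psi -> (forall x, 0 <= Psi x) ->
  (forall x, Psi x <= 2 * minsq x) -> `|e| = 1 ->
  leb.-integrable setT (EFin \o (fun r => Psi (e * r) * ppow (- g - 1) r)).
Proof.
move=> mP P0 Ple e1.
have mk (Q : R -> R) : measurable_fun setT Q ->
    measurable_fun setT (fun r : R => Q (e * r) * ppow (- g - 1) r).
  move=> mQ; apply: measurable_funM; last exact: measurable_ppow.
  by apply: (measurableT_comp mQ); exact: measurable_funM.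
have jm : leb.-integrable setT (EFin \o (fun r => minsq (e * r) * ppow (- g - 1) r)).
  apply/integrableP; split; first by apply/measurable_EFinP; apply: mk; exact: measurable_minsq.
  apply: le_lt_trans (Wint_minsq_fin g12 e1); rewrite le_eqVlt; apply/orP; left; apply/eqP.
  by apply: eq_integral => r _ /=; rewrite ger0_norm// mulr_ge0 ?minsq_ge0 ?ppow_ge0.
apply: (@integrable_dominated _ _ R leb _ (fun r => 2 * (minsq (e * r) * ppow (- g - 1) r))).
- exact: mk.
- move=> r; rewrite ger0_norm; last by rewrite mulr_ge0// ppow_ge0.
  by rewrite mulrA ler_wpM2r// ppow_ge0.
- exact: integrable_scale.
Qed.

Let mpsi (h : R -> R) : continuous h -> measurable_fun setT h.
Proof. by move=> ch; exact: continuous_measurable_fun. Qed.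

Lemma Wint_psi1 e : `|e| = 1 -> Wint g psi1 e = Kcos%:E.
Proof.
move=> e1; have j := Wint_fin (mpsi continuous_psi1) psi1_ge0 psi1_le e1.
rewrite /Wint -(EFin_Rintegral j) /Kcos -(integral_cos_power g12); congr EFin.
apply: eq_Rintegral => r _; rewrite /psi1; congr ((1 - _) * _).
have [e0|e0] := leP 0 e; move: e1; first by rewrite ger0_norm// => ->; rewrite mul1r.
by rewrite ltr0_norm// => /eqP; rewrite eqr_oppLR => /eqP ->; rewrite mulN1r cosN.
Qed.

Lemma Wint_psi2 : Wint g psi2 1 = Ksin%:E /\ Wint g psi2 (-1) = 0%E.
Proof.
have j := Wint_fin (mpsi continuous_psi2) psi2_ge0 psi2_le (normr1 R).
split.
  rewrite /Wint -(EFin_Rintegral j) /Ksin -(integral_sin_power g12); congr EFin.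
  apply: eq_Rintegral => r _; have [r0|r0] := leP r 0; first by rewrite ppow0// !mulr0.
  by rewrite mul1r /psi2 max_l// ge0_subr_sin// ltW.
apply: integral0_eq => r _; have [r0|r0] := leP r 0; first by rewrite ppow0// mulr0.
rewrite /psi2 max_r ?mul0r//; rewrite mulN1r sinN opprK addrC subr_le0.
by rewrite -subr_ge0 ge0_subr_sin// ltW.
Qed.

Lemma Wint_psi3 : Wint g psi3 1 = 0%E /\ Wint g psi3 (-1) = Ksin%:E.
Proof.
have [E1 E2] := Wint_psi2; rewrite -E1 -E2 /Wint.
have h x : psi3 x = psi2 (- x) by rewrite /psi3 /psi2 sinN opprK addrC.
by split; apply: eq_integral => r _; rewrite h !mul1r ?mulN1r ?opprK.
Qed.

Lemma Kcos_gt0 : 0 < Kcos.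
Proof.
rewrite -lte_fin -(Wint_psi1 (normr1 R)) /Wint.
have p0 := pi_gt0 R.
apply: (@integral_gt0_itv _ _ (pi / 2) pi (pi `^ (- g - 1))).
- apply: measurable_funM; last exact: measurable_ppow.
  by apply: (measurableT_comp (mpsi continuous_psi1)); exact: measurable_funM.
- by move=> r; rewrite mulr_ge0 ?ppow_ge0 ?psi1_ge0.
- by rewrite gtr_pMr// invf_lt1// ltr1n.
- by rewrite powR_gt0.
move=> r /andP[r1 r2].
have r0 : 0 < r by apply: lt_le_trans r1; rewrite divr_gt0.
rewrite ppowE// mul1r -[leLHS]mul1r; apply: ler_pM => //; first exact: powR_ge0.
  rewrite /psi1 -subr_ge0 addrAC subrr add0r oppr_ge0.
  have -> : r = (r - pi / 2) + pi / 2 by rewrite subrK.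
  rewrite cosDpihalf oppr_le0; apply: sin_ge0_pi; apply/andP; split; lra.
rewrite (_ : - g - 1 = - (g + 1)); last by ring.
have gg : 0 <= g + 1 by case/andP: g12 => h _; lra.
rewrite !powRN lef_pV2 ?posrE ?powR_gt0//.
by apply: ge0_ler_powR => //; rewrite nnegrE ltW.
Qed.

Lemma Ksin_Kcos : - (Ksin / Kcos) = tan (pi * g / 2).
Proof.
have := Kcos_gt0; rewrite /Ksin /Kcos /tan mulNr oppr_gt0.
set G := Gamma _ / _; set C := cos _ => GC.
have : G * C != 0 by rewrite lt_eqF.
rewrite mulf_eq0 negb_or => /andP[G0 C0].
field; by rewrite C0 G0.
Qed.

End values.

(** * Integrability of the covered mass *)

Section integrable_phi.
Context {R : realType}.
Local Notation leb := (@lebesgue_measure R).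
Local Notation leb2 := (@leb2 R).
Local Notation PT := (measurableTypeR R * measurableTypeR R)%type.
Variables (f : R * R -> R) (K : R).
Hypothesis cf : continuous f.
Hypothesis jf : leb2.-integrable setT (EFin \o f).

Let mphi := measurable_phi cf jf.
Let mf : measurable_fun setT f. Proof. exact: continuous_measurable_plane. Qed.

Lemma rect_sym (x y u : R * R) : rect x u y <-> rect y u x.
Proof.
rewrite /rect/= !in_itv/=; split => -[/andP[? ?] /andP[? ?]]; split; apply/andP; split; lra.
Qed.

(** The rectangles of a given size that cover a given point have their centres
    in a rectangle of that size. *)
Lemma integral_phi_le (v : R * R) : 0 < v.1 -> 0 < v.2 ->
  (\int[leb2]_x `|phi f (x, v)|%:E <= (v.1 * v.2)%:E * \int[leb2]_y `|f y|%:E)%E.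
Proof.
move=> v1 v2.
pose G (z : PT * PT) : \bar R := (`|f z.2| * \1_[set q : PT * PT | rect q.1 v q.2] z)%:E.
have mrect : measurable [set q : PT * PT | rect q.1 v q.2].
  have mp : measurable_fun setT (fun q : PT * PT => ((q.1, v), q.2) : ((R * R) * (R * R)) * (R * R)).
    have m1 : measurable_fun setT (fun q : PT * PT => (q.1, v) : (R * R) * (R * R)).
      apply/measurable_fun_pairP; split; first exact: (@measurable_fst _ _ PT PT).
      exact: measurable_cst.
    by apply/measurable_fun_pairP; split; [exact: m1|exact: measurable_snd].
  by have := mp measurableT _ measurable_rect_graph; rewrite setTI.
have G0 z : (0 <= G z)%E by rewrite lee_fin mulr_ge0.
have mG : measurable_fun setT G.
  apply/measurable_EFinP; apply: measurable_funM; last exact: measurable_indic.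
  by apply: measurableT_comp => //; exact: (measurableT_comp mf measurable_snd).
have GE (x y : PT) : G (x, y) = (`|f y|%:E * (\1_(rect y v) x)%:E)%E.
  rewrite /G -EFinM !indicE; congr ((_ * _%:R)%:E); congr nat_of_bool.
  by apply/idP/idP => /set_mem/= /rect_sym h; apply: mem_set.
have mI0 := @measurable_fun_fubini_tonelli_F _ _ PT PT R pl G mG G0.
have mI : measurable_fun setT (fun x : PT => \int[pl]_y G (x, y))%E by exact: mI0.
apply: (@le_trans _ _ (\int[pl]_x \int[pl]_y G (x, y))%E).
  apply: ge0_le_integral => //.
  - apply/measurable_EFinP; apply: measurableT_comp => //.
    exact: (measurableT_comp mphi (measurable_pair2 _)).
  move=> x _; rewrite phiE//.
  have jx : leb2.-integrable (rect x v) (EFin \o f).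
    by apply: integrableS jf => //; exact: measurable_rect.
  apply: (@le_trans _ _ (\int[leb2]_(y in rect x v) `|f y|)%:E).
    by rewrite lee_fin; apply: le_normr_Rintegral jx; exact: measurable_rect.
  rewrite /Rintegral fineK; last first.
    by apply: integrable_fin_num; [exact: measurable_rect|exact: integrable_norm jx].
  rewrite integral_mkcond le_eqVlt; apply/orP; left; apply/eqP.
  apply: eq_integral => y _; rewrite patchE /G indicE.
  rewrite (_ : ((x, y) \in _) = (y \in rect x v)); last by apply/idP/idP => /set_mem/mem_set.
  by case: ifP; rewrite ?mulr1 ?mulr0.
have -> : (\int[pl]_x \int[pl]_y G (x, y) = \int[pl]_y \int[pl]_x G (x, y))%E.
  have E1 := @fubini_tonelli1 _ _ PT PT R pl pl G mG G0.
  have E2 := @fubini_tonelli2 _ _ PT PT R pl pl G mG G0.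
  transitivity (\int[pl \x pl]_z G z)%E; [exact/esym/E1|exact: E2].
have -> : (\int[pl]_y \int[pl]_x G (x, y) = \int[pl]_y ((v.1 * v.2)%:E * `|f y|%:E))%E.
  apply: eq_integral => y _.
  rewrite (eq_integral (fun x : PT => `|f y|%:E * (\1_(rect y v) x)%:E)%E); last by move=> x _; exact: GE.
  rewrite ge0_integralZl//; last by apply/measurable_EFinP; apply: measurable_indic; exact: measurable_rect.
  rewrite integral_indic//; last exact: measurable_rect.
  by rewrite setIT muleC; congr (_ * _)%E; exact: leb2_rect.
rewrite ge0_integralZl//.
- by apply/measurable_EFinP; apply: measurableT_comp.
- by rewrite lee_fin mulr_ge0// ltW.
Qed.

Variables (f1 f2 : R -> R) (F : probability (R * R)%type R) (lambda rho : R).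
Hypothesis mf1 : measurable_fun setT f1.
Hypothesis mf2 : measurable_fun setT f2.
Hypothesis f10 : forall u, 0 <= f1 u.
Hypothesis f20 : forall u, 0 <= f2 u.
Hypothesis f1neg : forall u, u <= 0 -> f1 u = 0.
Hypothesis f2neg : forall u, u <= 0 -> f2 u = 0.
Hypothesis FE : forall A, measurable A ->
  F A = (\int[leb2]_(u in A) (f1 u.1 * f2 u.2)%:E)%E.
Hypothesis l0 : 0 < lambda.
Hypothesis r0 : 0 < rho.
Hypothesis mean1 : (\int[leb]_s (s * f1 s)%:E < +oo)%E.
Hypothesis mean2 : (\int[leb]_s (s * f2 s)%:E < +oo)%E.

(** The integral of the absolute covered mass is at most lambda rho^2 times the
    product of the mean edges and the total variation. *)
Lemma integrable_phi : (intensity_measure F rho l0).-integrable setT (EFin \o phi f).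
Proof.
apply/integrableP; split; first exact/measurable_EFinP.
have mabs : measurable_fun setT (fun z : (R * R) * (R * R) => `|phi f z|%:E).
  by apply/measurable_EFinP; exact: measurableT_comp.
rewrite (eq_integral (fun z : (R * R) * (R * R) => `|phi f z|%:E)); last by [].
rewrite (intensity_integral rho mf1 mf2 f10 f20 FE l0 mabs); last by move=> z; rewrite lee_fin.
have s0 (h : R -> R) s : (forall u, 0 <= h u) -> (forall u, u <= 0 -> h u = 0) -> 0 <= s * h s.
  by move=> h0 hn; have [e|e] := leP s 0; [rewrite hn// mulr0|rewrite mulr_ge0// ltW].
have mw : measurable_fun setT (fun u : R * R => f1 u.1 * f2 u.2).
  apply: measurable_funM.
    exact: (measurableT_comp mf1 measurable_fst).
  exact: (measurableT_comp mf2 measurable_snd).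
pose G (z : PT * PT) : \bar R := (`|phi f (z.1, dilation rho z.2)|%:E * (f1 z.2.1 * f2 z.2.2)%:E)%E.
have G0 z : (0 <= G z)%E by rewrite mule_ge0// lee_fin// mulr_ge0.
have mG : measurable_fun setT G.
  apply: emeasurable_funM.
    apply: (measurableT_comp mabs); apply/measurable_fun_pairP; split; first exact: measurable_fst.
    exact: (measurableT_comp (measurable_dilation rho) measurable_snd).
  by apply/measurable_EFinP; exact: (measurableT_comp mw measurable_snd).
rewrite (_ : (\int[leb2]_x _)%E = (\int[pl]_u \int[pl]_x G (x, u))%E); last first.
  have E1 := @fubini_tonelli1 _ _ PT PT R pl pl G mG G0.
  have E2 := @fubini_tonelli2 _ _ PT PT R pl pl G mG G0.
  transitivity (\int[pl \x pl]_z G z)%E; [exact/esym/E1|exact: E2].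
have nf0 : (0 <= \int[leb2]_y `|f y|%:E)%E by apply: integral_ge0.
have nff : (\int[leb2]_y `|f y|%:E < +oo)%E by case/integrableP: jf.
set C := (\int[leb2]_y `|f y|%:E)%E in nf0 nff *.
have mk : measurable_fun setT (fun u : PT => ((u.1 * f1 u.1) * (u.2 * f2 u.2))%:E).
  apply/measurable_EFinP; apply: measurable_funM; apply: measurable_funM.
  - exact: measurable_fst.
  - exact: (measurableT_comp mf1 measurable_fst).
  - exact: measurable_snd.
  - exact: (measurableT_comp mf2 measurable_snd).
have k0 (u : PT) : (0 <= ((u.1 * f1 u.1) * (u.2 * f2 u.2))%:E)%E.
  by rewrite lee_fin mulr_ge0// s0.
apply: (@le_lt_trans _ _ (lambda%:E * ((rho ^+ 2)%:E * C *
    \int[pl]_u ((u.1 * f1 u.1) * (u.2 * f2 u.2))%:E))%E).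
  rewrite lee_pmul2l ?lte_fin//.
  rewrite -ge0_integralZl//; last by rewrite mule_ge0// lee_fin sqr_ge0.
  have mI0 := @measurable_fun_fubini_tonelli_G _ _ PT PT R pl G mG G0.
  have mI : measurable_fun setT (fun u : PT => \int[pl]_x G (x, u))%E by exact: mI0.
  apply: ge0_le_integral => //.
  - by move=> u _; apply: integral_ge0 => x _; exact: G0.
  - exact: emeasurable_funM.
  move=> u _; rewrite /G /=.
  have [u1|u1] := leP u.1 0.
    rewrite f1neg// !(mul0r, mulr0) mule0 integral0_eq// => x _; by rewrite mule0.
  have [u2|u2] := leP u.2 0.
    rewrite f2neg// !(mul0r, mulr0) mule0 integral0_eq// => x _; by rewrite mule0.
  rewrite ge0_integralZr//; last 2 first.
  - exact: (measurableT_comp mabs (measurable_pair2 _)).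
  - by rewrite lee_fin mulr_ge0.
  have h := @integral_phi_le (dilation rho u) (mulr_gt0 r0 u1) (mulr_gt0 r0 u2).
  apply: (le_trans (lee_wpmul2r _ h)); first by rewrite lee_fin mulr_ge0.
  rewrite -/C /dilation/= le_eqVlt; apply/orP; left; apply/eqP.
  rewrite [X in (X * _ = _)%E]muleC [X in (_ = X * _)%E]muleC -!muleA -!EFinM.
  by congr (_ * _%:E)%E; ring.
have -> : (\int[pl]_u ((u.1 * f1 u.1) * (u.2 * f2 u.2))%:E =
   (\int[leb]_s (s * f1 s)%:E) * (\int[leb]_s (s * f2 s)%:E))%E.
  have := @fubini_tonelli1 _ _ (measurableTypeR R) (measurableTypeR R) R leb leb _ mk k0.
  move=> EE; transitivity (\int[leb]_x \int[leb]_y ((x * f1 x) * (y * f2 y))%:E)%E; first exact: EE.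
  rewrite -ge0_integralZr//; last 3 first.
  - by apply/measurable_EFinP; exact: measurable_funM.
  - by move=> s _; rewrite lee_fin s0.
  - by apply: integral_ge0 => s _; rewrite lee_fin s0.
  apply: eq_integral => x _; rewrite -ge0_integralZl//.
  - by apply/measurable_EFinP; exact: measurable_funM.
  - by move=> s _; rewrite lee_fin s0.
  - by rewrite lee_fin s0.
have a0 : (0 <= \int[leb]_s (s * f1 s)%:E)%E by apply: integral_ge0 => s _; rewrite lee_fin s0.
have b0 : (0 <= \int[leb]_s (s * f2 s)%:E)%E by apply: integral_ge0 => s _; rewrite lee_fin s0.
have fin (a : \bar R) : (0 <= a)%E -> (a < +oo)%E -> a \is a fin_num by move=> ? ?; rewrite ge0_fin_numE.
have : (lambda%:E * ((rho ^+ 2)%:E * C * (\int[leb]_s (s * f1 s)%:E * \int[leb]_s (s * f2 s)%:E)))%E \is a fin_num.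
  by apply: fin_numM => //; apply: fin_numM; apply: fin_numM => //; exact: fin.
by rewrite fin_numE => /andP[_]; rewrite ltey.
Qed.

End integrable_phi.

(** * The characteristic exponents and their limits *)

Lemma powR_cvg_pinfty (R : realType) (T : Type) (G : set_system T) {FG : Filter G}
    (u : T -> R) (a : R) : 0 < a ->
  u x @[x --> G] --> +oo -> u x `^ a @[x --> G] --> +oo.
Proof.
move=> a0 uoo; apply/cvgryPge => A.
have B0 : 0 <= Num.max A 0 by rewrite le_max lexx orbT.
move/cvgryPge : uoo => /(_ (Num.max A 0 `^ a^-1)); apply: filterS => x ux.
apply: (@le_trans _ _ (Num.max A 0)); first by rewrite le_max lexx.
rewrite -[leLHS]powRr1// -(mulVf (lt0r_neq0 a0)) powRrM.
apply: (ge0_ler_powR (ltW a0) _ _ ux); rewrite nnegrE ?powR_ge0//.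
exact: le_trans (powR_ge0 _ _) ux.
Qed.

Lemma powR_cvg_zero (R : realType) (T : Type) (G : set_system T) {FG : Filter G}
    (u : T -> R) (a : R) : 0 < a -> (forall x, 0 <= u x) ->
  u x @[x --> G] --> (0 : R) -> u x `^ a @[x --> G] --> (0 : R).
Proof.
move=> a0 u0 uc; apply/cvgrPdist_lt => e e0.
have ea : 0 < e `^ a^-1 by rewrite powR_gt0.
move/cvgrPdist_lt : uc => /(_ _ ea); apply: filterS => x.
rewrite !sub0r !normrN ger0_norm// ger0_norm ?powR_ge0// => ux.
rewrite -[ltRHS]powRr1 ?(ltW e0)// -(mulVf (lt0r_neq0 a0)) powRrM.
by apply: gt0_ltr_powR ux; rewrite ?nnegrE ?powR_ge0.
Qed.

Lemma norm_sub_le (R : realType) (x y X : R) : 0 <= x -> x <= X -> 0 <= y -> y <= X ->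
  `|x - y| <= X.
Proof. by move=> ? ? ? ?; rewrite ler_norml; apply/andP; split; lra. Qed.

Section exponent_limit.
Context {R : realType}.
Local Notation leb := (@lebesgue_measure R).
Local Notation leb2 := (@leb2 R).
Local Notation PT := (measurableTypeR R * measurableTypeR R)%type.
Local Notation MM := (@pl R \x @pl R)%E.
Variables (g c cf m2 : R) (f1 f2 : R -> R) (F : probability (R * R)%type R).
Hypothesis g12 : 1 < g < 2.
Hypothesis c0 : 0 < c.
Hypothesis cf0 : 0 < cf.
Hypothesis mf1 : measurable_fun setT f1.
Hypothesis mf2 : measurable_fun setT f2.
Hypothesis f10 : forall u, 0 <= f1 u.
Hypothesis f20 : forall u, 0 <= f2 u.
Hypothesis f1neg : forall u, u <= 0 -> f1 u = 0.
Hypothesis f2neg : forall u, u <= 0 -> f2 u = 0.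
Hypothesis f1_le : forall u, 0 < u -> f1 u <= cf * u `^ (- g - 1).
Hypothesis m2E : (\int[leb]_s (s `^ g * f2 s)%:E = m2%:E)%E.
Hypothesis FE : forall A, measurable A ->
  F A = (\int[leb2]_(u in A) (f1 u.1 * f2 u.2)%:E)%E.
Variables (f : R * R -> R) (K : R).
Hypothesis cf_ : continuous f.
Hypothesis jf : leb2.-integrable setT (EFin \o f).
Hypothesis fK : forall y, `|f y| <= K * (wt y.1 * wt y.2).

Let g0 : 0 < g. Proof. by case/andP: g12 => h _; exact: lt_trans ltr01 h. Qed.

Let m2_fin : (\int[leb]_s (s `^ g * f2 s)%:E < +oo)%E.
Proof. by rewrite m2E ltry. Qed.

Let mf : measurable_fun setT f. Proof. exact: continuous_measurable_plane. Qed.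

Section one_psi.
Variable Psi : R -> R.
Hypothesis cPsi : continuous Psi.
Hypothesis Psi0 : forall x, 0 <= Psi x.
Hypothesis Psi_le : forall x, Psi x <= 2 * minsq x.

Let mPsi : measurable_fun setT Psi. Proof. exact: continuous_measurable_fun. Qed.

Let Psi00 : Psi 0 = 0.
Proof. by apply/eqP; rewrite eq_le Psi0 andbT; have := Psi_le 0; rewrite minsq0 mulr0. Qed.

Lemma Rintegral_limit_integrand (Wp Wn : R) :
  Wint g Psi 1 = Wp%:E -> Wint g Psi (-1) = Wn%:E -> Lpow g leb2 f ->
  \int[MM]_z limit_integrand g c f2 f Psi z =
  m2 / c `^ g * (Wp * \int[leb2]_x apow g (Num.max (f x) 0) +
                 Wn * \int[leb2]_x apow g (- Num.min (f x) 0)).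
Proof.
move=> Ep En Lf; have [L1 L2 _ _] := Rintegral_parts g12 Lf.
have mk : measurable_fun setT (fun x => f x / c) by exact: measurable_funM.
have ci : 0 <= c^-1 by rewrite invr_ge0 ltW.
have part (h : R * R -> R) : Lpow g leb2 h -> (forall x, 0 <= h x) ->
    (\int[pl]_x ((h x / c) `^ g)%:E = ((c `^ g)^-1 * \int[leb2]_x apow g (h x))%:E)%E.
  move=> [mh jh] h0; rewrite EFinM (EFin_Rintegral jh) -ge0_integralZl//.
  - apply: eq_integral => x _; rewrite /= /apow ger0_norm// -EFinM powRM// mulrC -powRN.
    by rewrite -[c^-1]powR_inv1 ?(ltW c0)// -powRrM mulN1r.
  - by apply/measurable_EFinP; exact: (measurableT_comp (measurable_apow g)).
  - by move=> x _; rewrite lee_fin apow_ge0.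
  - by rewrite lee_fin invr_ge0 powR_ge0.
rewrite [LHS]/Rintegral; have -> := power_integral g0 mPsi Psi0 Psi00 mk mf2 f20 f2neg.
have -> : (\int[pl]_x (Num.max (f x / c) 0 `^ g)%:E =
    \int[pl]_x ((Num.max (f x) 0 / c) `^ g)%:E)%E.
  by apply: eq_integral => x _; rewrite maxr_pMl// mul0r.
have -> : (\int[pl]_x (Num.max (- (f x / c)) 0 `^ g)%:E =
    \int[pl]_x ((- Num.min (f x) 0 / c) `^ g)%:E)%E.
  by apply: eq_integral => x _; rewrite oppr_min oppr0 maxr_pMl// mul0r mulNr.
rewrite (part _ L1); last by move=> x; rewrite le_max lexx orbT.
rewrite (part _ L2); last by move=> x; rewrite oppr_ge0 ge_min lexx orbT.
rewrite Ep En m2E.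
by set Sp := \int[leb2]_x _; set Sn := \int[leb2]_x _; rewrite /=; ring.
Qed.

Lemma exponent_intensity (t rho lambda : R) (l0 : 0 < lambda) : 0 < rho ->
  let kappa := lambda `^ g^-1 in
  (intensity_measure F rho l0).-integrable setT
    (EFin \o (fun z => Psi (t * theta c f rho kappa z))) /\
  \int[intensity_measure F rho l0]_z Psi (t * theta c f rho kappa z) =
  \int[MM]_z integrand g c f1 f2 f Psi t rho kappa z.
Proof.
move=> r0 kappa; have k0 : 0 < kappa by rewrite powR_gt0.
have kg : kappa `^ g = lambda.
  by rewrite /kappa -powRrM mulVf ?powRr1 ?(ltW l0)// gt_eqF.
have mH : measurable_fun setT (fun z => Psi (t * theta c f rho kappa z)).
  apply: (measurableT_comp mPsi); apply: measurable_funM => //.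
  exact: (measurable_theta _ cf_ jf).
have E := intensity_integral_scale rho mf1 mf2 f10 f20 FE l0 k0 mH (fun z => Psi0 _).
have EI : (\int[intensity_measure F rho l0]_z (Psi (t * theta c f rho kappa z))%:E =
    \int[MM]_z (integrand g c f1 f2 f Psi t rho kappa z)%:E)%E.
  by rewrite E; apply: eq_integral => z _; rewrite /integrand /weight kg.
split; last by rewrite /Rintegral EI.
have [ji _] := integrable_integrand g12 c0 cf0 mf1 mf2 f10 f20 f1neg f2neg f1_le m2_fin
  cf_ jf fK cPsi Psi0 Psi_le t r0 k0.
apply/integrableP; split; first exact/measurable_EFinP.
rewrite (eq_integral (fun z => (Psi (t * theta c f rho kappa z))%:E)); last first.
  by move=> z _ /=; rewrite ger0_norm.
by rewrite EI -(EFin_Rintegral ji) ltry.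
Qed.

End one_psi.

Hypothesis mean1 : (\int[leb]_s (s * f1 s)%:E < +oo)%E.
Hypothesis mean2 : (\int[leb]_s (s * f2 s)%:E < +oo)%E.

(** The exponent of the compensated Poisson integral of t * theta. The two
    terms of the imaginary part are integrable one by one, since the edges have
    finite means. *)
Definition re_exponent (t rho lambda : R) (l0 : 0 < lambda) : R :=
  \int[intensity_measure F rho l0]_z (cos (t * theta c f rho (lambda `^ g^-1) z) - 1).

Definition im_exponent (t rho lambda : R) (l0 : 0 < lambda) : R :=
  \int[intensity_measure F rho l0]_z sin (t * theta c f rho (lambda `^ g^-1) z) -
  \int[intensity_measure F rho l0]_z (t * theta c f rho (lambda `^ g^-1) z).

Lemma integrable_theta (t rho lambda : R) (l0 : 0 < lambda) : 0 < rho ->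
  (intensity_measure F rho l0).-integrable setT
    (EFin \o (fun z => t * theta c f rho (lambda `^ g^-1) z)).
Proof.
move=> r0; have j := integrable_phi cf_ jf mf1 mf2 f10 f20 f1neg f2neg FE l0 r0 mean1 mean2.
have := integrable_scale (t / (c * lambda `^ g^-1 * rho ^+ 2)) j.
by congr (integrable _ _ (_ \o _)); apply/funext => z; rewrite /theta; ring.
Qed.

Lemma re_exponentE (t rho lambda : R) (l0 : 0 < lambda) : 0 < rho ->
  re_exponent t rho l0 =
  - \int[MM]_z integrand g c f1 f2 f psi1 t rho (lambda `^ g^-1) z.
Proof.
move=> r0; have [j <-] := exponent_intensity (@continuous_psi1 R) (@psi1_ge0 R) (@psi1_le R) t l0 r0.
rewrite /re_exponent -[RHS]mulN1r -RintegralZl//.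
by apply: eq_Rintegral => z _; rewrite /psi1; ring.
Qed.

Lemma im_exponentE (t rho lambda : R) (l0 : 0 < lambda) : 0 < rho ->
  im_exponent t rho l0 =
  \int[MM]_z integrand g c f1 f2 f psi3 t rho (lambda `^ g^-1) z -
  \int[MM]_z integrand g c f1 f2 f psi2 t rho (lambda `^ g^-1) z.
Proof.
move=> r0; have [j2 <-] := exponent_intensity (@continuous_psi2 R) (@psi2_ge0 R) (@psi2_le R) t l0 r0.
have [j3 <-] := exponent_intensity (@continuous_psi3 R) (@psi3_ge0 R) (@psi3_le R) t l0 r0.
have jt := integrable_theta t l0 r0.
have jd := integrable_sub j3 j2.
have js : (intensity_measure F rho l0).-integrable setT
    (EFin \o (fun z => sin (t * theta c f rho (lambda `^ g^-1) z))).
  have := integrable_add jt jd; congr (integrable _ _ (_ \o _)); apply/funext => z /=.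
  by rewrite -opprB psi23; ring.
rewrite /im_exponent -!RintegralB//.
by apply: eq_Rintegral => z _; rewrite -[in RHS]opprB psi23 opprB.
Qed.

(** Tightness needs one constant for all rho and lambda, and the order |t|^g. *)
Lemma exponent_bound : exists2 B : R, 0 <= B &
  forall (t rho lambda : R) (l0 : 0 < lambda), 0 < rho ->
    [/\ re_exponent t rho l0 <= 0, `|re_exponent t rho l0| <= B * `|t| `^ g &
        `|im_exponent t rho l0| <= B * `|t| `^ g].
Proof.
have K0 : 0 <= K.
  have := le_trans (normr_ge0 _) (fK (0, 0)).
  by rewrite pmulr_lge0// mulr_gt0// wt_gt0.
have D0 : 0 <= \int[MM]_z dom g cf f2 1 z.
  by apply: Rintegral_ge0 => z _; apply: dom_ge0.
have Kc : 0 <= K / c by rewrite divr_ge0// ltW.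
exists ((K / c) `^ g * \int[MM]_z dom g cf f2 1 z); first by rewrite mulr_ge0// powR_ge0.
move=> t rho lambda l0 r0; have k0 : 0 < lambda `^ g^-1 by rewrite powR_gt0.
have bnd (Psi : R -> R) : continuous Psi -> (forall x, 0 <= Psi x) ->
    (forall x, Psi x <= 2 * minsq x) ->
    0 <= \int[MM]_z integrand g c f1 f2 f Psi t rho (lambda `^ g^-1) z <=
    (K / c) `^ g * (\int[MM]_z dom g cf f2 1 z) * `|t| `^ g.
  move=> cP P0 Ple; apply/andP; split.
    apply: Rintegral_ge0 => z _; rewrite /integrand mulr_ge0//.
    by rewrite /weight !mulr_ge0 ?powR_ge0.
  have [_] := integrable_integrand g12 c0 cf0 mf1 mf2 f10 f20 f1neg f2neg f1_le m2_fin
    cf_ jf fK cP P0 Ple t r0 k0.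
  have -> : (`|t| * (K / c)) `^ g = `|t| `^ g * (K / c) `^ g.
    exact: (powRM g (normr_ge0 t) Kc).
  by move=> /le_trans; apply; rewrite -mulrA mulrC.
have /andP[a1 b1] := bnd _ (@continuous_psi1 R) (@psi1_ge0 R) (@psi1_le R).
have /andP[a2 b2] := bnd _ (@continuous_psi2 R) (@psi2_ge0 R) (@psi2_le R).
have /andP[a3 b3] := bnd _ (@continuous_psi3 R) (@psi3_ge0 R) (@psi3_le R).
rewrite re_exponentE// im_exponentE//; split; first by rewrite oppr_le0.
  by rewrite normrN ger0_norm.
exact: norm_sub_le.
Qed.

Hypothesis f1_tail : f1 u / u `^ (- g - 1) @[u --> +oo] --> (1 : R).
Hypothesis cg : c `^ g = Kcos g * m2.
Hypothesis m20 : 0 < m2.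
Hypothesis Lf : Lpow g leb2 f.

(** The limits are integrals of psi1, and of psi3 minus psi2, against
    r^(-g-1) dr f2(s) ds dx. The choice c^g = Kcos m2 cancels the constant of the
    real part; the imaginary part keeps -Ksin / Kcos = tan (pi g / 2). *)
Lemma exponent_limits (rho lambda : nat -> R) (l0 : forall n, 0 < lambda n) :
  (forall n, 0 < rho n) -> lambda n @[n --> \oo] --> +oo -> rho n @[n --> \oo] --> (0 : R) ->
  lambda n * rho n `^ g @[n --> \oo] --> (0 : R) ->
  (re_exponent 1 (rho n) (l0 n) @[n --> \oo] --> - \int[leb2]_x apow g (f x)) /\
  (im_exponent 1 (rho n) (l0 n) @[n --> \oo] -->
     tan (pi * g / 2) * \int[leb2]_x spow g (f x)).
Proof.
move=> r0 loo rc lrc.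
pose kappa n := lambda n `^ g^-1.
have k0 n : 0 < kappa n by rewrite powR_gt0.
have gi : 0 < g^-1 by rewrite invr_gt0.
have koo : kappa n @[n --> \oo] --> +oo.
  exact: (powR_cvg_pinfty gi loo).
have kr : rho n * kappa n @[n --> \oo] --> (0 : R).
  have E n : rho n * kappa n = (lambda n * rho n `^ g) `^ g^-1.
    rewrite powRM ?powR_ge0 ?(ltW (l0 _))// -powRrM mulfV ?gt_eqF//.
    by rewrite powRr1 ?(ltW (r0 _))// mulrC.
  have -> : (fun n => rho n * kappa n) = (fun n => (lambda n * rho n `^ g) `^ g^-1).
    by apply/funext.
  by apply: powR_cvg_zero lrc => // n; rewrite mulr_ge0 ?powR_ge0 ?(ltW (l0 _)).
have lim (Psi : R -> R) (Wp Wn : R) : continuous Psi -> (forall x, 0 <= Psi x) ->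
    (forall x, Psi x <= 2 * minsq x) -> Wint g Psi 1 = Wp%:E -> Wint g Psi (-1) = Wn%:E ->
    \int[MM]_z integrand g c f1 f2 f Psi 1 (rho n) (kappa n) z @[n --> \oo] -->
    m2 / c `^ g * (Wp * \int[leb2]_x apow g (Num.max (f x) 0) +
                 Wn * \int[leb2]_x apow g (- Num.min (f x) 0)).
  move=> cP P0 Ple Ep En; rewrite -(Rintegral_limit_integrand cP P0 Ple Ep En Lf).
  by have [] := exponent_cvg g12 c0 cf0 mf1 mf2 f10 f20 f1neg f2neg f1_le m2_fin cf_ jf fK
    cP P0 Ple f1_tail r0 k0 koo rc kr.
have [E2 E2'] := Wint_psi2 g12; have [E3 E3'] := Wint_psi3 g12.
have n1 : `|-1 : R| = 1 by rewrite normrN1.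
have l1 := lim _ _ _ (@continuous_psi1 R) (@psi1_ge0 R) (@psi1_le R)
  (Wint_psi1 g12 (normr1 R)) (Wint_psi1 g12 n1).
have l2 := lim _ _ _ (@continuous_psi2 R) (@psi2_ge0 R) (@psi2_le R) E2 E2'.
have l3 := lim _ _ _ (@continuous_psi3 R) (@psi3_ge0 R) (@psi3_le R) E3 E3'.
have [_ _ EI ES] := Rintegral_parts g12 Lf.
have Kc := Kcos_gt0 g12.
have kn : Kcos g != 0 by rewrite gt_eqF.
have mn : m2 != 0 by rewrite gt_eqF.
rewrite EI ES -Ksin_Kcos//; split.
- have -> : (fun n => re_exponent 1 (rho n) (l0 n)) =
     (fun n => - \int[MM]_z integrand g c f1 f2 f psi1 1 (rho n) (kappa n) z).
    by apply/funext => n; rewrite re_exponentE.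
  set Sp := \int[leb2]_x _; set Sn := \int[leb2]_x _.
  rewrite (_ : - (Sp + Sn) = - (m2 / c `^ g * (Kcos g * Sp + Kcos g * Sn))); first exact: cvgN l1.
  by rewrite cg; field; apply/andP.
- have -> : (fun n => im_exponent 1 (rho n) (l0 n)) =
     (fun n => \int[MM]_z integrand g c f1 f2 f psi3 1 (rho n) (kappa n) z -
       \int[MM]_z integrand g c f1 f2 f psi2 1 (rho n) (kappa n) z).
    by apply/funext => n; rewrite im_exponentE.
  set Sp := \int[leb2]_x _; set Sn := \int[leb2]_x _.
  rewrite (_ : - (Ksin g / Kcos g) * (Sp - Sn) = m2 / c `^ g * (0 * Sp + Ksin g * Sn) -
     m2 / c `^ g * (Ksin g * Sp + 0 * Sn)); first exact: cvgB l3 l2.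
  by rewrite cg; field; apply/andP.
Qed.

End exponent_limit.

(** * Linear combinations of measures and of their integrals *)

Section fields.
Context {R : realType}.
Local Notation leb2 := (@leb2 R).

Lemma has_logcf_shift d (Om : measurableType d) (P : probability Om R) (X : Om -> R) (A B b : R) :
  measurable_fun setT X -> has_logcf P X A B -> has_logcf P (fun w => X w - b) A (B - b).
Proof.
move=> mX [cX sX].
have jc : P.-integrable setT (EFin \o (fun w => cos (X w))).
  apply: (@bounded_integrable _ _ _ _ _ 1); first exact: (measurableT_comp (@measurable_cos R)).
  by move=> w; exact: norm_cos_le1.
have js : P.-integrable setT (EFin \o (fun w => sin (X w))).
  apply: (@bounded_integrable _ _ _ _ _ 1); first exact: (measurableT_comp (@measurable_sin R)).
  by move=> w; exact: norm_sin_le1.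
split.
  transitivity (\int[P]_w (cos b * cos (X w) + sin b * sin (X w))).
    by apply: eq_Rintegral => w _; rewrite cosB; ring.
  rewrite RintegralD//; [|exact: integrable_scale|exact: integrable_scale].
  by rewrite !RintegralZl// cX sX cosB; ring.
transitivity (\int[P]_w (cos b * sin (X w) - sin b * cos (X w))).
  by apply: eq_Rintegral => w _; rewrite sinB; ring.
rewrite RintegralB//; [|exact: integrable_scale|exact: integrable_scale].
by rewrite !RintegralZl// cX sX sinB; ring.
Qed.

Lemma MP_czero : MP (czero : M2 R).
Proof.
have D : continuous_density (czero : M2 R) (fun=> 0).
  split; first by move=> x; exact: cvg_cst.
  by move=> A mA; rewrite integral0.
split; rewrite (densityE D)//; exists 1, 1; split => // x.
by rewrite normr0 mul1r expR_ge0.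
Qed.

(** The combination is formed independently of the field, so that one measure
    serves both the fields and their limit. *)
Lemma MP_linear_combination (n : nat) (a : 'I_n -> R) (m : 'I_n -> M2 R) :
  (forall j, MP (m j)) -> exists2 mu : M2 R, MP mu &
  forall d (Om : measurableType d) (P : probability Om R) (W : M2 R -> Om -> R),
    linear_field P W -> {ae P, forall w, W mu w = \sum_j a j * W (m j) w}.
Proof.
move=> Mm; elim: (index_enum 'I_n) => [|j s [mu Mmu IH]].
  exists (cadd (cscale 0 czero) (cscale 0 czero)); first by have [] := MP_comb 0 0 MP_czero MP_czero.
  move=> d Om P W LW; have := LW 0 0 _ _ MP_czero MP_czero.
  by apply: filterS => w ->; rewrite big_nil !mul0r addr0.
exists (cadd (cscale (a j) (m j)) (cscale 1 mu)); first by have [] := MP_comb (a j) 1 (Mm j) Mmu.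
move=> d Om P W LW; have h1 := LW (a j) 1 _ _ (Mm j) Mmu; have h2 := IH _ _ _ _ LW.
by apply: filterS2 h1 h2 => w -> e; rewrite big_cons mul1r e.
Qed.

Lemma MP_density (mu : M2 R) : MP mu ->
  [/\ continuous (density mu), leb2.-integrable setT (EFin \o density mu) &
      exists K, forall y, `|density mu y| <= K * (wt y.1 * wt y.2)].
Proof.
move=> [D [C [c [C0 c0 H]]]]; split; first by case: D.
  exact: continuous_density_integrable D.
exists (C * (1 + 4 / c ^+ 2) ^+ 2) => y; apply: le_trans (H y) _.
rewrite -mulrA ler_pM2l// mulrDr expRD.
have -> : (1 + 4 / c ^+ 2) ^+ 2 * (wt y.1 * wt y.2) =
    ((1 + 4 / c ^+ 2) * wt y.1) * ((1 + 4 / c ^+ 2) * wt y.2) by ring.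
by apply: ler_pM; rewrite ?expR_ge0// exp_le_wt.
Qed.

Lemma phi_comb (a b : R) (f g : R * R -> R) z :
  leb2.-integrable setT (EFin \o f) -> leb2.-integrable setT (EFin \o g) ->
  phi (fun x => a * f x + b * g x) z = a * phi f z + b * phi g z.
Proof.
move=> jf jg.
have jr h : leb2.-integrable setT (EFin \o h) -> leb2.-integrable (rect z.1 z.2) (EFin \o h).
  by move=> jh; apply: integrableS jh => //; exact: measurable_rect.
have mr : measurable (rect z.1 z.2) by exact: measurable_rect.
have E : \int[leb2]_(y in rect z.1 z.2) (a * f y + b * g y) =
    a * \int[leb2]_(y in rect z.1 z.2) f y + b * \int[leb2]_(y in rect z.1 z.2) g y.
  rewrite RintegralD//; last 2 first.
  - by apply: (jr (fun y => a * f y)); exact: integrable_scale.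
  - by apply: (jr (fun y => b * g y)); exact: integrable_scale.
  by rewrite !RintegralZl//; exact: jr.
by rewrite /phi E; ring.
Qed.

Lemma rect_integral_phi (nu : {measure set ((R * R) * (R * R))%type -> \bar R}) (mu : M2 R) :
  MP mu -> rect_integral nu mu = \int[nu]_z phi (density mu) z.
Proof.
move=> M; have [_ jf _] := MP_density M; have [[_ D] _] := M.
rewrite /rect_integral /Rintegral; congr fine; rewrite [LHS]integral_mkcond.
apply: eq_integral => z _; rewrite patchE.
case: ifPn => [/set_mem/= [_ z2]|zN].
  have [z21 z22] := z2.
  have p1 : 0 < z.2.1 by move: z21; rewrite /Rplus/= in_itv/= andbT.
  have p2 : 0 < z.2.2 by move: z22; rewrite /Rplus/= in_itv/= andbT.
  rewrite (_ : z = (z.1, z.2)) ?phiE//=; last by case: (z).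
  have mr : measurable (rect z.1 z.2) by exact: measurable_rect.
  rewrite D//= /Rintegral fineK//; apply: integrable_fin_num => //.
  by apply: integrableS jf.
rewrite (_ : z = (z.1, z.2)) ?phi0//; last by case: (z).
by move=> z2; move/negP: zN; apply; apply: mem_set; split.
Qed.

End fields.

(** * Convergence of the normalized fields *)

(** The constant K depends on the law only through g and B and so serves a whole
    family of laws. *)
Lemma power_tail (R : realType) (g B e : R) : 0 < g -> 0 <= B -> 0 < e ->
  exists2 K : R, 0 < K & forall d (Om : measurableType d) (P : probability Om R) (X : Om -> R),
    measurable_fun setT X ->
    (forall t, 1 - \int[P]_w cos (t * X w) <= B * `|t| `^ g) ->
    (P [set w | (K <= `|X w|)%R] <= e%:E)%E.
Proof.
move=> g0 B0 e0.
have B1 : 0 < 2 * (B + 1) by rewrite mulr_gt0// ltr_wpDl.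
(* With this dl, B dl^g <= e / 2. *)
pose dl := (e / (2 * (B + 1))) `^ g^-1.
have d0 : 0 < dl by rewrite powR_gt0// divr_gt0.
have dg : dl `^ g = e / (2 * (B + 1)).
  by rewrite -powRrM mulVf ?powRr1 ?gt_eqF// divr_ge0 ?(ltW e0) ?(ltW B1).
exists (2 / dl); first by rewrite divr_gt0.
move=> d Om P X mX H.
apply: le_trans (tail_from_charfun (A := e / 2) mX d0 _) _.
  move=> t /andP[t0 td]; apply: le_trans (H t) _.
  apply: (@le_trans _ _ (B * dl `^ g)).
    rewrite ler_wpM2l// ge0_ler_powR ?nnegrE ?(ltW g0) ?(ltW d0)//.
    by rewrite ger0_norm.
  rewrite dg (_ : B * _ = e / 2 * (B / (B + 1))); last by field; rewrite gt_eqF// ltr_wpDl.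
  rewrite ler_piMr ?divr_ge0 ?(ltW e0)// ler_pdivrMr ?ltr_wpDl// mul1r.
  by rewrite lerDl.
by rewrite mulrC divfK.
Qed.

Lemma cvg_at_right_seq (R : realType) (u : nat -> R) (p : R) : (forall n, p < u n) ->
  u n @[n --> \oo] --> p -> u n @[n --> \oo] --> p^'+.
Proof.
move=> pu up A Ap; have h : \forall n \near \oo, p < u n -> A (u n) by exact: (up _ Ap).
have {}h : \forall n \near \oo, A (u n) by apply: filterS h => n; exact.
exact: h.
Qed.

Section normalized_fields.
Context {R : realType}.
Local Notation leb := (@lebesgue_measure R).
Local Notation leb2 := (@leb2 R).
Variables (g c cf m2 : R) (f1 f2 : R -> R) (F : probability (R * R)%type R).
Hypothesis g12 : 1 < g < 2.
Hypothesis c0 : 0 < c.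
Hypothesis cf0 : 0 < cf.
Hypothesis mf1 : measurable_fun setT f1.
Hypothesis mf2 : measurable_fun setT f2.
Hypothesis f10 : forall u, 0 <= f1 u.
Hypothesis f20 : forall u, 0 <= f2 u.
Hypothesis f1neg : forall u, u <= 0 -> f1 u = 0.
Hypothesis f2neg : forall u, u <= 0 -> f2 u = 0.
Hypothesis f1_le : forall u, 0 < u -> f1 u <= cf * u `^ (- g - 1).
Hypothesis m2E : (\int[leb]_s (s `^ g * f2 s)%:E = m2%:E)%E.
Hypothesis FE : forall A, measurable A ->
  F A = (\int[leb2]_(u in A) (f1 u.1 * f2 u.2)%:E)%E.
Hypothesis mean1 : (\int[leb]_s (s * f1 s)%:E < +oo)%E.
Hypothesis mean2 : (\int[leb]_s (s * f2 s)%:E < +oo)%E.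
Hypothesis f1_tail : f1 u / u `^ (- g - 1) @[u --> +oo] --> (1 : R).
Hypothesis cg : c `^ g = Kcos g * m2.
Hypothesis m20 : 0 < m2.
Variable lambda : R -> R.
Hypothesis lambda_gt0 : forall rho, 0 < rho -> 0 < lambda rho.
Hypothesis lambda_infty : lambda rho @[rho --> 0^'+] --> +oo.
Hypothesis lambda_small : lambda rho * rho `^ g @[rho --> 0^'+] --> (0 : R).
Variables (d : measure_display) (Om : measurableType d) (P : probability Om R)
  (N : R -> R.-ker Om ~> ((R * R) * (R * R))%type).
Hypothesis N_poisson : forall rho, 0 < rho ->
  poisson_random_measure P (intensity (lambda rho) F rho) (N rho).

Definition normalized (rho : R) (mu : M2 R) (w : Om) : R :=
  (rect_integral (N rho w) mu - fine 'E_P[fun w => rect_integral (N rho w) mu]) /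
  (c * lambda rho `^ g^-1 * rho ^+ 2).

Let nu rho (r0 : 0 < rho) := intensity_measure F rho (lambda_gt0 r0).

Let HN rho (r0 : 0 < rho) : poisson_random_measure P (nu r0) (N rho).
Proof. exact: N_poisson. Qed.

Let jphi rho (r0 : 0 < rho) (mu : M2 R) : MP mu ->
  (nu r0).-integrable setT (EFin \o phi (density mu)).
Proof.
move=> /MP_density[cf_ jf _].
exact: (integrable_phi cf_ jf mf1 mf2 f10 f20 f1neg f2neg FE (lambda_gt0 r0) r0 mean1 mean2).
Qed.

Let meanE rho (r0 : 0 < rho) (mu : M2 R) : MP mu ->
  fine 'E_P[fun w => rect_integral (N rho w) mu] = \int[nu r0]_z phi (density mu) z.
Proof.
move=> M; rewrite fine_expectation; have [_ <-] := prm_expectation (HN r0) (jphi r0 M).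
by apply: eq_Rintegral => w _; rewrite rect_integral_phi.
Qed.

Lemma measurable_normalized rho mu : MP mu -> measurable_fun setT (normalized rho mu).
Proof.
move=> M; have [cf_ jf _] := MP_density M.
apply: measurable_funM => //; apply: measurable_funB => //.
rewrite (_ : (fun w => _) = fun w => \int[N rho w]_z phi (density mu) z); last first.
  by apply/funext => w; rewrite rect_integral_phi.
by apply: measurable_Rintegral_kernel; exact: measurable_phi.
Qed.

Lemma normalized_linear rho : 0 < rho -> linear_field P (normalized rho).
Proof.
move=> r0 a b mu mu' M M'; have [Mc dc] := MP_comb a b M M'.
have [_ jf _] := MP_density M; have [_ jf' _] := MP_density M'.
have comb (m : {measure set ((R * R) * (R * R))%type -> \bar R}) :
    m.-integrable setT (EFin \o phi (density mu)) ->
    m.-integrable setT (EFin \o phi (density mu')) ->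
    \int[m]_z phi (density (cadd (cscale a mu) (cscale b mu'))) z =
    a * \int[m]_z phi (density mu) z + b * \int[m]_z phi (density mu') z.
  move=> j j'; rewrite dc.
  transitivity (\int[m]_z (a * phi (density mu) z + b * phi (density mu') z)).
    by apply: eq_Rintegral => z _; rewrite phi_comb.
  rewrite RintegralD//; [|exact: integrable_scale|exact: integrable_scale].
  by rewrite !RintegralZl.
have h := prm_integrable_ae (HN r0) (jphi r0 M).
have h' := prm_integrable_ae (HN r0) (jphi r0 M').
have key (x y x' y' D : R) : (a * x + b * y - (a * x' + b * y')) / D =
    a * ((x - x') / D) + b * ((y - y') / D) by ring.
apply: filterS2 h h' => w j j'.
have e1 := comb _ j j'; have e2 := comb _ (jphi r0 M) (jphi r0 M').
rewrite /normalized (meanE r0 Mc) (meanE r0 M) (meanE r0 M').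
rewrite (rect_integral_phi _ Mc) (rect_integral_phi _ M) (rect_integral_phi _ M').
rewrite e1 e2.
exact: key.
Qed.

Lemma normalized_logcf rho (r0 : 0 < rho) mu t : MP mu ->
  has_logcf P (fun w => t * normalized rho mu w)
    (re_exponent g c F (density mu) t rho (lambda_gt0 r0))
    (im_exponent g c F (density mu) t rho (lambda_gt0 r0)).
Proof.
move=> M; have [cf_ jf _] := MP_density M.
have jt := integrable_theta g c mf1 mf2 f10 f20 f1neg f2neg FE cf_ jf mean1 mean2 t (lambda_gt0 r0) r0.
have mt := integrable_mfun jt.
have mI := measurable_Rintegral_kernel (N rho) mt.
have h := has_logcf_shift (\int[nu r0]_z (t * theta c (density mu) rho (lambda rho `^ g^-1) z)) mI
  (prm_has_logcf (HN r0) jt).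
apply: has_logcf_ae h.
- exact: measurable_funB.
- by apply: measurable_funM => //; exact: measurable_normalized.
have := prm_integrable_ae (HN r0) (jphi r0 M); apply: filterS => w j.
rewrite /normalized (meanE r0)// rect_integral_phi//.
have E (m : {measure set ((R * R) * (R * R))%type -> \bar R}) :
    m.-integrable setT (EFin \o phi (density mu)) ->
    \int[m]_z (t * theta c (density mu) rho (lambda rho `^ g^-1) z) =
    t / (c * lambda rho `^ g^-1 * rho ^+ 2) * \int[m]_z phi (density mu) z.
  move=> jm; rewrite -RintegralZl//; apply: eq_Rintegral => z _; rewrite /theta; ring.
rewrite !E//; [by ring|exact: jphi].
Qed.

Variables (d' : measure_display) (Om' : measurableType d') (Q : probability Om' R)
  (L : set (R * R) -> Om' -> R) (S : M2 R -> Om' -> R).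
Hypothesis HL : stable_random_measure Q g L.
Hypothesis HS : forall mu, MP mu -> is_stable_integral Q g L (density mu) (S mu).

Lemma normalized_cvg_trig (mu : M2 R) : MP mu ->
  (\int[P]_w cos (normalized rho mu w) @[rho --> 0^'+] --> \int[Q]_w cos (S mu w)) /\
  (\int[P]_w sin (normalized rho mu w) @[rho --> 0^'+] --> \int[Q]_w sin (S mu w)).
Proof.
move=> M; have [cf_ jf [K fK]] := MP_density M.
have Lf := Lpow_density g12 HL HS M.
have [hc hs] := stable_field_logcf g12 HL HS M.
have lim (u : nat -> R) : (forall n, 0 < u n) /\ (u n @[n --> \oo] --> (0 : R)) ->
    (\int[P]_w cos (normalized (u n) mu w) @[n --> \oo] --> \int[Q]_w cos (S mu w)) /\
    (\int[P]_w sin (normalized (u n) mu w) @[n --> \oo] --> \int[Q]_w sin (S mu w)).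
  move=> [u0 uc]; have ur := cvg_at_right_seq u0 uc.
  have [lA lB] := exponent_limits g12 c0 cf0 mf1 mf2 f10 f20 f1neg f2neg f1_le m2E FE cf_ jf fK
    mean1 mean2 f1_tail cg m20 Lf (fun n => lambda_gt0 (u0 n)) u0
    (cvg_comp _ _ ur lambda_infty) uc (cvg_comp _ _ ur lambda_small).
  have lE := cvg_comp _ _ lA (@continuous_expR R _).
  have E n : has_logcf P (fun w => normalized (u n) mu w)
      (re_exponent g c F (density mu) 1 (u n) (lambda_gt0 (u0 n)))
      (im_exponent g c F (density mu) 1 (u n) (lambda_gt0 (u0 n))).
    have := normalized_logcf (u0 n) 1 M.
    by rewrite (_ : (fun w => 1 * _) = normalized (u n) mu)//; apply/funext => w; rewrite mul1r.
  split.
    have lC := cvg_comp _ _ lB (@continuous_cos R _).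
    by rewrite hc; apply: cvg_congr (cvgM lE lC) _ _ => // n; have [-> _] := E n.
  have lS := cvg_comp _ _ lB (@continuous_sin R _).
  by rewrite hs; apply: cvg_congr (cvgM lE lS) _ _ => // n; have [_ ->] := E n.
split; apply/cvg_at_rightP => u uP; by have [] := lim u uP.
Qed.

Lemma normalized_bound (mu : M2 R) : MP mu -> exists2 B : R, 0 <= B &
  (forall rho, 0 < rho -> forall t, 1 - \int[P]_w cos (t * normalized rho mu w) <= B * `|t| `^ g) /\
  (forall t, 1 - \int[Q]_w cos (t * S mu w) <= B * `|t| `^ g).
Proof.
move=> M; have [cf_ jf [K fK]] := MP_density M.
have [B B0 HB] := exponent_bound g12 c0 cf0 mf1 mf2 f10 f20 f1neg f2neg f1_le m2E FE cf_ jf fK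
  mean1 mean2.
set I := \int[leb2]_x apow g (density mu x); set J := \int[leb2]_x spow g (density mu x).
pose T := tan (pi * g / 2).
have I0 : 0 <= I by apply: Rintegral_ge0 => x _; exact: apow_ge0.
have BI : 0 <= I + `|T| * `|J| by rewrite addr_ge0// mulr_ge0.
exists (B + B + (I + `|T| * `|J|)); first by rewrite addr_ge0// addr_ge0.
split=> [rho r0 t|t].
  have [-> _] := normalized_logcf r0 t M.
  have [h1 h2 h3] := HB t rho _ (lambda_gt0 r0) r0.
  apply: le_trans (subr1_logcf_le _ h1) _.
  rewrite 2!mulrDl ler_wpDr ?mulr_ge0 ?powR_ge0//.
  exact: lerD.
have [_ [-> _]] := stable_integral_logcf g12 HL t (measurable_density M) (HS M).
have p0 : 0 <= apow g t * I by rewrite mulr_ge0// apow_ge0.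
apply: le_trans (subr1_logcf_le _ _) _; first by rewrite oppr_le0.
rewrite normrN -/I -/J -/T (ger0_norm p0).
have h : `|T * (spow g t * J)| <= `|T| * `|J| * apow g t.
  rewrite (normrM T) (normrM (spow g t)) mulrCA mulrC.
  by apply: ler_wpM2l; [exact: mulr_ge0|exact: norm_spow_le].
apply: le_trans (lerD (lexx _) h) _.
rewrite mulrC -mulrDl ler_wpM2r ?apow_ge0//.
by rewrite lerDr addr_ge0.
Qed.

(** Each linear combination of coordinates is the coordinate of one measure,
    up to null sets, so that the joint characteristic functions converge by the
    case of one measure. *)
Lemma normalized_cvg_fdd : cvg_fdd MP (0 : R)^'+ P normalized Q S.
Proof.
move=> n m Mm G cG bG.
have g0 : 0 < g by case/andP: g12 => h _; exact: lt_trans ltr01 h.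
have right0 : \forall rho \near (0 : R)^'+, 0 < rho by exact: nbhs_right_gt.
have comb (h : R -> R) : measurable_fun setT h ->
    (forall mu, MP mu -> \int[P]_w h (normalized rho mu w) @[rho --> 0^'+] --> \int[Q]_w h (S mu w)) ->
    forall a : 'I_n -> R, \int[P]_w h (\sum_j a j * normalized rho (m j) w) @[rho --> 0^'+] -->
      \int[Q]_w h (\sum_j a j * S (m j) w).
  move=> mh H a; have [mu Mmu lin] := MP_linear_combination a Mm.
  have mS : measurable_fun setT (S mu) by have [] := HS Mmu.
  have -> : \int[Q]_w h (\sum_j a j * S (m j) w) = \int[Q]_w h (S mu w).
    apply: ae_eq_Rintegral.
    - apply: (measurableT_comp mh); apply: measurable_bigsum => j.
      by apply: measurable_funM => //; have [] := HS (Mm j).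
    - exact: (measurableT_comp mh).
    - by have := lin _ _ _ _ (stable_linear_field g12 HL HS); apply: filterS => w ->.
  apply: cvg_trans (H _ Mmu); apply: near_eq_cvg.
  apply: filterS right0 => rho r0; apply: ae_eq_Rintegral.
  - by apply: (measurableT_comp mh); exact: measurable_normalized.
  - apply: (measurableT_comp mh); apply: measurable_bigsum => j.
    by apply: measurable_funM => //; exact: measurable_normalized.
  - by have := lin _ _ _ _ (normalized_linear r0); apply: filterS => w ->.
apply: weak_cvg_from_charfun => //.
- by move=> rho j; exact: measurable_normalized.
- by move=> j; have [] := HS (Mm j).
- by apply: comb; [exact: measurable_cos|move=> mu M; have [] := normalized_cvg_trig M].
- by apply: comb; [exact: measurable_sin|move=> mu M; have [] := normalized_cvg_trig M].
move=> e e0.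
have /choice[B HB] : forall j, exists B : R, 0 <= B /\
  ((forall rho, 0 < rho -> forall t, 1 - \int[P]_w cos (t * normalized rho (m j) w) <= B * `|t| `^ g) /\
  (forall t, 1 - \int[Q]_w cos (t * S (m j) w) <= B * `|t| `^ g)).
  by move=> j; have [B B0 HB] := normalized_bound (Mm j); exists B.
have B0 : 0 <= \sum_j B j by apply: sumr_ge0 => j _; have [] := HB j.
have Bj j (t : R) : B j * `|t| `^ g <= (\sum_j B j) * `|t| `^ g.
  rewrite ler_wpM2r ?powR_ge0// (bigD1 j)//= lerDl; apply: sumr_ge0 => i _; by have [] := HB i.
have [K K0 HK] := power_tail g0 B0 e0.
exists K; split => //.
  apply: filterS right0 => rho r0 j; apply: HK; first exact: measurable_normalized.
  by move=> t; have [_ [h _]] := HB j; exact: le_trans (h _ r0 t) (Bj j t).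
move=> j; apply: HK; first by have [] := HS (Mm j).
by move=> t; have [_ [_ h]] := HB j; exact: le_trans (h t) (Bj j t).
Qed.

End normalized_fields.

Theorem theorem8 (R : realType) (gamma1 gamma2 : R) (f1 f2 : R -> R)
    (F : probability (R * R)%type R) (lambda : R -> R)
    (* standing assumptions *)
    (mf1 : measurable_fun Rplus f1) (mf2 : measurable_fun Rplus f2)
    (f1_ge0 : forall u, 0 < u -> 0 <= f1 u)
    (f2_ge0 : forall u, 0 < u -> 0 <= f2 u)
    (FE : forall A, measurable A ->
      F A = (\int[leb2]_(u in A `&` Rplus2) (f1 u.1 * f2 u.2)%:E)%E)
    (f1_tail : f1 u / u `^ (- gamma1 - 1) @[u --> +oo] --> (1 : R))
    (f2_tail : f2 u / u `^ (- gamma2 - 1) @[u --> +oo] --> (1 : R))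
    (f1_mean :
      (\int[lebesgue_measure]_(u in Rplus) (u * f1 u)%:E < +oo)%E)
    (f2_mean :
      (\int[lebesgue_measure]_(u in Rplus) (u * f2 u)%:E < +oo)%E)
    (lambda_gt0 : forall rho, 0 < rho -> 0 < lambda rho)
    (* Poisson random measures N rho, for 0 < rho *)
    (d : measure_display) (Om : measurableType d) (P : probability Om R)
    (N : R -> R.-ker Om ~> ((R * R) * (R * R))%type)
    (N_poisson : forall rho, 0 < rho ->
      poisson_random_measure P (intensity (lambda rho) F rho) (N rho))
    (* hypotheses of the theorem *)
    (gamma1_gt1 : 1 < gamma1) (gamma1_lt2 : gamma1 < 2)
    (gamma12 : gamma1 < gamma2)
    (f1_le : exists2 c : R, 0 < c &
      forall u, 0 < u -> f1 u <= c * u `^ (- gamma1 - 1))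
    (lambda_infty : lambda rho @[rho --> 0^'+] --> +oo)
    (lambda_small : lambda rho * rho `^ gamma1 @[rho --> 0^'+] --> (0 : R))
    (* limit field *)
    (d' : measure_display) (Om' : measurableType d') (Q : probability Om' R)
    (Lambda : set (R * R) -> Om' -> R)
    (Lambda_stable : stable_random_measure Q gamma1 Lambda)
    (Sgamma : M2 R -> Om' -> R)
    (SgammaE : forall mu, MP mu ->
      is_stable_integral Q gamma1 Lambda (density mu) (Sgamma mu)) :
  let J rho mu w := rect_integral (N rho w) mu in
  let Jtilde rho mu w := J rho mu w - fine 'E_P[J rho mu] in
  [/\ linear_field Q Sgamma,
      forall mu, MP mu ->
        charfun Q (Sgamma mu) 1 =
        stable_charfun gamma1 (sigma gamma1 mu) (beta gamma1 mu) 1 &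
      cvg_fdd MP (0 : R)^'+ P
        (fun rho mu w => Jtilde rho mu w /
           (c_const gamma1 f2 * lambda rho `^ gamma1^-1 * rho ^+ 2))
        Q Sgamma].
Proof.
move=> J Jtilde.
have g12 : 1 < gamma1 < 2 by rewrite gamma1_gt1.
have g0 : 0 < gamma1 by exact: lt_trans gamma1_gt1.
have mRp : measurable (@Rplus R) by exact: measurable_itv.
have inRp (u : R) : (u \in @Rplus R) = (0 < u).
  by apply/idP/idP => [/set_mem|u0]; [|apply: mem_set]; rewrite /Rplus/= in_itv/= andbT.
(* Off the positive half-line the densities are unconstrained; they are set to 0. *)
pose h1 : R -> R := f1 \_ Rplus; pose h2 : R -> R := f2 \_ Rplus.
have hE (f : R -> R) u : (f \_ Rplus) u = if 0 < u then f u else 0 by rewrite patchE inRp.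
have h10 u : 0 <= h1 u by rewrite /h1 hE; case: ifPn => // u0; exact: f1_ge0.
have h20 u : 0 <= h2 u by rewrite /h2 hE; case: ifPn => // u0; exact: f2_ge0.
have h1neg u : u <= 0 -> h1 u = 0 by rewrite /h1 hE leNgt => /negbTE ->.
have h2neg u : u <= 0 -> h2 u = 0 by rewrite /h2 hE leNgt => /negbTE ->.
have mh1 : measurable_fun setT h1 by apply/(measurable_restrictT _ mRp).
have mh2 : measurable_fun setT h2 by apply/(measurable_restrictT _ mRp).
have [cf cf0 f1_lec] := f1_le.
have h1_le u : 0 < u -> h1 u <= cf * u `^ (- gamma1 - 1).
  by move=> u0; rewrite /h1 hE u0; exact: f1_lec.
have tail (f : R -> R) a : f u / u `^ (- a - 1) @[u --> +oo] --> (1 : R) ->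
    (f \_ Rplus) u / u `^ (- a - 1) @[u --> +oo] --> (1 : R).
  apply: cvg_trans; apply: near_eq_cvg.
  have p : \forall u \near +oo, (0 : R) < u by exact: nbhs_pinfty_gt.
  by apply: filterS p => u u0; rewrite hE u0.
have restr (k f : R -> R) : (\int[lebesgue_measure]_s (k s * (f \_ Rplus) s)%:E =
    \int[lebesgue_measure]_(s in Rplus) (k s * f s)%:E)%E.
  rewrite [in RHS]integral_mkcond; apply: eq_integral => s _.
  by rewrite [in RHS]patchE inRp hE; case: ifP; rewrite ?mulr0.
have FE' A : measurable A -> F A = (\int[leb2]_(u in A) (h1 u.1 * h2 u.2)%:E)%E.
  move=> mA; rewrite FE// integral_mkcondr; apply: eq_integral => u _.
  rewrite patchE /h1 /h2 !hE.
  have -> : (u \in @Rplus2 R) = (0 < u.1) && (0 < u.2).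
    apply/idP/andP => [/set_mem[]|[u1 u2]].
      by rewrite /Rplus/= !in_itv/= !andbT.
    by apply: mem_set; split; rewrite /Rplus/= in_itv/= andbT.
  by case: (0 < u.1); case: (0 < u.2) => /=; rewrite ?(mul0r, mulr0).
have mean1 : (\int[lebesgue_measure]_s (s * h1 s)%:E < +oo)%E by rewrite (restr id).
have mean2 : (\int[lebesgue_measure]_s (s * h2 s)%:E < +oo)%E by rewrite (restr id).
have mom0 := moment_gt0 gamma1_gt1 gamma12 mh2 h20 (tail _ _ f2_tail).
have momf := moment_fin gamma1_gt1 gamma12 mh2 h20 h2neg (tail _ _ f2_tail) mean2.
pose m2 := fine (\int[lebesgue_measure]_s (s `^ gamma1 * h2 s)%:E)%E.
have m2E : (\int[lebesgue_measure]_s (s `^ gamma1 * h2 s)%:E = m2%:E)%E.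
  by rewrite fineK// ge0_fin_numE// ltW.
have m20 : 0 < m2 by rewrite -lte_fin -m2E.
have K0 := Kcos_gt0 g12.
have cE : c_const gamma1 f2 = Kcos gamma1 `^ gamma1^-1 * m2 `^ gamma1^-1.
  by rewrite /c_const /Rintegral -(restr (fun s => s `^ gamma1)).
have c0 : 0 < c_const gamma1 f2 by rewrite cE; apply: mulr_gt0; apply: powR_gt0.
have cg : c_const gamma1 f2 `^ gamma1 = Kcos gamma1 * m2.
  rewrite cE powRM; [|exact: powR_ge0|exact: powR_ge0].
  by rewrite -!powRrM (mulVf (lt0r_neq0 g0)) (powRr1 (ltW K0)) (powRr1 (ltW m20)).
split.
- exact: stable_linear_field g12 Lambda_stable SgammaE.
- by move=> mu; exact: stable_field_charfun g12 Lambda_stable SgammaE _.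
- exact: (normalized_cvg_fdd g12 c0 cf0 mh1 mh2 h10 h20 h1neg h2neg h1_le m2E FE' mean1 mean2
    (tail _ _ f1_tail) cg m20 lambda_gt0 lambda_infty lambda_small N_poisson Lambda_stable SgammaE).
Qed.
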